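(* Let $d,k\in\mathbb{N}^*$, let $p\in\mathbb{N}^*$ divide $k$, and let $0\le m<d$ be an integer. Then there exist holomorphic automorphisms of $\mathbb{C}^d$ possessing $k/p$ disjoint $p$-cycles of non-recurrent, attracting Fatou components biholomorphic to $\mathbb{C}^{d-m}\times(\mathbb{C}^* )^m$ and attracted to the origin.
   Context: $\mathbb{N}^*=\{1,2,3,\ldots\}$ and $\mathbb{C}^*=\mathbb{C}\setminus\{0\}$. The Fatou set of a holomorphic automorphism $G$ of $\mathbb{C}^d$ is the set of points $z\in\mathbb{C}^d$ such that the family of iterates $\{G^n\}_{n\in\mathbb{N}}$ is normal on a neighbourhood of $z$; its connected components are the Fatou components of $G$. A Fatou component $V$ is $p$-periodic if $G^p(V)=V$ and $G^q(V)\ne V$ for $1\le q<p$; in this case $(V,G(V),\ldots,G^{p-1}(V))$ is called a $p$-periodic cycle (or $p$-cycle) of Fatou components. A Fatou component $V$ is attracting to (attracted to) a point $P\in\mathbb{C}^d$ if $(G|_V)^n\to P$ as $n\to\infty$; a periodic Fatou component $V$ attracting to $P$ is non-recurrent if $P\in\partial V$.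
   Formalization: The dimension is taken to be d ≥ 2 instead of d ≥ 1: for d = 1 (so m = 0) the claim is false, since a Fatou component in C biholomorphic to C is all of C, has empty boundary, and so cannot be non-recurrent. *)

(* Defs.v *)
From HB Require Import structures.
From mathcomp Require Import all_boot all_order all_algebra.
From mathcomp Require Import complex.
From mathcomp Require Import all_classical all_reals all_analysis.

Set Implicit Arguments.
Unset Strict Implicit.
Unset Printing Implicit Defensive.

Import Order.TTheory GRing.Theory Num.Theory.
Import numFieldNormedType.Exports.

Local Open Scope classical_set_scope.
Local Open Scope ring_scope.

Section Holomorphic.
Context {R : realType} {X Y : normedModType R[i]}.

(* [differentiable] is Frechet differentiability over the scalar field R[i],
   that is, complex differentiability; on an open set of a finite-dimensional
   space this is holomorphy. All sets below to which it is applied are open. *)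
Definition holomorphic_on (U : set X) (f : X -> Y) : Prop :=
  forall x, U x -> differentiable f x.

End Holomorphic.

Section Biholomorphic.
Context {R : realType} {X Y : normedModType R[i]}.

Definition biholomorphism (V : set X) (W : set Y) (f : X -> Y) : Prop :=
  exists g : Y -> X,
    [/\ holomorphic_on V f /\ holomorphic_on W g,
        set_fun V W f, set_fun W V g,
        {in V, cancel f g} & {in W, cancel g f}].

Definition biholomorphic (V : set X) (W : set Y) : Prop :=
  exists f, biholomorphism V W f.

End Biholomorphic.

Section Fatou.
Context {R : realType} {X : normedModType R[i]}.
Implicit Types (G : X -> X) (U V : set X) (P : X) (p : nat).

Definition automorphism G : Prop := biholomorphism [set: X] [set: X] G.

Definition compact_in U : set (set X) := [set K | compact K /\ K `<=` U].

Definition compactly_converges U (h : nat -> X -> X) (g : X -> X) : Prop :=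
  {family compact_in U, h @ \oo --> g}.

Definition compactly_diverges U (h : nat -> X -> X) : Prop :=
  forall K L : set X, compact_in U K -> compact L ->
    \forall n \near \oo, h n @` K `&` L = set0.

(* Sequences in F are arbitrary: they may repeat members of F. Locally uniform
   divergence to infinity is allowed, as is usual for maps into a non-compact
   space. *)
Definition normal_on U (F : set (X -> X)) : Prop :=
  forall h : nat -> X -> X, (forall n, F (h n)) ->
  exists2 s : nat -> nat, {homo s : n l / (n < l)%N} &
    (exists g, compactly_converges U (h \o s) g) \/
    compactly_diverges U (h \o s).

Definition fatou_set G : set X :=
  [set z | exists2 U, open_nbhs z U & normal_on U (range (fun n => iter n G))].

Definition fatou_component G V : Prop :=
  exists2 z, fatou_set G z & V = connected_component (fatou_set G) z.

Definition periodic_fatou_component G p V : Prop :=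
  [/\ fatou_component G V, (0 < p)%N, iter p G @` V = V &
      forall q, (0 < q < p)%N -> iter q G @` V <> V].

Definition fatou_cycle G p (c : 'I_p -> set X) : Prop :=
  exists2 V, periodic_fatou_component G p V &
    forall j : 'I_p, c j = iter j G @` V.

Definition attracted_to G V P : Prop :=
  compactly_converges V (fun n => iter n G) (cst P).

Definition boundary V : set X := closure V `\` interior V.

Definition non_recurrent_attracted_to G V P : Prop :=
  attracted_to G V P /\ boundary V P.

End Fatou.

(* The product of C^a and the b-th power of the punctured plane. *)
Definition affine_torus (R : realType) (a b : nat) :
    set ('rV[R[i]]_a * 'rV[R[i]]_b)%type :=
  [set w : 'rV[R[i]]_a * 'rV[R[i]]_b | forall l : 'I_b, w.2 ord0 l != 0].

Arguments affine_torus R (a b)%_N : clear implicits.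

(* Main.v *)
(* A palindromic composition [G] of shears and overshears of C^2 fixes the line x = 0 pointwise. With u = x y^j, the
   coordinates (1/u - n, y n^beta) of the n-th iterate converge on a basin B of the origin, and the limit Phi maps B
   biholomorphically onto C^2 if j = 0 and onto C x C^* if j > 0. Under (z_1, ..., z_r, y, t) |-> ((z_1 ... z_r)^k, y)
   the map [G] lifts to an automorphism of C^d that contracts t and rotates z_1 by a primitive p-th root of unity. On B
   the coordinate x has a k-th root xi, so the preimage of B splits into the k sets z_1 ... z_r = omega xi with
   omega^k = 1; they are parametrized by Phi, z_1, ..., z_(r-1) and t, and the lift permutes them in cycles of length p.
   The choice j = 0, r = m + 1 yields m <= d - 2, and j = k, r = d - 1 yields m = d - 1.

   These sets are Fatou components because they are closed in the Fatou set: near a Fatou point q adherent to them the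
   iterates tend to 0 uniformly. If x(q) = 0, this is impossible since x = 0 is fixed pointwise by G, and since
   G^(-1) = D G D with D(x, y) = (-x, y) provides backward orbits that tend to the origin. If x(q) <> 0, Cauchy's
   estimate for |x_n|^(1 / ln n) transfers the rate of decay of x_n from the basin to q, and the local expansion of [G]
   then forces the orbit of q to converge in the coordinates above. *)
From HB Require Import structures.
Require Import Defs.
From mathcomp Require Import all_boot all_order all_algebra.
From mathcomp Require Import complex.
From mathcomp Require Import all_classical all_reals all_analysis.
From mathcomp Require Import ring lra zify.

Set Implicit Arguments.
Unset Strict Implicit.
Unset Printing Implicit Defensive.

Import Order.TTheory GRing.Theory Num.Theory.
Import numFieldNormedType.Exports.

Local Open Scope classical_set_scope.
Local Open Scope ring_scope.

(** * A real-valued norm *)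

(** The form of [G] is dictated by one requirement: [1/u - n] must converge along orbits without a
    logarithmic correction, so the error of one step must be summable. The middle of the word is a
    symmetrized commutator of the shear [y + c x] and of an overshear that multiplies [x] by nearly
    [(1 - y^J)^(-c)], with [J = j + 1]; it sends [u] to [u (1 - u + ...)]. The outer factors [res]
    preserve [u] and only tune the decay of [y]. The palindromic symmetry removes the term of first
    order in [x / y] from the error, and the cubic truncation [logp] of the logarithm leaves a term
    in [y^(3 J)]. If [y] is of order [n^(-beta)], the remaining errors [(x / y)^2] and [y^(3 J)]
    have orders [n^(-2 (1 - J beta))] and [n^(-3 J beta)]; the choice [J beta = 2/5] balances them
    at [n^(-6/5)]. All function theory rests on second-order Taylor bounds with explicit constants:
    Cauchy's estimate and the Weierstrass theorem are obtained for them by a discrete averaging over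
    roots of unity, and every limit below is holomorphic as a locally uniform limit. *)

Definition nm (R : realType) (V : normedZmodType R[i]) (x : V) : R :=
  locked (complex.Re `|x|).

Section RealNorm.
Context {R : realType}.
Implicit Types V : normedZmodType R[i].

(** Norms take values in [R[i]]; this bridge moves every estimate to real numbers, where linear
    arithmetic applies. *)
Lemma nmE V (x : V) : `|x| = (nm x)%:C%C.
Proof. by rewrite /nm -lock RRe_real // ger0_real. Qed.

Lemma nm_ge0 V (x : V) : 0 <= nm x.
Proof. by rewrite -ler0c -nmE. Qed.

Lemma nm0 V : nm (0 : V) = 0.
Proof. by rewrite /nm -lock normr0. Qed.

Lemma nm_eq0 V (x : V) : (nm x == 0) = (x == 0).
Proof. by rewrite -[RHS]normr_eq0 nmE (inj_eq (@complexI _)). Qed.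

Lemma nm_gt0 V (x : V) : (0 < nm x) = (x != 0).
Proof. by rewrite lt_def nm_ge0 andbT nm_eq0. Qed.

Lemma nmN V (x : V) : nm (- x) = nm x.
Proof. by rewrite /nm -!lock normrN. Qed.

Lemma nmB V (x y : V) : nm (x - y) = nm (y - x).
Proof. by rewrite -nmN opprB. Qed.

Lemma nmD V (x y : V) : nm (x + y) <= nm x + nm y.
Proof. by rewrite -lecR rmorphD /= -!nmE ler_normD. Qed.

Lemma nm_sub V (x y : V) : nm (x - y) <= nm x + nm y.
Proof. by rewrite -(nmN y) nmD. Qed.

Lemma nm_tri V (z x y : V) : nm (x - y) <= nm (x - z) + nm (z - y).
Proof. by rewrite -{1}(subrK z x) -addrA nmD. Qed.

Lemma nm_dist V (x y : V) : nm x - nm y <= nm (x - y).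
Proof. by rewrite lerBlDr -{1}(subrK y x) nmD. Qed.

Lemma nm_distC V (x y : V) : nm x - nm y <= nm (y - x).
Proof. by rewrite nmB nm_dist. Qed.

Lemma nm_sum V (I : Type) (s : seq I) (P : pred I) (F : I -> V) :
  nm (\sum_(i <- s | P i) F i) <= \sum_(i <- s | P i) nm (F i).
Proof.
elim/big_rec2: _ => [|i a b _ le_ba]; first by rewrite nm0.
by rewrite (le_trans (nmD _ _)) // lerD2l.
Qed.

Lemma nmZ (V : normedModType R[i]) (a : R[i]) (x : V) : nm (a *: x) = nm a * nm x.
Proof.
by apply: (@complexI R); rewrite -nmE normrZ !nmE rmorphM.
Qed.

Implicit Types z : R[i].

Lemma nmM z1 z2 : nm (z1 * z2) = nm z1 * nm z2.
Proof. by apply: (@complexI R); rewrite -nmE normrM !nmE rmorphM. Qed.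

Lemma nm1 : nm (1 : R[i]) = 1.
Proof. by apply: (@complexI R); rewrite -nmE normr1. Qed.

Lemma nmX z n : nm (z ^+ n) = nm z ^+ n.
Proof. by elim: n => [|n IH]; rewrite ?nm1 // !exprS nmM IH. Qed.

Lemma nmV z : nm z^-1 = (nm z)^-1.
Proof. by apply: (@complexI R); rewrite -nmE normfV nmE fmorphV. Qed.

Lemma nm_real (a : R) : nm (a%:C%C) = `|a|.
Proof. by rewrite /nm -lock normc_def /= expr0n /= addr0 sqrtr_sqr. Qed.

Lemma nm_nat n : nm (n%:R : R[i]) = n%:R.
Proof. by rewrite -(rmorph_nat (real_complex R)) nm_real normr_nat. Qed.

Lemma sqr_nm z : nm z ^+ 2 = complex.Re z ^+ 2 + complex.Im z ^+ 2.
Proof.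
rewrite /nm -lock normc_def /= sqr_sqrtr //.
by rewrite addr_ge0 // sqr_ge0.
Qed.

Lemma Re_le_nm z : `|complex.Re z| <= nm z.
Proof.
rewrite -(@ler_pXn2r _ 2) ?nnegrE ?nm_ge0 // real_normK ?num_real // sqr_nm.
by rewrite lerDl sqr_ge0.
Qed.

Lemma Im_le_nm z : `|complex.Im z| <= nm z.
Proof.
rewrite -(@ler_pXn2r _ 2) ?nnegrE ?nm_ge0 // real_normK ?num_real // sqr_nm.
by rewrite lerDr sqr_ge0.
Qed.

Lemma nm_le_ReIm z : nm z <= `|complex.Re z| + `|complex.Im z|.
Proof.
rewrite -(@ler_pXn2r _ 2) ?nnegrE ?nm_ge0 ?addr_ge0 // sqr_nm.
rewrite sqrrD !real_normK ?num_real // -addrA lerD2l lerDr.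
by rewrite mulrn_wge0 // mulr_ge0.
Qed.

Lemma nm_pair (V W : normedModType R[i]) (x : V) (y : W) :
  nm (x, y) = Num.max (nm x) (nm y).
Proof.
apply: (@complexI R); rewrite -nmE prod_normE /= !nmE /Order.max ltcR.
by case: ifP.
Qed.

Lemma nm_row n (v : 'rV[R[i]]_n) i : nm (v ord0 i) <= nm v.
Proof.
rewrite -lecR -!nmE [X in _ <= X]mx_normE -num_abs_le //.
by apply/bigmax_geP; right; exists (ord0, i) => //; rewrite -num_le /= normr_id.
Qed.

Lemma nm_row_le n (v : 'rV[R[i]]_n) (e : R) :
  0 <= e -> (forall i, nm (v ord0 i) <= e) -> nm v <= e.
Proof.
move=> e0 le_ve; rewrite -lecR -nmE.
have [-> |v0] := eqVneq `|v| 0; first by rewrite ler0c.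
have [[i k] /= eqv] := mx_norm_neq0 v0.
by rewrite (eqv : `|v| = _) nmE lecR (ord1 i).
Qed.

Lemma nbhs_nm (V : normedModType R[i]) (x : V) (A : set V) :
  nbhs x A <-> exists2 e : R, 0 < e & forall y, nm (y - x) < e -> A y.
Proof.
split=> [/nbhs_normP[e /= e0 sub]|[e e0 sub]].
  have ee : e = (complex.Re e)%:C%C by rewrite RRe_real // gtr0_real.
  exists (complex.Re e) => [|y xy]; first by rewrite -ltcR -ee.
  by apply: sub; rewrite /ball_ /= nmE ee ltcR nmB.
apply/nbhs_normP; exists (e%:C)%C => [|y]; first by rewrite /= ltcR.
by rewrite /ball_ /= nmE ltcR nmB; apply: sub.
Qed.

End RealNorm.

(** * Complex exponential *)

Section ComplexExponential.
Context {R : realType}.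
Implicit Types (z : R[i]) (a b : R).

Definition cexp z : R[i] :=
  (expR (complex.Re z))%:C%C * Complex (cos (complex.Im z)) (sin (complex.Im z)).

Lemma cexp0 : cexp 0 = 1.
Proof. by rewrite /cexp /= expR0 cos0 sin0 mul1r. Qed.

Lemma cexpD z1 z2 : cexp (z1 + z2) = cexp z1 * cexp z2.
Proof.
case: z1 z2 => [a b] [c d]; rewrite /cexp /= expRD cosD sinD.
by apply/eqP; rewrite eq_complex /=; apply/andP; split; apply/eqP; ring.
Qed.

Lemma nm_cexp z : nm (cexp z) = expR (complex.Re z).
Proof.
rewrite /cexp nmM nm_real ger0_norm ?expR_ge0 // -[RHS]mulr1; congr (_ * _).
by apply/eqP; rewrite -sqrp_eq1 ?nm_ge0 // sqr_nm /= cos2Dsin2.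
Qed.

Lemma cexp_neq0 z : cexp z != 0.
Proof. by rewrite -nm_gt0 nm_cexp expR_gt0. Qed.

Lemma cexpN z : cexp (- z) = (cexp z)^-1.
Proof.
by apply: (mulIf (cexp_neq0 z)); rewrite -cexpD addNr cexp0 mulVf ?cexp_neq0.
Qed.

Lemma cexpMn z n : cexp (z *+ n) = cexp z ^+ n.
Proof. by elim: n => [|n IH]; rewrite ?cexp0 // mulrS exprS cexpD IH. Qed.

(** The inequality [1 + x <= e^x] at [a] and at [- a] encloses [e^a] between [1 + a] and
    [1 / (1 - a)]. *)
Lemma expR_sub1_le a : `|a| <= 1 / 2 -> `|expR a - 1 - a| <= 2 * a ^+ 2.
Proof.
rewrite ler_norml => /andP[a1 a2]; have := expR_ge1Dx a.
have := expR_ge1Dx (- a); rewrite expRN => le1 le2.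
rewrite ger0_norm; last by lra.
have : expR a * (1 - a) <= 1.
  by rewrite mulrC -ler_pdivlMr ?expR_gt0 // div1r.
nra.
Qed.

Lemma sin_le_id a : `|sin a| <= `|a|.
Proof.
suff main b : 0 <= b -> `|sin b| <= b.
  have [a0|a0] := leP 0 a; first by rewrite (ger0_norm a0) main.
  by rewrite (ltr0_norm a0) -normrN -sinN main // oppr_ge0 ltW.
move=> b0; have [|c _] := @MVT_segment R (@sin R) (@cos R) 0 b b0.
  by apply: continuous_subspaceT => x; exact: continuous_sin.
rewrite sin0 !subr0 => -> ; rewrite normrM (ger0_norm b0) ler_piMl //.
exact: cos_max.
Qed.

Lemma cos_sub1_le a : `|cos a - 1| <= a ^+ 2.
Proof.
have -> : cos a - 1 = - (2 * sin (a / 2) ^+ 2).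
  have {1}-> : a = a / 2 + a / 2 by field.
  by rewrite cosD -!expr2 cos2sin2; ring.
rewrite normrN normrM normrX ger0_norm // -(real_normK (num_real a)).
have := sin_le_id (a / 2); rewrite normrM (@ger0_norm _ 2^-1) // => le1.
have := normr_ge0 (sin (a / 2)); have := normr_ge0 a; nra.
Qed.

Lemma sin_sub_le a : `|a| <= 1 -> `|sin a - a| <= a ^+ 2.
Proof.
suff main b : 0 <= b -> b <= 1 -> `|sin b - b| <= b ^+ 2.
  have [a0|a0] := leP 0 a; first by rewrite ger0_norm //; exact: main.
  rewrite ltr0_norm // => a1; rewrite -sqrrN -normrN opprB addrC -sinN.
  by rewrite -{2}(opprK a) main // oppr_ge0 ltW.
move=> b0 b1.
have [|c] := @MVT_segment R (fun x => sin x - x) (fun x => cos x - 1) 0 b b0.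
  apply: continuous_subspaceT => y.
  by apply: cvgB; [exact: continuous_sin|exact: cvg_id].
rewrite sin0 !subr0 => /itvP cb ->; rewrite normrM (ger0_norm b0) expr2.
rewrite ler_wpM2r // (le_trans (cos_sub1_le c)) //.
have c0 : 0 <= c by rewrite cb.
have cb' : c <= b by rewrite cb.
nra.
Qed.

Lemma cexp_sub1_le z : nm z <= 1 / 2 -> nm (cexp z - 1 - z) <= 12 * nm z ^+ 2.
Proof.
move=> z2; set r := nm z in z2 *; have r0 : 0 <= r := nm_ge0 z.
have := Re_le_nm z; have := Im_le_nm z; rewrite -/r.
case: z @r z2 r0 => a b r z2 r0 /= bz az.
have a2 : a ^+ 2 <= r ^+ 2 by rewrite -real_normK ?num_real // lerXn2r ?nnegrE.
have b2 : b ^+ 2 <= r ^+ 2 by rewrite -real_normK ?num_real // lerXn2r ?nnegrE.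
have := expR_sub1_le (le_trans az z2); have := cos_sub1_le b.
have := sin_sub_le (le_trans bz (le_trans z2 _)); move=> /(_ ltac:(lra)).
set A := expR a; set c := cos b; set s := sin b => le_s le_c le_e.
have A2 : `|A| <= 2.
  rewrite /A ger0_norm ?expR_ge0 //; move: le_e az; rewrite !ler_norml => /andP[_ le_e] /andP[_ az].
  rewrite -/A; nra.
apply: (le_trans (nm_le_ReIm _)); rewrite /cexp /= -/A -/c -/s.
rewrite !mul0r subr0 addr0 !oppr0 addr0.
have -> : A * c - 1 - a = A * (c - 1) + (A - 1 - a) by ring.
have -> : A * s - b = A * (s - b) + (A - 1 - a) * b + a * b by ring.
have h1 : `|A * (c - 1) + (A - 1 - a)| <= 2 * r ^+ 2 + 2 * r ^+ 2.
  rewrite (le_trans (ler_normD _ _)) // lerD //; last by lra.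
  by rewrite normrM ler_pM // (le_trans le_c).
have h2 : `|A * (s - b) + (A - 1 - a) * b + a * b| <= 2 * r ^+ 2 + 2 * r ^+ 2 * (1/2) + r * r.
  rewrite (le_trans (ler_normD _ _)) // lerD //; last by rewrite normrM ler_pM.
  rewrite (le_trans (ler_normD _ _)) // lerD //; first by rewrite normrM ler_pM // (le_trans le_s).
  by rewrite normrM ler_pM //; lra.
by rewrite -expr2 in h2; nra.
Qed.

Lemma cexp_lip z : nm z <= 1 / 2 -> nm (cexp z - 1) <= 7 * nm z.
Proof.
move=> z2; have := cexp_sub1_le z2; have := nm_tri z (cexp z - 1) 0.
rewrite !subr0; have := nm_ge0 z; nra.
Qed.

(** Polar coordinates: [acos] gives the angle up to sign, and the sign of the imaginary part
    decides. *)
Lemma cexp_surj z : z != 0 -> exists w, cexp w = z.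
Proof.
move=> z0; have nz : 0 < nm z by rewrite nm_gt0.
pose c := complex.Re z / nm z; pose s := complex.Im z / nm z.
have cs : c ^+ 2 + s ^+ 2 = 1.
  by rewrite !expr_div_n -mulrDl -sqr_nm divff // expf_neq0 // gt_eqF.
have c1 : -1 <= c <= 1.
  by have s0 := sqr_ge0 s; apply/andP; split; nra.
have [t ct st] : exists2 t, cos t = c & sin t = s.
  have cacos : cos (acos c) = c by rewrite acosK // in_itv.
  have sacos : sin (acos c) = Num.sqrt (1 - c ^+ 2) by exact: sin_acos.
  have s2 : 1 - c ^+ 2 = s ^+ 2 by rewrite -cs addrAC subrr add0r.
  have [s0|s0] := leP 0 s.
    by exists (acos c); rewrite // sacos s2 sqrtr_sqr ger0_norm.
  exists (- acos c); first by rewrite cosN.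
  by rewrite sinN sacos s2 sqrtr_sqr ltr0_norm // opprK.
exists (Complex (ln (nm z)) t); rewrite /cexp /= lnK // ct st.
case: z z0 nz @c @s cs c1 ct st => a b z0 nz c s cs c1 ct st.
have nz' : nm (a +i* b)%C != 0 by rewrite gt_eqF.
apply/eqP; rewrite eq_complex /= /c /s /= !mul0r subr0 addr0.
by apply/andP; split; apply/eqP; rewrite mulrC divfK.
Qed.

End ComplexExponential.

Lemma cvg_nmP (R : realType) (V W : normedModType R[i]) (f : V -> W) (x : V) (l : W) :
  f y @[y --> x] --> l <->
  forall e : R, 0 < e -> exists2 d : R, 0 < d & forall y, nm (y - x) < d -> nm (f y - l) < e.
Proof.
split=> [fl e e0|H A /nbhs_nm[e e0 sA]].
  have /fl/nbhs_nm[d d0 sub] : nbhs l [set w | nm (w - l) < e] by apply/nbhs_nm; exists e.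
  by exists d.
by have [d d0 sub] := H e e0; apply/nbhs_nm; exists d => // y /sub /sA.
Qed.

(** * Quantitative complex differentiability *)

Section TaylorDef.
Context {R : realType} {V W : normedModType R[i]}.

(* [f] is bounded by [K] and [K]-Lipschitz on [A], with a second-order Taylor bound; a quantitative and
   composable form of complex differentiability. *)
Definition tayl (A : set V) (f : V -> W) (D : V -> V -> W) (K : R) : Prop :=
  0 <= K /\ forall x, A x ->
  [/\ forall (a : R[i]) u v, D x (a *: u + v) = a *: D x u + D x v,
      nm (f x) <= K, forall h, nm (D x h) <= K * nm h &
      forall y, A y -> nm (f y - f x) <= K * nm (y - x) /\
                       nm (f y - f x - D x (y - x)) <= K * nm (y - x) ^+ 2].

Definition nice A f := exists D K, tayl A f D K.

Definition nball (x : V) (r : R) : set V := [set y | nm (y - x) < r].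

Lemma nball0 x r : 0 < r -> nball x r x.
Proof. by rewrite /nball /= subrr nm0. Qed.

Lemma tayl_sub A B f D K : A `<=` B -> tayl B f D K -> tayl A f D K.
Proof.
move=> sAB [K0 tB]; split=> // x /sAB Bx; have [H1 H2 H3 H4] := tB x Bx.
by split=> // y /sAB; apply: H4.
Qed.

Lemma nice_sub A B f : A `<=` B -> nice B f -> nice A f.
Proof. by move=> sAB [D [K tB]]; exists D, K; apply: tayl_sub tB. Qed.

Lemma tayl_eq A f g D K : (forall x, A x -> f x = g x) -> tayl A f D K -> tayl A g D K.
Proof.
move=> fg [K0 tA]; split=> // x Ax; have [H1 H2 H3 H4] := tA x Ax.
by split=> // [|y Ay]; rewrite -?fg //; apply: H4.
Qed.

Lemma nice_eq A f g : (forall x, A x -> f x = g x) -> nice A f -> nice A g.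
Proof. by move=> fg [D [K tA]]; exists D, K; apply: tayl_eq tA. Qed.

Lemma nice_cst A (c : W) : nice A (fun=> c).
Proof.
exists (fun _ _ => 0), (nm c); split=> [|x Ax]; first exact: nm_ge0.
split=> // [a u v|h|y Ay]; first by rewrite scaler0 addr0.
  by rewrite nm0 mulr_ge0 ?nm_ge0.
by rewrite !subrr nm0; split; rewrite ?mulr_ge0 ?exprn_ge0 ?nm_ge0 // oppr0.
Qed.

Lemma nice_lin A (f : V -> W) (M L : R) :
  (forall (a : R[i]) u v, f (a *: u + v) = a *: f u + f v) ->
  (forall x, nm (f x) <= L * nm x) -> (forall x, A x -> nm x <= M) -> nice A f.
Proof.
move=> flin fL AM; pose M' := Num.max M 0; pose L' := Num.max L 0.
have L0 : 0 <= L' by rewrite le_max lexx orbT.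
have M0 : 0 <= M' by rewrite le_max lexx orbT.
have fL' x : nm (f x) <= L' * nm x.
  by rewrite (le_trans (fL x)) // ler_wpM2r ?nm_ge0 // le_max lexx.
have fB x y : f (x - y) = f x - f y by rewrite addrC -scaleN1r flin scaleN1r addrC.
exists (fun=> f), (L' * (M' + 1)); split=> [|x Ax]; first by rewrite mulr_ge0 ?addr_ge0.
have le1 : L' <= L' * (M' + 1) by rewrite ler_peMr // lerDr.
split=> // [|h|y Ay].
- rewrite (le_trans (fL' x)) // ler_wpM2l // (le_trans (AM x Ax)) // /M'.
  by rewrite (@le_trans _ _ (Num.max M 0)) ?le_max ?lexx // lerDl.
- by rewrite (le_trans (fL' h)) // ler_wpM2r ?nm_ge0.
- rewrite -fB subrr nm0 (le_trans (fL' _)) ?ler_wpM2r ?nm_ge0 //.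
  by rewrite mulr_ge0 ?exprn_ge0 ?nm_ge0 // (le_trans L0).
Qed.

Lemma nice_bounded A f : nice A f -> exists2 K : R, 0 <= K & forall x, A x -> nm (f x) <= K.
Proof. by move=> [D [K [K0 tA]]]; exists K => // x /tA[]. Qed.

Lemma nice_lip A f : nice A f -> exists2 K : R, 0 < K &
  forall x y, A x -> A y -> nm (f y - f x) <= K * nm (y - x).
Proof.
move=> [D [K [K0 tA]]]; exists (K + 1) => [|x y /tA[_ _ _ H] /H[le1 _]]; first lra.
by rewrite (le_trans le1) // ler_wpM2r ?nm_ge0 // lerDl.
Qed.

Lemma nice_differentiable x e f : 0 < e -> nice (nball x e) f -> differentiable f x.
Proof.
move=> e0 [D [K [K0 tA]]]; have [Dlin _ DK DT] := tA x (nball0 x e0).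
pose aux := GRing.isLinear.Build R[i] V W _ (D x) (Dlin : linear (D x)).
pose df : {linear V -> W} := HB.pack (D x) aux.
have K1 : 0 < K + 1 by rewrite ltr_pwDr.
have dfc : continuous df.
  move=> v; apply/cvg_nmP => d d0; exists (d / (K + 1)); first by rewrite divr_gt0.
  move=> y; rewrite ltr_pdivlMr // => le_y.
  have -> : df y - df v = D x (y - v) by rewrite -[RHS]/(df (y - v)) linearB.
  rewrite (le_lt_trans (DK _)) //.
  by rewrite (le_lt_trans _ le_y) // mulrC ler_wpM2l ?nm_ge0 // lerDl.
have dfx : f \o shift x = cst (f x) + df +o_ 0 id.
  apply/eqaddoP => d d0; have dd : d = (complex.Re d)%:C%C by rewrite RRe_real // gtr0_real.
  have d0' : 0 < complex.Re d by rewrite -ltcR -dd.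
  apply/nbhs_nm; exists (Num.min e (complex.Re d / (K + 1))).
    by rewrite lt_min e0 divr_gt0.
  move=> y; rewrite subr0 lt_min => /andP[ye yd].
  have := DT (y + x); rewrite /nball /= addrK => /(_ ye) [_ le_y].
  rewrite dd !nmE -rmorphM lecR /=.
  have -> : (f \o shift x - (cst (f x) + df : V -> W)) y = f (y + x) - f x - D x y.
    by rewrite /= opprD addrA.
  rewrite (le_trans le_y) // expr2 mulrA ler_wpM2r ?nm_ge0 //.
  move: yd; rewrite ltr_pdivlMr // => yd; have := nm_ge0 y; nra.
have ddf := diff_unique dfc dfx.
by apply/diff_locallyP; rewrite ddf.
Qed.

End TaylorDef.

Section TaylorComp.
Context {R : realType} {U V W : normedModType R[i]}.

Lemma nice_comp (A : set U) (B : set V) (f : U -> V) (g : V -> W) :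
  nice A f -> nice B g -> (forall x, A x -> B (f x)) -> nice A (g \o f).
Proof.
move=> [Df [K1 [K10 tf]]] [Dg [K2 [K20 tg]]] AB.
exists (fun x h => Dg (f x) (Df x h)), (K2 + K2 * K1 + K2 * K1 ^+ 2).
have K12 : 0 <= K2 * K1 by rewrite mulr_ge0.
have K112 : 0 <= K2 * K1 ^+ 2 by rewrite mulr_ge0 ?sqr_ge0.
split=> [|x Ax]; first by rewrite !addr_ge0.
have [fl fb fD fT] := tf x Ax; have [gl gb gD gT] := tg _ (AB x Ax).
split=> [a u v||h|y Ay].
- by rewrite fl gl.
- by rewrite /= (le_trans gb) // -addrA lerDl addr_ge0.
- rewrite (le_trans (gD _)) // (le_trans (ler_wpM2l K20 (fD h))) // mulrA.
  by rewrite ler_wpM2r ?nm_ge0 // -addrA addrCA lerDl addr_ge0.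
- have [f1 f2] := fT y Ay; have [g1 g2] := gT _ (AB y Ay).
  have h0 := nm_ge0 (y - x); set h := nm (y - x) in f1 f2 h0 *; split.
    rewrite /= (le_trans g1) // (le_trans (ler_wpM2l K20 f1)) // mulrA.
    by rewrite ler_wpM2r ?nm_ge0 // -addrA addrCA lerDl addr_ge0.
  have gDB u v : Dg (f x) (u - v) = Dg (f x) u - Dg (f x) v.
    by rewrite addrC -scaleN1r gl scaleN1r addrC.
  rewrite /=; set d := f y - f x in f1 f2 g1 g2 *.
  have -> : g (f y) - g (f x) - Dg (f x) (Df x (y - x)) =
    (g (f y) - g (f x) - Dg (f x) d) + Dg (f x) (d - Df x (y - x)).
    by rewrite (gDB d) subrKA.
  rewrite (le_trans (nmD _ _)) //.
  have s1 : nm (g (f y) - g (f x) - Dg (f x) d) <= K2 * K1 ^+ 2 * h ^+ 2.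
    rewrite (le_trans g2) // -mulrA -exprMn ler_wpM2l // lerXn2r ?nnegrE ?nm_ge0 //.
    by rewrite mulr_ge0.
  have s2 : nm (Dg (f x) (d - Df x (y - x))) <= K2 * K1 * h ^+ 2.
    by rewrite (le_trans (gD _)) // -mulrA ler_wpM2l.
  have := sqr_ge0 h; nra.
Qed.

Lemma nice_pair (A : set U) (f : U -> V) (g : U -> W) :
  nice A f -> nice A g -> nice A (fun x => (f x, g x)).
Proof.
move=> [Df [K1 [K10 tf]]] [Dg [K2 [K20 tg]]].
exists (fun x h => (Df x h, Dg x h)), (K1 + K2); split=> [|x Ax]; first exact: addr_ge0.
have [fl fb fD fT] := tf x Ax; have [gl gb gD gT] := tg x Ax.
split=> [a u v||h|y Ay].
- by rewrite fl gl.
- by rewrite nm_pair ge_max (le_trans fb) ?lerDl // (le_trans gb) ?lerDr.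
- by rewrite nm_pair ge_max (le_trans (fD h)) ?(le_trans (gD h)) // ler_wpM2r ?nm_ge0 ?lerDl ?lerDr.
- have [f1 f2] := fT y Ay; have [g1 g2] := gT y Ay; split.
    by rewrite nm_pair ge_max (le_trans f1) ?(le_trans g1) // ler_wpM2r ?nm_ge0 ?lerDl ?lerDr.
  by rewrite nm_pair ge_max (le_trans f2) ?(le_trans g2) // ler_wpM2r ?exprn_ge0 ?nm_ge0 ?lerDl ?lerDr.
Qed.

End TaylorComp.

Section MeanValue.
Context {R : realType} {V W : normedModType R[i]}.

Lemma segment_nball (x0 x y : V) (r t : R) : 0 <= t <= 1 ->
  nball x0 r x -> nball x0 r y -> nball x0 r (x + t%:C%C *: (y - x)).
Proof.
move=> /andP[t0 t1] /= xr yr; rewrite /nball /=.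
have -> : x + t%:C%C *: (y - x) - x0 = (1 - t)%:C%C *: (x - x0) + t%:C%C *: (y - x0).
  rewrite rmorphB rmorph1 scalerBl scale1r !scalerBr.
  set a := t%:C%C *: x; set b := t%:C%C *: y; set c := t%:C%C *: x0.
  by rewrite opprB -[RHS]addrA [c - a + _]addrC subrKA addrAC.
rewrite (le_lt_trans (nmD _ _)) // !nmZ !nm_real ger0_norm ?subr_ge0 // ger0_norm //.
have [am bm] : nm (x - x0) <= Num.max (nm (x - x0)) (nm (y - x0)) /\
  nm (y - x0) <= Num.max (nm (x - x0)) (nm (y - x0)) by rewrite !le_max !lexx orbT.
have mr : Num.max (nm (x - x0)) (nm (y - x0)) < r by rewrite gt_max; apply/andP.
apply: le_lt_trans mr; nra.
Qed.

(** Cut the segment into [n] equal pieces: each increment differs from its linear part by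
    [O(1 / n^2)], so the total error is [K |h|^2 / n] and disappears in the limit. The constant [K]
    is thus absent from the conclusion. *)
Lemma mean_value (A : set V) (f : V -> W) D K (x y : V) (M : R) :
  tayl A f D K ->
  (forall t : R, 0 <= t <= 1 -> A (x + t%:C%C *: (y - x))) ->
  (forall t : R, 0 <= t <= 1 -> nm (D (x + t%:C%C *: (y - x)) (y - x)) <= M) ->
  nm (f y - f x) <= M.
Proof.
move=> [K0 tA] Ax DM; set h := y - x in Ax DM *.
pose p (t : R) := x + t%:C%C *: h.
have step (n i : nat) : (i < n.+1)%N ->
    nm (f (p (i.+1%:R / n.+1%:R)) - f (p (i%:R / n.+1%:R))) <=
    M / n.+1%:R + K * nm h ^+ 2 / n.+1%:R ^+ 2.
  move=> lin; have n0 : (0 : R) < n.+1%:R by rewrite ltr0n.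
  have i01 j : (j <= n.+1)%N -> 0 <= (j%:R / n.+1%:R : R) <= 1.
    by move=> le_j; rewrite divr_ge0 //= ler_pdivrMr // mul1r ler_nat.
  have [Dl _ _ DT] := tA _ (Ax _ (i01 i (ltnW lin))).
  have [_ ] := DT _ (Ax _ (i01 _ lin)).
  have -> : x + (i.+1%:R / n.+1%:R)%:C%C *: h - (x + (i%:R / n.+1%:R)%:C%C *: h) = (n.+1%:R^-1)%:C%C *: h.
    rewrite opprD addrACA subrr add0r -scalerBl -rmorphB; congr (_%:C%C *: _).
    by rewrite -mulrBl -natrB // subSnn mul1r.
  have Dz c : D (p (i%:R / n.+1%:R)) (c *: h) = c *: D (p (i%:R / n.+1%:R)) h.
    have D0 : D (p (i%:R / n.+1%:R)) 0 = 0.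
      have := Dl 1 0 0; rewrite !scale1r addr0 => /eqP.
      by rewrite -subr_eq0 opprD addrA subrr sub0r oppr_eq0 => /eqP.
    by have := Dl c h 0; rewrite addr0 D0 addr0.
  rewrite -/(p _) -/(p _) Dz nmZ nm_real ger0_norm ?invr_ge0 ?ler0n // => le2.
  have le1 : nm ((n.+1%:R^-1)%:C%C *: D (p (i%:R / n.+1%:R)) h) <= M / n.+1%:R.
    rewrite nmZ nm_real ger0_norm ?invr_ge0 ?ler0n // mulrC ler_wpM2r ?invr_ge0 //.
    exact: DM (i01 i (ltnW lin)).
  have -> : f (p (i.+1%:R / n.+1%:R)) - f (p (i%:R / n.+1%:R)) =
    (f (p (i.+1%:R / n.+1%:R)) - f (p (i%:R / n.+1%:R)) - (n.+1%:R^-1)%:C%C *: D (p (i%:R / n.+1%:R)) h) + (n.+1%:R^-1)%:C%C *: D (p (i%:R / n.+1%:R)) h by rewrite subrK.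
  rewrite (le_trans (nmD _ _)) // addrC lerD // (le_trans le2) //.
  by rewrite exprMn exprVn (mulrC _ (nm h ^+ 2)) mulrA.
have tele n : nm (f y - f x) <= M + K * nm h ^+ 2 / n.+1%:R.
  have n0 : (n.+1%:R : R) != 0 by rewrite pnatr_eq0.
  have fy : f y = f (p (n.+1%:R / n.+1%:R)).
    by rewrite divff // /p scale1r /h addrC subrK.
  have fx : f x = f (p (0%:R / n.+1%:R)) by rewrite mul0r /p scale0r addr0.
  rewrite fy fx.
  have -> : M + K * nm h ^+ 2 / n.+1%:R = n.+1%:R * (M / n.+1%:R + K * nm h ^+ 2 / n.+1%:R ^+ 2).
    by field.
  have ind m : (m <= n.+1)%N -> nm (f (p (m%:R / n.+1%:R)) - f (p (0%:R / n.+1%:R))) <=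
      m%:R * (M / n.+1%:R + K * nm h ^+ 2 / n.+1%:R ^+ 2).
    elim: m => [|m IH] le_m; first by rewrite subrr nm0 mul0r.
    rewrite (le_trans (nm_tri (f (p (m%:R / n.+1%:R))) _ _)) //.
    rewrite -[X in _ <= X * _]natr1 mulrDl mul1r addrC.
    by rewrite lerD ?IH ?(ltnW le_m) //; exact: step.
  exact: ind.
apply/ler_addgt0Pr => e e0.
have [n] : exists n : nat, K * nm h ^+ 2 / e < n.+1%:R.
  have := archi_boundP (divr_ge0 (mulr_ge0 K0 (sqr_ge0 (nm h))) (ltW e0)).
  by set b := Num.bound _ => lt_b; exists b; rewrite (lt_trans lt_b) // ltr_nat.
rewrite ltr_pdivrMr // => lt_n; rewrite (le_trans (tele n)) // lerD2l.
by rewrite ler_pdivrMr ?ltr0n // [e * _]mulrC ltW.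
Qed.

End MeanValue.

(** * Cauchy estimates without integration *)

Section CauchyEstimate.
Context {R : realType}.
Local Notation C := (R[i]^o).

Lemma sum_shift (V : zmodType) n (F : nat -> V) :
  F n = F 0%N -> \sum_(i < n) F i.+1 = \sum_(i < n) F i.
Proof.
case: n => [|n] Fn; first by rewrite !big_ord0.
by rewrite big_ord_recr big_ord_recl /= Fn addrC.
Qed.

Lemma root_of_unity_near1 : exists2 c : R, 0 < c & forall n, (2 < n)%N ->
  exists w : R[i], [/\ w ^+ n = 1, w != 1, nm w = 1 & nm (w - 1) <= c / n%:R].
Proof.
(* The bound [7 (2 pi)] of [cexp_lip] is below [16 pi]; so is [2 n] if [2 pi / n > 1/2], where only
   [|w - 1| <= 2] is available. *)
pose c : R := 16 * pi; have p0 := pi_gt0 R.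
exists (Num.max c 2) => [|n n2]; first by rewrite lt_max ltr0n orbT.
have n0 : (0 : R) < n%:R by rewrite ltr0n (ltn_trans _ n2).
have n0' : n%:R != 0 :> R by rewrite gt_eqF.
pose z : R[i] := Complex 0 (2 * pi / n%:R).
have nz : nm z = 2 * pi / n%:R.
  apply/eqP; rewrite -(@eqrXn2 _ 2) ?nm_ge0 ?divr_ge0 ?mulr_ge0 ?ltW // sqr_nm /=.
  by rewrite expr0n add0r.
exists (cexp z); split.
- rewrite -cexpMn /cexp.
  have -> : z *+ n = Complex 0 (2 * pi).
    have zM k : z *+ k = Complex 0 ((2 * pi / n%:R) *+ k).
      elim: k => [|k IH]; first by rewrite !mulr0n.
      rewrite mulrS IH [in RHS]mulrS; apply/eqP; rewrite eq_complex /=.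
      by rewrite addr0 !eqxx.
    by rewrite zM -mulr_natr divfK.
  by rewrite /= expR0 mul1r mulrC mulr_natr cos2pi sin2pi.
- apply/eqP => /(congr1 (@complex.Im R))/eqP; rewrite /cexp /= expR0 mul1r mul0r addr0.
  apply/negP; rewrite gt_eqF // sin_gt0_pi // divr_gt0 ?mulr_gt0 //=.
  by rewrite ltr_pdivrMr // mulrC ltr_pM2l // ltr_nat.
- by rewrite nm_cexp /= expR0.
- have [le2|gt2] := leP (nm z) (1 / 2).
    rewrite (le_trans (cexp_lip le2)) // nz; apply: (@le_trans _ _ (c / n%:R)).
      by rewrite mulrA ler_wpM2r ?invr_ge0 ?ltW // /c; lra.
    by apply: ler_wpM2r; [rewrite invr_ge0 ltW|rewrite le_max lexx].
  rewrite (le_trans (nm_sub _ _)) // nm_cexp nm1 /= expR0 ler_pdivlMr //.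
  rewrite le_max; apply/orP; left; move: gt2; rewrite nz ltr_pdivlMr // /c; lra.
Qed.

(* A discrete form of Cauchy's formula: along a lattice of points [r / l ^ k * w ^ i] the complex linearity of
   the derivative turns radial increments into angular ones. *)
Lemma cauchy_disc (A : set C) (f : C -> C) D (K r M : R) : 0 < r ->
  tayl A f D K -> (forall t, nm t <= r -> A t) -> (forall t, nm t <= r -> nm (f t) <= M) ->
  nm (D 0 1) <= M / r.
Proof.
move=> r0 [K0 tA] Ar0 fM0.
have Ar (z : R[i]) : nm z <= r -> A z by exact: Ar0.
have fM (z : R[i]) : nm z <= r -> nm (f z : R[i]) <= M by exact: fM0.
have DT (x y : R[i]) : nm x <= r -> nm y <= r ->
    nm (f y - f x - D x (y - x) : R[i]) <= K * nm (y - x) ^+ 2.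
  by move=> /Ar /tA[_ _ _ H] /Ar Ay; have [] := H _ Ay.
rewrite -[nm _]/(nm (D 0 1 : R[i])); have [c c0 rootP] := root_of_unity_near1.
have M0 : 0 <= M by rewrite (le_trans (nm_ge0 (f 0))) // fM // nm0 ltW.
have Dz (t z : R[i]) : nm t <= r -> D t z = z * D t 1 :> R[i].
  move=> /Ar /tA[Dl _ _ _]; have D0 : D t 0 = 0.
    have := Dl 1 0 0; rewrite !scale1r addr0 => /eqP.
    by rewrite -subr_eq0 opprD addrA subrr sub0r oppr_eq0 => /eqP.
  have := Dl z 1 0; rewrite addr0 D0 addr0 => E.
  by apply: etrans E; congr (D t _); exact: esym (mulr1 _).
(* The three terms are the bound on the outer circle, the error of all radial steps, which vanishes
   as [n] grows, and the error on the innermost circle, which vanishes as [m] grows. *)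
suff main n m : (2 < n)%N -> nm (D 0 1) <= M / r + K * ((1 + c) / n%:R) * r + K * (r / (1 + n%:R^-1) ^+ m).
  apply/ler_addgt0Pr => e e0.
  have [n n2 le_n] : exists2 n, (2 < n)%N & K * ((1 + c) / n%:R) * r <= e / 2.
    have := archi_boundP (divr_ge0 (mulr_ge0 (mulr_ge0 K0 (addr_ge0 ler01 (ltW c0))) (ltW r0)) (ltW (divr_gt0 e0 (ltr0n R 2)))).
    set b := Num.bound _ => lt_b; exists b.+3 => //.
    move: lt_b; rewrite ltr_pdivrMr ?divr_gt0 // => lt_b.
    rewrite mulrA mulrAC ler_pdivrMr ?ltr0n // (le_trans (ltW lt_b)) //.
    rewrite mulrC; apply: ler_wpM2l; first by rewrite divr_ge0 // ltW.
    by rewrite ler_nat -addn3 leq_addr.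
  have [m le_m] : exists m, K * (r / (1 + n%:R^-1) ^+ m) <= e / 2.
    have n0 : (0 : R) < n%:R by rewrite ltr0n (ltn_trans _ n2).
    have := archi_boundP (divr_ge0 (mulr_ge0 (mulr_ge0 K0 (ltW r0)) (ltW n0)) (ltW (divr_gt0 e0 (ltr0n R 2)))).
    set b := Num.bound _; rewrite ltr_pdivrMr ?divr_gt0 // => lt_b; exists b.
    have bern : 1 + b%:R / n%:R <= (1 + n%:R^-1) ^+ b :> R.
      elim: (b) => [|k IH]; first by rewrite mul0r addr0.
      rewrite exprS -natr1; have := ltr0n R n; rewrite (ltn_trans _ n2) // => _.
      have i0 : 0 < n%:R^-1 :> R by rewrite invr_gt0.
      have k0 : (0 : R) <= k%:R by rewrite ler0n.
      set i : R := n%:R^-1 in i0 IH *; set P := _ ^+ k in IH *.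
      have := mulr_ge0 k0 (mulr_ge0 (ltW i0) (ltW i0)); nra.
    have p0 : 0 < (1 + n%:R^-1) ^+ b :> R by rewrite exprn_gt0 // addr_gt0 ?invr_gt0.
    rewrite mulrA ler_pdivrMr //.
    have : b%:R / n%:R * (e / 2) <= (1 + n%:R^-1) ^+ b * (e / 2).
      apply: ler_wpM2r; first by rewrite divr_ge0 // ltW.
      by rewrite (le_trans _ bern) // lerDr.
    rewrite -/(_ <= _) => le1; rewrite (le_trans _ (le_trans le1 _)) //; last by rewrite mulrC.
    by rewrite mulrAC ler_pdivlMr // ltW.
  by rewrite (le_trans (main n m n2)) // -addrA lerD2l; lra.
move=> n2; have [w [wn w1 nw le_w]] := rootP n n2.
have n0 : (0 : R) < n%:R by rewrite ltr0n (ltn_trans _ n2).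
have n0' : (n%:R : R[i]) != 0 by rewrite pnatr_eq0 -lt0n (ltn_trans _ n2).
pose l : R := 1 + n%:R^-1; have l1 : 1 < l by rewrite ltrDl invr_gt0.
have l0 : 0 < l := lt_trans ltr01 l1.
pose rho k : R := r / l ^+ k.
have rho0 k : 0 < rho k by rewrite divr_gt0 ?exprn_gt0.
have rhoS k : l * rho k.+1 = rho k.
  have l0' : l != 0 by rewrite gt_eqF.
  by rewrite /rho exprS; field; rewrite l0' expf_neq0.
have rho_dec k : rho k.+1 <= rho k by rewrite -(rhoS k); apply: ler_peMl; apply: ltW.
have rho_le k : rho k <= r.
  by elim: k => [|k IH]; [rewrite /rho expr0 divr1|rewrite (le_trans (rho_dec k))].
(* Up to the factor [n], a discrete first Fourier coefficient of [f] on the circle of radius [s],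
   divided by [s]: it tends to [n f'(0)] for small [s]. *)
pose q (s : R) : R[i] := s^-1%:C%C * \sum_(i < n) (w ^- i) * f (s%:C%C * w ^+ i).
have nwX i : nm (w ^+ i) = 1 by rewrite nmX nw expr1n.
have nmq s i : 0 <= s -> nm (s%:C%C * w ^+ i) = s.
  by move=> s0; rewrite nmM nm_real nwX mulr1 ger0_norm.
have w0 : w != 0 by rewrite -nm_gt0 nw.
have step k : nm (q (rho k) - q (rho k.+1)) <= n%:R * (K * ((1 + c) / n%:R) * (rho k - rho k.+1)).
  set s := rho k.+1; have s0 : 0 < s := rho0 k.+1; have sr : s <= r := rho_le k.+1.
  have lsr : l * s <= r by rewrite rhoS.
  rewrite -rhoS -/s; clearbody s; pose a i : R[i] := s%:C%C * w ^+ i; pose F i := w ^- i * f (a i).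
  have na i : nm (a i) = s by rewrite nmq // ltW.
  have shift : \sum_(i < n) w ^- i * f (w * a i) = w * \sum_(i < n) F i.
    have FS i : w ^- i * f (w * a i) = w * F i.+1.
      have -> : F i.+1 = w ^- i.+1 * f (w * a i) by rewrite /F /a mulrCA exprS.
      by rewrite exprS; field; rewrite w0 expf_neq0.
    rewrite (eq_bigr (fun i : 'I_n => w * F i.+1)) => [|i _]; last exact: FS.
    rewrite -mulr_sumr; congr (_ * _).
    by apply: sum_shift; rewrite /F /a wn expr0 invr1 mulr1.
  (* The radial increment [(l - 1) a] is [mu] times the angular increment [(w - 1) a]; hence the
     derivative drops out of [e1 - mu e2], and the angular increments only shift the sum. *)
  pose mu := (l - 1)%:C%C / (w - 1).
  have muw : mu * (w - 1) = (l - 1)%:C%C by rewrite divfK // subr_eq0.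
  pose e1 i : R[i] := f (l%:C%C * a i) - f (a i) - D (a i) ((l - 1)%:C%C * a i).
  pose e2 i : R[i] := f (w * a i) - f (a i) - D (a i) ((w - 1) * a i).
  have la i : nm (l%:C%C * a i) = l * s by rewrite nmM nm_real na ger0_norm // ltW.
  have e1P i : nm (e1 i) <= K * (l - 1) ^+ 2 * s ^+ 2.
    have := DT (a i) (l%:C%C * a i); rewrite na la => /(_ sr lsr).
    have -> : l%:C%C * a i - a i = (l - 1)%:C%C * a i by rewrite rmorphB rmorph1 mulrBl mul1r.
    move=> le_e; apply: (le_trans le_e).
    by rewrite nmM nm_real na exprMn mulrA real_normK ?num_real.
  have e2P i : nm (e2 i) <= K * nm (w - 1) ^+ 2 * s ^+ 2.
    have := DT (a i) (w * a i); rewrite nmM nw mul1r na => /(_ sr sr).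
    have -> : w * a i - a i = (w - 1) * a i by rewrite mulrBl mul1r.
    by move=> le_e; apply: (le_trans le_e); rewrite nmM na exprMn mulrA.
  have key : \sum_(i < n) w ^- i * f ((l * s)%:C%C * w ^+ i) - l%:C%C * \sum_(i < n) F i =
      \sum_(i < n) w ^- i * (e1 i - mu * e2 i).
    have E i : w ^- i * (e1 i - mu * e2 i) = w ^- i * f ((l * s)%:C%C * w ^+ i) - l%:C%C * F i
        - mu * (w ^- i * f (w * a i) - w * F i).
      have lE : l%:C%C = 1 + mu * (w - 1) by rewrite muw rmorphB rmorph1 addrC subrK.
      have lae : (l * s)%:C%C * w ^+ i = l%:C%C * a i by rewrite rmorphM -mulrA.
      rewrite lae /e1 /e2 (Dz (a i) ((l - 1)%:C%C * a i)) ?na //.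
      rewrite (Dz (a i) ((w - 1) * a i)) ?na //.
      have aux (v X Y Z b g t lc l1' : R[i]) : l1' = mu * (t - 1) -> lc = 1 + mu * (t - 1) ->
        v * (X - Y - l1' * b * g - mu * (Z - Y - (t - 1) * b * g)) =
        v * X - lc * (v * Y) - mu * (v * Z - t * (v * Y)) by move=> -> ->; ring.
      exact: aux (esym muw) lE.
    rewrite (eq_bigr _ (fun (i : 'I_n) _ => E i)).
    rewrite !sumrB -!mulr_sumr sumrB shift -mulr_sumr.
    by rewrite subrr mulr0 subr0.
  have -> : q (l * s) - q s = (l * s)^-1%:C%C *
      (\sum_(i < n) w ^- i * f ((l * s)%:C%C * w ^+ i) - l%:C%C * \sum_(i < n) F i).
    rewrite /q mulrBr mulrA; congr (_ - _ * _).
    rewrite -rmorphM; congr (_%:C%C).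
    by rewrite invfM mulrAC mulVf ?mul1r // gt_eqF.
  rewrite key nmM nm_real ger0_norm; last by rewrite invr_ge0 mulr_ge0 // ltW.
  rewrite mulrC ler_pdivrMr ?mulr_gt0 //.
  have mu_le : nm mu * nm (w - 1) = l - 1 by rewrite -nmM muw nm_real ger0_norm // subr_ge0 ltW.
  have ei i : nm (w ^- i * (e1 i - mu * e2 i)) <= K * (l - 1) * s ^+ 2 * ((1 + c) / n%:R).
    rewrite nmM nmV nwX invr1 mul1r (le_trans (nm_sub _ _)) // nmM.
    have h1 := e1P i; have h2 := ler_wpM2l (nm_ge0 mu) (e2P i).
    apply: (le_trans (lerD h1 h2)).
    have -> : K * (l - 1) ^+ 2 * s ^+ 2 + nm mu * (K * nm (w - 1) ^+ 2 * s ^+ 2) =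
      K * (l - 1) * s ^+ 2 * ((l - 1) + nm (w - 1)).
      by rewrite [in RHS]mulrDr -{4}mu_le; ring.
    apply: ler_wpM2l; first by rewrite !mulr_ge0 ?sqr_ge0 ?subr_ge0 // ltW.
    by rewrite mulrDl mul1r lerD // /l addrC addKr.
  rewrite (le_trans (nm_sum _ _ _)) //.
  apply: (@le_trans _ _ (\sum_(i < n) K * (l - 1) * s ^+ 2 * ((1 + c) / n%:R))).
    by apply: ler_sum => i _; exact: ei.
  have E0 : 0 <= (1 + c) / n%:R by rewrite divr_ge0 ?addr_ge0 // ltW.
  rewrite sumr_const card_ord -[leLHS]mulr_natl -subr_ge0.
  set E := (1 + c) / n%:R in E0 *; have N0 := ltW n0; set N : R := n%:R in N0 *.
  have -> : N * (K * E * (l * s - s)) * (l * s) - N * (K * (l - 1) * s ^+ 2 * E) =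
    N * K * E * (l * s - s) ^+ 2 by ring.
  apply: mulr_ge0; last exact: sqr_ge0.
  by apply: mulr_ge0 => //; apply: mulr_ge0.
have total k : nm (q r - q (rho k)) <= n%:R * (K * ((1 + c) / n%:R) * (r - rho k)).
  elim: k => [|k IH]; first by rewrite /rho expr0 divr1 !subrr nm0 !mulr0.
  rewrite (le_trans (nm_tri (q (rho k)) _ _)) // (le_trans (lerD IH (step k))) //.
  by rewrite -!mulrDr addrA subrK.
have q0 s : 0 < s -> s <= r -> nm (q s - n%:R * D 0 1) <= n%:R * (K * s).
  move=> s0 sr; have s0' : s != 0 by rewrite gt_eqF.
  have sumw : \sum_(i < n) w ^- i = 0.
    apply/eqP; rewrite -(mulrI_eq0 _ (lregP (_ : w^-1 - 1 != 0))).
      rewrite (eq_bigr (fun i : 'I_n => w^-1 ^+ i)) => [|i _]; last by rewrite exprVn.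
      by rewrite -subrX1 exprVn wn invr1 subrr.
    by rewrite subr_eq0 invr_eq1.
  pose d i : R[i] := f (s%:C%C * w ^+ i) - f 0 - D 0 (s%:C%C * w ^+ i).
  have dP i : nm (d i) <= K * s ^+ 2.
    have ns : nm (s%:C%C * w ^+ i) = s := nmq _ _ (ltW s0).
    have le_d := DT 0 (s%:C%C * w ^+ i); rewrite nm0 ns in le_d.
    by move: (le_d (ltW r0) sr); rewrite subr0 ns.
  have -> : q s - n%:R * D 0 1 = s^-1%:C%C * \sum_(i < n) w ^- i * d i.
    have E i : w ^- i * d i = w ^- i * f (s%:C%C * w ^+ i) - w ^- i * f 0 - s%:C%C * D 0 1.
      rewrite /d (Dz 0) ?nm0 ?(ltW r0) // !mulrBr mulrA mulrCA mulVf ?mulr1 //.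
      by rewrite expf_neq0.
    rewrite (eq_bigr _ (fun (i : 'I_n) _ => E i)) !sumrB -mulr_suml sumw mul0r subr0.
    rewrite mulrBr /q; congr (_ - _).
    rewrite sumr_const card_ord mulrnAr mulrA -rmorphM mulVf // rmorph1 mul1r.
    exact: mulr_natl.
  rewrite nmM nm_real ger0_norm; last by rewrite invr_ge0 ltW.
  rewrite mulrC ler_pdivrMr //.
  rewrite (le_trans (nm_sum _ _ _)) // (@le_trans _ _ (\sum_(i < n) K * s ^+ 2)) //.
    by apply: ler_sum => i _; rewrite nmM nmV nwX invr1 mul1r dP.
  by rewrite sumr_const card_ord -[leLHS]mulr_natl -!mulrA -expr2.
have qr : nm (q r) <= n%:R * (M / r).
  rewrite /q nmM nm_real ger0_norm; last by rewrite invr_ge0 ltW.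
  rewrite mulrC mulrA; apply: ler_wpM2r; first by rewrite invr_ge0 ltW.
  rewrite (le_trans (nm_sum _ _ _)) // (@le_trans _ _ (\sum_(i < n) M)) //.
    by apply: ler_sum => i _; rewrite nmM nmV nwX invr1 mul1r fM // nmq // ltW.
  by rewrite sumr_const card_ord -[leLHS]mulr_natl.
rewrite -(ler_pM2l n0).
have -> : n%:R * nm (D 0 1) = nm (n%:R * D 0 1) by rewrite nmM nm_nat.
have le1 := q0 _ (rho0 m) (rho_le m); have le2 := total m.
have le3 := nm_dist (n%:R * D 0 1) (q (rho m)); rewrite nmB in le3.
have le4 := nm_dist (q (rho m)) (q r); rewrite nmB in le4.
rewrite !mulrDr -/(rho m).
have : n%:R * (K * ((1 + c) / n%:R) * (r - rho m)) <= n%:R * (K * ((1 + c) / n%:R) * r).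
  apply: ler_wpM2l; first by rewrite ler0n.
  apply: ler_wpM2l; first by rewrite mulr_ge0 // divr_ge0 ?addr_ge0 ?ler0n // ltW.
  by rewrite gerBl ltW.
rewrite -/l -/(rho m).
lra.
Qed.

End CauchyEstimate.

(** The limit is the supremum of the lower bounds [u n - T n], each of which lies below every
    [u m + T m]. *)
Lemma real_cauchy (R : realType) (u T : nat -> R) :
  (forall n m, (n <= m)%N -> `|u m - u n| <= T n) -> exists l, forall n, `|u n - l| <= T n.
Proof.
move=> uT; pose A := range (fun n => u n - T n).
have ub m : ubound A (u m + T m).
  move=> _ [n _ <-]; have := uT _ _ (leq_maxl n m); have := uT _ _ (leq_maxr n m).
  by rewrite !ler_norml => /andP[_ h1] /andP[h2 _]; lra.
have hA : has_sup A by split; [exists (u 0%N - T 0%N), 0%N|exists (u 0%N + T 0%N)].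
exists (sup A) => n; rewrite ler_norml.
have h1 : sup A <= u n + T n by apply: ge_sup => //; exact: hA.1.
have h2 : u n - T n <= sup A by apply: ub_le_sup; [exact: hA.2|exists n].
by apply/andP; split; lra.
Qed.

Lemma complex_cauchy (R : realType) (u : nat -> R[i]) (T : nat -> R) :
  (forall n m, (n <= m)%N -> nm (u m - u n) <= T n) ->
  exists l, forall n, nm (u n - l) <= 2 * T n.
Proof.
move=> uT.
have [n m le_nm|a aP] := @real_cauchy R (fun n => complex.Re (u n)) T.
  rewrite (le_trans _ (uT n m le_nm)) // (le_trans _ (Re_le_nm _)) //.
  by case: (u m) (u n) => [? ?] [? ?].
have [n m le_nm|b bP] := @real_cauchy R (fun n => complex.Im (u n)) T.
  rewrite (le_trans _ (uT n m le_nm)) // (le_trans _ (Im_le_nm _)) //.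
  by case: (u m) (u n) => [? ?] [? ?].
exists (Complex a b) => n; rewrite (le_trans (nm_le_ReIm _)) //.
by move: (aP n) (bP n); case: (u n) => c d /=; lra.
Qed.

(** * Cauchy's estimate in normed spaces and the Weierstrass theorem *)

Section Weierstrass.
Context {R : realType} {V : normedModType R[i]}.
Local Notation C := (R[i]^o).
Implicit Types (f : V -> C) (x y h : V).

Lemma tayl_lin0 A f D K x : tayl A f D K -> A x ->
  (D x 0 = 0) * (forall c h, D x (c *: h) = c *: D x h) * (forall u v, D x (u - v) = D x u - D x v).
Proof.
move=> [_ tA] /tA[Dl _ _ _].
have D0 : D x 0 = 0.
  have := Dl 1 0 0; rewrite !scale1r addr0 => /eqP.
  by rewrite -subr_eq0 opprD addrA subrr sub0r oppr_eq0 => /eqP.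
split; first split=> // c h; first by have := Dl c h 0; rewrite !addr0 D0 addr0.
by move=> u v; rewrite addrC -scaleN1r Dl scaleN1r addrC.
Qed.

(** Restriction to a complex line reduces Cauchy's estimate to one variable. *)
Lemma tayl_slice A f D K x h : tayl A f D K ->
  tayl [set t : C | A (x + t *: h)] (fun t => f (x + t *: h))
    (fun t c => D (x + t *: h) (c *: h)) (K * (1 + nm h + nm h ^+ 2)).
Proof.
move=> [K0 tA]; have h0 := nm_ge0 h; have h2 := sqr_ge0 (nm h).
have E0 : 0 <= 1 + nm h + nm h ^+ 2 by rewrite !addr_ge0.
have le1 : K <= K * (1 + nm h + nm h ^+ 2).
  by rewrite ler_peMr // -addrA lerDl addr_ge0.
have le2 : K * nm h <= K * (1 + nm h + nm h ^+ 2).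
  by rewrite ler_wpM2l // addrAC lerDr addr_ge0.
have le3 : K * nm h ^+ 2 <= K * (1 + nm h + nm h ^+ 2).
  by rewrite ler_wpM2l // lerDr addr_ge0.
split=> [|t At]; first exact: mulr_ge0.
have [Dl fb DK DT] := tA _ At; split.
- by move=> a u v; rewrite scalerDl -scalerA Dl.
- exact: le_trans fb _.
- move=> c; rewrite (le_trans (DK _)) // nmZ [nm c * _]mulrC mulrA.
  by rewrite ler_wpM2r ?nm_ge0.
- move=> s As; have [] := DT _ As.
  have -> : x + s *: h - (x + t *: h) = (s - t) *: h.
    by rewrite opprD addrACA subrr add0r scalerBl.
  rewrite nmZ [nm (s - t) * _]mulrC exprMn (mulrA K (nm h)) (mulrA K (nm h ^+ 2)) => f1 f2; split.
    by rewrite (le_trans f1) // ler_wpM2r ?nm_ge0.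
  by rewrite (le_trans f2) // ler_wpM2r ?exprn_ge0 ?nm_ge0.
Qed.

Lemma cauchy_dir A f D K x h (r M : R) : 0 < r -> tayl A f D K ->
  (forall y, nm (y - x) <= r -> A y) -> (forall y, A y -> nm (f y) <= M) ->
  nm (D x h) <= M / r * nm h.
Proof.
move=> r0 tA sA fM.
have Ax : A x by apply: sA; rewrite subrr nm0 ltW.
have [->|h0] := eqVneq h 0; first by rewrite (tayl_lin0 tA Ax) !nm0 mulr0.
have nh : 0 < nm h by rewrite nm_gt0.
have sub (t : C) : nm t <= r / nm h -> A (x + t *: h).
  move=> le_t; apply: sA; rewrite addrC addKr nmZ.
  by rewrite -ler_pdivlMr.
have := @cauchy_disc R _ _ _ _ (r / nm h) M (divr_gt0 r0 nh) (tayl_slice x h tA) sub (fun t le_t => fM _ (sub t le_t)).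
by rewrite scale0r addr0 scale1r invf_div mulrA mulrAC.
Qed.

(** The new constant involves only the bound [M] and the radius, not [K], so a bounded family
    becomes uniformly controlled on a smaller ball. Cauchy's estimate is used at radius [r / 8] for
    [f], and then for [z |-> f (z + e) - f z], which controls the variation of the derivative; the
    mean value inequality for [f - D x] gives the second-order bound. *)
Lemma cauchy_tayl x0 r f D K M : 0 < r -> tayl (nball x0 r) f D K ->
  (forall x, nball x0 r x -> nm (f x) <= M) ->
  tayl (nball x0 (r / 4)) f D (M * (1 + 8 / r + 64 / r ^+ 2)).
Proof.
move=> r0 tA fM.
have M0 : 0 <= M by rewrite (le_trans (nm_ge0 (f x0))) // fM //; exact: nball0.
have [K0 tA'] := tA.
have r8 : 0 < r / 8 by rewrite divr_gt0.
have i0 : 0 < r^-1 by rewrite invr_gt0.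
have near x y : nm (x - x0) < r / 2 -> nm (y - x) <= r / 8 -> nball x0 r y.
  by move=> h1 h2; rewrite /nball /=; have := nm_tri x y x0; lra.
have D_le x h : nm (x - x0) < r / 2 -> nm (D x h) <= M * (8 / r) * nm h.
  move=> xr; have := cauchy_dir h r8 tA (fun y => near x y xr) fM.
  by rewrite invf_div.
have lip x y : nm (x - x0) < r / 2 -> nm (y - x0) < r / 2 ->
    nm (f y - f x) <= M * (8 / r) * nm (y - x).
  move=> xr yr; have seg t : 0 <= t <= 1 -> nm (x + t%:C%C *: (y - x) - x0) < r / 2.
    by move=> t01; apply: (segment_nball t01).
  apply: (mean_value tA) => t t01; first by apply: (near _ _ (seg t t01)); rewrite subrr nm0 ltW.
  exact: D_le (seg t t01).
have D_lip x y h : nm (x - x0) < r / 4 -> nm (y - x0) < r / 4 ->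
    nm (D y h - D x h) <= M * (64 / r ^+ 2) * nm (y - x) * nm h.
  move=> xr yr; pose e := y - x; pose g z : C := f (z + e) - f z.
  have ez z : nm (z - x) <= r / 8 -> nm (z - x0) < r / 2 /\ nm (z + e - x0) < r / 2.
    move=> le_z; split; first by have := nm_tri x z x0; lra.
    have -> : z + e - x0 = (z - x) + (y - x0).
      by rewrite /e !addrA; congr (_ - _); rewrite addrAC.
    by have := nmD (z - x) (y - x0); lra.
  pose B := [set z | nm (z - x) <= r / 8].
  have tg : tayl B g (fun z u => D (z + e) u - D z u) (K + K).
    split=> [|z Bz]; first exact: addr_ge0.
    have [z1 z2] := ez z Bz.
    have A1 : nball x0 r z by rewrite /nball /=; lra.
    have A2 : nball x0 r (z + e) by rewrite /nball /=; lra.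
    have [Dl1 fb1 DK1 DT1] := tA' z A1; have [Dl2 fb2 DK2 DT2] := tA' _ A2.
    split.
    - by move=> a u v; rewrite Dl1 Dl2 scalerBr opprD addrACA.
    - by rewrite (le_trans (nm_sub _ _)) // lerD.
    - by move=> u; rewrite (le_trans (nm_sub _ _)) // mulrDl lerD.
    - move=> w Bw; have [w1 w2] := ez w Bw.
      have A3 : nball x0 r w by rewrite /nball /=; lra.
      have A4 : nball x0 r (w + e) by rewrite /nball /=; lra.
      have [f1 f2] := DT1 w A3; have [f3 f4] := DT2 _ A4.
      have we : w + e - (z + e) = w - z by rewrite opprD addrACA subrr addr0.
      rewrite we in f3 f4; rewrite /g; split.
        have -> : f (w + e) - f w - (f (z + e) - f z) = (f (w + e) - f (z + e)) - (f w - f z).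
          by move: (f (w + e)) (f w) (f (z + e)) (f z) => a b c d; ring.
        by rewrite (le_trans (nm_sub _ _)) // mulrDl lerD.
      have -> : f (w + e) - f w - (f (z + e) - f z) - (D (z + e) (w - z) - D z (w - z)) =
        (f (w + e) - f (z + e) - D (z + e) (w - z)) - (f w - f z - D z (w - z)).
        move: (f (w + e)) (f w) (f (z + e)) (f z) (D (z + e) _) (D z _) => a b c d p q; ring.
      by rewrite (le_trans (nm_sub _ _)) // mulrDl lerD.
  have gM z : B z -> nm (g z) <= M * (8 / r) * nm e.
    move=> /ez[z1 z2]; have := lip z (z + e) z1 z2.
    by rewrite addrAC subrr add0r.
  have := cauchy_dir h r8 tg (fun z => id) gM.
  have -> : x + e = y by rewrite /e addrC subrK.
  by move/le_trans; apply; rewrite le_eqVlt; apply/orP; left; apply/eqP; field; rewrite gt_eqF.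
have c0 : 0 <= M * (8 / r) by rewrite mulr_ge0 // divr_ge0 // ltW.
have c1 : 0 <= M * (64 / r ^+ 2) by rewrite mulr_ge0 // divr_ge0 // sqr_ge0.
rewrite !mulrDr mulr1; split=> [|x xr]; first by rewrite !addr_ge0.
have xr' : nm (x - x0) < r / 4 by [].
have Ax : nball x0 r x by rewrite /nball /=; lra.
have [Dl fb DK DT] := tA' x Ax; split=> //.
- by rewrite (le_trans (fM x Ax)) // -addrA lerDl addr_ge0.
- move=> h; rewrite (le_trans (D_le x h _)) //; first lra.
  by rewrite ler_wpM2r ?nm_ge0 // addrAC lerDr addr_ge0.
- move=> y yr; have yr' : nm (y - x0) < r / 4 by [].
  have n0 := nm_ge0 (y - x); split.
    rewrite (le_trans (lip x y _ _)) //; [lra|lra|].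
    by rewrite ler_wpM2r // addrAC lerDr addr_ge0.
  have := @mean_value R V C (nball x0 r) (fun z => f z - D x (z - x)) (fun z u => D z u - D x u) (K + K + K * (r + r)) x y (M * (64 / r ^+ 2) * nm (y - x) ^+ 2).
  have -> : f y - D x (y - x) - (f x - D x (x - x)) = f y - f x - D x (y - x).
    by rewrite subrr !(tayl_lin0 tA Ax); move: (f y) (f x) (D x y) (D x x) => a b c d; ring.
  move=> mv.
  rewrite (le_trans (mv _ _ _)) //; last by rewrite ler_wpM2r ?sqr_ge0 // lerDr addr_ge0.
  + split=> [|z zr]; first by rewrite !addr_ge0 ?mulr_ge0 ?addr_ge0 // ltW.
    have [Dlz fbz DKz DTz] := tA' z zr; have KK : 0 <= K * (r + r) by rewrite mulr_ge0 ?addr_ge0 // ltW.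
    have zx : nm (z - x) <= r + r.
      by have := nm_tri x0 z x; rewrite (nmB x0); have : nm (z - x0) < r := zr; lra.
    split.
    * by move=> a u v; rewrite Dlz Dl scalerBr opprD addrACA.
    * rewrite (le_trans (nm_sub _ _)) // (le_trans (lerD fbz (DK _))) //.
      by rewrite -addrA lerD2l (le_trans (ler_wpM2l K0 zx)) // lerDr.
    * move=> u; rewrite (le_trans (nm_sub _ _)) // (le_trans (lerD (DKz u) (DK u))) //.
      by rewrite -mulrDl ler_wpM2r ?nm_ge0 // lerDl.
    * move=> w wr; have [f1 f2] := DTz w wr.
      have Dwz : D x (w - x) = D x (w - z) + D x (z - x).
        by rewrite -[in RHS](subrK z w) addrK !(tayl_lin0 tA Ax); move: (D x w) (D x z) (D x x) => a b c; ring.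
      rewrite Dwz; split.
        have -> : f w - (D x (w - z) + D x (z - x)) - (f z - D x (z - x)) = (f w - f z) - D x (w - z).
          by move: (f w) (f z) (D x (w - z)) (D x (z - x)) => a b c d; ring.
        rewrite (le_trans (nm_sub _ _)) // (le_trans (lerD f1 (DK _))) //.
        by rewrite -mulrDl ler_wpM2r ?nm_ge0 // lerDl.
      have -> : f w - (D x (w - z) + D x (z - x)) - (f z - D x (z - x)) - (D z (w - z) - D x (w - z))
          = f w - f z - D z (w - z).
        by move: (f w) (f z) (D x (w - z)) (D x (z - x)) (D z _) => a b c d g; ring.
      by rewrite (le_trans f2) // ler_wpM2r ?sqr_ge0 // -addrA lerDl addr_ge0.
  + by move=> t t01; have := @segment_nball R V x0 x y r t t01; apply=> //; rewrite /nball /=; lra.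
  + move=> t t01; have zr : nball x0 (r / 4) (x + t%:C%C *: (y - x)) by exact: (segment_nball t01).
    rewrite (le_trans (D_lip x _ _ xr' zr)) // addrAC subrr add0r nmZ nm_real.
    have /andP[t0 t1] := t01; rewrite ger0_norm //.
    have -> : M * (64 / r ^+ 2) * (t * nm (y - x)) * nm (y - x) = M * (64 / r ^+ 2) * nm (y - x) ^+ 2 * t.
      by ring.
    by rewrite ler_piMr // mulr_ge0 ?sqr_ge0.
Qed.

(** Weierstrass' theorem. Cauchy's estimate for [F m - F n] makes the derivatives converge, and
    [cauchy_tayl] provides Taylor bounds uniform in [n], which pass to the limit. *)
Lemma nice_lim x0 r (F : nat -> V -> C) f (e : nat -> R) : 0 < r ->
  (forall n, nice (nball x0 r) (F n)) ->
  (forall n x, nball x0 r x -> nm (F n x - f x) <= e n) ->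
  (forall n m, (n <= m)%N -> e m <= e n) -> (forall d, 0 < d -> exists n, e n < d) ->
  nice (nball x0 (r / 4)) f.
Proof.
move=> r0 Fnice Ff edec e0.
have /choice[DK DKP] : forall n, exists p : (V -> V -> C) * R, tayl (nball x0 r) (F n) p.1 p.2.
  by move=> n; have [D [K t]] := Fnice n; exists (D, K).
pose D n := (DK n).1; pose K n := (DK n).2.
have tF n : tayl (nball x0 r) (F n) (D n) (K n) := DKP n.
have [N eN] := e0 1 ltr01.
have ele n : (N <= n)%N -> e n <= 1 by move=> /edec le_e; rewrite (le_trans le_e) // ltW.
have e_ge0 n : 0 <= e n by rewrite (le_trans (nm_ge0 (F n x0 - f x0))) // Ff //; exact: nball0.
(* [F N] is bounded by [K N], and for [n >= N] both [F n] and [F N] are within 1 of [f]. *)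
pose M := K N + 2.
have FM n x : (N <= n)%N -> nball x0 r x -> nm (F n x) <= M.
  move=> Nn xr; have [_ fb _ _] := (tF N).2 x xr.
  have h1 := Ff n x xr; have h2 := Ff N x xr; have h3 := ele n Nn; have h4 := ele N (leqnn N).
  have h5 := nm_tri (f x) (F n x) (F N x); have h6 := nm_dist (F n x) (F N x).
  by rewrite (nmB (f x)) in h5; rewrite /M; lra.
pose Kc := M * (1 + 8 / r + 64 / r ^+ 2).
have tF4 n : (N <= n)%N -> tayl (nball x0 (r / 4)) (F n) (D n) Kc.
  by move=> Nn; apply: cauchy_tayl => // x; exact: FM.
have lim_le (a b c : R) : 0 <= c -> (forall n, (N <= n)%N -> a <= b + c * e n) -> a <= b.
  move=> c0 H; apply/ler_addgt0Pr => d d0.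
  have [n en] := e0 (d / (c + 1)) (divr_gt0 d0 (ltr_wpDl c0 ltr01)).
  have Nn := H _ (leq_maxl N n); rewrite (le_trans Nn) // lerD2l.
  move: en; rewrite ltr_pdivlMr; last by rewrite ltr_wpDl.
  by have := edec _ _ (leq_maxr N n); have := e_ge0 (maxn N n); nra.
have DD n m x h : (N <= n)%N -> (n <= m)%N -> nball x0 (r / 4) x ->
    nm (D m x h - D n x h) <= 4 / r * nm h * e n.
  move=> Nn nm_ xr; pose g z : C := F m z - F n z.
  have tg : tayl (nball x0 r) g (fun z u => D m z u - D n z u) (K m + K n).
    have [Kn tn] := tF n; have [Km tm] := tF m; split=> [|z zr]; first exact: addr_ge0.
    have [l1 b1 d1 t1] := tm z zr; have [l2 b2 d2 t2] := tn z zr; split.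
    - by move=> a u v; rewrite l1 l2 scalerBr opprD addrACA.
    - by rewrite (le_trans (nm_sub _ _)) // lerD.
    - by move=> u; rewrite (le_trans (nm_sub _ _)) // mulrDl lerD.
    - move=> w wr; have [f1 f2] := t1 w wr; have [f3 f4] := t2 w wr; rewrite /g; split.
        have -> : F m w - F n w - (F m z - F n z) = (F m w - F m z) - (F n w - F n z).
          by move: (F m w) (F n w) (F m z) (F n z) => a b c d; ring.
        by rewrite (le_trans (nm_sub _ _)) // mulrDl lerD.
      have -> : F m w - F n w - (F m z - F n z) - (D m z (w - z) - D n z (w - z)) =
          (F m w - F m z - D m z (w - z)) - (F n w - F n z - D n z (w - z)).
        by move: (F m w) (F n w) (F m z) (F n z) (D m z _) (D n z _) => a b c d p q; ring.
      by rewrite (le_trans (nm_sub _ _)) // mulrDl lerD.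
  have gM z : nball x0 r z -> nm (g z) <= 2 * e n.
    move=> zr; have h1 := Ff n z zr; have h2 := Ff m z zr; have h3 := edec _ _ nm_.
    by have := nm_tri (f z) (F m z) (F n z); rewrite (nmB (f z)) /g; lra.
  have sub z : nm (z - x) <= r / 2 -> nball x0 r z.
    by move=> zx; have := nm_tri x z x0; have : nm (x - x0) < r / 4 := xr; rewrite /nball /=; lra.
  have := cauchy_dir h (divr_gt0 r0 (ltr0n R 2)) tg sub gM.
  by move/le_trans; apply; rewrite le_eqVlt; apply/orP; left; apply/eqP; field; rewrite gt_eqF.
have /choice[L LP] : forall p : V * V, exists l : C, nball x0 (r / 4) p.1 ->
    forall n, (N <= n)%N -> nm (D n p.1 p.2 - l) <= 8 / r * nm p.2 * e n.
  move=> [x h] /=; have [xr|] := pselect (nball x0 (r / 4) x); last by exists 0.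
  have [|l lP] := @complex_cauchy R (fun n => D (N + n)%N x h) (fun n => 4 / r * nm h * e (N + n)%N).
    by move=> n m le_nm; apply: DD => //; [exact: leq_addr|rewrite leq_add2l].
  exists l => _ n Nn; have := lP (n - N)%N; rewrite subnKC // => /le_trans; apply.
  by rewrite le_eqVlt; apply/orP; left; apply/eqP; field; rewrite gt_eqF.
have c8 h : 0 <= 8 / r * nm h by rewrite mulr_ge0 ?nm_ge0 // divr_ge0 // ltW.
have LE x h n : nball x0 (r / 4) x -> (N <= n)%N -> nm (D n x h - L (x, h)) <= 8 / r * nm h * e n.
  by move=> xr; apply: LP (x, h) xr n.
exists (fun x h => L (x, h)), Kc; split=> [|x xr]; first by have [] := tF4 N (leqnn N).
have xr' : nball x0 r x by have : nm (x - x0) < r / 4 := xr; rewrite /nball /=; lra.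
split.
- move=> a u v; apply/eqP; rewrite -subr_eq0 -nm_eq0 eq_le nm_ge0 andbT.
  apply: (lim_le _ _ (8 / r * nm (a *: u + v) + nm a * (8 / r * nm u) + 8 / r * nm v)).
    by rewrite !addr_ge0 // mulr_ge0 ?nm_ge0.
  move=> n Nn; have [Dl _ _ _] := (tF4 n Nn).2 x xr.
  have h1 := LE x (a *: u + v) n xr Nn; have h2 := ler_wpM2l (nm_ge0 a) (LE x u n xr Nn).
  have h3 := LE x v n xr Nn; rewrite -nmZ in h2; rewrite Dl in h1.
  have -> : L (x, a *: u + v) - (a *: L (x, u) + L (x, v)) =
     (a *: (D n x u - L (x, u)) + (D n x v - L (x, v))) - (a *: D n x u + D n x v - L (x, a *: u + v)).
    rewrite scalerBr; move: (a *: D n x u) (a *: L (x, u)) (L (x, v)) (D n x v) (L (x, a *: u + v)) => p q s t w; ring.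
  by rewrite add0r (le_trans (nm_sub _ _)) // (le_trans (lerD (nmD _ _) (lexx _))) //; lra.
- apply: (lim_le _ _ 1) => // n Nn; have [_ fb _ _] := (tF4 n Nn).2 x xr.
  by have := Ff n x xr'; have := nm_dist (f x) (F n x); rewrite nmB; lra.
- move=> h; apply: (lim_le _ _ (8 / r * nm h)) => // n Nn; have [_ _ DKn _] := (tF4 n Nn).2 x xr.
  by have := DKn h; have := LE x h n xr Nn; have := nm_dist (L (x, h)) (D n x h); rewrite nmB; lra.
- move=> y yr; have yr' : nball x0 r y by have : nm (y - x0) < r / 4 := yr; rewrite /nball /=; lra.
  split.
    apply: (lim_le _ _ 2) => // n Nn; have [_ _ _ DT] := (tF4 n Nn).2 x xr; have [h1 _] := DT y yr.
    have h2 := Ff n x xr'; have h3 := Ff n y yr'.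
    have -> : f y - f x = (F n y - F n x) - ((F n y - f y) - (F n x - f x)).
      by move: (f y) (f x) (F n y) (F n x) => a b c d; ring.
    have := nm_sub (F n y - F n x) ((F n y - f y) - (F n x - f x)).
    by have := nm_sub (F n y - f y) (F n x - f x); lra.
  apply: (lim_le _ _ (2 + 8 / r * nm (y - x))); first by rewrite addr_ge0.
  move=> n Nn; have [_ _ _ DT] := (tF4 n Nn).2 x xr; have [_ h1] := DT y yr.
  have h2 := Ff n x xr'; have h3 := Ff n y yr'; have h4 := LE x (y - x) n xr Nn.
  have -> : f y - f x - L (x, y - x) = (F n y - F n x - D n x (y - x)) -
      (((F n y - f y) - (F n x - f x)) - (D n x (y - x) - L (x, y - x))).
    by move: (f y) (f x) (F n y) (F n x) (L (x, y - x)) (D n x (y - x)) => a b c d p q; ring.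
  have := nm_sub (F n y - F n x - D n x (y - x)) ((F n y - f y) - (F n x - f x) - (D n x (y - x) - L (x, y - x))).
  have := nm_sub ((F n y - f y) - (F n x - f x)) (D n x (y - x) - L (x, y - x)).
  by have := nm_sub (F n y - f y) (F n x - f x); lra.
Qed.

End Weierstrass.

(** * Algebraic operations, exponential and inverse for functions with Taylor bounds *)

Section NiceCalculus.
Context {R : realType} {V : normedModType R[i]}.
Local Notation C := (R[i]^o).
Implicit Types (A : set V) (f g : V -> C).

Lemma nice_of_bound (B : set C) (F D : C -> R[i]) (K : R) : 0 <= K ->
  (forall x, B x -> nm (F x) <= K) -> (forall x, B x -> nm (D x) <= K) ->
  (forall x y, B x -> B y -> nm (F y - F x) <= K * nm (y - x : R[i])) ->
  (forall x y, B x -> B y -> nm (F y - F x - D x * (y - x)) <= K * nm (y - x : R[i]) ^+ 2) ->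
  nice B (F : C -> C).
Proof.
move=> K0 F1 D1 F2 F3; exists (fun x h => D x * h : C), K; split=> // x Bx; split.
- move=> a u v; rewrite mulrDr; congr (_ + _).
  by rewrite -[a *: u]/(a * u) -[RHS]/(a * (D x * u)) mulrCA.
- exact: F1.
- by move=> h; rewrite nmM ler_wpM2r ?nm_ge0 ?D1.
- by move=> y By; split; [apply: F2|apply: F3].
Qed.

Lemma niceD A f g : nice A f -> nice A g -> nice A (fun x => f x + g x).
Proof.
move=> nf ng; have [K1 K10 f1] := nice_bounded nf; have [K2 K20 g1] := nice_bounded ng.
apply: (@nice_comp R V (C * C)%type C A [set p | nm p.1 <= K1 /\ nm p.2 <= K2] _ (fun p : C * C => p.1 + p.2)
  (nice_pair nf ng)) => [|x Ax /=]; last by rewrite f1 ?g1.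
apply: (@nice_lin _ _ _ _ _ (K1 + K2) 2) => [a u v|p|p [p1 p2]] /=.
- by rewrite scalerDr addrACA.
- have : nm p.1 <= nm p /\ nm p.2 <= nm p.
    by case: p => a b /=; rewrite nm_pair !le_max !lexx orbT.
  by move=> [h1 h2]; have := nmD p.1 p.2; lra.
- by case: p p1 p2 => a b /= h1 h2; rewrite nm_pair ge_max; apply/andP; split; lra.
Qed.

Lemma niceM A f g : nice A f -> nice A g -> nice A (fun x => f x * g x).
Proof.
move=> nf ng; have [K1 K10 f1] := nice_bounded nf; have [K2 K20 g1] := nice_bounded ng.
pose B := [set p : C * C | nm p.1 <= K1 /\ nm p.2 <= K2].
apply: (@nice_comp R V (C * C)%type C A B _ (fun p : C * C => p.1 * p.2)
  (nice_pair nf ng)) => [|x Ax /=]; last by split; [exact: f1|exact: g1].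
have fs (p : C * C) : nm p.1 <= nm p /\ nm p.2 <= nm p.
  by case: p => a b /=; rewrite nm_pair !le_max !lexx orbT.
have K12 : 0 <= K1 * K2 by rewrite mulr_ge0.
exists (fun p h => p.1 * h.2 + p.2 * h.1 : C), (K1 * K2 + K1 + K2 + 1).
split=> [|p [p1 p2]]; first by rewrite !addr_ge0.
have Dle (h : C * C) : nm (p.1 * h.2 + p.2 * h.1 : R[i]) <= (K1 + K2) * nm h.
  have [h1 h2] := fs h; rewrite (le_trans (nmD _ _)) // !nmM mulrDl.
  by rewrite lerD // ler_pM ?nm_ge0.
split.
- move=> a u v /=; rewrite -![_ *: _]/(_ * _) /=.
  move: (p.1) (p.2) => P Q; ring.
- rewrite nmM (le_trans (ler_pM (nm_ge0 _) (nm_ge0 _) p1 p2)) //.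
  by rewrite -!addrA lerDl !addr_ge0.
- move=> h; rewrite (le_trans (Dle h)) // ler_wpM2r ?nm_ge0 //.
  by rewrite -!addrA addrCA lerD2l [K1 * K2 + _]addrCA lerDl addr_ge0.
- move=> q [q1 q2]; have [d1 d2] := fs (q - p); have n0 := nm_ge0 (q - p); split.
    have -> : q.1 * q.2 - p.1 * p.2 = q.1 * (q.2 - p.2) + p.2 * (q.1 - p.1) :> R[i].
      by move: (q.1) (q.2) (p.1) (p.2) => a b c d; ring.
    rewrite (le_trans (nmD _ _)) // !nmM.
    have : nm (q.1 : R[i]) * nm (q.2 - p.2 : R[i]) <= K1 * nm (q - p) by rewrite ler_pM ?nm_ge0.
    have : nm (p.2 : R[i]) * nm (q.1 - p.1 : R[i]) <= K2 * nm (q - p) by rewrite ler_pM ?nm_ge0.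
    nra.
  have -> : q.1 * q.2 - p.1 * p.2 - (p.1 * (q - p).2 + p.2 * (q - p).1) = (q.1 - p.1) * (q.2 - p.2) :> R[i].
    by rewrite /=; move: (q.1) (q.2) (p.1) (p.2) => a b c d; ring.
  rewrite nmM; have : nm (q.1 - p.1 : R[i]) * nm (q.2 - p.2 : R[i]) <= nm (q - p) * nm (q - p).
    by rewrite ler_pM ?nm_ge0.
  have := sqr_ge0 (nm (q - p)); rewrite -expr2; nra.
Qed.

Lemma niceN A f : nice A f -> nice A (fun x => - f x).
Proof.
move=> nf; apply: nice_eq (niceM (nice_cst A (-1 : C)) nf) => x _; exact: mulN1r.
Qed.

Lemma niceB A f g : nice A f -> nice A g -> nice A (fun x => f x - g x).
Proof. by move=> nf /niceN; apply: niceD. Qed.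

Lemma niceX A f n : nice A f -> nice A (fun x => f x ^+ n).
Proof.
move=> nf; elim: n => [|n IH]; first exact: (nice_cst A (1 : C)).
by apply: nice_eq (niceM nf IH) => x _; rewrite exprS.
Qed.

Lemma nice_prod A (I : Type) (s : seq I) (F : I -> V -> C) :
  (forall i, nice A (F i)) -> nice A (fun x => \prod_(i <- s) F i x).
Proof.
move=> nF; elim: s => [|i s IH].
  by apply: nice_eq (nice_cst A (1 : C)) => x _; rewrite big_nil.
by apply: nice_eq (niceM (nF i) IH) => x _; rewrite big_cons.
Qed.

Lemma nice_exp A f : nice A f -> nice A (fun x => cexp (f x) : C).
Proof.
move=> nf; have [K K0 f1] := nice_bounded nf.
apply: (@nice_comp R V C C A [set z : C | nm z <= K] _ cexp nf); last exact: f1.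
have E0 := expR_ge0 K; have E2 := expR_ge0 (2 * K).
have expK (z : R[i]) k : nm z <= k -> nm (cexp z) <= expR k.
  move=> zk; rewrite nm_cexp ler_expR (le_trans _ zk) //.
  exact: le_trans (ler_norm _) (Re_le_nm _).
(* For [|h| > 1/2] one has [4 |h|^2 >= 1], so a crude bound of the left-hand side is absorbed by the
   second summand. *)
pose L := 12 + 4 * (expR (2 * K) + 1 + 2 * K).
have second (h : R[i]) : nm h <= 2 * K -> nm (cexp h - 1 - h) <= L * nm h ^+ 2.
  move=> hK; have h0 := nm_ge0 h; have [h1|h1] := leP (nm h) (1 / 2).
    by rewrite (le_trans (cexp_sub1_le h1)) // ler_wpM2r ?sqr_ge0 // /L; lra.
  have s1 := nm_sub (cexp h - 1) h; have s2 := nm_sub (cexp h) 1.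
  have s3 := expK h _ hK; rewrite nm1 in s2.
  have h2 : 1 / 4 <= nm h ^+ 2 by nra.
  have S0 : 0 <= expR (2 * K) + 1 + 2 * K by lra.
  apply: (@le_trans _ _ (expR (2 * K) + 1 + 2 * K)); first lra.
  by rewrite /L; nra.
have L0 : 0 <= L by rewrite /L; lra.
clearbody L.
have first_ (h : R[i]) : nm h <= 2 * K -> nm (cexp h - 1) <= (L * 2 * K + 1) * nm h.
  move=> hK; have h0 := nm_ge0 h; have := second h hK.
  by have := nm_dist (cexp h - 1) h; have := ler_wpM2l L0 (ler_wpM2r h0 hK); nra.
have dK (x y : R[i]) : nm x <= K -> nm y <= K -> nm (y - x) <= 2 * K.
  by move=> xK yK; have := nm_sub y x; lra.
have LK : 0 <= L * 2 * K by rewrite !mulr_ge0.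
apply: (@nice_of_bound _ cexp cexp (expR K * (L + L * 2 * K + 1))) => [||x|x y xK yK|x y xK yK].
- by rewrite mulr_ge0 // !addr_ge0.
- by move=> x /expK le1; rewrite (le_trans le1) // ler_peMr //; lra.
- by move=> /expK le1; rewrite (le_trans le1) // ler_peMr //; lra.
- have -> : cexp y - cexp x = cexp x * (cexp (y - x) - 1).
    by rewrite mulrBr -cexpD [x + _]addrC subrK mulr1.
  rewrite nmM -mulrA ler_pM ?nm_ge0 ?expK // (le_trans (first_ _ (dK x y xK yK))) //.
  by rewrite ler_wpM2r ?nm_ge0 //; lra.
- have -> : cexp y - cexp x - cexp x * (y - x) = cexp x * (cexp (y - x) - 1 - (y - x)).
    by rewrite !mulrBr -cexpD [x + _]addrC subrK mulr1.
  rewrite nmM -mulrA ler_pM ?nm_ge0 ?expK // (le_trans (second _ (dK x y xK yK))) //.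
  by rewrite ler_wpM2r ?sqr_ge0 //; lra.
Qed.

Lemma nice_inv A f (c : R) : 0 < c -> (forall x, A x -> c <= nm (f x)) ->
  nice A f -> nice A (fun x => (f x)^-1).
Proof.
move=> c0 fc nf; have i0 : 0 < c^-1 by rewrite invr_gt0.
apply: (@nice_comp R V C C A [set z : C | c <= nm z] _ (@GRing.inv R[i]) nf); last exact: fc.
have nz (z : R[i]) : c <= nm z -> z != 0 by move=> cz; rewrite -nm_gt0 (lt_le_trans c0).
have inv_le (z : R[i]) : c <= nm z -> nm z^-1 <= c^-1.
  by move=> cz; rewrite nmV lef_pV2 ?posrE // (lt_le_trans c0).
have i2 : 0 <= c^-1 ^+ 2 by rewrite sqr_ge0.
have i3 : 0 <= c^-1 ^+ 3 by rewrite exprn_ge0 // ltW.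
apply: (@nice_of_bound _ (@GRing.inv R[i]) (fun z => - z^-1 ^+ 2) (c^-1 + c^-1 ^+ 2 + c^-1 ^+ 3)).
- by rewrite !addr_ge0 // ltW.
- by move=> x /inv_le le1; rewrite (le_trans le1) // -addrA lerDl addr_ge0.
- move=> x /inv_le le1; rewrite nmN nmX (@le_trans _ _ (c^-1 ^+ 2)) //.
    by rewrite lerXn2r ?nnegrE ?nm_ge0 // ltW.
  by rewrite addrAC lerDr addr_ge0 // ltW.
- move=> x y cx cy; have -> : y^-1 - x^-1 = - (x^-1 * y^-1 * (y - x)) by field; rewrite !nz.
  rewrite nmN nmM ler_wpM2r ?nm_ge0 // nmM.
  apply: (@le_trans _ _ (c^-1 * c^-1)); first by rewrite ler_pM ?nm_ge0 ?inv_le.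
  by rewrite -expr2 addrAC lerDr addr_ge0 // ltW.
- move=> x y cx cy.
  have -> : y^-1 - x^-1 - - x^-1 ^+ 2 * (y - x) = x^-1 ^+ 2 * y^-1 * (y - x) ^+ 2 by field; rewrite !nz.
  rewrite nmM nmX ler_wpM2r ?sqr_ge0 // nmM nmX.
  apply: (@le_trans _ _ (c^-1 ^+ 2 * c^-1)).
    by rewrite ler_pM ?exprn_ge0 ?nm_ge0 ?inv_le // lerXn2r ?nnegrE ?nm_ge0 ?inv_le // ltW.
  by rewrite -exprSr lerDr addr_ge0 // ltW.
Qed.

End NiceCalculus.

Section NiceCoordinates.
Context {R : realType}.
Local Notation C := (R[i]^o).

Lemma nice_fst (V W : normedModType R[i]) (p : V * W) r : nice (nball p r) fst.
Proof.
apply: (@nice_lin _ _ _ _ _ (nm p + r) 1) => [a u v|[a b]|q]; first by [].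
  by rewrite mul1r nm_pair le_max lexx.
by rewrite /nball /= => qr; have := nm_dist q p; lra.
Qed.

Lemma nice_snd (V W : normedModType R[i]) (p : V * W) r : nice (nball p r) snd.
Proof.
apply: (@nice_lin _ _ _ _ _ (nm p + r) 1) => [a u v|[a b]|q]; first by [].
  by rewrite mul1r nm_pair le_max lexx orbT.
by rewrite /nball /= => qr; have := nm_dist q p; lra.
Qed.

Lemma nice_coord n (p : 'rV[R[i]]_n) r (i : 'I_n) :
  nice (nball p r) (fun v : 'rV[R[i]]_n => v ord0 i : C).
Proof.
apply: (@nice_lin _ _ _ _ _ (nm p + r) 1) => [a u v|v|q]; first by rewrite !mxE.
  by rewrite mul1r nm_row.
by rewrite /nball /= => qr; have := nm_dist q p; lra.
Qed.

Lemma nice_row (V : normedModType R[i]) (A : set V) n (F : 'I_n -> V -> C) :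
  (forall i, nice A (F i)) -> nice A (fun x => (\row_i F i x : 'rV[R[i]]_n)).
Proof.
move=> nF.
have /choice[DK DKP] : forall i, exists p : (V -> V -> C) * R, tayl A (F i) p.1 p.2.
  by move=> i; have [D [K t]] := nF i; exists (D, K).
pose K := \sum_i (DK i).2.
have K0 i : 0 <= (DK i).2 by have [] := DKP i.
have leK i : (DK i).2 <= K.
  by rewrite /K (bigD1 i) //= lerDl sumr_ge0.
have K00 : 0 <= K by rewrite sumr_ge0.
exists (fun x h => \row_i ((DK i).1 x h : R[i])), K; split=> // x Ax; split.
- move=> a u v; apply/rowP => i; rewrite !mxE.
  by have [_ /(_ x Ax)[Dl _ _ _]] := DKP i; rewrite Dl.
- apply: nm_row_le => // i; rewrite mxE.
  by have [_ /(_ x Ax)[_ fb _ _]] := DKP i; exact: le_trans fb (leK i).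
- move=> h; apply: nm_row_le => [|i]; first by rewrite mulr_ge0 ?nm_ge0.
  rewrite mxE; have [_ /(_ x Ax)[_ _ DKi _]] := DKP i.
  by rewrite (le_trans (DKi h)) // ler_wpM2r ?nm_ge0.
- move=> y Ay; split.
    apply: nm_row_le => [|i]; first by rewrite mulr_ge0 ?nm_ge0.
    rewrite !mxE; have [_ /(_ x Ax)[_ _ _ /(_ y Ay)[DT _]]] := DKP i.
    by rewrite (le_trans DT) // ler_wpM2r ?nm_ge0.
  apply: nm_row_le => [|i]; first by rewrite mulr_ge0 ?sqr_ge0.
  rewrite !mxE; have [_ /(_ x Ax)[_ _ _ /(_ y Ay)[_ DT]]] := DKP i.
  by rewrite (le_trans DT) // ler_wpM2r ?sqr_ge0.
Qed.

End NiceCoordinates.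

(** * Local expansions *)

Section ExponentialTaylor.
Context {R : realType}.
Local Notation C := (R[i]^o).
Implicit Types z : R[i].

(** Integration of an estimate: a bound of order [n] for the derivative [D] of [f] and [f 0 = 0]
    give order [n + 1] for [f], by the mean value inequality on the segment from 0 to [z]. *)
Lemma cexp_tayl (f D : C -> R[i]) (K : R) : 0 <= K ->
  (forall x y, nm (x : R[i]) <= 1 / 2 -> nm (y : R[i]) <= 1 / 2 ->
     nm (f y - f x - D x * (y - x)) <= K * nm (y - x : R[i]) ^+ 2) ->
  f 0 = 0 -> forall (M : R) n, 0 <= M -> (forall z, nm z <= 1 / 2 -> nm (D z) <= M * nm z ^+ n) ->
  forall z, nm z <= 1 / 2 -> nm (f z) <= M * nm z ^+ n.+1.
Proof.
move=> K0 fT f0 M n M0 DM z z2; have z0 := nm_ge0 z.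
have Mz : 0 <= M * nm z ^+ n by rewrite mulr_ge0 ?exprn_ge0.
pose B := [set w : C | nm (w : R[i]) <= nm z].
have B2 w : B w -> nm (w : R[i]) <= 1 / 2 by move=> Bw; apply: le_trans z2.
have DB w : B w -> nm (D w) <= M * nm z ^+ n.
  move=> Bw; rewrite (le_trans (DM w (B2 w Bw))) // ler_wpM2l //.
  by rewrite lerXn2r ?nnegrE ?nm_ge0.
pose L := M * nm z ^+ n + K * (nm z + nm z).
have L1 : M * nm z ^+ n <= L by rewrite lerDl mulr_ge0 ?addr_ge0.
have tf : tayl B (f : C -> C) (fun x h => D x * h : C) (L + L * nm z + K).
  have fL (x y : C) : B x -> B y -> nm (f y - f x) <= L * nm (y - x : R[i]).
    move=> Bx By; have := fT x y (B2 x Bx) (B2 y By); have := nm_sub (y : R[i]) x.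
    have := nm_dist (f y - f x) (D x * (y - x)); rewrite nmM.
    have := DB x Bx; have : nm (x : R[i]) <= nm z := Bx; have : nm (y : R[i]) <= nm z := By.
    have := nm_ge0 (y - x : R[i]); set d := nm (y - x : R[i]) => d0 yz xz le1 le2 le3 le4.
    have le5 : nm (D x) * d <= M * nm z ^+ n * d by rewrite ler_wpM2r.
    have le6 : K * d ^+ 2 <= K * (nm z + nm z) * d.
      by rewrite expr2 mulrA ler_wpM2r // ler_wpM2l //; lra.
    by rewrite /L mulrDl; lra.
  have L0 : 0 <= L := le_trans Mz L1.
  clearbody L.
  split=> [|x Bx]; first by rewrite !addr_ge0 // mulr_ge0.
  split.
  - move=> a u v; rewrite mulrDr; congr (_ + _).
    by rewrite -[a *: u]/(a * u) -[RHS]/(a * (D x * u)) mulrCA.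
  - have B0 : B 0 by rewrite /B /= nm0.
    have := fL 0 x B0 Bx; rewrite f0 !subr0 => le1; rewrite (le_trans le1) //.
    have : L * nm (x : R[i]) <= L * nm z by rewrite ler_wpM2l.
    by lra.
  - move=> h; rewrite nmM ler_wpM2r ?nm_ge0 // (le_trans (DB x Bx)) //.
    by have := mulr_ge0 L0 z0; lra.
  - move=> y By; split.
      rewrite (le_trans (fL x y Bx By)) // ler_wpM2r ?nm_ge0 //.
      by have := mulr_ge0 L0 z0; lra.
    rewrite (le_trans (fT x y (B2 x Bx) (B2 y By))) // ler_wpM2r ?sqr_ge0 //.
    by have := mulr_ge0 L0 z0; lra.
have := @mean_value _ _ _ _ _ _ _ (0 : C) z (M * nm z ^+ n.+1) tf.
rewrite f0 !subr0; apply.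
  move=> t /andP[t0 t1]; rewrite /B /= add0r nmM nm_real ger0_norm //.
  by rewrite ler_piMl.
move=> t /andP[t0 t1]; rewrite add0r nmM exprSr mulrA ler_wpM2r //.
apply: DB; rewrite /B /= nmM nm_real ger0_norm //.
by rewrite ler_piMl.
Qed.

Lemma cexp_second : exists2 K : R, 0 <= K & forall x y : R[i], nm x <= 1 / 2 -> nm y <= 1 / 2 ->
  nm (cexp y - cexp x - cexp x * (y - x)) <= K * nm (y - x) ^+ 2.
Proof.
have E1 := expR_ge0 (1 : R); have E2 := expR_ge0 (1 / 2 : R).
exists (expR (1 / 2) * (12 + 4 * (expR 1 + 2))) => [|x y x2 y2].
  by rewrite mulr_ge0 //; lra.
have -> : cexp y - cexp x - cexp x * (y - x) = cexp x * (cexp (y - x) - 1 - (y - x)).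
  by rewrite !mulrBr -cexpD [x + _]addrC subrK mulr1.
have expK (z : R[i]) k : nm z <= k -> nm (cexp z) <= expR k.
  move=> zk; rewrite nm_cexp ler_expR (le_trans _ zk) //.
  exact: le_trans (ler_norm _) (Re_le_nm _).
rewrite nmM -mulrA ler_pM ?nm_ge0 ?expK //.
have h1 : nm (y - x) <= 1 by have := nm_sub y x; lra.
have h0 := nm_ge0 (y - x); move: h0 h1; set h := y - x => h0 h1.
have [h2|h2] := leP (nm h) (1 / 2).
  by rewrite (le_trans (cexp_sub1_le h2)) // ler_wpM2r ?sqr_ge0 //; lra.
have s1 := nm_sub (cexp h - 1) h; have s2 := nm_sub (cexp h) 1.
have s3 := expK h _ h1; rewrite nm1 in s2.
have h4 : 1 / 4 <= nm h ^+ 2 by nra.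
apply: (@le_trans _ _ (expR 1 + 2)); first lra.
by nra.
Qed.

(** Each Taylor remainder of the exponential is the derivative of the next one, so [cexp_tayl]
    raises the order twice, starting from [cexp_sub1_le]. *)
Lemma cexp_sub3_le : exists2 K : R, 0 <= K & forall z, nm z <= 1 / 2 ->
  nm (cexp z - 1 - z - z ^+ 2 / 2 - z ^+ 3 / 6) <= K * nm z ^+ 4.
Proof.
have [K K0 KP] := cexp_second.
exists 12 => //.
have h2 (x : R[i]) : nm (x ^+ 2 / 2) = nm x ^+ 2 / 2 by rewrite nmM nmV nmX nm_nat.
have two : (2 : R[i]) != 0 by rewrite pnatr_eq0.
have six : (6 : R[i]) != 0 by rewrite pnatr_eq0.
have T2 z : nm z <= 1 / 2 -> nm (cexp z - 1 - z - z ^+ 2 / 2) <= 12 * nm z ^+ 3.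
  apply: (@cexp_tayl (fun z => cexp z - 1 - z - z ^+ 2 / 2) (fun z => cexp z - 1 - z) (K + 1)) => //; first lra.
  - move=> x y x2 y2.
    have -> : cexp y - 1 - y - y ^+ 2 / 2 - (cexp x - 1 - x - x ^+ 2 / 2) - (cexp x - 1 - x) * (y - x) =
      (cexp y - cexp x - cexp x * (y - x)) - (y - x) ^+ 2 / 2 :> R[i] by field.
    rewrite (le_trans (nm_sub _ _)) // h2; have := KP x y x2 y2.
    by have := sqr_ge0 (nm (y - x : R[i])); lra.
  - by rewrite cexp0 expr0n /= !mul0r !subr0 subrr.
  - exact: cexp_sub1_le.
apply: (@cexp_tayl (fun z => cexp z - 1 - z - z ^+ 2 / 2 - z ^+ 3 / 6) (fun z => cexp z - 1 - z - z ^+ 2 / 2) (K + 2)) => //; first lra.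
- move=> x y x2 y2.
  have -> : cexp y - 1 - y - y ^+ 2 / 2 - y ^+ 3 / 6 - (cexp x - 1 - x - x ^+ 2 / 2 - x ^+ 3 / 6)
     - (cexp x - 1 - x - x ^+ 2 / 2) * (y - x) =
    (cexp y - cexp x - cexp x * (y - x)) - (y - x) ^+ 2 * (1 / 2 + (y + 2 * x) / 6) :> R[i] by field.
  rewrite (le_trans (nm_sub _ _)) // nmM nmX.
  have n1 : nm (1 / 2 + (y + 2 * x) / 6 : R[i]) <= 1.
    rewrite (le_trans (nmD _ _)) // !nmM !nmV !nm_nat nm1.
    by have := nmD (y : R[i]) (2 * x); rewrite nmM nm_nat; lra.
  have := KP x y x2 y2; have := ler_wpM2l (sqr_ge0 (nm (y - x : R[i]))) n1.
  by have := sqr_ge0 (nm (y - x : R[i])); lra.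
- by rewrite cexp0 !expr0n /= !mul0r !subr0 subrr.
Qed.

(* The exponent is the Taylor polynomial of [- ln (1 - s)], hence the factor is [1 - s + O(s^4)]. *)
Definition logp (s : R[i]) : R[i] := s + s ^+ 2 / 2 + s ^+ 3 / 3.

Definition logrem (s : R[i]) : R[i] := cexp (- logp s) - 1 + s.

Lemma nm_logp_le s : nm s <= 1 / 10 -> nm (logp s) <= 2 * nm s.
Proof.
move=> s1; have s0 := nm_ge0 s; rewrite /logp (le_trans (nmD _ _)) // (le_trans (lerD (nmD _ _) (lexx _))) //.
rewrite ![nm (_ / _)]nmM !nmV !nm_nat !nmX.
have : nm s ^+ 2 <= nm s by nra.
have : nm s ^+ 3 <= nm s by rewrite exprSr; have := sqr_ge0 (nm s); nra.
lra.
Qed.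

Lemma logrem_le : exists2 K : R, 0 <= K & forall s, nm s <= 1 / 10 -> nm (logrem s) <= K * nm s ^+ 4.
Proof.
have [K K0 KP] := cexp_sub3_le; exists (16 * K + 100) => [|s s1]; first lra.
have two : (2 : R[i]) != 0 by rewrite pnatr_eq0.
have s0 := nm_ge0 s; set z := - logp s.
have zs : nm z <= 2 * nm s by rewrite nmN nm_logp_le.
have le1 := KP z ltac:(lra).
have z4 : nm z ^+ 4 <= 16 * nm s ^+ 4.
  have -> : 16 * nm s ^+ 4 = (2 * nm s) ^+ 4 by ring.
  by rewrite lerXn2r ?nnegrE ?nm_ge0 // mulr_ge0.
(* The cubic Taylor polynomial of the exponential at [- logp s] is [1 - s + s^4 k]; this is the
   cofactor of [s^4]. *)
pose k : R[i] := 5 / 24 - s / 8 - 19 * s ^+ 2 / 144 - 7 * s ^+ 3 / 72 - s ^+ 4 / 36 - s ^+ 5 / 162.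
have kE : logrem s = (cexp z - 1 - z - z ^+ 2 / 2 - z ^+ 3 / 6) + s ^+ 4 * k.
  by rewrite /logrem -/z; move: (cexp z) => E; rewrite /z /logp /k; field.
have k1 : nm k <= 2.
  have s2 : nm s ^+ 2 <= 1 by rewrite exprn_ile1 //; lra.
  have s3 : nm s ^+ 3 <= 1 by rewrite exprn_ile1 //; lra.
  have s4 : nm s ^+ 4 <= 1 by rewrite exprn_ile1 //; lra.
  have s5 : nm s ^+ 5 <= 1 by rewrite exprn_ile1 //; lra.
  rewrite /k; do 5 rewrite (le_trans (nm_sub _ _)) // -lerBrDr.
  by rewrite ![nm (_ / _)]nmM [nm (7 * _)]nmM [nm (19 * _)]nmM !nmV !nmX !nm_nat; lra.
rewrite kE (le_trans (nmD _ _)) // nmM nmX.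
have s4 : 0 <= nm s ^+ 4 by rewrite exprn_ge0.
have := ler_wpM2l K0 z4; have := ler_wpM2l s4 k1; lra.
Qed.

(** [logrem] is [O(m^4)] on the ball of radius [4 m]; Cauchy's estimate at radius [m] bounds its
    derivative by [O(m^3)] on the ball of radius [2 m], which contains the segment. The Lipschitz
    form matters because only the difference of two remainders enters the increment of [1/u]. *)
Lemma logrem_lip : exists2 K : R, 0 <= K & forall (m : R) s t, 0 < m -> m <= 1 / 40 ->
  nm s <= m -> nm t <= m -> nm (logrem t - logrem s) <= K * m ^+ 3 * nm (t - s).
Proof.
have [K K0 KP] := logrem_le; exists (256 * K) => [|m s t m0 m1 sm tm]; first lra.
have N : nice (nball (0 : C) (4 * m)) (logrem : C -> C).
  have I : nice (nball (0 : C) (4 * m)) (fun s : C => s).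
    apply: (@nice_lin _ _ _ _ _ (4 * m) 1) => [a u v|x|x] //; first by rewrite mul1r.
    by rewrite /nball /= subr0; exact: ltW.
  apply: niceD => //; apply: niceB (nice_cst _ (1 : C)).
  apply: nice_exp; apply: niceN; apply: niceD.
    by apply: niceD => //; apply: niceM (niceX 2 I) (nice_cst _ _).
  by apply: niceM (niceX 3 I) (nice_cst _ _).
have [D [L tD]] := N.
have B4 (z : C) : nball 0 (4 * m) z -> nm (logrem z) <= 256 * K * m ^+ 4.
  rewrite /nball /= subr0 => zm; rewrite (le_trans (KP z _)) //; first lra.
  have -> : 256 * K * m ^+ 4 = K * (4 * m) ^+ 4 by ring.
  by rewrite ler_wpM2l // lerXn2r ?nnegrE ?nm_ge0 ?ltW // mulr_gt0.
have seg (u : R) : 0 <= u <= 1 -> nball (0 : C) (2 * m) (s + u%:C%C *: (t - s)).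
  by move=> u01; apply: segment_nball => //; rewrite /nball /= subr0; lra.
have := @mean_value _ _ _ _ _ _ _ (s : C) (t : C) (256 * K * m ^+ 3 * nm (t - s)) tD.
apply=> u u01; have := seg u u01; rewrite /nball /= => zm; first lra.
have Bz (y : C) : nm (y - (s + u%:C%C *: (t - s))) <= m -> nball 0 (4 * m) y.
  move=> ym; rewrite /nball /=; have := nm_tri (s + u%:C%C *: (t - s)) y 0; lra.
have := cauchy_dir (t - s : C) m0 tD Bz B4.
by have -> : 256 * K * m ^+ 4 / m = 256 * K * m ^+ 3 by field; rewrite gt_eqF.
Qed.

End ExponentialTaylor.

Lemma binomial2 (R : realType) (M : R) n : 0 <= M -> exists2 K : R, 0 <= K & forall t : R[i], nm t <= M ->
  nm ((1 + t) ^+ n - 1 - n%:R * t - 'C(n, 2)%:R * t ^+ 2) <= K * nm t ^+ 3.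
Proof.
move=> M0; elim: n => [|n [K K0 IH]].
  by exists 0 => // t _; rewrite expr0 !mul0r subrr !subr0 nm0.
exists ('C(n, 2)%:R + (1 + M) * K) => [|t tM].
  by rewrite addr_ge0 ?ler0n // mulr_ge0 // addr_ge0.
have t0 := nm_ge0 t.
have -> : (1 + t) ^+ n.+1 - 1 - n.+1%:R * t - 'C(n.+1, 2)%:R * t ^+ 2 =
  (1 + t) * ((1 + t) ^+ n - 1 - n%:R * t - 'C(n, 2)%:R * t ^+ 2) + 'C(n, 2)%:R * t ^+ 3.
  rewrite binS bin1 natrD -natr1 exprS; move: ((1 + t) ^+ n) => E; ring.
rewrite (le_trans (nmD _ _)) // [nm (_ * (_ - _))]nmM [nm (_%:R * _)]nmM nmX nm_nat.
rewrite mulrDl addrC lerD2l -mulrA.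
rewrite ler_pM ?nm_ge0 ?IH // (le_trans (nmD _ _)) // nm1; lra.
Qed.

(** * Domination with a uniform constant *)

Section BigO.
Context {R : realType} {T : Type}.
Implicit Types (D : T -> Prop) (f : T -> R[i]) (g : T -> R).

(** Landau's symbol without a limit: one constant on the whole domain [D], into which all smallness
    conditions are put. *)
Definition bigO D f g := exists2 K : R, 0 <= K & forall t, D t -> nm (f t) <= K * g t.

Lemma O_eq D f1 f2 g : (forall t, D t -> f1 t = f2 t) -> bigO D f1 g -> bigO D f2 g.
Proof. by move=> e [K K0 H]; exists K => // t Dt; rewrite -e ?H. Qed.

Lemma O_le D f g1 g2 (c : R) : 0 <= c -> (forall t, D t -> g1 t <= c * g2 t) -> bigO D f g1 -> bigO D f g2.
Proof.
move=> c0 le12 [K K0 H]; exists (K * c) => [|t Dt]; first exact: mulr_ge0.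
by rewrite (le_trans (H t Dt)) // -mulrA ler_wpM2l ?le12.
Qed.

Lemma O_add D f1 f2 g : bigO D f1 g -> bigO D f2 g -> bigO D (fun t => f1 t + f2 t) g.
Proof.
move=> [K1 K10 H1] [K2 K20 H2]; exists (K1 + K2) => [|t Dt]; first exact: addr_ge0.
by rewrite (le_trans (nmD _ _)) // mulrDl lerD ?H1 ?H2.
Qed.

Lemma O_opp D f g : bigO D f g -> bigO D (fun t => - f t) g.
Proof. by move=> [K K0 H]; exists K => // t Dt; rewrite nmN H. Qed.

Lemma O_sub D f1 f2 g : bigO D f1 g -> bigO D f2 g -> bigO D (fun t => f1 t - f2 t) g.
Proof. by move=> H1 /O_opp; apply: O_add. Qed.

Lemma O_mul D f1 f2 g1 g2 : bigO D f1 g1 -> bigO D f2 g2 ->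
  bigO D (fun t => f1 t * f2 t) (fun t => g1 t * g2 t).
Proof.
move=> [K1 K10 H1] [K2 K20 H2]; exists (K1 * K2) => [|t Dt]; first exact: mulr_ge0.
by rewrite nmM mulrACA ler_pM ?nm_ge0 ?H1 ?H2.
Qed.

Lemma O_exp D f g n : bigO D f g -> bigO D (fun t => f t ^+ n) (fun t => g t ^+ n).
Proof.
move=> H; elim: n => [|n IH]; first by exists 1 => // t _; rewrite !expr0 nm1 mulr1.
have [K K0 H'] := O_mul H IH; exists K => // t Dt; rewrite !exprS; exact: H'.
Qed.

End BigO.

(** * The automorphism of the plane *)

Section BaseMap.
Context {R : realType} (j : nat).
Local Notation J := j.+1.
Implicit Types (p : R[i] * R[i]) (c : R[i]).

Definition beta : R := 2 / (5 * J%:R).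

(** Time-[c] maps of complete flows: [res] belongs to the field with components [j u x] and [- u y],
    of which [u = x y^j] is a first integral, [she] to [(0, x)], and [ove] to
    [(logp (y^J) x, 0)]. *)
Definition res c p : R[i] * R[i] :=
  (p.1 * cexp (j%:R * (c * (p.1 * p.2 ^+ j))), p.2 * cexp (- (c * (p.1 * p.2 ^+ j)))).
Definition she c p : R[i] * R[i] := (p.1, p.2 + c * p.1).
Definition ove c p : R[i] * R[i] := (p.1 * cexp (c * logp (p.2 ^+ J)), p.2).

(** The middle of the word multiplies [y] by [1 + u] to leading order and the two factors [res] by
    [1 - 2 cc u]; the net rate is [2 cc - 1 = beta]. *)
Definition cc : R[i] := ((1 + beta) / 2)%:C%C.

(* A palindromic word in complete flows that fix the line [x = 0] pointwise; to leading order near the origin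
   it multiplies [x] by [1 - (1 - j beta) u] and [y] by [1 - beta u], where [u = x y ^ j]. *)
Definition G p : R[i] * R[i] :=
  locked (res cc (she 2^-1 (ove 1 (she (-1) (ove (-1) (she 2^-1 (res cc p))))))).

Lemma GE p : G p = res cc (she 2^-1 (ove 1 (she (-1) (ove (-1) (she 2^-1 (res cc p)))))).
Proof. by rewrite /G -lock. Qed.

(** The coordinates met while the word is read from right to left: [Gx1], [Gh], [Gx4] are the
    successive values of [x], and [Gy1], ..., [Gy4] those of [y]. *)
Definition Gu p := p.1 * p.2 ^+ j.
Definition Gx1 p := (res cc p).1.
Definition Gy1 p := (res cc p).2.
Definition Gy2 p := Gy1 p + 2^-1 * Gx1 p.
Definition Gl2 p := logp (Gy2 p ^+ J).
Definition Gh p := Gx1 p * cexp (- Gl2 p).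
Definition Gy3 p := Gy2 p - Gh p.
Definition Gl3 p := logp (Gy3 p ^+ J).
Definition Gx4 p := Gh p * cexp (Gl3 p).
Definition Gy4 p := Gy3 p + 2^-1 * Gx4 p.
Definition Gu4 p := Gx4 p * Gy4 p ^+ j.
(** An entire logarithm of the factor by which [G] multiplies [x]; having it globally is what makes
    roots of this factor, hence the lift, single-valued. *)
Definition Alog p : R[i] := locked (j%:R * (cc * (Gu p + Gu4 p)) + (Gl3 p - Gl2 p)).

Lemma AlogE p : Alog p = j%:R * (cc * (Gu p + Gu4 p)) + (Gl3 p - Gl2 p).
Proof. by rewrite /Alog -lock. Qed.

Lemma G_snd p : (G p).2 = Gy4 p * cexp (- (cc * Gu4 p)).
Proof.
by rewrite GE /res /she /ove /= mulN1r mul1r mulN1r.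
Qed.

Lemma G_fst_x4 p : (G p).1 = Gx4 p * cexp (j%:R * (cc * Gu4 p)).
Proof. by rewrite GE /res /she /ove /= mulN1r mul1r mulN1r. Qed.

Lemma G_fst p : (G p).1 = p.1 * cexp (Alog p).
Proof.
rewrite G_fst_x4 /Gx4 /Gh /Gx1 /= -/(Gu p).
have -> : Alog p = j%:R * (cc * Gu p) + (- Gl2 p) + Gl3 p + j%:R * (cc * Gu4 p).
  by rewrite AlogE; ring.
by rewrite !cexpD !mulrA.
Qed.

Definition eps : R := 1 / 100 / 100.

(** The factor [J] keeps not only [u] but also the exponent [j c u] of [res] small. *)
Definition small p := J%:R * nm p.1 <= eps /\ J%:R * nm p.2 <= eps.

Definition wr p : R := nm p.1 + nm p.2.
(** Errors are graded by the number of explicit factors [x] and by the total degree. Since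
    [|x| <= wr <= 1] on [small], a term may trade factors [x] for factors [wr] and may lose
    degree. *)
Definition wt (i k : nat) p : R := nm p.1 ^+ i * wr p ^+ k.

Lemma small_le p : small p ->
  [/\ nm p.1 <= eps, nm p.2 <= eps, j%:R * nm p.1 <= eps & J%:R * nm p.1 <= eps].
Proof.
move=> [s1 s2]; have x0 := nm_ge0 p.1; have y0 := nm_ge0 p.2.
have j0 : (0 : R) <= j%:R by rewrite ler0n.
have JE : (J%:R : R) = j%:R + 1 by rewrite natr1.
rewrite JE !mulrDl !mul1r in s1 s2.
have jx := mulr_ge0 j0 x0; have jy := mulr_ge0 j0 y0.
rewrite JE mulrDl mul1r; move: (j%:R * nm p.1) (j%:R * nm p.2) jx jy s1 s2 => q q' *.
by split; lra.
Qed.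

Lemma wt_le p i k i' k' : small p -> (i' <= i)%N -> (i' + k' <= i + k)%N -> wt i k p <= wt i' k' p.
Proof.
move=> /small_le[x1 y1 _ _] le_i le_ik; rewrite /eps in x1 y1; have x0 := nm_ge0 p.1; have y0 := nm_ge0 p.2.
have r0 : 0 <= wr p by rewrite addr_ge0.
have r1 : wr p <= 1 by rewrite /wr; lra.
have xr : nm p.1 <= wr p by rewrite /wr lerDl.
apply: (@le_trans _ _ (nm p.1 ^+ i' * wr p ^+ (i - i' + k))).
  rewrite /wt -{1}(subnKC le_i) exprD -mulrA exprD ler_wpM2l ?exprn_ge0 //.
  by rewrite ler_wpM2r ?exprn_ge0 // lerXn2r ?nnegrE.
rewrite /wt ler_wpM2l ?exprn_ge0 // ler_wiXn2l //.
by rewrite -(leq_add2l i') addnA subnKC.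
Qed.

Lemma O_wt f i k i' k' : bigO small f (wt i k) -> (i' <= i)%N -> (i' + k' <= i + k)%N -> bigO small f (wt i' k').
Proof. by move=> H h1 h2; apply: (O_le ler01 _ H) => p sp; rewrite mul1r wt_le. Qed.

Lemma O_wtM f1 f2 i k i' k' : bigO small f1 (wt i k) -> bigO small f2 (wt i' k') ->
  bigO small (fun p => f1 p * f2 p) (wt (i + i') (k + k')).
Proof.
move=> H1 H2; apply: (O_le ler01 _ (O_mul H1 H2)) => p _.
by rewrite mul1r /wt !exprD mulrACA.
Qed.

Lemma O_wtX f i k n : bigO small f (wt i k) -> bigO small (fun p => f p ^+ n) (wt (i * n) (k * n)).
Proof.
move=> H; apply: (O_le ler01 _ (O_exp n H)) => p _.
by rewrite mul1r /wt exprMn -!exprM.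
Qed.

Lemma O_exp1 T (D : T -> Prop) (f : T -> R[i]) g : (forall t, D t -> nm (f t) <= 1 / 2) -> bigO D f g ->
  bigO D (fun t => cexp (f t) - 1) g.
Proof.
move=> f2 [K K0 H]; exists (7 * K) => [|t Dt]; first exact: mulr_ge0.
by rewrite (le_trans (cexp_lip (f2 t Dt))) // -mulrA ler_wpM2l ?H.
Qed.

Lemma O_exp2 T (D : T -> Prop) (f : T -> R[i]) g : (forall t, D t -> nm (f t) <= 1 / 2) -> bigO D f g ->
  bigO D (fun t => cexp (f t) - 1 - f t) (fun t => g t ^+ 2).
Proof.
move=> f2 [K K0 H]; exists (12 * K ^+ 2) => [|t Dt]; first by rewrite mulr_ge0 ?sqr_ge0.
rewrite (le_trans (cexp_sub1_le (f2 t Dt))) // -mulrA ler_wpM2l // -exprMn.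
by rewrite lerXn2r ?nnegrE ?nm_ge0 ?H // (le_trans (nm_ge0 (f t)) (H t Dt)).
Qed.

Lemma O_powB T (D : T -> Prop) (f1 f2 : T -> R[i]) g d n : bigO D f1 g -> bigO D f2 g ->
  bigO D (fun t => f1 t - f2 t) d -> bigO D (fun t => f1 t ^+ n.+1 - f2 t ^+ n.+1) (fun t => d t * g t ^+ n).
Proof.
move=> H1 H2 H3.
apply: (@O_eq _ _ _ (fun t => (f1 t - f2 t) * \sum_(i < n.+1) f1 t ^+ (n - i) * f2 t ^+ i)).
  by move=> t _; rewrite subrXX.
apply: O_mul => //.
have Hs (m : nat) : (m <= n.+1)%N ->
    bigO D (fun t => \sum_(i < m) f1 t ^+ (n - i) * f2 t ^+ i) (fun t => g t ^+ n).
  elim: m => [_|m IH le_m].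
    exists 0 => // t Dt; by rewrite big_ord0 nm0 mul0r.
  apply: (@O_eq _ _ _ (fun t => (\sum_(i < m) f1 t ^+ (n - i) * f2 t ^+ i) + f1 t ^+ (n - m) * f2 t ^+ m)).
    by move=> t _; rewrite big_ord_recr.
  apply: O_add; first by apply: IH; exact: ltnW.
  apply: (O_le ler01 _ (O_mul (O_exp (n - m) H1) (O_exp m H2))) => t _.
  by rewrite mul1r -exprD subnK.
exact: Hs.
Qed.

Lemma cc_nm : nm cc <= 7 / 10 /\ 0 < beta <= 2 / 5.
Proof.
have J1 : (1 : R) <= J%:R by rewrite ler1n.
have b0 : 0 < beta by rewrite /beta divr_gt0 // mulr_gt0 // ltr0n.
have b1 : beta <= 2 / 5.
  by rewrite /beta ler_pdivrMr ?mulr_gt0 ?ltr0n //; lra.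
split; last by rewrite b0.
by rewrite nm_real ger0_norm; lra.
Qed.

Lemma nm_pow_le (z : R[i]) n : nm z <= 1 -> nm (z ^+ n.+1) <= nm z.
Proof. by move=> z1; rewrite nmX exprS ler_piMr ?nm_ge0 // exprn_ile1 ?nm_ge0. Qed.

Lemma nm_powj_le (z : R[i]) n : nm z <= 1 -> nm (z ^+ n) <= 1.
Proof. by move=> z1; rewrite nmX exprn_ile1 ?nm_ge0. Qed.

Lemma nm_mulexp (z w : R[i]) : nm w <= 1 / 14 -> nm z / 2 <= nm (z * cexp w) <= 3 / 2 * nm z.
Proof.
move=> w1; have := cexp_lip (_ : nm w <= 1 / 2); have z0 := nm_ge0 z.
have w2 : nm w <= 1 / 2 by lra.
move=> /(_ w2) le1; rewrite nmM; have := nm_dist (cexp w) 1; have := nm_dist 1 (cexp w).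
by rewrite (nmB 1) nm1 => h1 h2; apply/andP; split; nra.
Qed.

(** A priori bounds along the word: they place every exponent in the range where the local
    expansions of the exponential hold. *)
Lemma crude p : small p ->
  ([/\ nm (j%:R * (cc * Gu p)) <= 1 / 10 / 100, nm (cc * Gu p) <= 1 / 10 / 100,
      nm (Gx1 p) <= 3 / 2 * nm p.1, nm p.2 / 2 <= nm (Gy1 p) <= 3 / 2 * nm p.2 & nm (Gy2 p) <= 2 * wr p] /\
  [/\ nm (Gy2 p ^+ J) <= 1 / 10 / 100, nm (Gl2 p) <= 1 / 5 / 100, nm (Gh p) <= 9 / 4 * nm p.1, nm (Gy3 p) <= 5 * wr p &
      nm (Gy3 p ^+ J) <= 1 / 10 / 100]) /\
  [/\ nm (Gl3 p) <= 1 / 5 / 100, nm (Gx4 p) <= 4 * nm p.1, nm (Gy4 p) <= 7 * wr p, nm (j%:R * (cc * Gu4 p)) <= 1 / 10 / 100 &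
      nm (cc * Gu4 p) <= 1 / 10 / 100].
Proof.
move=> sp; have [x1 y1 jx Jx] := small_le sp; have [c7 _] := cc_nm; rewrite /eps in x1 y1 jx Jx.
have x0 := nm_ge0 p.1; have y0 := nm_ge0 p.2; have c0 := nm_ge0 cc.
have j0 : (0 : R) <= j%:R by rewrite ler0n.
have p2h : nm (2^-1 : R[i]) = 1 / 2 by rewrite nmV nm_nat div1r.
have cu (a b : R[i]) : nm b <= 1 -> nm (cc * (a * b)) <= nm a /\ nm (j%:R * (cc * (a * b))) <= j%:R * nm a.
  move=> b1; have a0 := nm_ge0 a; have b0 := nm_ge0 b.
  have h : nm (cc * (a * b)) <= nm a.
    rewrite !nmM -[leRHS]mul1r; apply: ler_pM => //; [exact: mulr_ge0|lra|].
    by rewrite ler_piMr.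
  by split=> //; rewrite [nm (_ * (_ * _))]nmM nm_nat ler_wpM2l.
have y1' : nm p.2 <= 1 by lra.
have [u1 u2] := cu p.1 (p.2 ^+ j) (nm_powj_le j y1').
rewrite -/(Gu p) in u1 u2.
have e1 : nm (j%:R * (cc * Gu p)) <= 1 / 14 by lra.
have e2 : nm (- (cc * Gu p)) <= 1 / 14 by rewrite nmN; lra.
have hx1 : nm (Gx1 p) <= 3 / 2 * nm p.1 by have /andP[_] := nm_mulexp p.1 e1.
have hy1 : nm p.2 / 2 <= nm (Gy1 p) <= 3 / 2 * nm p.2 := nm_mulexp p.2 e2.
have hy2 : nm (Gy2 p) <= 2 * wr p.
  have := nmD (Gy1 p) (2^-1 * Gx1 p); rewrite [nm (2^-1 * _)]nmM p2h /wr -/(Gy2 p).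
  by move/andP: hy1 => [_ h]; move: h hx1 x0 y0; clear; lra.
have w1 : wr p <= 1 / 50 / 100 by move: x1 y1; rewrite /wr; clear; lra.
have hs2 : nm (Gy2 p ^+ J) <= 1 / 10 / 100.
  by rewrite (le_trans (nm_pow_le _ _)) //; move: hy2 w1; clear; lra.
have hl2 : nm (Gl2 p) <= 1 / 5 / 100.
  by rewrite (le_trans (nm_logp_le _)) //; move: hs2; clear; lra.
have l2' : nm (- Gl2 p) <= 1 / 14 by rewrite nmN; move: hl2; clear; lra.
have /andP[_ hh] := nm_mulexp (Gx1 p) l2'.
rewrite -/(Gh p) in hh.
have hy3 : nm (Gy3 p) <= 5 * wr p.
  have := nm_sub (Gy2 p) (Gh p); rewrite -/(Gy3 p).
  by move: hy2 hh hx1 x0 y0; rewrite /wr; clear; lra.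
have hs3 : nm (Gy3 p ^+ J) <= 1 / 10 / 100.
  by rewrite (le_trans (nm_pow_le _ _)) //; move: hy3 w1; clear; lra.
have hl3 : nm (Gl3 p) <= 1 / 5 / 100.
  by rewrite (le_trans (nm_logp_le _)) //; move: hs3; clear; lra.
have l3' : nm (Gl3 p) <= 1 / 14 by move: hl3; clear; lra.
have /andP[_ hx4] := nm_mulexp (Gh p) l3'.
rewrite -/(Gx4 p) in hx4.
have hy4 : nm (Gy4 p) <= 7 * wr p.
  have := nmD (Gy3 p) (2^-1 * Gx4 p); rewrite [nm (2^-1 * _)]nmM p2h /wr -/(Gy4 p).
  by move: hy3 hx4 hh hx1 x0 y0; rewrite /wr; clear; lra.
have y4' : nm (Gy4 p) <= 1 by move: hy4 w1; clear; lra.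
have [u3 u4] := cu (Gx4 p) (Gy4 p ^+ j) (nm_powj_le j y4').
rewrite -/(Gu4 p) in u3 u4.
have x41 : nm (Gx4 p) <= 4 * nm p.1 by move: hx4 hh hx1 x0; clear; lra.
have jx4 : j%:R * nm (Gx4 p) <= 4 * (j%:R * nm p.1).
  by move: (ler_wpM2l j0 x41); clear; lra.
split; [split|]; split=> //; try by move: u1 u2 x1 jx; clear; lra.
- by move: hh hx1; clear; lra.
- by move: u4 jx4 jx; clear; lra.
- by move: u3 x41 x1; clear; lra.
Qed.

Lemma O_x : bigO small (fun p => p.1) (wt 1 0).
Proof. by exists 1 => // p _; rewrite mul1r /wt expr1 expr0 mulr1. Qed.

Lemma O_y : bigO small (fun p => p.2) (wt 0 1).
Proof. by exists 1 => // p _; rewrite mul1r /wt expr0 expr1 mul1r lerDr nm_ge0. Qed.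

Lemma O_one (a : R[i]) : bigO small (fun=> a) (wt 0 0).
Proof. by exists (nm a) => [|p _]; rewrite ?nm_ge0 // /wt !expr0 !mulr1. Qed.

Lemma O_scal a f i k : bigO small f (wt i k) -> bigO small (fun p => a * f p) (wt i k).
Proof. by move=> H; exact: (O_wtM (O_one a) H). Qed.

Lemma O_u : bigO small Gu (wt 1 j).
Proof. by have := O_wtM O_x (O_wtX j O_y); rewrite mul0n addn0 mul1n. Qed.

Lemma O_x1B : bigO small (fun p => Gx1 p - p.1) (wt 2 j).
Proof.
apply: (@O_eq _ _ _ (fun p => p.1 * (cexp (j%:R * (cc * Gu p)) - 1))).
  by move=> p _; rewrite /Gx1 /= mulrBr mulr1.
apply: (O_wtM O_x (O_exp1 _ (O_scal _ (O_scal _ O_u)))) => p /crude[[[h _ _ _ _] _] _].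
by rewrite (le_trans h) //; lra.
Qed.

Lemma O_x1 : bigO small Gx1 (wt 1 0).
Proof.
apply: (@O_eq _ _ _ (fun p => (Gx1 p - p.1) + p.1)) => [p _|]; first by rewrite subrK.
by apply: O_add O_x; apply: O_wt O_x1B _ _.
Qed.

Lemma O_y1B2 : bigO small (fun p => Gy1 p - p.2 + p.2 * (cc * Gu p)) (wt 2 j).
Proof.
apply: (@O_eq _ _ _ (fun p => p.2 * (cexp (- (cc * Gu p)) - 1 - - (cc * Gu p)))).
  by move=> p _; rewrite /Gy1 /= -/(Gu p); ring.
have H : bigO small (fun p => cexp (- (cc * Gu p)) - 1 - - (cc * Gu p)) (wt 2 (j * 2)).
  apply: (O_le ler01 _ (O_exp2 _ (O_opp (O_scal cc O_u)))) => [p _|p /crude[[[_ h _ _ _] _] _]].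
    by rewrite mul1r /wt exprMn -!exprM.
  by rewrite nmN (le_trans h) //; lra.
by apply: O_wt (O_wtM O_y H) _ _; lia.
Qed.

Lemma O_y1B : bigO small (fun p => Gy1 p - p.2) (wt 1 J).
Proof.
apply: (@O_eq _ _ _ (fun p => (Gy1 p - p.2 + p.2 * (cc * Gu p)) - p.2 * (cc * Gu p))) => [p _|].
  by rewrite addrK.
apply: O_sub; first by apply: O_wt O_y1B2 _ _; lia.
by apply: O_wt (O_wtM O_y (O_scal cc O_u)) _ _; lia.
Qed.

Lemma O_y1 : bigO small Gy1 (wt 0 1).
Proof.
apply: (@O_eq _ _ _ (fun p => (Gy1 p - p.2) + p.2)) => [p _|]; first by rewrite subrK.
by apply: O_add O_y; apply: O_wt O_y1B _ _; lia.
Qed.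

Lemma O_y2B : bigO small (fun p => Gy2 p - p.2) (wt 1 0).
Proof.
apply: (@O_eq _ _ _ (fun p => (Gy1 p - p.2) + 2^-1 * Gx1 p)) => [p _|]; first by rewrite /Gy2 addrAC.
by apply: O_add; [apply: O_wt O_y1B _ _; lia|apply: O_scal; exact: O_x1].
Qed.

Lemma O_y2 : bigO small Gy2 (wt 0 1).
Proof. by apply: O_add O_y1 _; apply: O_scal; apply: O_wt O_x1 _ _. Qed.

Lemma O_logp f k : bigO small f (wt 0 k) -> bigO small (fun p => logp (f p)) (wt 0 k).
Proof.
move=> H; apply: O_add; first apply: O_add => //.
  apply: (@O_eq _ _ _ (fun p => 2^-1 * f p ^+ 2)) => [p _|]; first by rewrite mulrC.
  by apply: O_scal; apply: O_wt (O_wtX 2 H) _ _; lia.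
apply: (@O_eq _ _ _ (fun p => 3^-1 * f p ^+ 3)) => [p _|]; first by rewrite mulrC.
by apply: O_scal; apply: O_wt (O_wtX 3 H) _ _; lia.
Qed.

Lemma O_logpB f k : bigO small f (wt 0 k) -> bigO small (fun p => logp (f p) - f p) (wt 0 (2 * k)).
Proof.
move=> H; apply: (@O_eq _ _ _ (fun p => 2^-1 * f p ^+ 2 + 3^-1 * f p ^+ 3)).
  by move=> p _; rewrite /logp !(mulrC _^-1); ring.
apply: O_add; first by apply: O_scal; apply: O_wt (O_wtX 2 H) _ _; lia.
by apply: O_scal; apply: O_wt (O_wtX 3 H) _ _; lia.
Qed.

Lemma O_s2 : bigO small (fun p => Gy2 p ^+ J) (wt 0 J).
Proof. by apply: O_wt (O_wtX J O_y2) _ _; lia. Qed.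

Lemma O_l2 : bigO small Gl2 (wt 0 J).
Proof. exact: O_logp O_s2. Qed.

Lemma O_hB1 : bigO small (fun p => Gh p - Gx1 p) (wt 1 J).
Proof.
apply: (@O_eq _ _ _ (fun p => Gx1 p * (cexp (- Gl2 p) - 1))) => [p _|].
  by rewrite /Gh mulrBr mulr1.
apply: (O_wtM O_x1 (O_exp1 _ (O_opp O_l2))) => p /crude[[_ [_ h _ _ _]] _].
by rewrite nmN (le_trans h) //; lra.
Qed.

Lemma O_hB : bigO small (fun p => Gh p - p.1) (wt 1 J).
Proof.
apply: (@O_eq _ _ _ (fun p => (Gh p - Gx1 p) + (Gx1 p - p.1))) => [p _|]; first by rewrite addrA subrK.
by apply: O_add O_hB1 _; apply: O_wt O_x1B _ _; lia.
Qed.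

Lemma O_h : bigO small Gh (wt 1 0).
Proof.
apply: (@O_eq _ _ _ (fun p => (Gh p - p.1) + p.1)) => [p _|]; first by rewrite subrK.
by apply: O_add O_x; apply: O_wt O_hB _ _; lia.
Qed.

Lemma O_y3 : bigO small Gy3 (wt 0 1).
Proof. by apply: O_sub O_y2 _; apply: O_wt O_h _ _. Qed.

Lemma O_s3 : bigO small (fun p => Gy3 p ^+ J) (wt 0 J).
Proof. by apply: O_wt (O_wtX J O_y3) _ _; lia. Qed.

Lemma O_l3 : bigO small Gl3 (wt 0 J).
Proof. exact: O_logp O_s3. Qed.

Lemma O_s32 : bigO small (fun p => Gy3 p ^+ J - Gy2 p ^+ J) (wt 1 j).
Proof.
have y32 : bigO small (fun p => Gy3 p - Gy2 p) (wt 1 0).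
  apply: (@O_eq _ _ _ (fun p => - Gh p)) => [p _|]; first by rewrite /Gy3 addrAC subrr add0r.
  exact: O_opp O_h.
apply: (O_le ler01 _ (O_powB j O_y3 O_y2 y32)) => p _.
by rewrite mul1r /wt expr0 mul1r !expr1 mulr1.
Qed.

Lemma O_l32 : bigO small (fun p => Gl3 p - Gl2 p) (wt 1 j).
Proof.
apply: (@O_eq _ _ _ (fun p => (Gy3 p ^+ J - Gy2 p ^+ J) * (1 + (2^-1 * (Gy2 p ^+ J + Gy3 p ^+ J)
   + 3^-1 * (Gy2 p ^+ J * Gy2 p ^+ J + Gy2 p ^+ J * Gy3 p ^+ J + Gy3 p ^+ J * Gy3 p ^+ J))))).
  by move=> p _; rewrite /Gl3 /Gl2 /logp; set a := _ ^+ J; set b := _ ^+ J; field.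
have W s : bigO small s (wt 0 J) -> bigO small s (wt 0 0) by move=> H; apply: O_wt H _ _.
have := O_wtM O_s32 (O_add (O_one 1) (O_add (O_scal 2^-1 (O_add (W _ O_s2) (W _ O_s3)))
  (O_scal 3^-1 (O_add (O_add (O_wtM (W _ O_s2) (W _ O_s2)) (O_wtM (W _ O_s2) (W _ O_s3))) (O_wtM (W _ O_s3) (W _ O_s3)))))).
by move=> H; apply: O_wt H _ _; lia.
Qed.

Lemma O_x4Bh : bigO small (fun p => Gx4 p - Gh p) (wt 1 J).
Proof.
apply: (@O_eq _ _ _ (fun p => Gh p * (cexp (Gl3 p) - 1))) => [p _|]; first by rewrite mulrBr mulr1.
apply: (O_wtM O_h (O_exp1 _ O_l3)) => p /crude[_ [h _ _ _ _]].
by rewrite (le_trans h) //; lra.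
Qed.

Lemma O_x4B : bigO small (fun p => Gx4 p - p.1) (wt 1 J).
Proof.
apply: (@O_eq _ _ _ (fun p => (Gx4 p - Gh p) + (Gh p - p.1))) => [p _|]; first by rewrite addrA subrK.
exact: O_add O_x4Bh O_hB.
Qed.

Lemma O_x4 : bigO small Gx4 (wt 1 0).
Proof.
apply: (@O_eq _ _ _ (fun p => (Gx4 p - p.1) + p.1)) => [p _|]; first by rewrite subrK.
by apply: O_add O_x; apply: O_wt O_x4B _ _; lia.
Qed.

Lemma y41E p : Gy4 p - Gy1 p = 2^-1 * (Gx4 p - Gh p) - 2^-1 * (Gh p - Gx1 p).
Proof. by rewrite /Gy4 /Gy3 /Gy2; field. Qed.

Lemma O_y41 : bigO small (fun p => Gy4 p - Gy1 p) (wt 1 J).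
Proof.
apply: (@O_eq _ _ _ (fun p => 2^-1 * (Gx4 p - Gh p) - 2^-1 * (Gh p - Gx1 p))) => [p _|].
  by rewrite y41E.
by apply: O_sub; apply: O_scal; [exact: O_x4Bh|exact: O_hB1].
Qed.

Lemma O_y4B : bigO small (fun p => Gy4 p - p.2) (wt 1 J).
Proof.
apply: (@O_eq _ _ _ (fun p => (Gy4 p - Gy1 p) + (Gy1 p - p.2))) => [p _|]; first by rewrite addrA subrK.
exact: O_add O_y41 O_y1B.
Qed.

Lemma O_y4 : bigO small Gy4 (wt 0 1).
Proof.
apply: (@O_eq _ _ _ (fun p => (Gy4 p - p.2) + p.2)) => [p _|]; first by rewrite subrK.
by apply: O_add O_y; apply: O_wt O_y4B _ _; lia.
Qed.

Lemma O_u4 : bigO small Gu4 (wt 1 j).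
Proof. by have := O_wtM O_x4 (O_wtX j O_y4); rewrite mul0n addn0 mul1n. Qed.

Lemma O_Alog : bigO small Alog (wt 1 j).
Proof.
apply: (O_eq (fun p _ => esym (AlogE p))).
apply: O_add O_l32; apply: O_scal; apply: O_scal; exact: O_add O_u O_u4.
Qed.

Lemma O_y5B4 : bigO small (fun p => (G p).2 - Gy4 p + Gy4 p * (cc * Gu4 p)) (wt 2 j).
Proof.
apply: (@O_eq _ _ _ (fun p => Gy4 p * (cexp (- (cc * Gu4 p)) - 1 - - (cc * Gu4 p)))).
  by move=> p _; rewrite G_snd; ring.
have H : bigO small (fun p => cexp (- (cc * Gu4 p)) - 1 - - (cc * Gu4 p)) (wt 2 (j * 2)).
  apply: (O_le ler01 _ (O_exp2 _ (O_opp (O_scal cc O_u4)))) => [p _|p /crude[_ [_ _ _ _ h]]].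
    by rewrite mul1r /wt exprMn -!exprM.
  by rewrite nmN (le_trans h) //; lra.
by apply: O_wt (O_wtM O_y4 H) _ _; lia.
Qed.

(** The three shears move [y] by half of [h] times the sum of [e^l - 1] over the two overshears,
    which is [x y^J = u y] to leading order. The factors [res] remove [2 cc u y], and
    [2 cc - 1 = beta]. *)
Lemma O_snd2 : exists2 K : R, 0 <= K & forall p, small p ->
  nm ((G p).2 - p.2 * (1 - beta%:C%C * Gu p)) <= K * (wt 2 j p + wt 1 (2 * J) p).
Proof.
pose E1 p := (G p).2 - Gy4 p + Gy4 p * (cc * Gu4 p).
pose E2 p := Gy1 p - p.2 + p.2 * (cc * Gu p).
pose E3 p := Gx4 p * (Gy4 p ^+ J - p.2 ^+ J) + (Gx4 p - p.1) * p.2 ^+ J.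
have O3 : bigO small E3 (wt 1 (2 * J)).
  have y4J := O_powB j O_y4 O_y O_y4B.
  have y4J' : bigO small (fun p => Gy4 p ^+ J - p.2 ^+ J) (wt 1 (J + j)).
    by apply: (O_le ler01 _ y4J) => p _; rewrite mul1r /wt expr0 mul1r !expr1 -mulrA -exprD.
  apply: O_add; first by apply: O_wt (O_wtM O_x4 y4J') _ _; lia.
  by apply: O_wt (O_wtM O_x4B (O_wtX J O_y)) _ _; lia.
pose E4 p := (cexp (Gl3 p) - 1 - Gl3 p) + (Gl3 p - Gy3 p ^+ J).
pose E5 p := (cexp (Gl2 p) - 1 - Gl2 p) + (Gl2 p - Gy2 p ^+ J).
have O4 : bigO small E4 (wt 0 (2 * J)).
  apply: O_add; last exact: O_logpB O_s3.
  apply: (O_le ler01 _ (O_exp2 _ O_l3)) => [p _|p /crude[_ [h _ _ _ _]]].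
    by rewrite mul1r /wt !expr0 !mul1r -exprM mulnC.
  by rewrite (le_trans h) //; lra.
have O5 : bigO small E5 (wt 0 (2 * J)).
  apply: O_add; last exact: O_logpB O_s2.
  apply: (O_le ler01 _ (O_exp2 _ O_l2)) => [p _|p /crude[[_ [_ h _ _ _]] _]].
    by rewrite mul1r /wt !expr0 !mul1r -exprM mulnC.
  by rewrite (le_trans h) //; lra.
pose E6 p := 2^-1 * Gh p * (E4 p + E5 p).
have O6 : bigO small E6 (wt 1 (2 * J)).
  by have := O_wtM (O_scal 2^-1 O_h) (O_add O4 O5); rewrite addn0 add0n.
pose E7 p := 2^-1 * Gh p * ((Gy2 p ^+ J - p.2 ^+ J) + (Gy2 p ^+ J - p.2 ^+ J) + (Gy3 p ^+ J - Gy2 p ^+ J)).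
have O7 : bigO small E7 (wt 2 j).
  have y2J := O_powB j O_y2 O_y O_y2B.
  have y2J' : bigO small (fun p => Gy2 p ^+ J - p.2 ^+ J) (wt 1 j).
    by apply: (O_le ler01 _ y2J) => p _; rewrite mul1r /wt expr0 mul1r !expr1 mulr1.
  by have := O_wtM (O_scal 2^-1 O_h) (O_add (O_add y2J' y2J') O_s32); rewrite !add0n.
pose E8 p := (Gh p - p.1) * p.2 ^+ J.
have O8 : bigO small E8 (wt 1 (2 * J)) by apply: O_wt (O_wtM O_hB (O_wtX J O_y)) _ _; lia.
have O_a : bigO small (fun p => E1 p + E2 p + E7 p) (wt 2 j).
  by apply: O_add O7; apply: O_add; [exact: O_y5B4|exact: O_y1B2].
have O_b : bigO small (fun p => - (cc * E3 p) + E6 p + E8 p) (wt 1 (2 * J)).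
  by apply: O_add O8; apply: O_add O6; apply: O_opp; apply: O_scal.
(* [E1], [E2] are the second-order errors of the two factors [res], [E4] and [E5] those of the
   overshears; [E3], [E7] and [E8] come from replacing intermediate coordinates by [x] and [y]. *)
have key p : (G p).2 - p.2 * (1 - beta%:C%C * Gu p) =
    (E1 p + E2 p + E7 p) + (- (cc * E3 p) + E6 p + E8 p).
  have hx1 : Gx1 p = Gh p * cexp (Gl2 p).
    by rewrite /Gh -mulrA -cexpD addNr cexp0 mulr1.
  have hy : Gy4 p - Gy1 p = 2^-1 * Gh p * ((cexp (Gl3 p) - 1) + (cexp (Gl2 p) - 1)).
    by rewrite y41E hx1 /Gx4; ring.
  have hb : beta%:C%C = 2 * cc - 1 :> R[i].
    have -> : beta = 2 * ((1 + beta) / 2) - 1 by field.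
    by rewrite rmorphB rmorphM rmorph1 (rmorph_nat (real_complex R) 2).
  have hy4 : Gy4 p = Gy1 p + 2^-1 * Gh p * ((cexp (Gl3 p) - 1) + (cexp (Gl2 p) - 1)).
    by rewrite -hy addrC subrK.
  rewrite hb /E1 /E2 /E3 /E6 /E4 /E5 /E7 /E8 /Gu /Gu4 !exprS.
  move: hy4; move: (G p).2 (Gy4 p) (Gy4 p ^+ j) (Gx4 p) (Gy1 p) (cexp (Gl3 p)) (cexp (Gl2 p)) (Gl3 p) (Gl2 p).
  move=> g y4 y4j x4 y1 e3 e2 l3 l2 ->.
  by field.
have [K1 K10 H1] := O_a; have [K2 K20 H2] := O_b.
exists (K1 + K2) => [|p sp]; first exact: addr_ge0.
rewrite key (le_trans (nmD _ _)) // (le_trans (lerD (H1 p sp) (H2 p sp))) //.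
have w1 : 0 <= wt 2 j p by rewrite mulr_ge0 ?exprn_ge0 ?addr_ge0 ?nm_ge0.
have w2 : 0 <= wt 1 (2 * J) p by rewrite mulr_ge0 ?exprn_ge0 ?addr_ge0 ?nm_ge0.
by nra.
Qed.

End BaseMap.

(** * Cancellations in the increment of [1/u] *)

Section Cancellation.
Context {R : realType} (j : nat).
Local Notation J := j.+1.
Local Notation T := (R[i] * R[i])%type.
Implicit Types t : T.

(** The pair [t] stands for [(v, S)] with [Y = y2 - h / 2 = y3 + h / 2] the middle of the central
    shear, [v = h / (2 Y)] and [S = Y^J]. Then [y2 = Y (1 + v)] and [y3 = Y (1 - v)], while
    [y1 = Y (1 + Na)] and [y4 = Y (1 + Nb)]. *)
Definition Ns2 t : R[i] := t.2 * (1 + t.1) ^+ J.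
Definition Ns3 t : R[i] := t.2 * (1 - t.1) ^+ J.
Definition NF2 t := cexp (- logp (Ns2 t)).
Definition NF3 t := cexp (- logp (Ns3 t)).
Definition Na t := t.1 * (1 - cexp (logp (Ns2 t))).
Definition Nb t := - (t.1 * (1 - cexp (logp (Ns3 t)))).
(** The numerator of [1/u(G p) - 1/u(p) - 1] over the denominator [2 v S ((1 + Na) (1 + Nb))^j]. The
    change of [v] into [- v] exchanges [Ns2] with [Ns3] and [Na] with [Nb], so it is odd in [v]:
    this is the effect of the palindromic word. *)
Definition Nnum t := NF3 t * (1 + Na t) ^+ j - NF2 t * (1 + Nb t) ^+ j - 2 * t.1 * t.2 * ((1 + Na t) * (1 + Nb t)) ^+ j.
Definition Ndom t := [/\ nm t.1 <= 4, nm t.2 <= 1 / 10 / 100, nm (Ns2 t) <= 1 / 10 / 100 & nm (Ns3 t) <= 1 / 10 / 100].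
Definition mw (i k : nat) t := nm t.1 ^+ i * nm t.2 ^+ k.

Lemma O_mw f i k i' k' : bigO Ndom f (mw i k) -> (i' <= i)%N -> (k' <= k)%N -> bigO Ndom f (mw i' k').
Proof.
move=> H le_i le_k; apply: (O_le _ _ H); first exact: (@exprn_ge0 _ (i - i') 4).
move=> t [v4 s1 _ _]; have v0 := nm_ge0 t.1; have s0 := nm_ge0 t.2.
rewrite /mw -{1}(subnKC le_i) exprD mulrA [4 ^+ _ * _]mulrC ler_pM ?mulr_ge0 ?exprn_ge0 //.
  by rewrite ler_wpM2l ?exprn_ge0 // lerXn2r ?nnegrE.
by rewrite ler_wiXn2l // (le_trans s1) //; lra.
Qed.

Lemma O_mwM f1 f2 i k i' k' : bigO Ndom f1 (mw i k) -> bigO Ndom f2 (mw i' k') ->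
  bigO Ndom (fun t => f1 t * f2 t) (mw (i + i') (k + k')).
Proof.
move=> H1 H2; apply: (O_le ler01 _ (O_mul H1 H2)) => p _.
by rewrite mul1r /mw !exprD mulrACA.
Qed.

Lemma O_mwX f i k n : bigO Ndom f (mw i k) -> bigO Ndom (fun p => f p ^+ n) (mw (i * n) (k * n)).
Proof.
move=> H; apply: (O_le ler01 _ (O_exp n H)) => p _.
by rewrite mul1r /mw exprMn -!exprM.
Qed.

Lemma O_mwC (a : R[i]) : bigO Ndom (fun=> a) (mw 0 0).
Proof. by exists (nm a) => [|p _]; rewrite ?nm_ge0 // /mw !expr0 !mulr1. Qed.

Lemma O_mwZ a f i k : bigO Ndom f (mw i k) -> bigO Ndom (fun p => a * f p) (mw i k).
Proof. by move=> H; exact: (O_mwM (O_mwC a) H). Qed.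

Lemma O_mw1 f i k : bigO Ndom f (mw i k) -> bigO Ndom (fun p => 1 + f p) (mw 0 0).
Proof. by move=> H; apply: O_add (O_mwC 1) _; apply: O_mw H _ _. Qed.

Lemma O_mwv : bigO Ndom (fun t => t.1) (mw 1 0).
Proof. by exists 1 => // p _; rewrite mul1r /mw expr1 expr0 mulr1. Qed.

Lemma O_mwS : bigO Ndom (fun t => t.2) (mw 0 1).
Proof. by exists 1 => // p _; rewrite mul1r /mw expr1 expr0 mul1r. Qed.

Lemma O_bin f i k n : bigO Ndom f (mw i k) ->
  bigO Ndom (fun p => (1 + f p) ^+ n - 1 - n%:R * f p - 'C(n, 2)%:R * f p ^+ 2) (mw (i * 3) (k * 3)).
Proof.
move=> H.
have [K K0 HK] : bigO Ndom f (mw 0 0) by apply: O_mw H _ _.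
have [K2 K20 H2] := binomial2 n K0.
have := O_mwX 3 H; move=> [K3 K30 H3]; exists (K2 * K3) => [|t Dt]; first exact: mulr_ge0.
have := HK t Dt; rewrite /mw !expr0 !mulr1 => /H2 /le_trans; apply.
by rewrite -mulrA ler_wpM2l // -nmX H3.
Qed.

Lemma O_s (f : T -> R[i]) : bigO Ndom f (mw 1 0) -> bigO Ndom (fun t => t.2 * (1 + f t) ^+ J) (mw 0 1).
Proof. by move=> H; apply: O_mwM O_mwS (O_mwX J (O_mw1 H)). Qed.

Lemma O_Ns2 : bigO Ndom Ns2 (mw 0 1).
Proof. exact: O_s O_mwv. Qed.

Lemma O_Ns3 : bigO Ndom Ns3 (mw 0 1).
Proof. exact: O_s (O_opp O_mwv). Qed.

Lemma O_logrem f : (forall t, Ndom t -> nm (f t) <= 1 / 10 / 100) -> bigO Ndom f (mw 0 1) ->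
  bigO Ndom (fun t => logrem (f t)) (mw 0 4).
Proof.
move=> fle H; have [K K0 HK] := @logrem_le R.
have := O_mwX 4 H; move=> [K3 K30 H3]; exists (K * K3) => [|t Dt]; first exact: mulr_ge0.
have f1 : nm (f t) <= 1 / 10 by have := fle t Dt; lra.
by rewrite (le_trans (HK _ f1)) // -mulrA ler_wpM2l // -nmX H3.
Qed.

Lemma O_logexp f : (forall t, Ndom t -> nm (f t) <= 1 / 10 / 100) -> bigO Ndom f (mw 0 1) ->
  bigO Ndom (fun t => cexp (logp (f t)) - 1) (mw 0 1).
Proof.
move=> fle H; apply: O_exp1 => [t Dt|].
  have := fle t Dt => h; have := nm_logp_le (_ : nm (f t) <= 1 / 10); move/(_ ltac:(lra)); lra.
have [K K0 HK] := H; exists (2 * K) => [|t Dt]; first exact: mulr_ge0.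
have := fle t Dt => h; have := nm_logp_le (_ : nm (f t) <= 1 / 10); move/(_ ltac:(lra)) => /le_trans; apply.
by rewrite -mulrA ler_wpM2l ?HK.
Qed.

Lemma dom2 t : Ndom t -> nm (Ns2 t) <= 1 / 10 / 100. Proof. by case. Qed.
Lemma dom3 t : Ndom t -> nm (Ns3 t) <= 1 / 10 / 100. Proof. by case. Qed.

Lemma O_Na : bigO Ndom Na (mw 1 1).
Proof.
apply: (@O_eq _ _ _ (fun t => - (t.1 * (cexp (logp (Ns2 t)) - 1)))) => [t _|].
  by rewrite -mulrN opprB.
by apply: O_opp; exact: (O_mwM O_mwv (O_logexp dom2 O_Ns2)).
Qed.

Lemma O_Nb : bigO Ndom Nb (mw 1 1).
Proof.
apply: (@O_eq _ _ _ (fun t => t.1 * (cexp (logp (Ns3 t)) - 1))) => [t _|].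
  by rewrite /Nb -mulrN opprB.
exact: (O_mwM O_mwv (O_logexp dom3 O_Ns3)).
Qed.

(** The linear terms are [2 J v S - 2 j v S - 2 v S = 0], and the quadratic ones cancel by
    oddness. *)
Lemma O_s23 : bigO Ndom (fun t => Ns2 t - Ns3 t - j%:R * (t.1 * (Ns2 t + Ns3 t)) - 2 * (t.1 * t.2)) (mw 3 1).
Proof.
have Bp := O_bin J O_mwv; have Bm := O_bin J (O_opp O_mwv).
set bp := (fun _ => _) in Bp; set bm := (fun _ => _) in Bm.
apply: (@O_eq _ _ _ (fun t => t.2 * ((bp t - bm t) - j%:R * (t.1 * ((bp t + bm t) + 2 * 'C(J, 2)%:R * t.1 ^+ 2))))) => [t _|].
  rewrite /bp /bm /Ns2 /Ns3; set A := (1 + t.1) ^+ J; set B := (1 - t.1) ^+ J; set c := 'C(J, 2)%:R.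
  have -> : J%:R = j%:R + 1 :> R[i] by rewrite natr1.
  ring.
have H : bigO Ndom (fun t => (bp t - bm t) - j%:R * (t.1 * ((bp t + bm t) + 2 * 'C(J, 2)%:R * t.1 ^+ 2))) (mw 3 0).
  apply: O_sub; first by apply: O_sub; [exact: Bp|exact: Bm].
  apply: O_mwZ; apply: (O_mwM (k' := 0) (i' := 2)) O_mwv _; apply: O_add.
    by apply: O_add; [apply: O_mw Bp _ _|apply: O_mw Bm _ _].
  by apply: O_mwZ; apply: O_mwX O_mwv.
by have := O_mwM O_mwS H; rewrite addn0 add0n.
Qed.

Lemma O_s2B3 : bigO Ndom (fun t => Ns2 t - Ns3 t) (mw 1 1).
Proof.
apply: (@O_eq _ _ _ (fun t => (Ns2 t - Ns3 t - j%:R * (t.1 * (Ns2 t + Ns3 t)) - 2 * (t.1 * t.2)) +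
   (j%:R * (t.1 * (Ns2 t + Ns3 t)) + 2 * (t.1 * t.2)))) => [t _|]; first by ring.
apply: O_add; first by apply: O_mw O_s23 _ _.
apply: O_add; last by apply: O_mwZ; exact: O_mwM O_mwv O_mwS.
apply: O_mwZ; exact: (O_mwM O_mwv (O_add O_Ns2 O_Ns3)).
Qed.

(** The remainders are separately of order [S^4]; their difference gains the factor [v], being
    Lipschitz with constant [O(S^3)] at points whose distance is [O(v S)]. *)
Lemma O_rem23 : bigO Ndom (fun t => logrem (Ns3 t) - logrem (Ns2 t)) (mw 1 4).
Proof.
have [K K0 HK] := @logrem_lip R; have [K2 K20 H2] := O_Ns2; have [K3 K30 H3] := O_Ns3.
have [K4 K40 H4] := O_s2B3.
exists (K * (K2 + K3 + 1) ^+ 3 * K4) => [|t Dt].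
  by rewrite !mulr_ge0 // !addr_ge0.
have [_ t21 s21 s31] := Dt; have := H2 t Dt; have := H3 t Dt; have := H4 t Dt; rewrite /mw !expr0 !mul1r !expr1.
move=> h4 h3 h2; have s0 := nm_ge0 t.2.
(* The Lipschitz bound needs a positive radius, so [S = 0] is treated apart. *)
have [t20|t20] := eqVneq (nm t.2) 0.
  rewrite t20 !mulr0 in h2 h3; rewrite t20 expr0n /= !mulr0.
  have -> : Ns2 t = 0 by apply/eqP; rewrite -nm_eq0; apply/eqP; apply/le_anti; rewrite h2 nm_ge0.
  have -> : Ns3 t = 0 by apply/eqP; rewrite -nm_eq0; apply/eqP; apply/le_anti; rewrite h3 nm_ge0.
  by rewrite subrr nm0.
have tp : 0 < nm t.2 by rewrite lt_def t20.
pose m := Num.min (1 / 40) ((K2 + K3 + 1) * nm t.2).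
have m0 : 0 < m by rewrite lt_min; apply/andP; split; [lra|rewrite mulr_gt0 //; lra].
have m1 : m <= 1 / 40 by rewrite ge_min lexx.
have ms : m <= (K2 + K3 + 1) * nm t.2 by rewrite ge_min lexx orbT.
have l2 : nm (Ns2 t) <= m by rewrite le_min; apply/andP; split; [lra|nra].
have l3 : nm (Ns3 t) <= m by rewrite le_min; apply/andP; split; [lra|nra].
rewrite (le_trans (HK _ _ _ m0 m1 l2 l3)) //.
have -> : K * (K2 + K3 + 1) ^+ 3 * K4 * (nm t.1 * nm t.2 ^+ 4) =
  (K * ((K2 + K3 + 1) * nm t.2) ^+ 3) * (K4 * (nm t.1 * nm t.2)) by rewrite exprMn; ring.
apply: ler_pM; [|exact: nm_ge0| |by rewrite nmB].
  by apply: mulr_ge0 => //; apply: exprn_ge0; exact: ltW.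
by rewrite ler_wpM2l // lerXn2r // nnegrE; [exact: ltW|exact: le_trans (ltW m0) ms].
Qed.

Lemma NF_E s : cexp (- logp s) = 1 - s + logrem s :> R[i].
Proof. by rewrite /logrem; ring. Qed.

Lemma O_NF32 : bigO Ndom (fun t => NF3 t - NF2 t) (mw 1 1).
Proof.
apply: (@O_eq _ _ _ (fun t => (Ns2 t - Ns3 t) + (logrem (Ns3 t) - logrem (Ns2 t)))) => [t _|].
  by rewrite /NF3 /NF2 !NF_E; ring.
by apply: O_add O_s2B3 _; apply: O_mw O_rem23 _ _.
Qed.

Lemma O_NF f : (forall t, Ndom t -> nm (f t) <= 1 / 10 / 100) -> bigO Ndom (fun t => cexp (logp (f t))) (mw 0 0) /\
  bigO Ndom (fun t => cexp (- logp (f t))) (mw 0 0).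
Proof.
move=> fle; split; exists 2 => // t Dt; rewrite /mw !expr0 !mulr1.
all: have h := fle t Dt; have := nm_logp_le (_ : nm (f t) <= 1 / 10); move/(_ ltac:(lra)) => h2.
  have := nm_mulexp 1 (_ : nm (logp (f t)) <= 1 / 14); move/(_ ltac:(lra)); rewrite mul1r nm1; lra.
have := nm_mulexp 1 (_ : nm (- logp (f t)) <= 1 / 14); rewrite nmN; move/(_ ltac:(lra)); rewrite mul1r nm1; lra.
Qed.

(** Both summands are of order [v S], but their sum is [v] times the difference of two exponentials
    that coincide at [v = 0], and gains a further factor [v]. *)
Lemma O_NaDb : bigO Ndom (fun t => Na t + Nb t) (mw 2 1).
Proof.
apply: (@O_eq _ _ _ (fun t => t.1 * ((NF2 t - NF3 t) * (cexp (logp (Ns2 t)) * cexp (logp (Ns3 t)))))) => [t _|].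
  have e2 : NF2 t * cexp (logp (Ns2 t)) = 1 by rewrite -cexpD addNr cexp0.
  have e3 : NF3 t * cexp (logp (Ns3 t)) = 1 by rewrite -cexpD addNr cexp0.
  rewrite /Na /Nb; move: e2 e3; move: (cexp (logp (Ns2 t))) (cexp (logp (Ns3 t))) (NF2 t) (NF3 t) => c2 c3 f2 f3 e2 e3.
  by transitivity (t.1 * ((f2 * c2) * c3 - (f3 * c3) * c2)); [ring|rewrite e2 e3; ring].
have [c2 _] := O_NF dom2; have [c3 _] := O_NF dom3.
have h : bigO Ndom (fun t => NF2 t - NF3 t) (mw 1 1).
  by apply: (O_eq _ (O_opp O_NF32)) => t _; rewrite opprB.
by have := O_mwM O_mwv (O_mwM h (O_mwM c2 c3)); rewrite !addn0 !add0n.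
Qed.

(** By oddness the terms after the linear one start at [v^3]. The coefficient of [v] would vanish if
    [exp (- logp s)] were exactly [1 - s]; the true remainder is [O(s^4)], and all of it is
    collected in [P2]. *)
Lemma O_Nnum : exists2 K : R, 0 <= K & forall t, Ndom t ->
  nm (Nnum t) <= K * (mw 3 1 t + mw 1 4 t).
Proof.
pose B f t := (1 + f t) ^+ j - 1 - j%:R * f t - 'C(j, 2)%:R * f t ^+ 2 : R[i].
pose ex2 t := cexp (logp (Ns2 t)) : R[i]; pose ex3 t := cexp (logp (Ns3 t)) : R[i].
pose P1 t := Ns2 t - Ns3 t - j%:R * (t.1 * (Ns2 t + Ns3 t)) - 2 * (t.1 * t.2).
pose P2 t := (logrem (Ns3 t) - logrem (Ns2 t)) + j%:R * (t.1 * (logrem (Ns2 t) + logrem (Ns3 t))).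
pose P3 t := - (j%:R * (t.1 * ((NF3 t - NF2 t) ^+ 2 * (ex2 t * ex3 t)))).
pose P4 t := 'C(j, 2)%:R * ((NF3 t - NF2 t) * Na t ^+ 2 + NF2 t * ((Na t - Nb t) * (Na t + Nb t))).
pose P5 t := NF3 t * B Na t - NF2 t * B Nb t.
pose Q t := (Na t + Nb t) + Na t * Nb t.
pose P6 t := - (2 * (t.1 * (t.2 * ((1 + Q t) ^+ j - 1)))).
have [c2 f2] := O_NF dom2; have [c3 f3] := O_NF dom3.
have O2 : bigO Ndom P2 (mw 1 4).
  apply: O_add O_rem23 _; apply: O_mwZ; apply: (O_mwM (i' := 0) (k := 0)) O_mwv _.
  by apply: O_add; [exact: O_logrem dom2 O_Ns2|exact: O_logrem dom3 O_Ns3].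
have O3 : bigO Ndom P3 (mw 3 1).
  apply: O_opp; apply: O_mwZ.
  by apply: O_mw (O_mwM O_mwv (O_mwM (O_mwX 2 O_NF32) (O_mwM c2 c3))) _ _.
have O4 : bigO Ndom P4 (mw 3 1).
  apply: O_mwZ; apply: O_add; first by apply: O_mw (O_mwM O_NF32 (O_mwX 2 O_Na)) _ _.
  by apply: O_mw (O_mwM f2 (O_mwM (O_sub O_Na O_Nb) O_NaDb)) _ _.
have O5 : bigO Ndom P5 (mw 3 1).
  by apply: O_sub; [apply: O_mw (O_mwM f3 (O_bin j O_Na)) _ _|apply: O_mw (O_mwM f2 (O_bin j O_Nb)) _ _].
have OQ : bigO Ndom Q (mw 2 1).
  by apply: O_add O_NaDb _; apply: O_mw (O_mwM O_Na O_Nb) _ _.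
have O6 : bigO Ndom P6 (mw 3 1).
  apply: O_opp; apply: O_mwZ.
  have OB : bigO Ndom (fun t => (1 + Q t) ^+ j - 1) (mw 2 1).
    apply: (@O_eq _ _ _ (fun t => B Q t + j%:R * Q t + 'C(j, 2)%:R * Q t ^+ 2)) => [t _|]; first by rewrite /B; ring.
    apply: O_add; last by apply: O_mwZ; apply: O_mw (O_mwX 2 OQ) _ _.
    by apply: O_add; [apply: O_mw (O_bin j OQ) _ _|apply: O_mwZ].
  by apply: O_mw (O_mwM O_mwv (O_mwM O_mwS OB)) _ _.
have [K1 K10 H1] := O_add (O_add O_s23 O3) (O_add O4 (O_add O5 O6)).
have [K2 K20 H2] := O2.
exists (K1 + K2) => [|t Dt]; first exact: addr_ge0.
have -> : Nnum t = (P1 t + P3 t + (P4 t + (P5 t + P6 t))) + P2 t.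
  have e2 : NF2 t * ex2 t = 1 by rewrite -cexpD addNr cexp0.
  have e3 : NF3 t * ex3 t = 1 by rewrite -cexpD addNr cexp0.
  have q1 : (1 + Na t) * (1 + Nb t) = 1 + Q t by rewrite /Q; ring.
  have r2 : logrem (Ns2 t) = NF2 t - 1 + Ns2 t by [].
  have r3 : logrem (Ns3 t) = NF3 t - 1 + Ns3 t by [].
  rewrite /Nnum q1 /P1 /P2 /P3 /P4 /P5 /P6 /B r2 r3.
  set X := (1 + Q t) ^+ j; set Ya := (1 + Na t) ^+ j; set Yb := (1 + Nb t) ^+ j.
  (* The linear terms of the two binomial expansions; since [NF2 ex2 = NF3 ex3 = 1], they reduce to
     a multiple of [NF2 + NF3 - 2] up to a square. *)
  have main : j%:R * (NF3 t * Na t - NF2 t * Nb t) = j%:R * (t.1 * (NF2 t - 1 + NF3 t - 1)) -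
      j%:R * (t.1 * ((NF3 t - NF2 t) ^+ 2 * (ex2 t * ex3 t))).
    rewrite /Na /Nb -/(ex2 t) -/(ex3 t).
    move: e2 e3; move: (NF2 t) (NF3 t) (ex2 t) (ex3 t) t.1 => f2' f3' c2' c3' v e2 e3.
    have h : (f3' - f2') ^+ 2 * (c2' * c3') = f3' * c2' + f2' * c3' - 2.
      transitivity ((f3' * c3') * (f3' * c2') - 2 * ((f2' * c2') * (f3' * c3')) + (f2' * c2') * (f2' * c3')); first by ring.
      by rewrite e2 e3 !mul1r mulr1 addrAC.
    by rewrite h; ring.
  transitivity ((NF3 t - NF2 t) + j%:R * (NF3 t * Na t - NF2 t * Nb t) + ('C(j, 2)%:R * (NF3 t * Na t ^+ 2 - NF2 t * Nb t ^+ 2))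
    + (NF3 t * (Ya - 1 - j%:R * Na t - 'C(j, 2)%:R * Na t ^+ 2) - NF2 t * (Yb - 1 - j%:R * Nb t - 'C(j, 2)%:R * Nb t ^+ 2))
    - 2 * t.1 * t.2 * X); first by ring.
  by rewrite main; ring.
have w1 : 0 <= mw 3 1 t by rewrite mulr_ge0 ?exprn_ge0 ?nm_ge0.
have w2 : 0 <= mw 1 4 t by rewrite mulr_ge0 ?exprn_ge0 ?nm_ge0.
rewrite (le_trans (nmD _ _)) // (le_trans (lerD (H1 t Dt) (H2 t Dt))) //.
by move: w1 w2 K10 K20; clear; nra.
Qed.

End Cancellation.

(** * The increment of [1/u] *)

Section InverseU.
Context {R : realType} (j : nat).
Local Notation J := j.+1.
Implicit Types (p : R[i] * R[i]).
Local Notation Gu := (@Gu R j).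
Local Notation G := (@G R j).
Local Notation small := (@small R j).

Lemma Gu_x1 p : Gu p = Gx1 j p * Gy1 j p ^+ j.
Proof.
rewrite /Gx1 /Gy1 /= exprMn -cexpMn mulrACA -cexpD mulr_natl mulNrn subrr cexp0 mulr1.
by rewrite /Gu.
Qed.

Lemma Gu_G p : Gu (G p) = Gu4 j p.
Proof.
rewrite /Gu G_snd G_fst_x4 exprMn -cexpMn mulrACA -cexpD mulr_natl mulNrn subrr cexp0 mulr1.
by rewrite /Gu4.
Qed.

Lemma Gx1_h p : Gx1 j p = Gh j p * cexp (Gl2 j p).
Proof. by rewrite /Gh -mulrA -cexpD addNr cexp0 mulr1. Qed.

Lemma Gh_neq0 p : p.1 != 0 -> Gh j p != 0.
Proof. by move=> x0; apply: mulf_neq0 (cexp_neq0 _); exact: mulf_neq0 (cexp_neq0 _). Qed.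

Lemma wr_small p : small p -> wr p <= 1 / 50 / 100.
Proof. by move=> /small_le[]; rewrite /wr /eps; lra. Qed.

(** Here [u = x] and [J = 1], and [(1 - y3) - (1 - y2) = h] is an exact identity, so only the
    remainders of [logp] contribute. This case is kept apart because for [j = 0] the coordinate [y]
    may vanish, and no ratio [x / y] may occur in the bound. *)
Lemma LEU0 : j = 0%N -> exists2 K : R, 0 <= K & forall p, small p -> p.1 != 0 ->
  nm ((Gu (G p))^-1 - (Gu p)^-1 - 1) <= K * wr p ^+ 3.
Proof.
move=> j0; have [K K0 HK] := @logrem_lip R; exists (K * 5 ^+ 3) => [|p sp x0].
  by rewrite mulr_ge0 // exprn_ge0.
have e1 (z : R[i]) : z ^+ j = 1 by rewrite j0.
have eJ (z : R[i]) : z ^+ J = z by rewrite exprS e1 mulr1.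
have h0 := Gh_neq0 x0.
rewrite Gu_G Gu_x1 /Gu4 !e1 !mulr1 Gx1_h /Gx4 (invfM (Gh j p) (cexp (Gl2 j p))) (invfM (Gh j p) (cexp (Gl3 j p))) -(cexpN (Gl2 j p)) -(cexpN (Gl3 j p)).
have w1 := wr_small sp; have wp : 0 < wr p by rewrite ltr_wpDr ?nm_ge0 // nm_gt0.
have [[_ _ _ _ hy2] [_ _ _ hy3 _]] := (crude sp).1.
have l3 : nm (Gy3 j p) <= 5 * wr p by [].
have l2 : nm (Gy2 j p) <= 5 * wr p by lra.
have m0 : 0 < 5 * wr p by lra.
have m1 : 5 * wr p <= 1 / 40 by lra.
have := HK _ _ _ m0 m1 l2 l3.
have y32 : Gy3 j p - Gy2 j p = - Gh j p by rewrite /Gy3 addrAC subrr add0r.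
rewrite y32 nmN exprMn mulrA => le.
have -> : (Gh j p)^-1 * cexp (- Gl3 j p) - (Gh j p)^-1 * cexp (- Gl2 j p) - 1 =
    (logrem (Gy3 j p) - logrem (Gy2 j p)) / Gh j p.
  rewrite /Gl3 /Gl2 !eJ !NF_E.
  have e : Gy3 j p = Gy2 j p - Gh j p by [].
  by rewrite {1}e; field.
rewrite nmM nmV ler_pdivrMr ?nm_gt0 //.
Qed.

(** Division of the bound of [O_Nnum] by [2 v S] leaves [v^2 + S^3], where [v] is comparable to
    [x / y] and [S] is at most of order [wr^J]. *)
Lemma LEUp : exists2 K : R, 0 <= K & forall p, small p -> p.1 != 0 -> nm p.1 <= nm p.2 ->
  nm ((Gu (G p))^-1 - (Gu p)^-1 - 1) <= K * ((nm p.1 / nm p.2) ^+ 2 + wr p ^+ (3 * J)).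
Proof.
have [K K0 HK] := @O_Nnum R j; exists (K * 4 ^+ j / 2 * (16 + 4 ^+ (3 * J))) => [|p sp x0 xy].
  by rewrite mulr_ge0 ?addr_ge0 ?exprn_ge0 // mulr_ge0 // mulr_ge0 ?exprn_ge0.
have h0 := Gh_neq0 x0; have w1 := wr_small sp; have [x1 y1 _ _] := small_le sp.
have xp : 0 < nm p.1 by rewrite nm_gt0.
have yp : 0 < nm p.2 by exact: lt_le_trans xy.
have [[[_ _ gx1 gy1 gy2] [gs2 gl2 gh gy3 gs3]] [gl3 _ _ _ _]] := crude sp.
have two : (2 : R[i]) != 0 by rewrite pnatr_eq0.
have p2h : nm (2^-1 : R[i]) = 1 / 2 by rewrite nmV nm_nat div1r.
set Y := Gy2 j p - 2^-1 * Gh j p.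
have le1 (l : R[i]) : nm l <= 1 / 5 / 100 -> nm (1 - cexp l) <= 7 * (1 / 5 / 100).
  by move=> l1; rewrite nmB (le_trans (cexp_lip _)) ?ler_wpM2l //; move: l1; clear; lra.
have gd : nm (Gx1 j p - Gh j p) <= 2 / 100 * (3 / 2) * nm p.1.
  have -> : Gx1 j p - Gh j p = Gx1 j p * (1 - cexp (- Gl2 j p)) by rewrite /Gh; ring.
  rewrite nmM; have := le1 (- Gl2 j p); rewrite nmN => /(_ gl2) h.
  rewrite (le_trans (ler_pM _ _ gx1 h)) ?nm_ge0 //; move: xp; clear; lra.
have EY : Gy1 j p = Y - 2^-1 * (Gx1 j p - Gh j p) by rewrite /Y /Gy2; ring.
have Ylow : nm p.2 / 3 <= nm Y.
  have := nm_sub Y (2^-1 * (Gx1 j p - Gh j p)); rewrite -EY [nm (2^-1 * _)]nmM p2h.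
  by move/andP: gy1 => [h _]; move: h gd xy yp; clear; lra.
have Yp : 0 < nm Y by move: Ylow yp; clear; lra.
have Y0 : Y != 0 by rewrite -nm_gt0.
have Yup : nm Y <= 4 * wr p.
  have := nm_sub (Gy2 j p) (2^-1 * Gh j p); rewrite -/Y [nm (2^-1 * _)]nmM p2h.
  by move: gh gy2 xp yp; rewrite /wr; clear; lra.
set v := 2^-1 * Gh j p / Y; set S := Y ^+ J.
have vle : nm v <= 4 * (nm p.1 / nm p.2).
  rewrite /v [nm (_ / Y)]nmM [nm (_ * Gh j p)]nmM (nmV Y) p2h ler_pdivrMr //.
  have -> : 4 * (nm p.1 / nm p.2) * nm Y = 4 * nm p.1 * (nm Y / nm p.2) by ring.
  have : 1 / 3 <= nm Y / nm p.2 by rewrite ler_pdivlMr // mulrC mulrA mulr1.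
  by move: gh xp; clear; nra.
have v4 : nm v <= 4.
  by rewrite (le_trans vle) // ler_piMr // ler_pdivrMr // mul1r.
have Y1 : nm Y <= 1 / 10 / 100 by move: Yup w1; clear; lra.
have S1 : nm S <= 1 / 10 / 100 by rewrite (le_trans (nm_pow_le _ _)) //; move: Y1; clear; lra.
have Yv : Y * v = 2^-1 * Gh j p by rewrite /v mulrC divfK.
have s2E : Ns2 j (v, S) = Gy2 j p ^+ J.
  by rewrite /Ns2 /= -exprMn mulrDr mulr1 Yv /Y subrK.
have s3E : Ns3 j (v, S) = Gy3 j p ^+ J.
  rewrite /Ns3 /= -exprMn mulrBr mulr1 Yv /Y /Gy3; congr (_ ^+ _).
  by field.
have Dt : Ndom j (v, S) by split; rewrite ?s2E ?s3E.
have := HK _ Dt; set N := Nnum j (v, S); set a := Na j (v, S); set b := Nb j (v, S) => leN.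
have aE : Y * (1 + a) = Gy1 j p.
  rewrite /a /Na s2E /= -/(Gl2 j p) mulrDr mulr1 mulrA Yv EY Gx1_h.
  by ring.
have bE : Y * (1 + b) = Gy4 j p.
  rewrite /b /Nb s3E /= -/(Gl3 j p) mulrDr mulr1 mulrN mulrA Yv /Gy4 /Gx4 /Y /Gy3.
  by field.
have ale : nm a <= 1 / 2.
  rewrite /a /Na s2E /= -/(Gl2 j p) nmM (le_trans (ler_pM _ _ v4 (le1 _ gl2))) ?nm_ge0 //; clear; lra.
have ble : nm b <= 1 / 2.
  rewrite /b /Nb s3E /= -/(Gl3 j p) nmN nmM (le_trans (ler_pM _ _ v4 (le1 _ gl3))) ?nm_ge0 //; clear; lra.
have one (z : R[i]) : nm z <= 1 / 2 -> 1 / 2 <= nm (1 + z).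
  by move=> z1; have := nm_sub (1 + z) z; rewrite addrK nm1; move: z1; clear; lra.
have a1 : 1 + a != 0 by rewrite -nm_gt0; have := one _ ale; clear; lra.
have b1 : 1 + b != 0 by rewrite -nm_gt0; have := one _ ble; clear; lra.
set P := 2 * v * S.
have v0 : v != 0 by apply: mulf_neq0; [apply: mulf_neq0 => //|]; exact: invr_neq0.
have S0 : S != 0 by rewrite expf_neq0.
have P0 : P != 0 by apply: mulf_neq0 => //; exact: mulf_neq0.
have PE : P = Gh j p * Y ^+ j.
  rewrite /P /S exprS; transitivity (2 * (Y * v) * Y ^+ j); first by ring.
  by rewrite Yv; field.
have UE : (Gu p)^-1 = cexp (- Gl2 j p) / (P * (1 + a) ^+ j).
  rewrite Gu_x1 -aE exprMn Gx1_h cexpN PE; field.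
  by rewrite !expf_neq0 // h0 cexp_neq0.
have U'E : (Gu (G p))^-1 = cexp (- Gl3 j p) / (P * (1 + b) ^+ j).
  rewrite Gu_G /Gu4 -bE exprMn /Gx4 cexpN PE; field.
  by rewrite !expf_neq0 // h0 cexp_neq0.
have -> : (Gu (G p))^-1 - (Gu p)^-1 - 1 = N / (P * ((1 + a) * (1 + b)) ^+ j).
  rewrite UE U'E /N /Nnum -/a -/b /NF2 /NF3 s2E s3E -/(Gl2 j p) -/(Gl3 j p) /= -/P exprMn.
  by field; rewrite !expf_neq0 // P0.
have den : nm P * (1 / 4) ^+ j <= nm (P * ((1 + a) * (1 + b)) ^+ j).
  have q : 1 / 4 <= nm ((1 + a) * (1 + b)).
    by rewrite nmM; have := one _ ale; have := one _ ble; clear; nra.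
  by rewrite [nm (P * _)]nmM [nm (_ ^+ j)]nmX ler_wpM2l ?nm_ge0 // lerXn2r ?nnegrE ?nm_ge0 ?divr_ge0.
have Pp : 0 < nm P by rewrite nm_gt0.
have q4 : 0 < (1 / 4 : R) ^+ j by rewrite exprn_gt0 // divr_gt0.
have PN : nm P = 2 * (nm v * nm S) by rewrite [nm P]nmM [nm (2 * v)]nmM nm_nat mulrA.
rewrite nmM nmV; apply: (@le_trans _ _ (nm N / (nm P * (1 / 4) ^+ j))).
  by rewrite ler_wpM2l ?nm_ge0 // lef_pV2 // posrE ?mulr_gt0 // (lt_le_trans _ den) // mulr_gt0.
rewrite ler_pdivrMr ?mulr_gt0 //; apply: (le_trans leN).
rewrite /mw /= PN.
have vp : 0 < nm v by rewrite nm_gt0.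
have Sp : 0 < nm S by rewrite nm_gt0.
have Sle : nm S ^+ 3 <= 4 ^+ (3 * J) * wr p ^+ (3 * J).
  rewrite -exprMn /S nmX -exprM mulnC lerXn2r ?nnegrE ?nm_ge0 //.
  exact: le_trans (nm_ge0 _) Yup.
have vle2 : nm v ^+ 2 <= 16 * (nm p.1 / nm p.2) ^+ 2.
  have -> : 16 * (nm p.1 / nm p.2) ^+ 2 = (4 * (nm p.1 / nm p.2)) ^+ 2 by ring.
  by rewrite lerXn2r ?nnegrE ?nm_ge0 // (le_trans (nm_ge0 _) vle).
have q44 : 4 ^+ j * (1 / 4) ^+ j = 1 :> R by rewrite -exprMn mul1r divff ?expr1n.
set A := (nm p.1 / nm p.2) ^+ 2; set B := wr p ^+ _.
have A0 : 0 <= A by rewrite sqr_ge0.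
have B0 : 0 <= B by rewrite exprn_ge0 // addr_ge0 ?nm_ge0.
set E := 4 ^+ (3 * J); have E0 : 0 <= E by rewrite exprn_ge0.
have key : nm v ^+ 2 + nm S ^+ 3 <= (16 + E) * (A + B).
  move: vle2 Sle; rewrite -/A -/B -/E; move: (nm v ^+ 2) (nm S ^+ 3) A0 B0 E0; clear.
  by move=> ? ? ? ? ? ? ?; nra.
have -> : K * 4 ^+ j / 2 * (16 + E) * (A + B) * (2 * (nm v * nm S) * (1 / 4) ^+ j) =
    K * (nm v * nm S) * ((16 + E) * (A + B)) * (4 ^+ j * (1 / 4) ^+ j) by field.
rewrite q44 mulr1.
have -> : K * (nm v ^+ 3 * nm S ^+ 1 + nm v ^+ 1 * nm S ^+ 4) =
  K * (nm v * nm S) * (nm v ^+ 2 + nm S ^+ 3) by ring.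
by rewrite ler_wpM2l // mulr_ge0 // mulr_ge0 ?nm_ge0.
Qed.

End InverseU.

(** * Powers of the time *)

Section Rates.
Context {R : realType} (j : nat).
Local Notation J := j.+1.
Implicit Types (n m N : nat) (z a b : int).

Lemma ln1D_ge (t : R) : 0 <= t -> t / (1 + t) <= ln (1 + t).
Proof.
move=> t0; have t1 : 0 < 1 + t by lra.
have -> : ln (1 + t) = - ln ((1 + t)^-1) by rewrite lnV // opprK.
have e : (1 + t)^-1 = 1 + (- (t / (1 + t))) by field; lra.
rewrite lerNr {1}e; apply: le_ln1Dx; rewrite ltrN2 ltr_pdivrMr //; lra.
Qed.

Lemma expR_le_inv (s : R) : s < 1 -> expR s <= (1 - s)^-1.
Proof.
move=> s1; have p : 0 < 1 - s by lra.
by rewrite -[expR s]invrK -expRN lef_pV2 ?posrE ?expR_gt0 // (le_trans _ (expR_ge1Dx _)).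
Qed.

Definition tn n : R := expR (ln n%:R / (100 * J)%:R).
(* [n ^ (z / (100 J))]: in this integral scale [n] is [pw n (100 J)] and [n ^ beta] is [pw n 40]. It is locked,
   because unfolding powers with exponents such as [100 * J] is prohibitively slow. *)
Definition pw n z : R := locked (tn n ^ z).

Lemma J100_gt0 : 0 < (100 * J)%:R :> R. Proof. by rewrite ltr0n. Qed.

Lemma tn_gt0 n : 0 < tn n. Proof. exact: expR_gt0. Qed.

Lemma tn_ge1 n : (0 < n)%N -> 1 <= tn n.
Proof.
by move=> n0; rewrite /tn -[X in X <= _]expR0 ler_expR divr_ge0 ?ln_ge0 ?ler1n //.
Qed.

Lemma pw_gt0 n z : 0 < pw n z. Proof. by rewrite /pw -lock exprz_gt0 ?tn_gt0. Qed.
Lemma pw_ge0 n z : 0 <= pw n z. Proof. exact/ltW/pw_gt0. Qed.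

Lemma pwD n a b : pw n a * pw n b = pw n (a + b).
Proof. by rewrite /pw -!lock expfzDr ?gt_eqF ?tn_gt0. Qed.

Lemma pwX n a (k : nat) : pw n a ^+ k = pw n (a * k%:Z).
Proof. by rewrite /pw -!lock -exprz_exp. Qed.

Lemma pwV n a : (pw n a)^-1 = pw n (- a).
Proof. by rewrite /pw -!lock invr_expz. Qed.

Lemma pw_le n a b : (0 < n)%N -> a <= b -> pw n a <= pw n b.
Proof. by move=> n0 ab; rewrite /pw -!lock ler_weXz2l // tn_ge1. Qed.

Lemma pw0 n : pw n 0 = 1. Proof. by rewrite /pw -lock expr0z. Qed.

Lemma pwE n z : pw n z = expR (ln n%:R * (z%:~R / (100 * J)%:R)).
Proof.
rewrite /pw -lock /tn; case: z => k; rewrite ?NegzE.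
  by rewrite -exprnP -expRM_natl; congr expR; rewrite -pmulrn; ring.
rewrite -invr_expz -exprnP -expRM_natl -expRN; congr expR.
by rewrite mulrNz -pmulrn; ring.
Qed.

Lemma pwn n : (0 < n)%N -> n%:R = pw n (100 * J)%N.
Proof.
by move=> n0; rewrite pwE -pmulrn divff ?mulr1 ?lnK ?posrE ?ltr0n ?gt_eqF ?J100_gt0.
Qed.

Lemma pwnV n : (0 < n)%N -> n%:R^-1 = pw n (- (100 * J)%N%:Z).
Proof. by move=> n0; rewrite -pwV -pwn. Qed.

Lemma pw_le1 n z : (0 < n)%N -> z <= 0 -> pw n z <= 1.
Proof. by move=> n0 z0; rewrite -(pw0 n) pw_le. Qed.

Lemma pw_large (M : R) : exists N, (0 < N)%N /\ forall n z, (N <= n)%N -> 1 <= z -> M <= pw n z.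
Proof.
have [B MB] : exists B : nat, Num.max M 1 ^+ (100 * J) <= B%:R.
  by exists (Num.trunc (Num.max M 1 ^+ (100 * J))).+1; exact/ltW/truncnS_gt.
exists B.+1; split=> // n z Bn z1; have n0 : (0 < n)%N by exact: leq_trans Bn.
have M1 : 1 <= Num.max M 1 by rewrite le_max lexx orbT.
apply: (@le_trans _ _ (pw n 1)); last exact: pw_le.
apply: (@le_trans _ _ (Num.max M 1)); first by rewrite le_max lexx.
have p0 := pw_ge0 n 1.
rewrite -(@ler_pXn2r _ (100 * J)%N) ?nnegrE ?(le_trans ler01 M1) //.
by rewrite pwX mul1r -pwn // (le_trans MB) // ler_nat; exact: ltnW.
Qed.

Lemma pw_succ n z : (0 < n)%N ->
  pw n.+1 z = pw n z * expR (z%:~R / (100 * J)%:R * ln (1 + n%:R^-1)).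
Proof.
move=> n0; have n1 : (0 : R) < n%:R by rewrite ltr0n.
rewrite !pwE -expRD.
have -> : n.+1%:R = n%:R * (1 + n%:R^-1) :> R.
  by rewrite -natr1 mulrDr mulr1 divff ?gt_eqF.
rewrite lnM ?posrE //.
by congr expR; ring.
Qed.

Lemma natV_ln n : (0 < n)%N ->
  [/\ 0 < n%:R^-1 :> R, n%:R^-1 <= 1 :> R, n%:R^-1 / 2 <= ln (1 + n%:R^-1 : R) <= n%:R^-1 &
      n%:R^-1 - n%:R^-1 ^+ 2 <= ln (1 + n%:R^-1 : R)].
Proof.
move=> n0; have n1 : (0 : R) < n%:R by rewrite ltr0n.
have t0 : 0 < n%:R^-1 :> R by rewrite invr_gt0.
have t1 : n%:R^-1 <= 1 :> R by rewrite invf_le1 // ler1n.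
move: (n%:R^-1) t0 t1 => t t0 t1.
have h := ln1D_ge (ltW t0); have h2 : ln (1 + t) <= t by apply: le_ln1Dx; lra.
have h3 : t / 2 <= t / (1 + t) by rewrite ler_pM2l // lef_pV2 ?posrE; lra.
have h4 : t - t ^+ 2 <= t / (1 + t).
  by rewrite ler_pdivlMr; [have := sqr_ge0 t; nra|lra].
by split=> //; [rewrite h2 (le_trans h3)|exact: le_trans h4 h].
Qed.

(** The discrete form of the primitive of [n^(-1-s)]: step errors are dominated by differences of a
    decreasing sequence. The constant [400 J] collects [s >= 1 / (100 J)],
    [ln (1 + 1/n) >= 1 / (2 n)] and [e^(-a) <= 1 - a / 2] for [0 <= a <= 1]. *)
Lemma pw_tele n z : (0 < n)%N -> 1 <= z ->
  pw n (- (100 * J)%N%:Z - z) <= (400 * J)%:R * (pw n (- z) - pw n.+1 (- z)).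
Proof.
move=> n0 z1; have [t0 t1 /andP[l1 _] _] := natV_ln n0.
rewrite -pwD -pwnV // pw_succ //.
set t : R := n%:R^-1 in t0 t1 l1 *; set P := pw n (- z); have P0 : 0 < P := pw_gt0 n (- z).
have J0 : (0 : R) < J%:R by rewrite ltr0n.
set s := t / (200 * J)%:R; have s0 : 0 < s by rewrite divr_gt0 // ltr0n.
have s1 : s <= 1 by rewrite ler_pdivrMr ?ltr0n // mul1r (le_trans t1) // ler1n.
have z1' : (1 : R) <= z%:~R by rewrite -[1]/(1%:~R) ler_int.
have le1 : (- z)%:~R / (100 * J)%:R * ln (1 + t) <= - s.
  rewrite mulrNz !mulNr lerN2 /s mulrAC ler_pdivlMr ?J100_gt0 //.
  have -> : t / (200 * J)%:R * (100 * J)%:R = t / 2.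
    by rewrite !natrM; field; rewrite ?pnatr_eq0 ?gt_eqF.
  have : 0 <= ln (1 + t) by lra.
  by move: l1 z1'; clear; nra.
have le2 : expR ((- z)%:~R / (100 * J)%:R * ln (1 + t)) <= 1 - s / 2.
  rewrite (le_trans (_ : _ <= expR (- s))) ?ler_expR //.
  apply: (le_trans (expR_le_inv _)); first by lra.
  by rewrite opprK -[leLHS]mul1r ler_pdivrMr; [nra|lra].
have tE : t = (400 * J)%:R * (s / 2).
  by rewrite /s !natrM; field; rewrite ?pnatr_eq0 ?gt_eqF.
have Q0 : (0 : R) < (400 * J)%:R by rewrite ltr0n.
rewrite {1}tE; move: (expR _) le2 => q le2.
have -> : (400 * J)%:R * (P - P * q) = (400 * J)%:R * (1 - q) * P by ring.
by rewrite ler_wpM2r ?(ltW P0) // ler_wpM2l ?(ltW Q0) //; lra.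
Qed.

Lemma pw_mono n m z : (0 < n)%N -> (n <= m)%N -> 0 <= z -> pw m (- z) <= pw n (- z).
Proof.
move=> n0 nm_ z0; rewrite -!pwV lef_pV2 ?posrE ?pw_gt0 //.
case: z z0 => // k _; rewrite /pw -!lock -[tn n ^ _]/(tn n ^+ k) -[tn m ^ _]/(tn m ^+ k).
rewrite lerXn2r ?nnegrE ?(ltW (tn_gt0 _)) // ler_expR ler_pM2r ?invr_gt0 ?J100_gt0 //.
by rewrite ler_ln ?posrE ?ltr0n ?ler_nat // (leq_trans n0).
Qed.

Lemma tele_sum (V : normedZmodType R[i]) (v : nat -> V) (K : R) N z : (0 < N)%N -> 1 <= z -> 0 <= K ->
  (forall n, (N <= n)%N -> nm (v n.+1 - v n) <= K * pw n (- (100 * J)%N%:Z - z)) ->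
  forall n m, (N <= n)%N -> (n <= m)%N ->
  nm (v m - v n) <= K * (400 * J)%:R * (pw n (- z) - pw m (- z)).
Proof.
move=> N0 z1 K0 H n m Nn /subnKC <-; elim: (m - n)%N => [|i IH].
  by rewrite addn0 !subrr nm0 mulr0.
have n0 : (0 < n + i)%N by rewrite addn_gt0 (leq_trans N0 Nn).
have := nm_tri (v (n + i)%N) (v (n + i.+1)%N) (v n).
have := H (n + i)%N (leq_trans Nn (leq_addr _ _)); rewrite -addnS => h1 h2.
have := ler_wpM2l K0 (pw_tele n0 z1); rewrite -addnS => h3.
apply: (le_trans h2); apply: (le_trans (lerD (le_trans h1 h3) IH)).
by rewrite mulrA -mulrDr addrC subrKA.
Qed.

Lemma beta_pw : 40%:~R / (100 * J)%:R = beta (R := R) j.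
Proof.
have J0 : (J%:R : R) != 0 by rewrite pnatr_eq0.
by rewrite /beta natrM; field.
Qed.

Lemma pw40_succ : exists2 K : R, 0 <= K & forall n, (0 < n)%N -> exists2 q : R, pw n.+1 40 = pw n 40 * q &
  0 <= q <= 2 /\ `|q - 1 - beta j / n%:R| <= K * n%:R^-1 ^+ 2.
Proof.
exists 2 => // n n0; exists (expR (beta j * ln (1 + n%:R^-1))); first by rewrite pw_succ // beta_pw.
have [t0 t1 /andP[l1 l2] l3] := natV_ln n0; have [_ /andP[b0 b1]] := cc_nm (R := R) j.
set t : R := n%:R^-1 in t0 t1 l1 l2 l3 *; set l := ln (1 + t) in l1 l2 l3 *; set b := beta j in b0 b1 *.
set s := b * l; have l0 : 0 <= l by lra.
have s0 : 0 <= s by rewrite /s mulr_ge0 // ltW.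
have st : s <= b * t by rewrite /s ler_pM2l.
have bt : b * t <= 2 / 5 by nra.
have h1 := expR_ge1Dx s.
have h2 : expR s <= 1 + s + 2 * s ^+ 2.
  rewrite (le_trans (expR_le_inv _)) //; first lra.
  by rewrite -[leLHS]mul1r ler_pdivrMr; [have := sqr_ge0 s; nra|lra].
have s2 : s ^+ 2 <= (2 / 5) ^+ 2 * t ^+ 2.
  rewrite -exprMn lerXn2r ?nnegrE //; first by nra.
  by rewrite (le_trans st) // ler_pM2r.
have sl : b * t - b * t ^+ 2 <= s.
  by have := ler_wpM2l (ltW b0) l3; rewrite mulrBr.
have bt2 : b * t ^+ 2 <= 2 / 5 * t ^+ 2 by rewrite ler_wpM2r ?sqr_ge0.
have tt := sqr_ge0 t; split.
  rewrite expR_ge0 (le_trans h2) //; clear -st bt s0; nra.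
rewrite ler_norml; apply/andP; split; clear -h1 h2 s2 sl bt2 tt st; lra.
Qed.

End Rates.

(** * One step in the regime of the basin *)

Section OneStep.
Context {R : realType} (j : nat).
Local Notation J := j.+1.
Implicit Types (p : R[i] * R[i]) (n N : nat).
Local Notation Gu := (@Gu R j).
Local Notation G := (@G R j).
Local Notation small := (@small R j).
Local Notation pw := (@pw R j).

(* The tolerance [-42 < -40 < -38] around [n ^ (- beta)] is what the error terms of one step allow. *)
Definition wreg n p := [/\ p.1 != 0, nm ((Gu p)^-1 - n%:R) <= n%:R / 2, nm p.2 <= pw n (- 38) &
  (0 < j)%N -> pw n (- 42) <= nm p.2].

Lemma Gu_nm p : nm (Gu p) = nm p.1 * nm p.2 ^+ j.
Proof. by rewrite /Gu nmM nmX. Qed.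

Lemma wreg_u n p : (0 < n)%N -> wreg n p -> [/\ nm (Gu p) <= 2 * pw n (- (100 * J)%N%:Z), Gu p != 0 &
  n%:R / 2 <= nm (Gu p)^-1].
Proof.
move=> n0 [x0 hU _ hy]; have n1 : (0 : R) < n%:R by rewrite ltr0n.
have lo : n%:R / 2 <= nm (Gu p)^-1.
  have := nm_tri (Gu p)^-1 n%:R 0; rewrite !subr0 nm_nat => h.
  by have := nm_dist n%:R (Gu p)^-1; rewrite nm_nat nmB; move: hU; clear; lra.
have u0 : Gu p != 0.
  apply/eqP => u0; move: lo; rewrite u0 invr0 nm0; move: n1; clear; lra.
split=> //; rewrite nmV in lo; have up : 0 < nm (Gu p) by rewrite nm_gt0.
rewrite -pwnV // -[leLHS]invrK -[2]invrK -invfM lef_pV2 ?posrE ?invr_gt0 //.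
  by move: lo; rewrite mulrC.
by rewrite mulr_gt0 // invr_gt0.
Qed.

Lemma wreg_x n p : (0 < n)%N -> wreg n p -> nm p.1 <= 2 * pw n (- (100 * J)%N%:Z + (42 * j)%N%:Z).
Proof.
move=> n0 w; have [u1 u0 _] := wreg_u n0 w; have [x0 _ _ hy] := w.
have yj : pw n (- (42 * j)%N%:Z) <= nm p.2 ^+ j.
  case: (posnP j) => [->|jp]; first by rewrite muln0 oppr0 pw0 expr0.
  have -> : pw n (- (42 * j)%N%:Z) = pw n (- 42) ^+ j by rewrite pwX; congr (pw n _); (clear; lia).
  by rewrite lerXn2r ?nnegrE ?nm_ge0 ?pw_ge0 ?hy.
have := ler_wpM2l (nm_ge0 p.1) yj; rewrite -Gu_nm => h.
have := le_trans h u1; rewrite -ler_pdivlMr ?pw_gt0 // pwV opprK -mulrA pwD.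
by [].
Qed.

Lemma wreg_small : exists2 N, (0 < N)%N & forall n p, (N <= n)%N -> wreg n p ->
  [/\ small p, (0 < j)%N -> nm p.1 <= nm p.2 & wr p <= 2 * pw n (- 38)].
Proof.
have [N [N0 HN]] := @pw_large R j (2 * J%:R / (@eps R) + 2); exists N => // n p Nn w.
have n0 : (0 < n)%N := leq_trans N0 Nn; have e0 : 0 < @eps R by rewrite /eps; lra.
have J0 : (0 : R) < J%:R by rewrite ltr0n.
have big z : 1 <= z -> [/\ J%:R * (2 * pw n (- z)) <= @eps R & 2 * pw n (- z) <= 1].
  move=> /(HN n _ Nn); have := @pw_gt0 R j n z; rewrite -pwV; move: (pw n z) => P P0 leP.
  have q : 0 < 2 * J%:R / (@eps R) by rewrite divr_gt0 // mulr_gt0.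
  split; last by rewrite ler_pdivrMr // mul1r; lra.
  rewrite mulrA ler_pdivrMr //.
  have : 2 * J%:R / (@eps R) <= P by lra.
  by rewrite ler_pdivrMr // [J%:R * 2]mulrC [(@eps R) * P]mulrC.
have hx := wreg_x n0 w; have [_ _ y1 hy] := w.
have [b1 _] := big ((100 * J)%N%:Z - (42 * j)%N%:Z) ltac:(clear; lia).
have [b2 _] := big 38 ltac:(clear; lia).
have xs (z : int) : z <= 42 -> nm p.1 <= pw n (- z).
  move=> z42; have [_ b3] := big (58 * J)%N%:Z ltac:(clear; lia).
  apply: (le_trans hx); have := ler_wpM2l (@pw_ge0 R j n (- z)) b3.
  rewrite mulrCA pwD mulr1; apply: le_trans; rewrite ler_wpM2l //.
  by apply: pw_le => //; move: z42; clear; lia.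
have y0 := nm_ge0 p.2; have x0 := nm_ge0 p.1; have p0 := @pw_gt0 R j n (- 38).
split; [split| |].
- rewrite (le_trans _ b1) // ler_wpM2l ?(ltW J0) // (le_trans hx) // ler_wpM2l //.
  by apply: pw_le => //; (clear; lia).
- by rewrite (le_trans _ b2) // ler_wpM2l ?(ltW J0) //; lra.
- by move=> jp; apply: le_trans (hy jp); apply: xs.
- by have := xs 38 isT; rewrite /wr; lra.
Qed.

Lemma G_fst_neq0 p : p.1 != 0 -> (G p).1 != 0.
Proof. by move=> x0; rewrite G_fst mulf_neq0 ?cexp_neq0. Qed.

(** The error exponent [110 J] means [n^(-11/10)], which is summable. Within the tolerance of
    [wreg], [(x / y)^2] has exponent at most [- 116 J] and [wr^(3 J)] at most [- 114 J]. *)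
Lemma stepU : exists2 N, (0 < N)%N & exists2 K : R, 0 <= K & forall n p, (N <= n)%N -> wreg n p ->
  nm ((Gu (G p))^-1 - (Gu p)^-1 - 1) <= K * pw n (- (110 * J)%N%:Z).
Proof.
have [N N0 HN] := wreg_small.
have rb n p k : (N <= n)%N -> wreg n p -> wr p ^+ (3 * k) <= 2 ^+ (3 * k) * pw n (- (114 * k)%N%:Z).
  move=> Nn w; have [_ _ r1] := HN n p Nn w.
  have -> : - (114 * k)%N%:Z = - 38 * (3 * k)%N%:Z by (clear; lia).
  by rewrite -pwX -exprMn lerXn2r ?nnegrE ?addr_ge0 ?nm_ge0 ?mulr_ge0 ?pw_ge0.
case: (posnP j) => [j0|jp].
  have [K K0 HK] := @LEU0 R j j0; exists N => //; exists (K * 8) => [|n p Nn w]; first by rewrite mulr_ge0.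
  have n0 : (0 < n)%N := leq_trans N0 Nn; have [sp _ _] := HN n p Nn w; have [x0 _ _ _] := w.
  rewrite (le_trans (HK p sp x0)) // -mulrA ler_wpM2l //.
  rewrite (le_trans (rb n p 1%N Nn w)) // muln1 (_ : 2 ^+ 3 = 8 :> R); last by ring.
  by rewrite ler_wpM2l // pw_le //; move: j0; clear; lia.
have [K K0 HK] := @LEUp R j; exists N => //; exists (K * (4 + 2 ^+ (3 * J))) => [|n p Nn w].
  by rewrite mulr_ge0 // addr_ge0 // exprn_ge0.
have n0 : (0 < n)%N := leq_trans N0 Nn; have [sp xy _] := HN n p Nn w; have [x0 _ _ hy] := w.
rewrite (le_trans (HK p sp x0 (xy jp))) // -mulrA ler_wpM2l // mulrDl lerD //.
  have -> : 4 = 2 ^+ 2 :> R by ring.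
  have -> : - (110 * J)%N%:Z = (- (55 * J)%N%:Z) * 2%N by (clear; lia).
  have yp : 0 < nm p.2 by apply: lt_le_trans (hy jp); rewrite pw_gt0.
  rewrite -pwX -exprMn lerXn2r ?nnegrE ?divr_ge0 ?nm_ge0 // ?mulr_ge0 ?pw_ge0 //.
  rewrite ler_pdivrMr // (le_trans (wreg_x n0 w)) // -mulrA ler_wpM2l //.
  apply: (@le_trans _ _ (pw n (- (55 * J)%N%:Z) * pw n (- 42))).
    by rewrite pwD pw_le //; (clear; lia).
  by rewrite ler_wpM2l ?pw_ge0 ?hy.
rewrite (le_trans (rb n p J Nn w)) // ler_wpM2l ?exprn_ge0 // pw_le //; (clear; lia).
Qed.

(** The growth [1 + beta / n] of [n^beta] compensates the factor [1 - beta u], because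
    [1/u - n = O(n^(1/2))] makes [u - 1/n] of order [n^(-3/2)]. The additive bound yields
    convergence; the relative bound for [j > 0] yields a limit different from 0. *)
Lemma stepk : exists2 N, (0 < N)%N & exists2 K : R, 0 <= K & forall n p, (N <= n)%N -> wreg n p ->
  nm ((Gu p)^-1 - n%:R) <= pw n (50 * J)%N ->
  nm ((G p).2 * (pw n.+1 40)%:C%C - p.2 * (pw n 40)%:C%C) <= K * pw n (- (110 * J)%N%:Z) /\
  ((0 < j)%N -> nm ((G p).2 * (pw n.+1 40)%:C%C - p.2 * (pw n 40)%:C%C) <=
    K * pw n (- (110 * J)%N%:Z) * nm (p.2 * (pw n 40)%:C%C)).
Proof.
have [N N0 HN] := wreg_small; have [K1 K10 HK1] := @O_snd2 R j; have [K2 K20 HK2] := @pw40_succ R j.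
exists N => //; exists (K1 * (8 * 2 ^+ j + 4 * 2 ^+ (2 * J)) + (3 + 2 * K2)).
  by rewrite !(addr_ge0, mulr_ge0, exprn_ge0).
move=> n p Nn w hU; have n0 : (0 < n)%N := leq_trans N0 Nn.
have n1 : (0 : R) < n%:R by rewrite ltr0n.
have [sp _ r1] := HN n p Nn w; have [x0 _ y38 hy] := w; have hx := wreg_x n0 w.
have [u1 u0 U1] := wreg_u n0 w.
have [q qE [/andP[q0 q2] q1]] := HK2 n n0; have [_ /andP[b0 b1]] := @cc_nm R j.
set P := pw n 40; have P0 : 0 <= P := @pw_ge0 R j n 40.
set e := (G p).2 - p.2 * (1 - (beta j)%:C%C * Gu p).
have r0 : 0 <= wr p by rewrite addr_ge0 ?nm_ge0.
have rk k : wr p ^+ k <= 2 ^+ k * pw n (- (38 * k)%N%:Z).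
  have -> : - (38 * k)%N%:Z = - 38 * k%:Z by (clear; lia).
  by rewrite -pwX -exprMn lerXn2r ?nnegrE // mulr_ge0 ?pw_ge0.
have le_e : nm e * (2 * P) <= K1 * (8 * 2 ^+ j + 4 * 2 ^+ (2 * J)) * pw n (- (112 * J)%N%:Z).
  have := HK1 p sp; rewrite -/e => he.
  have t1 : wt 2 j p <= 4 * 2 ^+ j * pw n (- (154 * J)%N%:Z - 46).
    rewrite /wt; apply: (le_trans (ler_pM _ _ (_ : _ <= (2 * pw n (- (100 * J)%N%:Z + (42 * j)%N%:Z)) ^+ 2) (rk j))).
    - by rewrite exprn_ge0 ?nm_ge0.
    - by rewrite exprn_ge0.
    - by rewrite lerXn2r ?nnegrE ?nm_ge0 // mulr_ge0 ?pw_ge0.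
    rewrite exprMn pwX mulrACA pwD (_ : 2 ^+ 2 = 4 :> R) ?ler_wpM2l ?mulr_ge0 ?exprn_ge0 //; last by ring.
    by apply: pw_le => //; (clear; lia).
  have t2 : wt 1 (2 * J) p <= 2 * 2 ^+ (2 * J) * pw n (- (134 * J)%N%:Z - 42).
    rewrite /wt expr1; apply: (le_trans (ler_pM _ _ hx (rk (2 * J)%N))); rewrite ?nm_ge0 ?exprn_ge0 //.
    rewrite mulrACA pwD ler_wpM2l ?mulr_ge0 ?exprn_ge0 //.
    by apply: pw_le => //; (clear; lia).
  have s1 : pw n (- (154 * J)%N%:Z - 46) * P <= pw n (- (112 * J)%N%:Z) by rewrite pwD pw_le //; (clear; lia).
  have s2 : pw n (- (134 * J)%N%:Z - 42) * P <= pw n (- (112 * J)%N%:Z) by rewrite pwD pw_le //; (clear; lia).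
  apply: (@le_trans _ _ (K1 * (wt 2 j p + wt 1 (2 * J) p) * (2 * P))).
    by rewrite ler_wpM2r // mulr_ge0.
  rewrite -!mulrA ler_wpM2l // [leLHS]mulrCA.
  have a0 : (0 : R) <= 2 ^+ j by rewrite exprn_ge0.
  have c0 : (0 : R) <= 2 ^+ (2 * J) by rewrite exprn_ge0.
  apply: (@le_trans _ _ (2 * ((4 * 2 ^+ j * pw n (- (154 * J)%N%:Z - 46) + 2 * 2 ^+ (2 * J) * pw n (- (134 * J)%N%:Z - 42)) * P))).
    by rewrite ler_wpM2l // ler_wpM2r // lerD.
  move: s1 s2 a0 c0; move: (2 ^+ j) (2 ^+ (2 * J)) (pw n (- (112 * J)%N%:Z)) (pw n (_ - 46)) (pw n (_ - 42)).
  by clear => a c V A B s1 s2 a0 c0; nra.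
set k := p.2 * P%:C%C.
(* [e] is the error of [O_snd2]; the bracket collects the error in [(1 + 1/n)^beta], a product of
   two terms of order [1/n], and the difference between [u] and [1/n]. *)
have main : (G p).2 * (pw n.+1 40)%:C%C - k = e * (P * q)%:C%C +
    k * ((q - 1 - beta j / n%:R)%:C%C + (beta j / n%:R)%:C%C * (1 - q%:C%C) + (beta j)%:C%C * q%:C%C * (n%:R^-1 - Gu p)).
  have c1 : (P * q)%:C%C = P%:C%C * q%:C%C :> R[i] by rewrite rmorphM.
  have c3 : (beta j / n%:R)%:C%C = (beta j)%:C%C * n%:R^-1 :> R[i].
    by rewrite rmorphM fmorphV rmorph_nat.
  have c2 : (q - 1 - beta j / n%:R)%:C%C = q%:C%C - 1 - (beta j)%:C%C * n%:R^-1 :> R[i].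
    by rewrite -c3 !rmorphB rmorph1.
  rewrite qE -/P c1 c2 c3 /k /e.
  by move: (Gu p) (G p).2 p.2 (P%:C%C) (q%:C%C) ((beta j)%:C%C) (n%:R^-1) => u g y P' q' b' v; clear; ring.
have du : nm (n%:R^-1 - Gu p) <= 2 * pw n (- (150 * J)%N%:Z).
  have -> : n%:R^-1 - Gu p = ((Gu p)^-1 - n%:R) * (n%:R^-1 * Gu p).
    have nn0 : n%:R != 0 :> R[i] by rewrite pnatr_eq0 -lt0n.
    by field; rewrite ?u0 ?nn0.
  rewrite nmM [nm (n%:R^-1 * _)]nmM nmV nm_nat (@pwnV R j) //.
  apply: (@le_trans _ _ (pw n (50 * J)%N * (pw n (- (100 * J)%N%:Z) * (2 * pw n (- (100 * J)%N%:Z))))).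
    by apply: ler_pM; rewrite ?mulr_ge0 ?nm_ge0 ?pw_ge0 // ler_wpM2l ?pw_ge0.
  have cm (a b : R) : a * (b * (2 * b)) = 2 * (a * (b * b)) by ring.
  by rewrite cm !pwD ler_wpM2l // pw_le //; (clear; lia).
have bn : `|beta j / n%:R| <= n%:R^-1 :> R.
  rewrite ger0_norm ?divr_ge0 ?(ltW b0) ?ler0n // ler_piMl ?invr_ge0 ?ler0n //; lra.
have n2 : n%:R^-1 ^+ 2 <= pw n (- (150 * J)%N%:Z) by rewrite (@pwnV R j) // pwX pw_le //; (clear; lia).
have qq : `|1 - q| <= (1 + K2) * n%:R^-1.
  have ni : n%:R^-1 ^+ 2 <= n%:R^-1 :> R.
    by rewrite expr2 ler_piMl ?invr_ge0 ?ler0n // invf_le1 // ler1n.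
  have -> : 1 - q = - (q - 1 - beta j / n%:R) - beta j / n%:R by ring.
  rewrite (le_trans (ler_normB _ _)) // normrN mulrDl mul1r addrC lerD // (le_trans q1) // ler_wpM2l //.
have brk : nm ((q - 1 - beta j / n%:R)%:C%C + (beta j / n%:R)%:C%C * (1 - q%:C%C) + (beta j)%:C%C * q%:C%C * (n%:R^-1 - Gu p))
    <= (3 + 2 * K2) * pw n (- (150 * J)%N%:Z).
  have -> : 1 - q%:C%C = (1 - q)%:C%C :> R[i] by rewrite rmorphB rmorph1.
  rewrite (le_trans (nmD _ _)) // (le_trans (lerD (nmD _ _) (lexx _))) // !nmM !nm_real.
  have h1 : `|beta j / n%:R| * `|1 - q| <= (1 + K2) * pw n (- (150 * J)%N%:Z).
    apply: (le_trans (ler_pM _ _ bn qq)) => //; rewrite mulrCA -expr2 ler_wpM2l // addr_ge0 //.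
  have h2 : `|beta j| * `|q| * nm (n%:R^-1 - Gu p) <= 2 * pw n (- (150 * J)%N%:Z).
    rewrite (le_trans _ du) // ler_piMl ?nm_ge0 // !ger0_norm ?(ltW b0) //; nra.
  have h3 : `|q - 1 - beta j / n%:R| <= K2 * pw n (- (150 * J)%N%:Z).
    by rewrite (le_trans q1) // ler_wpM2l.
  by move: h1 h2 h3; clear; lra.
have ep : nm (e * (P * q)%:C%C) <= K1 * (8 * 2 ^+ j + 4 * 2 ^+ (2 * J)) * pw n (- (112 * J)%N%:Z).
  apply: le_trans le_e; rewrite nmM nm_real ler_wpM2l ?nm_ge0 // ger0_norm ?mulr_ge0 // mulrC ler_wpM2r //.
have kE : nm k = nm p.2 * P by rewrite nmM nm_real ger0_norm.
have k2 : nm k <= pw n 2.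
  by rewrite kE (le_trans (ler_wpM2r P0 y38)) // pwD.
have A0 : 0 <= K1 * (8 * 2 ^+ j + 4 * 2 ^+ (2 * J)) by rewrite !(mulr_ge0, addr_ge0, exprn_ge0).
set A := K1 * _ in A0 ep *; set B := 3 + 2 * K2 in brk *.
have B0 : 0 <= B by rewrite addr_ge0 // mulr_ge0.
have k0 := nm_ge0 k; move: brk ep; set z1 := e * _; set z2 := (_ + _ : R[i]) => brk ep.
have le1 : nm (z1 + k * z2) <= A * pw n (- (112 * J)%N%:Z) + nm k * (B * pw n (- (150 * J)%N%:Z)).
  by rewrite (le_trans (nmD _ _)) // lerD // nmM ler_wpM2l.
rewrite -/k main; split=> [|jp]; apply: (le_trans le1); rewrite [(A + B) * _]mulrDl.
  rewrite lerD ?ler_wpM2l // ?pw_le //; first by (clear; lia).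
  apply: (le_trans (ler_wpM2r _ k2)); first by rewrite mulr_ge0 ?pw_ge0.
  by rewrite mulrCA pwD ler_wpM2l // pw_le //; (clear; lia).
have k3 : pw n (- 2) <= nm k.
  by rewrite kE; apply: le_trans (ler_wpM2r P0 (hy jp)); rewrite pwD.
rewrite mulrDl lerD //.
  rewrite -mulrA ler_wpM2l //; apply: le_trans (ler_wpM2l (@pw_ge0 R j n _) k3).
  by rewrite pwD pw_le //; (clear; lia).
rewrite [leRHS]mulrC ler_wpM2l // ler_wpM2l // pw_le //; (clear; lia).
Qed.

End OneStep.

(** * Entire maps *)

Section Entire.
Context {R : realType}.
Local Notation C := (R[i]^o).
Implicit Types (U V W : normedModType R[i]).

Definition entire V W (f : V -> W) := forall M : R, nice (nball 0 M) f.

Lemma entire_nice V W (f : V -> W) x r : entire f -> nice (nball x r) f.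
Proof.
move=> ef; apply: nice_sub (ef (nm x + r)) => y; rewrite /nball /= subr0 => yr.
by have := nm_dist y x; lra.
Qed.

Lemma nice_entire U V W (A : set U) (h : U -> V) (f : V -> W) : nice A h -> entire f -> nice A (f \o h).
Proof.
move=> nh ef; have [K K0 HK] := nice_bounded nh.
apply: nice_comp nh (ef (K + 1)) _ => x Ax; rewrite /nball /= subr0.
by rewrite (le_lt_trans (HK x Ax)) // ltrDl.
Qed.

Lemma entire_comp U V W (h : U -> V) (f : V -> W) : entire h -> entire f -> entire (f \o h).
Proof. by move=> eh ef M; apply: nice_entire. Qed.

Lemma entire_iter V (f : V -> V) n : entire f -> entire (iter n f).
Proof.
move=> ef; elim: n => [|n IH]; last exact: entire_comp IH ef.
move=> M; apply: (@nice_lin _ _ _ _ _ M 1) => // x; first by rewrite mul1r.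
by rewrite /nball /= subr0; exact: ltW.
Qed.

Lemma entire_differentiable V W (f : V -> W) x : entire f -> differentiable f x.
Proof. by move=> ef; apply: (nice_differentiable ltr01); exact: entire_nice. Qed.

End Entire.

(** * Regularity, invertibility and reversibility of the plane map *)

Section MapNice.
Context {R : realType} (j : nat).
Local Notation C := (R[i]^o).
Local Notation X2 := (C * C)%type.
Local Notation J := j.+1.

Lemma nice_mono (M : R) (a b : nat) (c : R[i]) :
  nice (nball (0 : X2) M) (fun p : X2 => c * (p.1 ^+ a * p.2 ^+ b) : C).
Proof.
apply: niceM (nice_cst _ (c : C)) _; apply: niceM; apply: niceX; [exact: nice_fst|exact: nice_snd].
Qed.

Lemma res_entire c : entire (res j c : X2 -> X2).
Proof.
have n1 M : nice (nball (0 : X2) M) (fun p : X2 => c * (p.1 * p.2 ^+ j) : C) by exact: (nice_mono M 1 j c).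
move=> M; apply: nice_pair.
  apply: niceM (nice_fst _ _) _; apply: nice_exp; exact: niceM (nice_cst _ (j%:R : C)) (n1 M).
by apply: niceM (nice_snd _ _) _; apply: nice_exp; apply: niceN.
Qed.

Lemma she_entire c : entire (she c : X2 -> X2).
Proof.
move=> M; apply: nice_pair (nice_fst _ _) _; apply: niceD (nice_snd _ _) _.
exact: niceM (nice_cst _ (c : C)) (nice_fst _ _).
Qed.

Lemma logp_nice (V : normedModType R[i]) (A : set V) (f : V -> C) : nice A f -> nice A (fun v => logp (f v) : C).
Proof.
move=> nf; have n2 := niceM (niceX 2 nf) (nice_cst _ (2^-1 : C)).
have n3 := niceM (niceX 3 nf) (nice_cst _ (3^-1 : C)).
exact: niceD (niceD nf n2) n3.
Qed.

Lemma ove_entire c : entire (ove j c : X2 -> X2).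
Proof.
move=> M; apply: nice_pair (nice_snd _ _); apply: niceM (nice_fst _ _) _; apply: nice_exp.
by apply: niceM (nice_cst _ (c : C)) _; apply: logp_nice; apply: niceX; exact: nice_snd.
Qed.

Lemma resK c : cancel (res j c) (res (R := R) j (- c)).
Proof.
move=> [x y]; rewrite /res /=.
have -> : x * cexp (j%:R * (c * (x * y ^+ j))) * (y * cexp (- (c * (x * y ^+ j)))) ^+ j = x * y ^+ j.
  by rewrite exprMn -cexpMn mulrACA -cexpD mulr_natl mulNrn subrr cexp0 mulr1.
rewrite !mulNr; move: (c * (x * y ^+ j)) => u.
by rewrite (mulrN j%:R u) opprK -(mulrA x) -(mulrA y) -!cexpD subrr addNr cexp0 !mulr1.
Qed.

Lemma sheK c : cancel (she c) (she (R := R) (- c)).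
Proof. by move=> [x y]; rewrite /she /= mulNr addrK. Qed.

Lemma oveK c : cancel (ove j c) (ove (R := R) j (- c)).
Proof. by move=> [x y]; rewrite /ove /= -mulrA -cexpD mulNr subrr cexp0 mulr1. Qed.

Definition Ginv (p : R[i] * R[i]) :=
  locked (res j (- cc j) (she (- 2^-1) (ove j 1 (she 1 (ove j (-1) (she (- 2^-1) (res j (- cc j) p))))))).

Lemma Ginv_def p :
  Ginv p = res j (- cc j) (she (- 2^-1) (ove j 1 (she 1 (ove j (-1) (she (- 2^-1) (res j (- cc j) p)))))).
Proof. by rewrite /Ginv -lock. Qed.

Lemma GK : cancel (G (R := R) j) Ginv.
Proof.
have o1 : cancel (ove j 1) (ove (R := R) j (-1)) := oveK 1.
have o2 : cancel (ove j (-1)) (ove (R := R) j 1) by have := oveK (-1); rewrite opprK.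
have s1 : cancel (she (-1)) (she (R := R) 1) by have := sheK (-1); rewrite opprK.
by move=> p; rewrite Ginv_def GE resK sheK o1 s1 o2 sheK resK.
Qed.

Definition flip (p : R[i] * R[i]) := (- p.1, p.2).

Lemma flipK : involutive flip.
Proof. by move=> [x y]; rewrite /flip /= opprK. Qed.

Lemma flip_res c p : flip (res j c p) = res j (- c) (flip p).
Proof. case: p => x y; rewrite /flip /res /=.
have -> : - c * (- x * y ^+ j) = c * (x * y ^+ j) by ring.
by rewrite mulNr. Qed.

Lemma flip_she c p : flip (she c p) = she (- c) (flip p).
Proof. by case: p => x y; rewrite /flip /she /= mulrNN. Qed.

Lemma flip_ove c p : flip (ove j c p) = ove j c (flip p).
Proof. by case: p => x y; rewrite /flip /ove /= mulNr. Qed.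

Lemma GinvE p : Ginv p = flip (G j (flip p)).
Proof.
rewrite Ginv_def GE flip_res flip_she flip_ove flip_she flip_ove flip_she flip_res flipK.
by rewrite opprK.
Qed.

Lemma GinvK : cancel Ginv (G (R := R) j).
Proof. by move=> p; have := GK (flip p); rewrite GinvE => h; rewrite GinvE -[LHS]flipK h flipK. Qed.

Lemma G_entire : entire (G j : X2 -> X2).
Proof.
have e3 := entire_comp (entire_comp (res_entire (cc j)) (she_entire 2^-1)) (ove_entire (-1)).
have e5 := entire_comp (entire_comp e3 (she_entire (-1))) (ove_entire 1).
have e := entire_comp (entire_comp e5 (she_entire 2^-1)) (res_entire (cc j)).
by move=> M; apply: nice_eq (e M) => p _; rewrite GE.
Qed.

Lemma Ginv_entire : entire (Ginv : X2 -> X2).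
Proof.
have e3 := entire_comp (entire_comp (res_entire (- cc j)) (she_entire (- 2^-1))) (ove_entire (-1)).
have e5 := entire_comp (entire_comp e3 (she_entire 1)) (ove_entire 1).
have e := entire_comp (entire_comp e5 (she_entire (- 2^-1))) (res_entire (- cc j)).
by move=> M; apply: nice_eq (e M) => p _; rewrite Ginv_def.
Qed.

Lemma Gu_nice (V : normedModType R[i]) (A : set V) (h : V -> X2) : nice A h -> nice A (fun v => Gu j (h v) : C).
Proof.
move=> nh; apply: (nice_entire (f := fun p : X2 => Gu j p : C)) nh _ => M.
exact: niceM (nice_fst _ _) (niceX _ (nice_snd _ _)).
Qed.

Lemma Alog_entire : entire (Alog j : X2 -> C).
Proof.
have e_snd : entire (snd : X2 -> C) by move=> M; exact: nice_snd.
have e1 : entire (res j (cc j) : X2 -> X2) := res_entire _.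
have e2 : entire ((she 2^-1 \o res j (cc j)) : X2 -> X2) := entire_comp e1 (she_entire _).
have e3 : entire ((she (-1) \o (ove j (-1) \o (she 2^-1 \o res j (cc j)))) : X2 -> X2).
  exact: entire_comp (entire_comp e2 (ove_entire _)) (she_entire _).
have e4 : entire ((she 2^-1 \o (ove j 1 \o (she (-1) \o (ove j (-1) \o (she 2^-1 \o res j (cc j)))))) : X2 -> X2).
  exact: entire_comp (entire_comp e3 (ove_entire _)) (she_entire _).
have nl h M : entire (h : X2 -> X2) -> nice (nball 0 M) (fun p => logp ((h p).2 ^+ J) : C).
  by move=> eh; apply: logp_nice; apply: niceX; exact: (entire_comp eh e_snd M).
move=> M.
have n2 := nl _ M e2; have n3 := nl _ M e3.
have nu := Gu_nice (e4 M).
have nu0 : nice (nball (0 : X2) M) (fun p => Gu j p : C) by exact: niceM (nice_fst _ _) (niceX _ (nice_snd _ _)).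
pose F (p : X2) : C :=
  j%:R * (cc j * (Gu j p + Gu j ((she 2^-1 \o (ove j 1 \o (she (-1) \o (ove j (-1) \o (she 2^-1 \o res j (cc j)))))) p)))
  + (logp (((she (-1) \o (ove j (-1) \o (she 2^-1 \o res j (cc j)))) p).2 ^+ J) -
     logp (((she 2^-1 \o res j (cc j)) p).2 ^+ J)).
have E (p : X2) : nball 0 M p -> F p = Alog j p.
  by move=> _; rewrite /F AlogE /Gl3 /Gl2 /Gu4 /Gy4 /Gx4 /Gy3 /Gl3 /Gh /Gl2 /Gy2 /she /ove /= !mulN1r !mul1r.
apply: nice_eq E _.
apply: niceD; last exact: niceB n3 n2.
apply: niceM (nice_cst _ (j%:R : C)) _; apply: niceM (nice_cst _ (cc j : C)) _; exact: niceD.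
Qed.

End MapNice.

Section Dist.
Context {R : realType} {V : normedModType R[i]}.
Implicit Types x y z : V.

Definition dist x y : R := nm (x - y).

Lemma nballE x r y : nball x r y = (dist y x < r). Proof. by []. Qed.
Lemma dist_ge0 x y : 0 <= dist x y. Proof. exact: nm_ge0. Qed.
Lemma distxx x : dist x x = 0. Proof. by rewrite /dist subrr nm0. Qed.
Lemma distC x y : dist x y = dist y x. Proof. exact: nmB. Qed.
Lemma dist_tri z x y : dist x y <= dist x z + dist z y. Proof. exact: nm_tri. Qed.

Lemma dist_eq0 x y : (forall e : R, 0 < e -> dist x y <= e) -> x = y.
Proof.
move=> H; apply/eqP; rewrite -subr_eq0 -nm_eq0; apply/eqP/le_anti; rewrite nm_ge0 andbT.
by apply/ler_addgt0Pl => e e0; rewrite addr0 H.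
Qed.

Lemma nice_dist (W : normedModType R[i]) (A : set V) (f : V -> W) : nice A f -> exists2 K : R, 0 < K &
  forall x y, A x -> A y -> nm (f y - f x) <= K * dist y x.
Proof. exact: nice_lip. Qed.

End Dist.

Section DistPair.
Context {R : realType}.
Local Notation X2 := (R[i]^o * R[i]^o)%type.
Implicit Types x y : X2.

Lemma dist_pair x y : dist x y = Num.max (nm (x.1 - y.1 : R[i])) (nm (x.2 - y.2 : R[i])).
Proof. by case: x y => [a b] [a' b']; exact: nm_pair. Qed.

Lemma dist_fst x y : nm (x.1 - y.1 : R[i]) <= dist x y.
Proof. by rewrite dist_pair le_max lexx. Qed.

Lemma dist_snd x y : nm (x.2 - y.2 : R[i]) <= dist x y.
Proof. by rewrite dist_pair le_max lexx orbT. Qed.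

Lemma dist_pair_le x y e : nm (x.1 - y.1 : R[i]) <= e -> nm (x.2 - y.2 : R[i]) <= e -> dist x y <= e.
Proof. by move=> h1 h2; rewrite dist_pair ge_max h1. Qed.

End DistPair.

(* [lra] after replacing all norms by fresh variables, which spares it expensive conversion tests. *)
Ltac nlra := clear; first [solve [repeat match goal with |- context [@nm ?T ?V ?x] => generalize (@nm T V x) | |- context [@dist ?T ?V ?x ?y] => generalize (@dist T V x y) end; clear; intros; lra] | lra].

(** * Fatou coordinates *)

Section Trap.
Context {R : realType} (j : nat).
Local Notation C := (R[i]^o).
Local Notation X2 := (C * C)%type.
Local Notation J := j.+1.
Implicit Types (p c : X2) (n N : nat).
Local Notation Gu := (@Gu R j).
Local Notation G := (@G R j).
Local Notation pw := (@pw R j).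
Local Notation wreg := (@wreg R j).

(* The limit of [phi n (G^n p)] conjugates [G] to the translation by [(1, 0)]. *)
Definition phi n p : X2 := locked ((Gu p)^-1 - n%:R, p.2 * (pw n 40)%:C%C).

Lemma phiE n p : phi n p = ((Gu p)^-1 - n%:R, p.2 * (pw n 40)%:C%C).
Proof. by rewrite /phi -lock. Qed.

(** The range of the limit coordinates: the whole plane if [j = 0], and the complement of the line
    [c.2 = 0] if [j > 0]. *)
Definition target c := (0 < j)%N -> c.2 != 0.

Definition bounded_by (M : R) c := [/\ nm (c.1 : R[i]) <= M, nm (c.2 : R[i]) <= M & (0 < j)%N -> M^-1 <= nm (c.2 : R[i])].

Lemma nballP c0 c r : nball c0 r c <-> nm (c.1 - c0.1 : R[i]) < r /\ nm (c.2 - c0.2 : R[i]) < r.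
Proof.
by rewrite nballE dist_pair gt_max; split=> /andP.
Qed.

Lemma nm_pair_le (x y : R[i]) (e : R) : nm x <= e -> nm y <= e -> nm ((x, y) : X2) <= e.
Proof. by move=> x1 y1; rewrite nm_pair ge_max x1. Qed.

Lemma bounded_ball c0 : target c0 -> exists2 r : R, 0 < r & exists2 M : R, 1 <= M &
  forall c, nball c0 r c -> bounded_by M c.
Proof.
move=> good; have a0 := nm_ge0 (c0.1 : R[i]); have b0 := nm_ge0 (c0.2 : R[i]).
case: (posnP j) => [j0|jp].
  exists 1 => //; exists (nm (c0.1 : R[i]) + nm (c0.2 : R[i]) + 1) => [|c /nballP[c1 c2]]; first by lra.
  have h1 := nm_dist (c.1 : R[i]) c0.1; have h2 := nm_dist (c.2 : R[i]) c0.2.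
  by split; [move: h1 c1 b0; clear; lra|move: h2 c2 a0; clear; lra|rewrite j0].
have bp : 0 < nm (c0.2 : R[i]) by rewrite nm_gt0 good.
set b := nm (c0.2 : R[i]) in b0 bp *.
exists (b / 2); first by lra.
have bi : 0 < b^-1 by rewrite invr_gt0.
exists (nm (c0.1 : R[i]) + 2 * b + 2 * b^-1 + 1) => [|c /nballP[c1 c2]]; first by lra.
have h1 := nm_dist (c.1 : R[i]) c0.1; have h2 := nm_dist (c.2 : R[i]) c0.2.
rewrite -/b in h2.
split; [by move: h1 c1 b0 bp bi; clear; lra|by move: h2 c2 a0 bp bi; clear; lra|move=> _].
have h3 : b / 2 <= nm (c.2 : R[i]).
  by have := nm_dist (c0.2 : R[i]) c.2; rewrite nmB -/b; move: c2; clear; lra.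
apply: le_trans h3; rewrite -[leRHS]invrK lef_pV2 ?posrE; [|lra|by rewrite invr_gt0; lra].
by rewrite invfM invrK mulrC; move: a0 bp bi; clear; lra.
Qed.

(** The constant [M] is absorbed for large [n] by the slack [pw n 2] between the exponent 40 of
    [phi] and the exponents 38 and 42 of [wreg]. *)
Lemma bounded_reg (M : R) : 1 <= M -> exists2 N, (0 < N)%N & forall n p, (N <= n)%N -> p.1 != 0 -> bounded_by M (phi n p) ->
  wreg n p /\ nm ((Gu p)^-1 - n%:R) <= pw n (50 * J)%N.
Proof.
move=> M1; have [N [N0 HN]] := @pw_large R j (2 * M); exists N => // n p Nn x0; rewrite phiE => -[/= h1 h2 h3].
have n0 : (0 < n)%N := leq_trans N0 Nn.
have [b1 b2 b3] : [/\ 2 * M <= pw n 2, 2 * M <= pw n (50 * J)%N & 2 * M <= pw n (100 * J)%N].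
  by split; apply: HN => //; clear; lia.
have P2 := @pw_gt0 R j n 2; have P40 := @pw_gt0 R j n 40.
have yE : nm p.2 = nm (p.2 * (pw n 40)%:C%C) * pw n (- 40).
  by rewrite nmM nm_real ger0_norm ?pw_ge0 // -mulrA pwD pw0 mulr1.
have P40' := @pw_gt0 R j n (- 40).
split; last by apply: (le_trans h1); move: b2 M1; clear; lra.
split=> //.
- by rewrite (@pwn R j n n0); apply: (le_trans h1); move: b3; clear; lra.
- rewrite yE; apply: (@le_trans _ _ (pw n 2 * pw n (- 40))); last by rewrite pwD.
  by rewrite ler_wpM2r ?(ltW P40') // (le_trans h2) //; move: b1 M1; clear; lra.
- move=> jp; rewrite yE; apply: (@le_trans _ _ (pw n (- 2) * pw n (- 40))); first by rewrite pwD.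
  rewrite ler_wpM2r ?(ltW P40') // (le_trans _ (h3 jp)) // -pwV lef_pV2 ?posrE //; last by lra.
  by move: b1 M1; clear; lra.
Qed.

Lemma stepphi : exists2 N, (0 < N)%N & exists2 K : R, 0 <= K & forall n p, (N <= n)%N -> wreg n p ->
  nm ((Gu p)^-1 - n%:R) <= pw n (50 * J)%N ->
  dist (phi n.+1 (G p)) (phi n p) <= K * pw n (- (110 * J)%N%:Z).
Proof.
have [N1 N10 [K1 K10 H1]] := @stepU R j; have [N2 N20 [K2 K20 H2]] := @stepk R j.
exists (maxn N1 N2); first by rewrite leq_max N10.
exists (K1 + K2) => [|n p]; first exact: addr_ge0.
rewrite geq_max => /andP[Nn1 Nn2] w hU; have P0 := @pw_ge0 R j n (- (110 * J)%N%:Z).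
rewrite !phiE; apply: dist_pair_le => /=.
  have -> : (Gu (G p))^-1 - n.+1%:R - ((Gu p)^-1 - n%:R) = (Gu (G p))^-1 - (Gu p)^-1 - 1.
    by rewrite -(natr1 n); ring.
  by rewrite (le_trans (H1 n p Nn1 w)) // ler_wpM2r // lerDl.
have [h _] := H2 n p Nn2 w hU.
by rewrite (le_trans h) // ler_wpM2r // lerDr.
Qed.

(** [n^(-1/10)], the order of the tail of a sum of step errors [n^(-11/10)]. *)
Definition rate n : R := pw n (- (10 * J)%N%:Z).

Lemma rate_gt0 n : 0 < rate n. Proof. exact: pw_gt0. Qed.

Lemma rate_small (d : R) : 0 < d -> exists2 N, (0 < N)%N & forall n, (N <= n)%N -> rate n < d.
Proof.
move=> d0; have [N [N0 HN]] := @pw_large R j (d^-1 + 1); exists N => // n Nn.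
rewrite /rate -pwV -[d]invrK ltf_pV2 ?posrE ?invr_gt0 ?pw_gt0 //.
by apply: lt_le_trans (HN n _ Nn _); [rewrite ltrDl|lia].
Qed.

Lemma rate_mono n m : (0 < n)%N -> (n <= m)%N -> rate m <= rate n.
Proof. by move=> n0 le_nm; apply: pw_mono. Qed.

Lemma rate_tele : exists2 K : R, 0 <= K & forall n, (0 < n)%N -> pw n (- (110 * J)%N%:Z) <= K * (rate n - rate n.+1).
Proof.
have h1 : (1 : int) <= (10 * J)%N by clear; lia.
exists (400 * J)%:R => [|n n0]; first exact: ler0n.
have := @pw_tele R j n (10 * J)%N n0 h1.
by have -> : - (100 * J)%N%:Z - (10 * J)%N%:Z = - (110 * J)%N%:Z by clear; lia.
Qed.

(** Bootstrap: while the sequence stays in the ball of radius [2 r] its increments telescope, and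
    their total [K rho 0 <= r] cannot take it out of this ball. *)
Lemma stay_near (V : normedModType R[i]) (v : nat -> V) (c0 : V) (K r : R) (rho : nat -> R) : 0 <= K ->
  (forall i, 0 <= rho i) -> K * rho 0%N <= r -> dist (v 0%N) c0 < r ->
  (forall i, dist (v i) c0 < 2 * r -> dist (v i.+1) (v i) <= K * (rho i - rho i.+1)) ->
  forall i, dist (v i) c0 < 2 * r /\ forall k, dist (v (i + k)%N) (v i) <= K * rho i.
Proof.
move=> K0 rho0 rN v0 inc.
have stay i : dist (v i) c0 < 2 * r /\ dist (v i) (v 0%N) <= K * (rho 0%N - rho i).
  elim: i => [|i [IH1 IH2]].
    by rewrite distxx subrr mulr0; split=> //; have := rho0 0%N; have := dist_ge0 (v 0%N) c0; move: v0; nlra.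
  have h : dist (v i.+1) (v 0%N) <= K * (rho 0%N - rho i.+1).
    rewrite (le_trans (dist_tri (v i) _ _)) // (le_trans (lerD (inc i IH1) IH2)) // -mulrDr.
    by rewrite addrC subrKA.
  split=> //; apply: (le_lt_trans (dist_tri (v 0%N) _ _)).
  have := ler_wpM2l K0 (rho0 i.+1); rewrite mulr0.
  by move: h v0 rN; rewrite mulrBr; nlra.
move=> i; split; first by have [] := stay i.
have sum k : dist (v (i + k)%N) (v i) <= K * (rho i - rho (i + k)%N).
  elim: k => [|k IH]; first by rewrite addn0 distxx subrr mulr0.
  have [hk _] := stay (i + k)%N; rewrite addnS (le_trans (dist_tri (v (i + k)%N) _ _)) //.
  rewrite (le_trans (lerD (inc _ hk) IH)) // -mulrDr.
  by rewrite addrC subrKA.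
by move=> k; rewrite (le_trans (sum k)) // ler_wpM2l // gerBl.
Qed.

(** Bounded coordinates put a point in the regime [wreg], where the step errors are summable, and
    then [stay_near] keeps the coordinates bounded. The constants are uniform in the entrance time
    [N] and in [p]. *)
Lemma trap c0 : target c0 -> exists2 r : R, 0 < r & exists2 N0, (0 < N0)%N & exists2 K : R, 0 <= K &
  (forall c, nball c0 (2 * r) c -> target c) /\
  (exists M : R, forall c, nball c0 (2 * r) c -> nm c <= M) /\
  (forall N, (N0 <= N)%N -> 2 * K * rate N < r) /\
  forall N p, (N0 <= N)%N -> p.1 != 0 -> nball c0 r (phi N p) -> forall i,
  [/\ nball c0 (2 * r) (phi (N + i) (iter i G p)), wreg (N + i) (iter i G p) &
  forall k, dist (phi (N + i + k) (iter (i + k) G p)) (phi (N + i) (iter i G p)) <= K * rate (N + i)].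
Proof.
move=> good; have [r2 r20 [M M1 HM]] := bounded_ball good.
have [N1 N10 HN1] := bounded_reg M1; have [N2 N20 [K2 K20 HN2]] := stepphi.
have [C4 C40 tele] := rate_tele.
have [K [K0 KE]] : exists K : R, 0 <= K /\ K = K2 * C4 by exists (K2 * C4); rewrite mulr_ge0.
have K1 : 0 < 2 * (K + 1) by rewrite mulr_gt0 // ltr_wpDl.
have d0 : 0 < r2 / 2 / (2 * (K + 1)) by rewrite !divr_gt0.
have [N3 N30 HN3] := rate_small d0.
exists (r2 / 2); first by rewrite divr_gt0.
exists (maxn N1 (maxn N2 N3)); first by rewrite leq_max N10.
exists K => //; have -> : 2 * (r2 / 2) = r2 by field.
split=> [c /HM[_ _ h] jp|].
  by rewrite -nm_gt0; apply: lt_le_trans (h jp); rewrite invr_gt0; move: M1; clear; lra.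
split; first by exists M => c /HM[h1 h2 _]; rewrite (surjective_pairing c); exact: nm_pair_le.
have rN' N : (N3 <= N)%N -> 2 * K * rate N < r2 / 2.
  move=> NN3; have := HN3 N NN3; rewrite ltr_pdivlMr //.
  by have := rate_gt0 N; generalize (rate N); move: K0; clear=> K0 t; lra.
split; first by move=> N; rewrite !geq_max => /and3P[_ _]; exact: rN'.
move=> N p; rewrite !geq_max => /and3P[NN1 NN2 NN3] x0 near0.
have N00 : (0 < N)%N := leq_trans N10 NN1.
have rN : K * rate (N + 0)%N <= r2 / 2.
  rewrite addn0; have := rN' N NN3.
  by have := rate_gt0 N; generalize (rate N); move: K0; clear=> K0 t; nra.
have xi i : (iter i G p).1 != 0 by elim: i => //= i IH; exact: G_fst_neq0.
have wr i : nball c0 r2 (phi (N + i) (iter i G p)) ->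
    wreg (N + i) (iter i G p) /\ nm ((Gu (iter i G p))^-1 - (N + i)%:R) <= pw (N + i) (50 * J)%N.
  by move=> /HM hb; exact: HN1 _ _ (leq_trans NN1 (leq_addr _ _)) (xi i) hb.
have near00 : dist (phi (N + 0)%N (iter 0%N G p)) c0 < r2 / 2 by rewrite addn0.
have inc i : dist (phi (N + i) (iter i G p)) c0 < 2 * (r2 / 2) ->
    dist (phi (N + i.+1) (iter i.+1 G p)) (phi (N + i) (iter i G p)) <= K * (rate (N + i) - rate (N + i.+1)).
  rewrite (_ : 2 * (r2 / 2) = r2) => [/wr[w hU]|]; last by field.
  rewrite addnS; apply: (le_trans (HN2 _ _ (leq_trans NN2 (leq_addr _ _)) w hU)).
  rewrite KE -mulrA ler_wpM2l //.
  by apply: tele; rewrite addn_gt0 N00.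
have St := stay_near (v := fun i => phi (N + i) (iter i G p)) (rho := fun i => rate (N + i)) K0
  (fun i => ltW (rate_gt0 _)) rN near00 inc.
move=> i; have [] := St i; rewrite (_ : 2 * (r2 / 2) = r2) => [hi hk|]; last by field.
split; [exact: hi|by have [] := wr i hi|].
by move=> k; rewrite -addnA; exact: hk.
Qed.

End Trap.

(** * The basin and the limit of the coordinates *)

Section Limit.
Context {R : realType} (j : nat).
Local Notation C := (R[i]^o).
Local Notation X2 := (C * C)%type.
Local Notation J := j.+1.
Implicit Types (p c : X2) (n N : nat).
Local Notation Gu := (@Gu R j).
Local Notation G := (@G R j : X2 -> X2).
Local Notation pw := (@pw R j).
Local Notation wreg := (@wreg R j).
Local Notation phi := (@phi R j).
Local Notation rate := (@rate R j).
Local Notation target := (@target R j).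

Lemma pair_cauchy (u : nat -> X2) (T : nat -> R) :
  (forall n m, (n <= m)%N -> dist (u m) (u n) <= T n) -> exists l, forall n, dist (u n) l <= 2 * T n.
Proof.
move=> H.
have [l1 H1] := @complex_cauchy R (fun n => (u n).1) T (fun n m h => le_trans (dist_fst _ _) (H n m h)).
have [l2 H2] := @complex_cauchy R (fun n => (u n).2) T (fun n m h => le_trans (dist_snd _ _) (H n m h)).
by exists (l1, l2) => n; apply: dist_pair_le; [exact: H1|exact: H2].
Qed.

Lemma nice_phi (V : normedModType R[i]) (A : set V) (h : V -> X2) n (M : R) : nice A h ->
  (forall v, A v -> Gu (h v) != 0 /\ nm (phi n (h v)) <= M) -> nice A (fun v => phi n (h v)).
Proof.
move=> nh H; case: (pselect (exists v, A v)) => [[v0 Av0]|no]; last first.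
  by exists (fun _ _ => 0), 0; split=> // v Av; case: no; exists v.
have M0 : 0 <= M := le_trans (nm_ge0 _) (H v0 Av0).2.
have q0 : 0 < M + n%:R + 1 by rewrite ltr_wpDl // addr_ge0.
apply: (nice_eq (f := fun v => ((Gu (h v))^-1 - n%:R, (h v).2 * (pw n 40)%:C%C) : X2)) => [v _|]; first by rewrite phiE.
apply: nice_pair; last first.
  have ns : nice A (fun v => (h v).2) by apply: nice_entire nh _ => K; exact: nice_snd.
  exact: niceM ns (nice_cst _ ((pw n 40)%:C%C : C)).
apply: niceB (nice_cst _ (n%:R : C)).
apply: (@nice_inv _ _ _ _ (M + n%:R + 1)^-1); [by rewrite invr_gt0| |exact: Gu_nice].
move=> v Av; have [u0 hM] := H v Av; have up : 0 < nm (Gu (h v)) by rewrite nm_gt0.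
rewrite -[leRHS]invrK lef_pV2 ?posrE ?invr_gt0 // -nmV.
have := nm_dist (Gu (h v))^-1 n%:R; rewrite nm_nat.
have : nm ((Gu (h v))^-1 - n%:R) <= M by apply: le_trans hM; rewrite phiE nm_pair le_max lexx.
by nlra.
Qed.

(** The last clause is stated for an arbitrary parametrization [g] of the points at time [N]: with
    [g = iter N G] it gives the holomorphy of [Phi], with [g = chart N] that of [Phi] read in the
    coordinates of time [N]. *)
Lemma trap_limit c0 : target c0 -> exists2 r : R, 0 < r & exists2 N0, (0 < N0)%N & exists2 K : R, 0 <= K &
  (forall N, (N0 <= N)%N -> K * rate N < r) /\
  (forall N p, (N0 <= N)%N -> p.1 != 0 -> nball c0 r (phi N p) -> exists c,
   [/\ target c, forall i, wreg (N + i) (iter i G p) &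
       forall i, dist (phi (N + i) (iter i G p)) c <= K * rate (N + i)]) /\
  forall (V : normedModType R[i]) (v0 : V) (d : R) (g f : V -> X2) N, 0 < d -> (N0 <= N)%N ->
    nice (nball v0 d) g -> (forall v, nball v0 d v -> (g v).1 != 0 /\ nball c0 r (phi N (g v))) ->
    (forall v, nball v0 d v -> forall i, dist (phi (N + i) (iter i G (g v))) (f v) <= K * rate (N + i)) ->
    nice (nball v0 (d / 4)) f.
Proof.
move=> good; have [r r0 [N0 N00 [K K0 [Ht [[M HM] [Hr Htr]]]]]] := trap good.
exists r => //; exists N0 => //; exists (2 * K); first by rewrite mulr_ge0.
split=> //; split=> [N p NN x0 near0|V v0 d g f N d0 NN ng Hg Hf].
  have HT := Htr N p NN x0 near0.
  have [c Hc] := @pair_cauchy (fun i => phi (N + i) (iter i G p)) (fun i => K * rate (N + i)) ltac:(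
    by move=> n m /subnKC <-; have [_ _] := HT n; move/(_ (m - n)%N); rewrite -addnA).
  exists c; split=> [|i|i]; last by rewrite -mulrA Hc.
    apply: Ht; rewrite nballE (le_lt_trans (dist_tri (phi N p) _ _)) //.
    have := Hc 0%N; rewrite addn0 mulrA distC /=; have := Hr N NN; move: near0; rewrite nballE.
    by move: (2 * K * rate N) => t; nlra.
  by have [] := HT i.
have N0' n : (0 < N + n)%N by rewrite addn_gt0 (leq_trans N00 NN).
have nF n : nice (nball v0 d) (fun v => phi (N + n) (iter n G (g v))).
  apply: (@nice_phi _ _ (fun v => iter n G (g v)) _ M) => [|v vd].
    exact: (nice_entire (f := iter n G) ng (entire_iter n (@G_entire R j))).
  have [x0 near0] := Hg v vd; have [h1 h2 _] := Htr N _ NN x0 near0 n.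
  by split; [have [] := wreg_u (N0' n) h2|exact: HM].
have pf : entire (fst : X2 -> C) by move=> M'; exact: nice_fst.
have ps : entire (snd : X2 -> C) by move=> M'; exact: nice_snd.
have mono n m : (n <= m)%N -> 2 * K * rate (N + m) <= 2 * K * rate (N + n).
  by move=> nm_; rewrite ler_wpM2l ?mulr_ge0 // rate_mono // leq_add2l.
have lim0 e : 0 < e -> exists n, 2 * K * rate (N + n) < e.
  move=> e0; have q : 0 < e / (2 * K + 1) by rewrite divr_gt0 // ltr_wpDl // mulr_ge0.
  have [N1 _ HN1] := @rate_small R j _ q; exists N1.
  have := HN1 (N + N1)%N (leq_addl _ _); rewrite ltr_pdivlMr; last by rewrite ltr_wpDl // mulr_ge0.
  by have := @rate_gt0 R j (N + N1); generalize (rate (N + N1)) => t; lra.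
apply: (nice_eq (f := fun v => ((f v).1, (f v).2))) => [v _|]; first by rewrite -surjective_pairing.
apply: nice_pair.
  apply: (@nice_lim _ _ _ _ (fun n v => (phi (N + n) (iter n G (g v))).1 : C) _ (fun n => 2 * K * rate (N + n))) => //.
    by move=> n; exact: nice_entire (nF n) pf.
  by move=> n v vd; apply: le_trans (Hf v vd n); exact: dist_fst.
apply: (@nice_lim _ _ _ _ (fun n v => (phi (N + n) (iter n G (g v))).2 : C) _ (fun n => 2 * K * rate (N + n))) => //.
  by move=> n; exact: nice_entire (nF n) ps.
by move=> n v vd; apply: le_trans (Hf v vd n); exact: dist_snd.
Qed.

Definition attr p c := forall e : R, 0 < e -> exists N, forall n, (N <= n)%N -> dist (phi n (iter n G p)) c < e.

Definition basin p := exists2 c, target c & attr p c.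

(** The value 0 for points without a limit is a mere default. *)
Definition Phi p : X2 := locked (xget 0 (attr p)).

Lemma attr_uniq p c c' : attr p c -> attr p c' -> c = c'.
Proof.
move=> H H'; apply: dist_eq0 => e e0.
have e2 : 0 < e / 2 by rewrite divr_gt0.
have [N HN] := H _ e2; have [N' HN'] := H' _ e2.
have := HN (maxn N N') (leq_maxl _ _); have := HN' (maxn N N') (leq_maxr _ _).
by have := dist_tri (phi (maxn N N') (iter (maxn N N') G p)) c c'; rewrite (distC c (phi _ _)); nlra.
Qed.

Lemma PhiE p c : attr p c -> Phi p = c.
Proof. by move=> H; rewrite /Phi -lock; case: xgetP => [d _ Hd|/(_ c)//]; exact: attr_uniq Hd H. Qed.

Lemma PhiP p : basin p -> target (Phi p) /\ attr p (Phi p).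
Proof. by move=> [c tc ac]; rewrite (PhiE ac). Qed.

Lemma rate_lim (K e : R) : 0 <= K -> 0 < e -> exists2 N, (0 < N)%N & forall n, (N <= n)%N -> K * rate n < e.
Proof.
move=> K0 e0; have q : 0 < e / (K + 1) by rewrite divr_gt0 // ltr_wpDl.
have [N N0 HN] := @rate_small R j _ q; exists N => // n /HN.
rewrite ltr_pdivlMr; last by rewrite ltr_wpDl.
by have := @rate_gt0 R j n; generalize (rate n) => t; clear; lra.
Qed.

Lemma attr_rate p c N (K : R) : 0 <= K ->
  (forall i, dist (phi (N + i) (iter i G (iter N G p))) c <= K * rate (N + i)) -> attr p c.
Proof.
move=> K0 H e e0; have [N1 _ HN1] := rate_lim K0 e0; exists (maxn N N1) => n; rewrite geq_max => /andP[Nn N1n].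
by have := H (n - N)%N; rewrite -iterD subnK // subnKC // => /le_lt_trans -> //; exact: HN1.
Qed.

Lemma iter_fst_neq0 n p : ((iter n G p).1 != 0) = (p.1 != 0).
Proof.
elim: n => //= n IH; rewrite -IH; move: (iter n G p) => q.
by rewrite (G_fst j q) mulf_eq0 (negPf (cexp_neq0 _)) orbF.
Qed.

Lemma iter_fst0 n p : p.1 = 0 -> iter n G p = p.
Proof.
move=> p0; have G0 : G p = p.
  have x1 : Gx1 j p = 0 by rewrite /Gx1 /= p0 mul0r.
  have h0 : Gh j p = 0 by rewrite /Gh x1 mul0r.
  have x4 : Gx4 j p = 0 by rewrite /Gx4 h0 mul0r.
  have u0 : Gu p = 0 by rewrite /Gu p0 mul0r.
  have u4 : Gu4 j p = 0 by rewrite /Gu4 x4 mul0r.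
  apply: injective_projections; first by rewrite G_fst p0 mul0r.
  rewrite G_snd u4 mulr0 oppr0 cexp0 mulr1 /Gy4 x4 mulr0 addr0 /Gy3 h0 subr0 /Gy2 x1 mulr0 addr0 /Gy1 /= -/(Gu p).
  by rewrite u0 mulr0 oppr0 cexp0 mulr1.
by elim: n => //= n ->.
Qed.

(** On the fixed line [u = 0], and with the convention that the inverse of 0 is 0 the first
    coordinate of [phi n] is [- n] along a constant orbit. *)
Lemma basin_neq0 p : basin p -> p.1 != 0.
Proof.
move=> [c _ ac]; apply/negP => /eqP p0.
have [N HN] := ac 1 ltr01; pose n := maxn N (Num.trunc (nm c + 1)).+1.
have := le_lt_trans (dist_fst _ _) (HN n (leq_maxl _ _)); rewrite iter_fst0 // phiE /Gu p0 mul0r invr0 sub0r /= => h1.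
have c1 : nm (c.1 : R[i]) <= nm c by rewrite (surjective_pairing c) nm_pair le_max lexx.
have : n%:R <= nm c + 1.
  have := nm_dist (n%:R : R[i]) (- c.1); rewrite nmN nm_nat opprK => h2.
  by move: h1; rewrite -nmN opprB opprK addrC => h1; move: h1 h2 c1; nlra.
apply/negP; rewrite -ltNge (lt_le_trans (truncnS_gt _)) // ler_nat leq_maxr //.
Qed.

Lemma wreg_nm : exists2 N, (0 < N)%N & forall n p, (N <= n)%N -> wreg n p -> nm p <= 2 * pw n (- 38).
Proof.
have [N N0 HN] := @wreg_small R j; exists N => // n p Nn w; have [_ _ h] := HN n p Nn w.
have x0 := nm_ge0 (p.1 : R[i]); have y0 := nm_ge0 (p.2 : R[i]).
by rewrite (surjective_pairing p); apply: nm_pair_le; move: h x0 y0; rewrite /wr; clear; lra.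
Qed.

(** A fixed iterate is continuous, so a whole ball enters the trap at the same time [N]; this gives
    openness, uniform rates and the holomorphy of [Phi] together. *)
Lemma basin_nbhd p0 : basin p0 -> exists2 d : R, 0 < d & exists2 N, (0 < N)%N & exists2 K : R, 0 <= K &
  nice (nball p0 d) Phi /\ forall p, nball p0 d p -> [/\ basin p,
    forall n, (N <= n)%N -> wreg n (iter n G p) &
    forall n, (N <= n)%N -> dist (phi n (iter n G p)) (Phi p) <= K * rate n].
Proof.
move=> b0; have x0 := basin_neq0 b0; have [t0 a0] := PhiP b0.
have [r r0 [N0 N00 [K K0 [_ [Ht Hn]]]]] := trap_limit t0.
have r2 : 0 < r / 2 by rewrite divr_gt0.
have [N1 HN1] := a0 _ r2; pose N := maxn N0 N1; have NN0 : (N0 <= N)%N := leq_maxl _ _.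
have near0 := HN1 N (leq_maxr _ _).
have eN : entire (iter N G : X2 -> X2) := entire_iter N (@G_entire R j).
have x0' : 0 < nm (p0.1 : R[i]) by rewrite nm_gt0.
have u0 : Gu (iter N G p0) != 0.
  have nb : nball (Phi p0) r (phi N (iter N G p0)) by rewrite nballE; apply: lt_trans near0 _; lra.
  have [c [_ w _]] := Ht N (iter N G p0) NN0 ltac:(by rewrite iter_fst_neq0) nb.
  by have := w 0%N; rewrite addn0 => /(wreg_u (leq_trans N00 NN0))[].
have nu : nice (nball p0 1) (fun p => Gu (iter N G p) : C) by apply: Gu_nice; exact: entire_nice.
have [L L0 HL] := nice_dist nu.
pose g := nm (Gu (iter N G p0)); have g0 : 0 < g by rewrite nm_gt0.
pose d1 := Num.min 1 (Num.min (nm (p0.1 : R[i])) (g / 2 / L)).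
have d10 : 0 < d1 by rewrite !lt_min ltr01 x0' !divr_gt0.
have d11 : d1 <= 1 by rewrite ge_min lexx.
have d12 : d1 <= nm (p0.1 : R[i]) by rewrite !ge_min lexx orbT.
have d13 : L * d1 <= g / 2.
  by rewrite mulrC -ler_pdivlMr // !ge_min lexx !orbT.
have ulow p : nball p0 d1 p -> g / 2 <= nm (Gu (iter N G p)).
  move=> pd; have p1 : nball p0 1 p by apply: lt_le_trans pd d11.
  have pdl : dist p p0 <= d1 by exact: ltW pd.
  have h2 := ler_wpM2l (ltW L0) pdl; have h3 := HL _ _ (nball0 p0 ltr01) p1.
  have := nm_dist (Gu (iter N G p0)) (Gu (iter N G p)); rewrite nmB -/g => h4.
  by move: h2 h3 h4 d13; nlra.
have up0 p : nball p0 d1 p -> Gu (iter N G p) != 0.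
  by move=> /ulow h; rewrite -nm_gt0; apply: lt_le_trans h; rewrite divr_gt0.
have nph : nice (nball p0 d1) (fun p => phi N (iter N G p)).
  have nN : nice (nball p0 d1) (iter N G) := entire_nice _ _ eN.
  have nI : nice (nball p0 d1) (fun p => (Gu (iter N G p))^-1 : C).
    by apply: (@nice_inv _ _ _ _ (g / 2)); [rewrite divr_gt0|exact: ulow|exact: Gu_nice].
  have ns : nice (nball p0 d1) (fun p => (iter N G p).2) by apply: (nice_entire (f := snd)) nN _ => M; exact: nice_snd.
  apply: (nice_eq (fun p _ => esym (phiE j N (iter N G p)))).
  apply: nice_pair; first exact: niceB nI (nice_cst _ (N%:R : C)).
  exact: niceM ns (nice_cst _ ((pw N 40)%:C%C : C)).
have [L2 L20 HL2] := nice_dist nph.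
pose d := Num.min d1 (r / 2 / L2); have d0 : 0 < d by rewrite lt_min d10 !divr_gt0.
have dd1 : d <= d1 by rewrite ge_min lexx.
have dd2 : L2 * d <= r / 2 by rewrite mulrC -ler_pdivlMr // ge_min lexx orbT.
have Hd p : nball p0 d p -> p.1 != 0 /\ nball (Phi p0) r (phi N (iter N G p)).
  move=> pd; have pd1 : nball p0 d1 p by apply: lt_le_trans pd dd1.
  split.
    apply/negP => /eqP p1; have := lt_le_trans pd1 d12; apply/negP; rewrite -leNgt.
    by have := dist_fst p p0; rewrite p1 sub0r nmN.
  have pdl : dist p p0 <= d by exact: ltW pd.
  have h1 := ler_wpM2l (ltW L20) pdl.
  have h2 : dist (phi N (iter N G p)) (phi N (iter N G p0)) <= L2 * dist p p0 := HL2 _ _ (nball0 p0 d10) pd1.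
  rewrite nballE (le_lt_trans (dist_tri (phi N (iter N G p0)) _ _)) //.
  by move: near0 h1 h2 dd2; nlra.
have Hx p : nball p0 d p -> exists c, [/\ target c, forall i, wreg (N + i) (iter i G (iter N G p)) &
    forall i, dist (phi (N + i) (iter i G (iter N G p))) c <= K * rate (N + i)].
  by move=> /Hd[x1 h]; apply: Ht => //; rewrite iter_fst_neq0.
have HP p : nball p0 d p -> forall i, dist (phi (N + i) (iter i G (iter N G p))) (Phi p) <= K * rate (N + i).
  by move=> /Hx[c [tc _ hc]] i; rewrite (PhiE (attr_rate K0 hc)).
exists (d / 4); first by rewrite divr_gt0.
exists N; first exact: leq_trans N00 NN0.
exists K; [exact: K0|split].
  apply: (Hn _ p0 d (iter N G) Phi N) => //; first exact: entire_nice.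
  by move=> v /Hd[h1 h2]; rewrite iter_fst_neq0.
move=> p pd; have pd' : nball p0 d p.
  by apply: lt_le_trans pd _; move: d0; clear; lra.
have [c [tc wc hc]] := Hx p pd'; split.
- by exists c; [exact: tc|exact: attr_rate K0 hc].
- by move=> n Nn; have := wc (n - N)%N; rewrite -iterD subnK // subnKC.
- by move=> n Nn; have := HP p pd' (n - N)%N; rewrite -iterD subnK // subnKC.
Qed.

End Limit.

(** * Inversion of maps close to the identity *)

Section LocalInverse.
Context {R : realType}.
Local Notation C := (R[i]^o).
Local Notation X2 := (C * C)%type.
Implicit Types (c : X2).

Lemma nice_fstE (V : normedModType R[i]) (A : set V) (f : V -> X2) : nice A f -> nice A (fun v => (f v).1).
Proof. by move=> nf; apply: (nice_entire (f := fst : X2 -> C)) nf _ => M; exact: nice_fst. Qed.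

Lemma nice_sndE (V : normedModType R[i]) (A : set V) (f : V -> X2) : nice A f -> nice A (fun v => (f v).2).
Proof. by move=> nf; apply: (nice_entire (f := snd : X2 -> C)) nf _ => M; exact: nice_snd. Qed.

Lemma nice_id (V : normedModType R[i]) (x : V) r : nice (nball x r) id.
Proof.
apply: entire_nice => M; apply: (@nice_lin _ _ _ _ _ M 1) => // y; first by rewrite mul1r.
by rewrite /nball /= subr0; exact: ltW.
Qed.

(** Cauchy's estimate for the small map [f - id] turns its uniform bound into the Lipschitz constant
    [1/2]; the radius shrinks from [8 rho] to [2 rho]. *)
Lemma near_id_lip (c0 : X2) (rho m : R) (f : X2 -> X2) : 0 < rho -> 0 <= m ->
  m * (1 + 1 / rho + 1 / rho ^+ 2) <= 1 / 2 -> nice (nball c0 (8 * rho)) f ->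
  (forall c, nball c0 (8 * rho) c -> dist (f c) c <= m) ->
  forall c c', nball c0 (2 * rho) c -> nball c0 (2 * rho) c' -> 
    nm ((f c').1 - c'.1 - ((f c).1 - c.1) : R[i]) <= 1 / 2 * dist c' c /\
    nm ((f c').2 - c'.2 - ((f c).2 - c.2) : R[i]) <= 1 / 2 * dist c' c.
Proof.
move=> rho0 m0 hm nf hf.
have r8 : 0 < 8 * rho by rewrite mulr_gt0.
have E : 8 * rho / 4 = 2 * rho by field.
have E2 : m * (1 + 8 / (8 * rho) + 64 / (8 * rho) ^+ 2) = m * (1 + 1 / rho + 1 / rho ^+ 2).
  by field; rewrite ?gt_eqF.
have n1 : nice (nball c0 (8 * rho)) (fun c => (f c).1 - c.1 : C).
  by apply: niceB; [exact: nice_fstE|exact: nice_fst].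
have n2 : nice (nball c0 (8 * rho)) (fun c => (f c).2 - c.2 : C).
  by apply: niceB; [exact: nice_sndE|exact: nice_snd].
have [D1 [K1 t1]] := n1; have [D2 [K2 t2]] := n2.
have c1 := cauchy_tayl r8 t1 (fun c hc => le_trans (dist_fst _ _) (hf c hc)).
have c2 := cauchy_tayl r8 t2 (fun c hc => le_trans (dist_snd _ _) (hf c hc)).
rewrite E E2 in c1 c2; move=> c c' hc hc'; have d0 := dist_ge0 c' c; split.
  have [_ /(_ c hc)[_ _ _ /(_ c' hc')[h _]]] := c1.
  by rewrite (le_trans h) // ler_wpM2r.
have [_ /(_ c hc)[_ _ _ /(_ c' hc')[h _]]] := c2.
by rewrite (le_trans h) // ler_wpM2r.
Qed.

(** The third condition bounds the constant of [cauchy_tayl] at radius [8 rho]; the fourth keeps the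
    iterates below inside the ball of radius [2 rho]. *)
Definition near_id c0 (rho m : R) (f : X2 -> X2) :=
  [/\ 0 < rho, 0 <= m, m * (1 + 1 / rho + 1 / rho ^+ 2) <= 1 / 2, m <= rho / 8 &
      nice (nball c0 (8 * rho)) f /\ forall c, nball c0 (8 * rho) c -> dist (f c) c <= m].

Lemma near_id_inj c0 (rho m : R) f c c' : near_id c0 rho m f -> nball c0 (2 * rho) c -> nball c0 (2 * rho) c' -> f c = f c' -> c = c'.
Proof.
move=> [rho0 m0 hm m8 [nf hf]] hc hc' e; have [h1 h2] := near_id_lip rho0 m0 hm nf hf hc' hc.
rewrite e in h1 h2.
have d : dist c c' <= 1 / 2 * dist c c'.
  apply: dist_pair_le; rewrite -nmN.
    by apply: le_trans h1; rewrite -subr_ge0 (_ : _ - _ = 0) //; apply/eqP; rewrite subr_eq0; apply/eqP; congr nm; ring.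
  by apply: le_trans h2; rewrite -subr_ge0 (_ : _ - _ = 0) //; apply/eqP; rewrite subr_eq0; apply/eqP; congr nm; ring.
have d0 := dist_ge0 c c'; apply: dist_eq0 => e' e'0.
by move: d d0 e'0; nlra.
Qed.

(** Picard iteration for [x = c - (f x - x)]. Each iterate is holomorphic in [c], so the inverse is
    holomorphic as a uniform limit. *)
Fixpoint approx_inv (f : X2 -> X2) n c : X2 := if n is n'.+1 then
  (c.1 - ((f (approx_inv f n' c)).1 - (approx_inv f n' c).1), c.2 - ((f (approx_inv f n' c)).2 - (approx_inv f n' c).2))
  else c.

Lemma approx_near c0 (rho m : R) f n c : near_id c0 rho m f -> nball c0 rho c -> dist (approx_inv f n c) c <= m /\ nball c0 (2 * rho) (approx_inv f n c).
Proof.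
move=> [rho0 m0 hm m8 [nf hf]] hc; have main x : dist x c <= m -> nball c0 (2 * rho) x.
  move=> h; rewrite nballE (le_lt_trans (dist_tri c _ _)) //.
  by move: hc h m8 rho0; rewrite nballE; nlra.
elim: n => [|n [IH1 IH2]]; first by rewrite /= distxx; split=> //; apply: main; rewrite distxx.
suff h : dist (approx_inv f n.+1 c) c <= m by split; [exact: h|exact: main].
have n8 : nball c0 (8 * rho) (approx_inv f n c).
  by move: IH2; rewrite !nballE => h; apply: lt_le_trans h _; rewrite ler_pM2r // ler_nat.
have h := hf _ n8.
apply: dist_pair_le => /=.
  by rewrite addrAC subrr add0r nmN; apply: le_trans h; exact: dist_fst.
by rewrite addrAC subrr add0r nmN; apply: le_trans h; exact: dist_snd.
Qed.

Lemma approx_step c0 (rho m : R) f n c : near_id c0 rho m f -> nball c0 rho c -> dist (approx_inv f n.+1 c) (approx_inv f n c) <= m * (1 / 2) ^+ n.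
Proof.
move=> H hc; have [rho0 m0 hm m8 [nf hf]] := H; elim: n => [|n IH].
  by rewrite expr0 mulr1; have [] := approx_near 1 H hc.
have [_ a1] := approx_near n H hc; have [_ a2] := approx_near n.+1 H hc.
have [h1 h2] := near_id_lip rho0 m0 hm nf hf a1 a2.
have e : m * (1 / 2) ^+ n.+1 = 1 / 2 * (m * (1 / 2) ^+ n) by rewrite exprS; ring.
rewrite e; apply: (@le_trans _ _ (1 / 2 * dist (approx_inv f n.+1 c) (approx_inv f n c))); last by rewrite ler_wpM2l.
set x := approx_inv f n c in h1 h2 *; set y := approx_inv f n.+1 c in h1 h2 *.
have y1 : y.1 = c.1 - ((f x).1 - x.1) by [].
have y2 : y.2 = c.2 - ((f x).2 - x.2) by [].
apply: dist_pair_le => /=; rewrite -/y.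
  rewrite -nmN; have -> : - (c.1 - ((f y).1 - y.1) - y.1) = (f y).1 - y.1 - ((f x).1 - x.1).
    by rewrite {2}y1; ring.
  exact: h1.
rewrite -nmN; have -> : - (c.2 - ((f y).2 - y.2) - y.2) = (f y).2 - y.2 - ((f x).2 - x.2).
  by rewrite {2}y2; ring.
exact: h2.
Qed.

Lemma near_id_inverse c0 (rho m : R) f : near_id c0 rho m f -> exists th : X2 -> X2, nice (nball c0 (rho / 4)) th /\
  forall c, nball c0 rho c -> nball c0 (2 * rho) (th c) /\ f (th c) = c.
Proof.
move=> H; have [rho0 m0 hm m8 [nf hf]] := H.
have h2 n : (0 : R) < (1 / 2) ^+ n by rewrite exprn_gt0 // divr_gt0.
have cau c : nball c0 rho c -> forall n k, (n <= k)%N -> dist (approx_inv f k c) (approx_inv f n c) <= 2 * m * (1 / 2) ^+ n.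
  move=> hc n k /subnKC <-; set i := (k - n)%N.
  apply: (@le_trans _ _ (2 * m * ((1 / 2) ^+ n - (1 / 2) ^+ (n + i)))); last first.
    by rewrite ler_wpM2l ?mulr_ge0 // gerBl ltW.
  elim: i => [|i IH]; first by rewrite addn0 distxx subrr mulr0.
  rewrite addnS (le_trans (dist_tri (approx_inv f (n + i) c) _ _)) // (le_trans (lerD (approx_step _ H hc) IH)) //.
  rewrite le_eqVlt; apply/orP; left; apply/eqP; by rewrite exprS; field.
have /choice[th Hth] : forall c, exists l, nball c0 rho c -> forall n, dist (approx_inv f n c) l <= 2 * (2 * m * (1 / 2) ^+ n).
  move=> c; case: (pselect (nball c0 rho c)) => [hc|no]; last by exists 0.
  by have [l Hl] := pair_cauchy (cau c hc); exists l.
have small e : 0 < e -> exists n, 2 * (2 * m * (1 / 2) ^+ n) < e.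
  move=> e0; have q : 0 < (4 * m + 1) / e by rewrite divr_gt0 // ltr_wpDl // mulr_ge0.
  exists (Num.trunc ((4 * m + 1) / e)).+1; set k := (Num.trunc _).+1.
  have k1 : (4 * m + 1) / e < k%:R by exact: truncnS_gt.
  have k2 : k%:R <= 2 ^+ k :> R by rewrite -natrX ler_nat ltnW // ltn_expl.
  rewrite div1r exprVn; have p2 : (0 : R) < 2 ^+ k by rewrite exprn_gt0.
  have -> : 2 * (2 * m / 2 ^+ k) = 4 * m / 2 ^+ k by ring.
  rewrite ltr_pdivrMr //; rewrite ltr_pdivrMr // in k1.
  have := ler_wpM2l (ltW e0) k2; move: k1; rewrite [_ * e]mulrC.
  by move: (2 ^+ k) (k%:R); clear => a b h1 h2; move: (e * b) (e * a) h1 h2 => x y; lra.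
have near c : nball c0 rho c -> nball c0 (2 * rho) (th c).
  move=> hc; rewrite nballE (le_lt_trans (dist_tri c _ _)) //.
  have := Hth c hc 0%N; rewrite expr0 mulr1 /= distC; move: hc m8 rho0; rewrite nballE; nlra.
have nth n : nice (nball c0 rho) (approx_inv f n).
  elim: n => [|n IH]; first exact: nice_id.
  have nfn : nice (nball c0 rho) (fun c => f (approx_inv f n c)).
    apply: nice_comp IH nf _ => c /(approx_near n H)[_].
    by rewrite !nballE => h; apply: lt_le_trans h _; rewrite ler_pM2r // ler_nat.
  have i1 := nice_fstE IH; have i2 := nice_sndE IH; have j1 := nice_fstE nfn; have j2 := nice_sndE nfn.
  by apply: nice_pair; [exact: niceB (nice_fst _ _) (niceB j1 i1)|exact: niceB (nice_snd _ _) (niceB j2 i2)].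
exists th; split.
  apply: (nice_eq (f := fun c => ((th c).1, (th c).2))) => [v _|]; first by rewrite -surjective_pairing.
  have mono n k : (n <= k)%N -> 2 * (2 * m * (1 / 2) ^+ k) <= 2 * (2 * m * (1 / 2) ^+ n).
    by move=> nk; rewrite !ler_wpM2l ?mulr_ge0 // ler_wiXn2l //; lra.
  apply: nice_pair.
    apply: (@nice_lim _ _ _ _ (fun n v => (approx_inv f n v).1 : C) _ (fun n => 2 * (2 * m * (1 / 2) ^+ n))) => //.
      by move=> n; exact: nice_fstE.
    by move=> n c hc; apply: le_trans (Hth c hc n); exact: dist_fst.
  apply: (@nice_lim _ _ _ _ (fun n v => (approx_inv f n v).2 : C) _ (fun n => 2 * (2 * m * (1 / 2) ^+ n))) => //.
    by move=> n; exact: nice_sndE.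
  by move=> n c hc; apply: le_trans (Hth c hc n); exact: dist_snd.
move=> c hc; split; first exact: near.
have [L L0 HL] := nice_dist nf.
have in8 x : nball c0 (2 * rho) x -> nball c0 (8 * rho) x.
  by rewrite !nballE => h; apply: lt_le_trans h _; rewrite ler_pM2r // ler_nat.
apply: dist_eq0 => e e0; have e1 : 0 < e / (L + 2) by rewrite divr_gt0 // addr_gt0.
have [n Hn] := small _ e1; have [_ an] := approx_near n H hc.
have st := approx_step n H hc; have hn := Hth c hc n.
have l1 : dist (f (th c)) (f (approx_inv f n c)) <= L * dist (th c) (approx_inv f n c).
  exact: HL (in8 _ an) (in8 _ (near c hc)).
have l2 : dist (f (approx_inv f n c)) c <= m * (1 / 2) ^+ n.
  apply: le_trans st; set x := approx_inv f n c; set y := approx_inv f n.+1 c.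
  have y1 : y.1 = c.1 - ((f x).1 - x.1) by [].
  have y2 : y.2 = c.2 - ((f x).2 - x.2) by [].
  apply: dist_pair_le; rewrite -nmN.
    have -> : - ((f x).1 - c.1) = y.1 - x.1 by rewrite y1; ring.
    exact: dist_fst.
  have -> : - ((f x).2 - c.2) = y.2 - x.2 by rewrite y2; ring.
  exact: dist_snd.
rewrite (le_trans (dist_tri (f (approx_inv f n c)) _ _)) // (le_trans (lerD l1 l2)) //.
move: Hn; rewrite ltr_pdivlMr ?addr_gt0 // => Hn; rewrite distC in hn.
have := ler_wpM2l (ltW L0) hn; have := h2 n; have := ltW L0.
move: (dist _ _) ((1 / 2) ^+ n) hn Hn m0 e0; clear => a b; nra.
Qed.

End LocalInverse.

(** * Injectivity and surjectivity of the limit coordinates *)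

Section Chart.
Context {R : realType} (j : nat).
Local Notation C := (R[i]^o).
Local Notation X2 := (C * C)%type.
Local Notation J := j.+1.
Implicit Types (p c : X2) (n N : nat).
Local Notation Gu := (@Gu R j).
Local Notation G := (@G R j : X2 -> X2).
Local Notation Gi := (@Ginv R j : X2 -> X2).
Local Notation pw := (@pw R j).
Local Notation wreg := (@wreg R j).
Local Notation phi := (@phi R j).
Local Notation rate := (@rate R j).
Local Notation target := (@target R j).
Local Notation attr := (@attr R j).
Local Notation basin := (@basin R j).
Local Notation Phi := (@Phi R j).

Lemma iter_GK N p : iter N G (iter N Gi p) = p.
Proof. by elim: N p => // N IH p; rewrite iterSr (iterS N Gi) GinvK IH. Qed.

Lemma iter_GiK N p : iter N Gi (iter N G p) = p.
Proof. by elim: N p => // N IH p; rewrite iterSr (iterS N G) GK IH. Qed.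

(** The inverse of [phi N]: [u = 1 / (c.1 + N)], [y = c.2 N^(-beta)], and [x = u / y^j]. *)
Definition chart N c : X2 := ((c.1 + N%:R)^-1 / (c.2 * (pw N (- 40))%:C%C) ^+ j, c.2 * (pw N (- 40))%:C%C).

Lemma pwC N a b : (pw N a)%:C%C * (pw N b)%:C%C = (pw N (a + b))%:C%C :> R[i].
Proof. by rewrite -rmorphM pwD. Qed.

Lemma pw_neq0 N a : (pw N a)%:C%C != 0 :> R[i].
Proof. by rewrite -nm_gt0 nm_real ger0_norm ?pw_ge0 // pw_gt0. Qed.

Lemma yj_neq0 N c : target c -> (c.2 * (pw N (- 40))%:C%C) ^+ j != 0.
Proof.
move=> tc; case: (posnP j) => [->|jp]; first by rewrite expr0 oner_neq0.
by rewrite expf_neq0 // mulf_neq0 ?tc ?pw_neq0.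
Qed.

Lemma phi_chart N c : target c -> c.1 + N%:R != 0 -> phi N (chart N c) = c.
Proof.
move=> tc c1; rewrite phiE /chart /Gu /= divfK ?yj_neq0 // invrK addrK.
by rewrite -mulrA pwC pw0 rmorph1 mulr1 -surjective_pairing.
Qed.

Lemma chart_phi N p : Gu p != 0 -> chart N (phi N p) = p.
Proof.
move=> u0; rewrite phiE /chart /= -mulrA pwC pw0 rmorph1 mulr1 subrK invrK /Gu mulfK.
  by rewrite -surjective_pairing.
by move: u0; rewrite /Gu mulf_eq0 negb_or => /andP[].
Qed.

Lemma phi_chart_near c0 : target c0 -> exists2 r : R, 0 < r & exists2 N1, (0 < N1)%N & forall N, (N1 <= N)%N ->
  nice (nball c0 r) (chart N) /\ forall c, nball c0 r c -> [/\ target c, (chart N c).1 != 0 & phi N (chart N c) = c].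
Proof.
move=> t0; have [r r0 [M M1 HM]] := bounded_ball t0.
have [N1 HN1] : exists N1, M + 1 <= N1%:R by exists (Num.trunc (M + 1)).+1; exact/ltW/truncnS_gt.
exists r => //; exists N1.+1 => // N NN.
have NM : M + 1 <= N%:R by apply: le_trans HN1 _; rewrite ler_nat ltnW.
have low c : nball c0 r c -> 1 <= nm (c.1 + N%:R : R[i]).
  move=> /HM[h _ _]; have := nm_dist (N%:R : R[i]) (- c.1).
  by rewrite nmN nm_nat opprK (addrC _ c.1); move: h NM; nlra.
have tg c : nball c0 r c -> target c.
  by move=> /HM[_ _ h] jp; rewrite -nm_gt0; apply: lt_le_trans (h jp); rewrite invr_gt0; apply: lt_le_trans M1.
have c10 c : nball c0 r c -> c.1 + N%:R != 0 by move=> /low h; rewrite -nm_gt0; apply: lt_le_trans h.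
split=> [|c hc]; last first.
  split; [exact: tg| |exact: phi_chart (tg c hc) (c10 c hc)].
  by rewrite /chart /= mulf_neq0 ?invr_neq0 ?c10 // yj_neq0 //; exact: tg.
set P := pw N (- 40); have P0 : 0 < P := @pw_gt0 R j N (- 40).
have n2 : nice (nball c0 r) (fun c => c.2 * P%:C%C : C) by exact: niceM (nice_snd _ _) (nice_cst _ (P%:C%C : C)).
apply: (nice_pair _ n2); apply: niceM.
  apply: (@nice_inv _ _ _ _ 1) => //.
  exact: niceD (nice_fst _ _) (nice_cst _ (N%:R : C)).
have q0 : 0 < M^-1 * P by rewrite mulr_gt0 // invr_gt0; apply: lt_le_trans M1.
apply: (@nice_inv _ _ _ _ ((M^-1 * P) ^+ j)); [by rewrite exprn_gt0| |exact: niceX n2].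
move=> c /HM[_ _ h]; case: (posnP j) => [->|jp]; first by rewrite !expr0 nm1.
rewrite nmX lerXn2r ?nnegrE ?(ltW q0) ?nm_ge0 // nmM nm_real ger0_norm ?(ltW P0) //.
by rewrite ler_wpM2r ?h ?(ltW P0).
Qed.

Lemma Phi_iter_Gi N q c (K : R) : 0 <= K -> target c ->
  (forall i, dist (phi (N + i) (iter i G q)) c <= K * rate (N + i)) ->
  attr (iter N Gi q) c /\ Phi (iter N Gi q) = c.
Proof.
move=> K0 tc H; have a : attr (iter N Gi q) c by apply: (attr_rate (N := N) K0) => i; rewrite iter_GK.
by split=> //; exact: PhiE.
Qed.

(** From time [N] on, the coordinates move by at most [K rate N] in total. Read in the chart of a
    large time [N], [Phi] is therefore close to the identity on a ball whose radius does not depend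
    on [N]. *)
Lemma chart_near_id c0 : target c0 -> exists2 rho : R, 0 < rho & exists2 m : R, 0 <= m &
  exists2 N1, (0 < N1)%N & forall N, (N1 <= N)%N ->
  [/\ near_id c0 rho m (fun c => Phi (iter N Gi (chart N c))), nice (nball c0 (8 * rho)) (chart N) &
      forall c, nball c0 (8 * rho) c -> basin (iter N Gi (chart N c))].
Proof.
move=> t0; have [r1 r10 [N1 N10 HN1]] := phi_chart_near t0.
have [r r0 [N0 N00 [K K0 [_ [Ht Hn]]]]] := trap_limit t0.
pose d := Num.min r1 r; have d0 : 0 < d by rewrite lt_min r10.
have dr1 : d <= r1 by rewrite ge_min lexx.
have dr : d <= r by rewrite ge_min lexx orbT.
pose rho := d / 32; have rho0 : 0 < rho by rewrite divr_gt0.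
have rE : 8 * rho = d / 4 by rewrite /rho; field.
pose A := 1 + 1 / rho + 1 / rho ^+ 2.
have A1 : 1 <= A.
  by rewrite /A -addrA lerDl addr_ge0 // divr_ge0 ?exprn_ge0 ?(ltW rho0).
have A0 : 0 < A := lt_le_trans ltr01 A1.
pose m := Num.min (1 / 2 / A) (rho / 8).
have m0 : 0 < m by rewrite lt_min !divr_gt0.
have mA : m * A <= 1 / 2 by rewrite -ler_pdivlMr // ge_min lexx.
have m8 : m <= rho / 8 by rewrite ge_min lexx orbT.
have [N2 N20 HN2] := @rate_lim R j K m K0 m0.
exists rho => //; exists m; first exact: ltW.
exists (maxn N0 (maxn N1 N2)); first by rewrite leq_max N00.
move=> N; rewrite !geq_max => /and3P[NN0 NN1 NN2].
have [nc Hc] := HN1 N NN1.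
have Hl c : nball c0 d c -> exists c', [/\ target c', basin (iter N Gi (chart N c)), Phi (iter N Gi (chart N c)) = c' &
    forall i, dist (phi (N + i) (iter i G (chart N c))) c' <= K * rate (N + i)].
  move=> hc; have hc1 : nball c0 r1 c by exact: lt_le_trans hc dr1.
  have [tc x0 pc] := Hc c hc1.
  have nr : nball c0 r (phi N (chart N c)) by rewrite pc; exact: lt_le_trans hc dr.
  have [c' [tc' _ h]] := Ht N (chart N c) NN0 x0 nr.
  have [h1 h2] := Phi_iter_Gi K0 tc' h.
  by exists c'; split=> //; exists c'.
have sub c : nball c0 (8 * rho) c -> nball c0 d c.
  rewrite rE !nballE => h; apply: lt_le_trans h _.
  by move: d0; clear; lra.
split; first split=> //; first exact: ltW.
- split=> [|c hc].
    rewrite rE; apply: (Hn _ c0 d (chart N) _ N d0 NN0).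
    + by apply: nice_sub nc => c hc; exact: lt_le_trans hc dr1.
    + move=> c hc; have hc1 : nball c0 r1 c by exact: lt_le_trans hc dr1.
      by have [_ x0 ->] := Hc c hc1; split=> //; exact: lt_le_trans hc dr.
    + by move=> c hc i; have [c' [_ _ -> h]] := Hl c hc; exact: h.
  have [c' [_ _ -> /(_ 0%N)]] := Hl c (sub c hc); rewrite addn0 /=.
  have [_ _ ->] : [/\ target c, (chart N c).1 != 0 & phi N (chart N c) = c].
    by apply: Hc; exact: lt_le_trans (sub c hc) dr1.
  by rewrite distC => h; apply: le_trans h _; apply: ltW; exact: HN2.
- by apply: nice_sub nc => c /sub hc; exact: lt_le_trans hc dr1.
- by move=> c /sub hc; have [c' []] := Hl c hc.
Qed.

(** At a large common time both orbits have coordinates in a ball where [Phi] is a perturbation of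
    the identity; there equal limits force equal points, and [iter N G] is injective. *)
Lemma Phi_inj p p' : basin p -> basin p' -> Phi p = Phi p' -> p = p'.
Proof.
move=> b b' e; have [t0 a] := PhiP b; have [_ a'] := PhiP b'; rewrite -e in a'.
have [rho rho0 [m m0 [N1 N10 HN1]]] := chart_near_id t0.
have r2 : 0 < 2 * rho by rewrite mulr_gt0.
have [N2 HN2] := a _ r2; have [N3 HN3] := a' _ r2.
have [d d0 [M1 M10 [K K0 [_ Hb]]]] := basin_nbhd b; have [d' d0' [M1' M10' [K' K0' [_ Hb']]]] := basin_nbhd b'.
have [N [NN1 NN2 NN3 NN4 NN5]] : exists N, [/\ (N1 <= N)%N, (N2 <= N)%N, (N3 <= N)%N, (M1 <= N)%N & (M1' <= N)%N].
  by exists (N1 + N2 + N3 + M1 + M1')%N; split; clear; lia.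
have [H _ _] := HN1 N NN1.
have u0 : Gu (iter N G p) != 0.
  by have [_ h _] := Hb p (nball0 p d0); have [] := wreg_u (leq_trans M10 NN4) (h N NN4).
have u0' : Gu (iter N G p') != 0.
  by have [_ h _] := Hb' p' (nball0 p' d0'); have [] := wreg_u (leq_trans M10' NN5) (h N NN5).
have cp := chart_phi N u0; have cp' := chart_phi N u0'.
have E : phi N (iter N G p) = phi N (iter N G p').
  apply: (near_id_inj H); [exact: HN2|exact: HN3|].
  by rewrite cp cp' (iter_GiK N p) (iter_GiK N p').
by rewrite -(iter_GiK N p) -cp E cp' (iter_GiK N p').
Qed.

(** Invert the near-identity map in the chart of time [N] and go back by [N] steps of the inverse
    automorphism. The regularity of the section [Psi] makes the global inverse of [Phi]
    holomorphic. *)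
Lemma Phi_surj c0 : target c0 -> exists2 d : R, 0 < d & exists2 Psi : X2 -> X2, nice (nball c0 d) Psi &
  forall c, nball c0 d c -> basin (Psi c) /\ Phi (Psi c) = c.
Proof.
move=> t0; have [rho rho0 [m m0 [N N0 HN]]] := chart_near_id t0.
have [H nc Hb] := HN N (leqnn N); have [th [nth Hth]] := near_id_inverse H.
have s1 c : nball c0 (rho / 4) c -> nball c0 rho c.
  by rewrite !nballE => h; apply: lt_le_trans h _; move: rho0; clear; lra.
have s8 c : nball c0 (2 * rho) c -> nball c0 (8 * rho) c.
  by rewrite !nballE => h; apply: lt_le_trans h _; move: rho0; clear; lra.
exists (rho / 4); first by rewrite divr_gt0.
exists (fun c => iter N Gi (chart N (th c))).
  have n1 : nice (nball c0 (rho / 4)) (chart N \o th).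
    by apply: nice_comp nth nc _ => c /s1 /Hth[/s8].
  exact: (nice_entire n1 (entire_iter N (@Ginv_entire R j))).
by move=> c /s1 /Hth[/s8 h1 h2]; split; [exact: Hb|exact: h2].
Qed.

End Chart.

(** * The logarithm of the first coordinate *)

Section LogLimit.
Context {R : realType}.
Implicit Types (a b z : R[i]).

Lemma powB_le a b (M : R) n : 1 <= M -> nm a <= M -> nm b <= M -> nm (a ^+ n - b ^+ n) <= n%:R * M ^+ n * nm (a - b).
Proof.
move=> M1 aM bM; have M0 : 0 <= M := le_trans ler01 M1.
elim: n => [|n IH]; first by rewrite subrr nm0 !mul0r.
have -> : a ^+ n.+1 - b ^+ n.+1 = a * (a ^+ n - b ^+ n) + (a - b) * b ^+ n by rewrite !exprS; ring.
rewrite (le_trans (nmD _ _)) // !nmM.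
have h1 := ler_pM (nm_ge0 _) (nm_ge0 _) aM IH.
have bn : nm (b ^+ n) <= M ^+ n.+1.
  rewrite nmX (le_trans (_ : _ <= M ^+ n)) ?lerXn2r ?nnegrE ?nm_ge0 //.
  by rewrite exprS ler_peMl // exprn_ge0.
have h2 := ler_wpM2l (nm_ge0 (a - b)) bn.
rewrite (le_trans (lerD h1 h2)) // -natr1 exprS le_eqVlt; apply/orP; left; apply/eqP; ring.
Qed.

Lemma log_near1 z : nm z <= 1 / 24 -> nm z <= 2 * nm (cexp z - 1).
Proof.
move=> z1; have z0 := nm_ge0 z.
have h := cexp_sub1_le (_ : nm z <= 1 / 2).
have {}h : nm (cexp z - 1 - z) <= 12 * nm z ^+ 2 by apply: h; lra.
have h2 : nm z <= nm (cexp z - 1) + nm (cexp z - 1 - z).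
  by have := nm_sub (cexp z - 1) (cexp z - 1 - z); rewrite (_ : cexp z - 1 - (cexp z - 1 - z) = z) //; ring.
by move: (nm z) (nm (cexp z - 1)) (nm (cexp z - 1 - z)) h h2 z0 z1; clear => a b c; nra.
Qed.

(** That [e^(w m - w n)] is close to 1 determines [w m - w n] only modulo [2 pi i]. Increments of at
    most [1/48] exclude jumps: [1/48 + 1/48 = 1/24] is the range of [log_near1], which then restores
    the bound [2 dl n]. *)
Lemma log_cauchy (w : nat -> R[i]) N (dl : nat -> R) :
  (forall n m, (N <= n)%N -> (n <= m)%N -> nm (cexp (w m - w n) - 1) <= dl n) ->
  (forall n, (N <= n)%N -> dl n <= 1 / 96) ->
  (forall n, (N <= n)%N -> nm (w n.+1 - w n) <= 1 / 48) ->
  forall n m, (N <= n)%N -> (n <= m)%N -> nm (w m - w n) <= 2 * dl n.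
Proof.
move=> H1 H2 H3 n m Nn /subnKC <-; elim: (m - n)%N => [|i IH].
  have := H1 n n Nn (leqnn n); rewrite addn0 !subrr cexp0 subrr nm0; lra.
have h1 := H2 n Nn; have h2 := H3 (n + i)%N (leq_trans Nn (leq_addr _ _)).
have h3 := nm_tri (w (n + i)%N) (w (n + i.+1)%N) (w n); rewrite addnS in h3 *.
have z1 : nm (w (n + i).+1 - w n) <= 1 / 24.
  by move: IH h1 h2 h3; nlra.
rewrite (le_trans (log_near1 z1)) // ler_wpM2l // -addnS H1 //; exact: leq_addr.
Qed.

Definition climit (u : nat -> R[i]) z := forall e : R, 0 < e -> exists N, forall n, (N <= n)%N -> nm (u n - z) < e.

Lemma climit_uniq u z z' : climit u z -> climit u z' -> z = z'.
Proof.
move=> H H'; apply/eqP; rewrite -subr_eq0 -nm_eq0; apply/eqP/le_anti; rewrite nm_ge0 andbT.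
apply/ler_addgt0Pl => e e0; rewrite addr0; have e2 : 0 < e / 2 by rewrite divr_gt0.
have [N HN] := H _ e2; have [N' HN'] := H' _ e2.
have := HN (N + N')%N (leq_addr _ _); have := HN' (N + N')%N (leq_addl _ _).
by have := nm_tri (u (N + N')%N) z z'; rewrite (nmB z (u _)); nlra.
Qed.

Lemma climit_bound u z N (T : nat -> R) : (forall n, (N <= n)%N -> nm (u n - z) <= T n) ->
  (forall e, 0 < e -> exists N, forall n, (N <= n)%N -> T n < e) -> climit u z.
Proof.
move=> H1 H2 e e0; have [N2 HN2] := H2 e e0; exists (N + N2)%N => n Nn.
by rewrite (le_lt_trans (H1 n _)) ?HN2 //; lia.
Qed.

Lemma climit_cst z : climit (fun=> z) z.
Proof. by move=> e e0; exists 0%N => n _; rewrite subrr nm0. Qed.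

Lemma climit_ext u v z N : climit u z -> (forall n, (N <= n)%N -> u n = v n) -> climit v z.
Proof. by move=> H E e e0; have [M HM] := H e e0; exists (N + M)%N => n Nn; rewrite -E ?HM //; lia. Qed.

Lemma climitD u v z z' : climit u z -> climit v z' -> climit (fun n => u n + v n) (z + z').
Proof.
move=> H H' e e0; have e2 : 0 < e / 2 by rewrite divr_gt0.
have [N HN] := H _ e2; have [N' HN'] := H' _ e2; exists (N + N')%N => n Nn.
have h1 := HN n ltac:(lia); have h2 := HN' n ltac:(lia).
rewrite opprD addrACA; have := nmD (u n - z) (v n - z'); move: h1 h2; nlra.
Qed.

Lemma climitM u v z z' : climit u z -> climit v z' -> climit (fun n => u n * v n) (z * z').
Proof.
move=> H H' e e0; pose M := nm z + nm z' + 1.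
have z0 := nm_ge0 z; have z0' := nm_ge0 z'.
have M0 : 0 < M by rewrite /M; lra.
have q0 : 0 < Num.min 1 (e / (2 * M)) by rewrite lt_min ltr01 divr_gt0 // mulr_gt0.
have [N HN] := H _ q0; have [N' HN'] := H' _ q0; exists (N + N')%N => n Nn.
have := HN n ltac:(lia); have := HN' n ltac:(lia); rewrite !lt_min => /andP[h1 h2] /andP[h3 h4].
rewrite ltr_pdivlMr ?mulr_gt0 // in h2; rewrite ltr_pdivlMr ?mulr_gt0 // in h4.
have -> : u n * v n - z * z' = (u n - z) * v n + z * (v n - z') by ring.
rewrite (le_lt_trans (nmD _ _)) // !nmM.
have v1 : nm (v n) <= M by have := nm_dist (v n) z'; move: h1; rewrite /M; move: z0; nlra.
have zM : nm z <= M by rewrite /M; move: z0'; clear; lra.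
have a0 := nm_ge0 (u n - z); have b0 := nm_ge0 (v n - z').
have t1 := ler_wpM2l a0 v1; have t2 := ler_wpM2r b0 zM.
move: t1 t2 h2 h4; move: (nm (u n - z)) (nm (v n - z')) => a b; clear; nra.
Qed.

Lemma climit_exp u z : climit u z -> climit (fun n => cexp (u n)) (cexp z).
Proof.
move=> H e e0; pose q := Num.min (1 / 2) (e / (7 * nm (cexp z) + 1)).
have c0 := nm_ge0 (cexp z).
have d0 : 0 < 7 * nm (cexp z) + 1 by lra.
have q0 : 0 < q by rewrite lt_min !divr_gt0.
have [N HN] := H _ q0; exists N => n /HN; rewrite lt_min => /andP[h1 h2].
have -> : cexp (u n) - cexp z = cexp z * (cexp (u n - z) - 1) by rewrite mulrBr mulr1 -cexpD (addrC z) subrK.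
rewrite nmM; have h := cexp_lip (ltW h1); rewrite ltr_pdivlMr // in h2.
apply: (@le_lt_trans _ _ (nm (cexp z) * (7 * nm (u n - z)))); first by rewrite ler_wpM2l.
have := nm_ge0 (u n - z); move: h2; move: (nm (cexp z)) (nm (u n - z)) c0 => a b; clear; nra.
Qed.

Lemma climitV u z : z != 0 -> climit u z -> climit (fun n => (u n)^-1) z^-1.
Proof.
move=> z0 H e e0; have zp : 0 < nm z by rewrite nm_gt0.
have q0 : 0 < Num.min (nm z / 2) (e * (nm z * nm z) / 2) by rewrite lt_min !divr_gt0 // !mulr_gt0.
have [N HN] := H _ q0; exists N => n /HN; rewrite lt_min => /andP[h1 h2].
have lo : nm z / 2 < nm (u n) by have := nm_dist z (u n); rewrite nmB; move: h1; nlra.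
have up : 0 < nm (u n) by apply: lt_trans lo; rewrite divr_gt0.
have u0 : u n != 0 by rewrite -nm_gt0.
have -> : (u n)^-1 - z^-1 = - (u n - z) / (u n * z) by field; rewrite u0 z0.
rewrite nmM nmN nmV nmM ltr_pdivrMr ?mulr_gt0 //.
apply: (lt_le_trans h2); rewrite -mulrA ler_wpM2l ?(ltW e0) //.
by move: lo zp; move: (nm z) (nm (u n)) => a b; clear; nra.
Qed.

End LogLimit.

(** * Asymptotics of the logarithm of [x_n] *)

Section Lambda.
Context {R : realType} (j : nat).
Local Notation C := (R[i]^o).
Local Notation X2 := (C * C)%type.
Local Notation J := j.+1.
Implicit Types (p c : X2) (n N : nat).
Local Notation Gu := (@Gu R j).
Local Notation G := (@G R j : X2 -> X2).
Local Notation pw := (@pw R j).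
Local Notation wreg := (@wreg R j).
Local Notation phi := (@phi R j).
Local Notation rate := (@rate R j).
Local Notation target := (@target R j).
Local Notation basin := (@basin R j).
Local Notation Phi := (@Phi R j).
Local Notation Alog := (@Alog R j).

(** An entire choice of the logarithm of [x_n / x_0]. *)
Definition Slog n p : R[i] := \sum_(i < n) Alog (iter i G p).

Lemma SlogS n p : Slog n.+1 p = Slog n p + Alog (iter n G p).
Proof. by rewrite /Slog big_ord_recr. Qed.

Lemma SlogSr n p : Slog n.+1 p = Alog p + Slog n (G p).
Proof. by rewrite /Slog big_ord_recl; congr (_ + _); apply: eq_bigr => i _; rewrite -iterSr. Qed.

Lemma Slog_entire n : entire (Slog n : X2 -> C).
Proof.
elim: n => [|n IH] M.
  by apply: nice_eq (nice_cst _ (0 : C)) => v _; rewrite /Slog big_ord0.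
have nA : nice (nball (0 : X2) M) (Alog \o iter n G : X2 -> C).
  exact: entire_comp (entire_iter n (@G_entire R j)) (@Alog_entire R j) M.
by apply: nice_eq (niceD (IH M) nA) => v _; rewrite SlogS.
Qed.

Lemma iter_fst n p : (iter n G p).1 = p.1 * cexp (Slog n p).
Proof.
elim: n => [|n IH]; first by rewrite /Slog big_ord0 cexp0 mulr1.
by rewrite SlogS cexpD mulrA -IH /= (G_fst j (iter n G p)).
Qed.

(* [pw n zal] is [n ^ alpha] with [alpha = 1 - j beta]: along an orbit of the basin, [x_n] is of the order of
   [n ^ (- alpha)], and [wlog n] is the logarithm of [n ^ alpha x_n / x_0]. *)
Definition zal : int := (100 * J)%N%:Z - (40 * j)%N%:Z.
Definition lnal n : R := ln n%:R * (zal%:~R / (100 * J)%:R).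
Definition wlog n p : R[i] := Slog n p + (lnal n)%:C%C.

Lemma cexp_real (t : R) : cexp t%:C%C = (expR t)%:C%C.
Proof. by apply/eqP; rewrite eq_complex /cexp /= cos0 sin0 !mulr0 !mul0r !subr0 mulr1 addr0 !eqxx. Qed.

Lemma cexp_lnal n : cexp (lnal n)%:C%C = (pw n zal)%:C%C.
Proof. by rewrite cexp_real /lnal pwE. Qed.

(** This is [1 / (n^alpha x_n)], written through the coordinates [phi n] so that its limit
    [(Phi p).2 ^+ j] is visible. *)
Definition Zn n p : R[i] := (1 + (phi n (iter n G p)).1 / n%:R) * (phi n (iter n G p)).2 ^+ j.

Lemma cexp_wlog n p : (0 < n)%N -> Gu (iter n G p) != 0 -> p.1 != 0 -> cexp (wlog n p) = (p.1 * Zn n p)^-1 /\ Zn n p != 0.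
Proof.
move=> n0 u0 x0; rewrite /wlog cexpD cexp_lnal.
have nn : n%:R != 0 :> R[i] by rewrite pnatr_eq0 -lt0n.
set q := iter n G p; have q1 : q.1 = p.1 * cexp (Slog n p) := iter_fst n p.
have -> : cexp (Slog n p) = q.1 / p.1 by rewrite q1 mulrC mulKf.
have P40 := @pw_neq0 R j n 40.
have y0 : q.2 ^+ j != 0 by move: u0; rewrite /Gu mulf_eq0 negb_or => /andP[].
have qx0 : q.1 != 0 by move: u0; rewrite /Gu mulf_eq0 negb_or => /andP[].
have ZE : Zn n p = (pw n zal)%:C%C^-1 / q.1.
  rewrite /Zn -/q phiE /= exprMn.
  have -> : 1 + ((Gu q)^-1 - n%:R) / n%:R = (Gu q)^-1 / n%:R by field; rewrite u0 nn.
  have -> : (pw n zal)%:C%C = n%:R / (pw n 40)%:C%C ^+ j :> R[i].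
    rewrite -(rmorph_nat (real_complex R)) -rmorphXn -fmorphV -rmorphM; congr (_%:C)%C.
    by rewrite (@pwn R j) // pwX pwV pwD; congr pw; rewrite /zal; lia.
  rewrite /Gu; field.
  by rewrite qx0 y0 nn expf_neq0.
have z0 := @pw_neq0 R j n zal.
split; last by rewrite ZE mulf_neq0 ?invr_neq0.
by rewrite ZE; field; rewrite x0 qx0 z0.
Qed.

Lemma natV_rate n : (0 < n)%N -> n%:R^-1 <= rate n.
Proof. by move=> n0; rewrite (@pwnV R j) // pw_le //; clear; lia. Qed.

Lemma rate_le1 n : (0 < n)%N -> rate n <= 1.
Proof. by move=> n0; apply: pw_le1 => //; clear; lia. Qed.

Lemma Zn_near p0 : basin p0 -> exists2 d : R, 0 < d & exists2 N, (0 < N)%N & exists2 K : R, 0 <= K & exists2 b : R, 0 < b &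
  nice (nball p0 d) Phi /\ forall p, nball p0 d p -> [/\ basin p,
    forall n, (N <= n)%N -> wreg n (iter n G p),
    forall n, (N <= n)%N -> dist (phi n (iter n G p)) (Phi p) <= K * rate n,
    forall n, (N <= n)%N -> nm (Zn n p - (Phi p).2 ^+ j) <= K * rate n & b <= nm ((Phi p).2 ^+ j)].
Proof.
move=> b0; have [d d0 [N N0 [K K0 [nP HP]]]] := basin_nbhd b0.
have [M0 M00 HM0] := nice_bounded nP; have [L L0 HL] := nice_lip (nice_sndE nP).
pose M := M0 + K + 1; have M1 : 1 <= M by rewrite /M lerDr addr_ge0.
have [t0 _] := PhiP b0.
have [b [b00 [d1 [d10 [d1d Hb]]]]] : exists b : R, 0 < b /\ exists d1 : R, 0 < d1 /\ d1 <= d /\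
    forall p, nball p0 d1 p -> b <= nm ((Phi p).2 ^+ j).
  case: (posnP j) => [j0|jp].
    by exists 1; split=> //; exists d; split=> //; split=> // p _; rewrite j0 expr0 nm1.
  have y0 : 0 < nm ((Phi p0).2 : R[i]) by rewrite nm_gt0 t0.
  set y := nm _ in y0.
  exists ((y / 2) ^+ j); split; first by rewrite exprn_gt0 // divr_gt0.
  exists (Num.min d (y / 2 / L)); split; first by rewrite lt_min d0 !divr_gt0.
  split=> [|p]; first by rewrite ge_min lexx.
  rewrite nballE lt_min => /andP[pd pL]; rewrite ltr_pdivlMr // in pL.
  have h : nm ((Phi p).2 - (Phi p0).2 : R[i]) <= L * dist p p0 := HL p0 p (nball0 p0 d0) pd.
  have h2 : y - nm ((Phi p).2 : R[i]) <= nm ((Phi p).2 - (Phi p0).2 : R[i]).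
    exact: nm_distC.
  have y2 : 0 <= y / 2 by rewrite divr_ge0 // ltW.
  have h3 : y / 2 <= nm ((Phi p).2 : R[i]).
    by rewrite [L * _]mulrC in h; move: (le_trans h2 (le_trans h (ltW pL))); clear; lra.
  rewrite (nmX ((Phi p).2 : R[i]) j); apply: lerXn2r h3; rewrite nnegrE; [exact: y2|exact: nm_ge0].
exists d1 => //; exists N => //.
exists (K + (2 * j%:R * M ^+ j * K + M * M ^+ j)); first by rewrite !(addr_ge0, mulr_ge0, exprn_ge0) // (le_trans ler01).
have sub1 p : nball p0 d1 p -> nball p0 d p by move=> h; exact: lt_le_trans h d1d.
exists b; [exact: b00|split; first exact: nice_sub sub1 nP].
move=> p hp; have hpd : nball p0 d p by apply: lt_le_trans hp d1d.
have [bp wp rp] := HP p hpd.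
have Mj : 0 <= M ^+ j by rewrite exprn_ge0 // (le_trans ler01).
have M00' : 0 <= M := le_trans ler01 M1.
split=> //; last exact: Hb.
  move=> n Nn; apply: le_trans (rp n Nn) _; rewrite ler_wpM2r ?(ltW (rate_gt0 _ _)) //.
  by rewrite lerDl !(addr_ge0, mulr_ge0).
move=> n Nn; have n0 : (0 < n)%N := leq_trans N0 Nn; rewrite /Zn.
set f := phi n (iter n G p); have hf : dist f (Phi p) <= K * rate n := rp n Nn.
have r1 := rate_le1 n0; have r0 := ltW (@rate_gt0 R j n).
have PM : nm (Phi p) <= M0 := HM0 p hpd.
have PM1 : nm ((Phi p).1 : R[i]) <= M0 by apply: le_trans PM; rewrite {2}(surjective_pairing (Phi p)) nm_pair le_max lexx.
have PM2 : nm ((Phi p).2 : R[i]) <= M0 by apply: le_trans PM; rewrite {2}(surjective_pairing (Phi p)) nm_pair le_max lexx orbT.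
have Kr : K * rate n <= K by rewrite ler_piMr.
have fM1 : nm (f.1 : R[i]) <= M.
  by have := nm_dist (f.1 : R[i]) (Phi p).1; have := le_trans (dist_fst f (Phi p)) hf; rewrite /M; move: PM1 Kr; move: (K * rate n) => a; nlra.
have fM2 : nm (f.2 : R[i]) <= M.
  by have := nm_dist (f.2 : R[i]) (Phi p).2; have := le_trans (dist_snd f (Phi p)) hf; rewrite /M; move: PM2 Kr; move: (K * rate n) => a; nlra.
have PM2' : nm ((Phi p).2 : R[i]) <= M by apply: le_trans PM2 _; rewrite /M; move: K0; clear; lra.
have h1 := powB_le j M1 fM2 PM2'.
have h2 : nm (f.2 - (Phi p).2 : R[i]) <= K * rate n := le_trans (dist_snd f (Phi p)) hf.
have -> : (1 + f.1 / n%:R) * f.2 ^+ j - (Phi p).2 ^+ j = (f.2 ^+ j - (Phi p).2 ^+ j) + f.1 / n%:R * f.2 ^+ j by ring.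
rewrite (le_trans (nmD _ _)) // [nm (_ * f.2 ^+ j)]nmM [nm (f.1 / _)]nmM nmV nm_nat nmX.
have h3 : nm (f.1 : R[i]) / n%:R <= M * rate n.
  by apply: ler_pM; rewrite ?nm_ge0 ?invr_ge0 ?ler0n ?natV_rate.
have h4 : nm (f.2 : R[i]) ^+ j <= M ^+ j by rewrite lerXn2r ?nnegrE ?nm_ge0.
have h5 : nm (f.1 : R[i]) / n%:R * nm (f.2 : R[i]) ^+ j <= M * rate n * M ^+ j.
  by apply: ler_pM; rewrite ?mulr_ge0 ?exprn_ge0 ?nm_ge0 ?invr_ge0.
have h6 : j%:R * M ^+ j * nm (f.2 - (Phi p).2 : R[i]) <= j%:R * M ^+ j * (K * rate n).
  by rewrite ler_wpM2l // mulr_ge0.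
apply: (le_trans (lerD (le_trans h1 h6) h5)).
have a0 : 0 <= j%:R * M ^+ j * K by rewrite !mulr_ge0.
have b0' : 0 <= j%:R * M ^+ j * K * rate n by rewrite mulr_ge0.
have c0 : 0 <= K * rate n by rewrite mulr_ge0.
move: b0' c0; clear => b0' c0; rewrite -subr_ge0.
have -> : (K + (2 * j%:R * M ^+ j * K + M * M ^+ j)) * rate n - (j%:R * M ^+ j * (K * rate n) + M * rate n * M ^+ j) =
  K * rate n + j%:R * M ^+ j * K * rate n by ring.
exact: addr_ge0.
Qed.

Lemma lnal_diff n : (0 < n)%N -> `|lnal n.+1 - lnal n| <= pw n (- 1).
Proof.
move=> n0.
have nr : (0 : R) < n%:R by rewrite ltr0n.
have -> : lnal n.+1 - lnal n = (zal%:~R / (100 * J)%:R) * ln (1 + n%:R^-1).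
  have e1 : n.+1%:R = n%:R * (1 + n%:R^-1) :> R by rewrite -natr1 mulrDr mulr1 divff ?gt_eqF.
  have e2 : 0 < 1 + n%:R^-1 :> R by rewrite addr_gt0 // invr_gt0.
  by rewrite /lnal e1 lnM ?posrE //; ring.
have [t0 t1 /andP[l1 l2] _] := @natV_ln R n n0.
have J100 : (0 : R) < (100 * J)%:R by rewrite ltr0n.
have zal0 : 0 <= zal by rewrite /zal; clear; lia.
have zal1 : zal <= (100 * J)%N%:Z by rewrite /zal; clear; lia.
have z1 : (0 <= zal%:~R / (100 * J)%:R :> R) && (zal%:~R / (100 * J)%:R <= 1 :> R).
  by rewrite divr_ge0 ?ler0z ?(ltW J100) //= ler_pdivrMr // mul1r pmulrn ler_int.
have /andP[z0 z1'] := z1; have l0 : 0 <= ln (1 + n%:R^-1) :> R by apply: le_trans l1; rewrite divr_ge0 // ltW.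
have ni : (0 : R) <= n%:R^-1 by exact: ltW.
have le1 := le_trans (ler_piMl l0 z1') l2.
have le2 : n%:R^-1 <= pw n (- 1) by rewrite (@pwnV R j) // pw_le //; clear; lia.
by rewrite ger0_norm; [exact: le_trans le1 le2|exact: mulr_ge0].
Qed.

Lemma Alog_small (e : R) : 0 < e -> exists2 N, (0 < N)%N & forall n p, (N <= n)%N -> wreg n p ->
  nm (Alog p + (lnal n.+1 - lnal n)%:C%C) <= e.
Proof.
move=> e0; have [K K0 HK] := @O_Alog R j; have [N1 N10 HN1] := @wreg_small R j.
have [N2 [N20 HN2]] := @pw_large R j ((2 * K + 1) / e).
exists (maxn N1 N2); first by rewrite leq_max N10.
move=> n p; rewrite geq_max => /andP[NN1 NN2] w; have n0 : (0 < n)%N := leq_trans N10 NN1.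
have [sp _ r1] := HN1 n p NN1 w; have hx := wreg_x n0 w.
have al1 : nm (Alog p) <= K * (2 * pw n (- 58)).
  rewrite (le_trans (HK p sp)) // ler_wpM2l //.
  have := wt_le (i := 1) (k := j) (i' := 1) (k' := 0) sp isT ltac:(clear; lia) => h.
  apply: le_trans h _; rewrite /wt expr1 expr0 mulr1 (le_trans hx) // ler_wpM2l // pw_le //; clear; lia.
have ln1 := lnal_diff n0.
have p58 : pw n (- 58) <= pw n (- 1) by rewrite pw_le.
have p1 : (2 * K + 1) * pw n (- 1) <= e.
  have := HN2 n 1 NN2 (lexx _); rewrite ler_pdivrMr // -pwV ler_pdivrMr ?pw_gt0 //.
  by rewrite [pw n 1 * e]mulrC.
rewrite (le_trans (nmD _ _)) // nm_real; move: al1 ln1 (ler_wpM2l K0 p58) p1.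
by move: (nm (Alog p)) (pw n (- 1)) (pw n (- 58)) (`|_|) => a b c d; clear; nra.
Qed.

(** [Zn_near] makes the exponentials of [wlog n] converge at the speed [rate n], and the increments
    of [wlog n] are small by [Alog_small]; hence [log_cauchy] applies uniformly near [p0], and the
    limit is holomorphic. *)
Lemma wlog_near p0 : basin p0 -> exists2 d : R, 0 < d & exists2 N, (0 < N)%N & exists2 K : R, 0 <= K &
  exists2 F : X2 -> C, nice (nball p0 d) F & forall p, nball p0 d p -> forall n, (N <= n)%N -> nm (wlog n p - F p) <= K * rate n.
Proof.
move=> b0; have [d d0 [N N0 [K K0 [b b00 [nP HP]]]]] := Zn_near b0.
have e48 : (0 : R) < 1 / 48 by rewrite divr_gt0.
have [N1 N10 HN1] := Alog_small e48.
have q0 : 0 < b / 2 by rewrite divr_gt0.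
have [N2 N20 HN2] := @rate_lim R j K (b / 2) K0 q0.
have K40 : 0 <= 4 * K / b by rewrite !mulr_ge0 // invr_ge0 ltW.
have e96 : (0 : R) < 1 / 96 by rewrite divr_gt0.
have [N3 N30 HN3] := @rate_lim R j (4 * K / b) (1 / 96) K40 e96.
have [M [NM NM1 NM2 NM3]] : exists M, [/\ (N <= M)%N, (N1 <= M)%N, (N2 <= M)%N & (N3 <= M)%N].
  by exists (N + N1 + N2 + N3)%N; split; clear; lia.
have cau p : nball p0 d p -> forall n m, (M <= n)%N -> (n <= m)%N -> nm (wlog m p - wlog n p) <= 2 * (4 * K / b * rate n).
  move=> hp; have [bp wp rp zp lo] := HP p hp.
  have x0 := basin_neq0 bp.
  apply: (log_cauchy (N := M)) => n.
  - move=> m Mn nm_; have n0 : (0 < n)%N := leq_trans N0 (leq_trans NM Mn).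
    have Mm := leq_trans Mn nm_; have m0 := leq_trans n0 nm_.
    have [_ un _] := wreg_u n0 (wp n (leq_trans NM Mn)); have [_ um _] := wreg_u m0 (wp m (leq_trans NM Mm)).
    have [En Zn0] := cexp_wlog n0 un x0; have [Em Zm0] := cexp_wlog m0 um x0.
    have -> : cexp (wlog m p - wlog n p) - 1 = (Zn n p - Zn m p) / Zn m p.
      rewrite cexpD cexpN En Em invrK; field.
      by rewrite Zm0 x0.
    have hz1 := zp n (leq_trans NM Mn); have hz2 := zp m (leq_trans NM Mm).
    have rmn : rate m <= rate n by apply: rate_mono.
    have Krm : K * rate m <= K * rate n by rewrite ler_wpM2l.
    have Krn := HN2 n (leq_trans NM2 Mn).
    have Zlow : b / 2 <= nm (Zn m p).
      have := nm_dist ((Phi p).2 ^+ j : R[i]) (Zn m p); rewrite nmB => h.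
      by move: h hz2 Krm Krn lo; move: (K * rate m) (K * rate n) => x y; nlra.
    have Zp : 0 < nm (Zn m p) by rewrite nm_gt0.
    rewrite nmM nmV ler_pdivrMr //.
    have hh := nm_tri ((Phi p).2 ^+ j : R[i]) (Zn n p) (Zn m p); rewrite (nmB ((Phi p).2 ^+ j)) in hh.
    have l1 : nm (Zn n p - Zn m p) <= 2 * (K * rate n).
      by move: hh hz1 hz2 Krm; move: (K * rate m) (K * rate n) => x y; nlra.
    apply: (le_trans l1); have Kr0 : 0 <= K * rate n by rewrite mulr_ge0 // ltW ?rate_gt0.
    apply: (@le_trans _ _ (4 * K / b * rate n * (b / 2))); last first.
      by rewrite ler_wpM2l // mulr_ge0 // ltW ?rate_gt0.
    by rewrite le_eqVlt; apply/orP; left; apply/eqP; field; rewrite gt_eqF.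
  - by move=> Mn; apply: ltW; exact: HN3 _ (leq_trans NM3 Mn).
  - move=> Mn; have := HN1 n _ (leq_trans NM1 Mn) (wp n (leq_trans NM Mn)).
    have -> // : Alog (iter n G p) + (lnal n.+1 - lnal n)%:C%C = wlog n.+1 p - wlog n p.
    by rewrite /wlog SlogS rmorphB; ring.
have /choice[F HF] : forall p, exists l, nball p0 d p -> forall i, nm (wlog (M + i) p - l) <= 2 * (2 * (4 * K / b * rate (M + i))).
  move=> p; case: (pselect (nball p0 d p)) => [hp|no]; last by exists 0.
  have cp n m (h : (n <= m)%N) : nm (wlog (M + m) p - wlog (M + n) p) <= 2 * (4 * K / b * rate (M + n)).
    by apply: cau hp _ _ _ _; [exact: leq_addr|rewrite leq_add2l].
  by have [l Hl] := @complex_cauchy R (fun i => wlog (M + i) p) (fun i => 2 * (4 * K / b * rate (M + i))) cp; exists l.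
pose K' := 2 * (2 * (4 * K / b)); have K'0 : 0 <= K' by rewrite /K' mulr_ge0 // mulr_ge0.
have K'E n : 2 * (2 * (4 * K / b * rate n)) = K' * rate n by rewrite /K'; ring.
have M0 : (0 < M)%N := leq_trans N0 NM.
exists (d / 4); first by rewrite divr_gt0.
exists M => //; exists K' => //.
exists F => [|p hp n Mn].
  apply: (@nice_lim _ _ _ _ (fun i p => wlog (M + i) p : C) _ (fun i => K' * rate (M + i))) => //.
  - move=> i; apply: niceD; last exact: (nice_cst _ ((lnal (M + i))%:C%C : C)).
    exact: entire_nice (Slog_entire _).
  - by move=> n v hv; rewrite -K'E; exact: HF.
  - by move=> n m nm_; rewrite ler_wpM2l // rate_mono ?addn_gt0 ?M0 // leq_add2l.
  - move=> e ee0; have [N4 _ HN4] := @rate_lim R j K' e K'0 ee0; exists N4; exact: HN4 _ (leq_addl _ _).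
have hp' : nball p0 d p by apply: lt_le_trans hp _; move: d0; clear; lra.
by have := HF p hp' (n - M)%N; rewrite subnKC // K'E.
Qed.

Definition Lam p : R[i] := locked (xget 0 [set l | climit (fun n => wlog n p) l]).

Lemma LamE p l : climit (fun n => wlog n p) l -> Lam p = l.
Proof. by move=> H; rewrite /Lam -lock; case: xgetP => [d _ Hd|/(_ l)//]; exact: climit_uniq Hd H. Qed.

Lemma Lam_nice p0 : basin p0 -> exists2 d : R, 0 < d & nice (nball p0 d) (Lam : X2 -> C) /\
  forall p, nball p0 d p -> climit (fun n => wlog n p) (Lam p).
Proof.
move=> b0; have [d d0 [N N0 [K K0 [F nF HF]]]] := wlog_near b0.
have lim p : nball p0 d p -> climit (fun n => wlog n p) (F p).
  move=> hp; apply: climit_bound (HF p hp) _ => e e0.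
  by have [N1 _ H] := @rate_lim R j K e K0 e0; exists N1.
exists d => //; split=> [|p hp]; last by rewrite (LamE (lim p hp)); exact: lim.
by apply: nice_eq nF => p hp; rewrite (LamE (lim p hp)).
Qed.

Lemma LamP p : basin p -> climit (fun n => wlog n p) (Lam p).
Proof. by move=> /Lam_nice[d d0 [_ H]]; apply: H; exact: nball0. Qed.

Lemma cexp_Lam p : basin p -> cexp (Lam p) = (p.1 * (Phi p).2 ^+ j)^-1 /\ (Phi p).2 ^+ j != 0.
Proof.
move=> b; have x0 := basin_neq0 b.
have [d d0 [N N0 [K K0 [b' b0 [_ HP]]]]] := Zn_near b; have [_ wp _ zp lo] := HP p (nball0 p d0).
have y0 : (Phi p).2 ^+ j != 0 by rewrite -nm_gt0; exact: lt_le_trans lo.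
split=> //.
have limZ : climit (fun n => Zn n p) ((Phi p).2 ^+ j).
  by apply: climit_bound zp _ => e e0; have [N1 _ H] := @rate_lim R j K e K0 e0; exists N1.
have l1 := climitV (mulf_neq0 x0 y0) (climitM (climit_cst p.1) limZ).
apply: climit_uniq (climit_exp (LamP b)) _.
apply: (climit_ext (N := N) l1) => n Nn; have n0 := leq_trans N0 Nn.
have [_ un _] := wreg_u n0 (wp n Nn).
by have [-> _] := cexp_wlog n0 un x0.
Qed.

Lemma attr_climit p c : attr j p c <-> climit (fun n => (phi n (iter n G p)).1) c.1 /\ climit (fun n => (phi n (iter n G p)).2) c.2.
Proof.
split=> [H|[H1 H2] e e0].
  by split=> e /H[N HN]; exists N => n /HN; apply: le_lt_trans; [exact: dist_fst|exact: dist_snd].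
have [N1 HN1] := H1 e e0; have [N2 HN2] := H2 e e0; exists (N1 + N2)%N => n Nn.
by rewrite dist_pair gt_max HN1 ?HN2 //; lia.
Qed.

Lemma climit_shift (u : nat -> R[i]) z : climit u z <-> climit (fun n => u n.+1) z.
Proof.
split=> H e /H[N HN]; first by exists N => n Nn; apply: HN; exact: leq_trans Nn _.
by exists N.+1 => -[//|n]; exact: HN.
Qed.

Lemma pw40_ratio : climit (fun n => (pw n 40 / pw n.+1 40)%:C%C) 1.
Proof.
have [K K0 HK] := @pw40_succ R j; have [_ /andP[b0 b1]] := @cc_nm R j.
suff H : climit (fun n => (pw n.+1 40 / pw n 40)%:C%C : R[i]) 1.
  have := climitV (oner_neq0 _) H; rewrite invr1 => H'; apply: (climit_ext (N := 0%N) H') => n _.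
  by rewrite -fmorphV invfM invrK mulrC.
apply: (climit_bound (N := 1%N) (T := fun n => (K + 1) * rate n)) => [n n0|e e0]; last first.
  by have [N _ HN] := @rate_lim R j (K + 1) e (addr_ge0 K0 ler01) e0; exists N.
have [q -> [_ hq]] := HK n n0.
rewrite mulrC mulKf ?gt_eqF ?pw_gt0 // -(rmorph1 (real_complex R)) -rmorphB nm_real.
have r1 := @natV_rate n n0; have n1 : (n%:R^-1 : R) ^+ 2 <= n%:R^-1.
  by rewrite expr2 ler_piMl ?invr_ge0 // invf_le1 ?ler1n ?ltr0n.
have -> : q - 1 = (q - 1 - beta j / n%:R) + beta j / n%:R by ring.
rewrite (le_trans (ler_normD _ _)) // mulrDl mul1r lerD //.
  by rewrite (le_trans hq) // ler_wpM2l // (le_trans n1).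
have ni : (0 : R) <= n%:R^-1 by rewrite invr_ge0.
rewrite ger0_norm ?mulr_ge0 ?(ltW b0) // (le_trans _ r1) // ler_piMl //; move: b1; clear; lra.
Qed.

Lemma attr_G p c : attr j p c -> attr j (G p) (c.1 + 1, c.2).
Proof.
move=> /attr_climit[/climit_shift H1 /climit_shift H2]; apply/attr_climit; split=> /=.
  apply: (climit_ext (N := 0%N) (climitD H1 (climit_cst 1))) => n _.
  by rewrite !phiE -iterSr /= -(natr1 n); ring.
rewrite -[c.2]mulr1; apply: (climit_ext (N := 0%N) (climitM H2 pw40_ratio)) => n _.
by rewrite !phiE -iterSr /= -mulrA -rmorphM mulrCA divff ?gt_eqF ?pw_gt0 // mulr1.
Qed.

Lemma attr_Gi p c : attr j p c -> attr j (Ginv j p) (c.1 - 1, c.2).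
Proof.
move=> /attr_climit[H1 H2]; apply/attr_climit; split=> /=; apply/climit_shift.
  apply: (climit_ext (N := 0%N) (climitD H1 (climit_cst (- 1)))) => n _.
  by rewrite !phiE iterSr GinvK /= -(natr1 n); ring.
have H := climitV (oner_neq0 _) pw40_ratio; rewrite invr1 in H.
rewrite -[c.2]mulr1; apply: (climit_ext (N := 0%N) (climitM H2 H)) => n _.
rewrite !phiE iterSr GinvK /= -mulrA -fmorphV -rmorphM invfM invrK mulrCA.
by rewrite mulKf ?gt_eqF ?pw_gt0.
Qed.

Lemma basin_G p : basin p -> basin (G p) /\ Phi (G p) = ((Phi p).1 + 1, (Phi p).2).
Proof.
by move=> /PhiP[t a]; have a' := attr_G a; split; [exists ((Phi p).1 + 1, (Phi p).2)|exact: PhiE].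
Qed.

Lemma basin_Gi p : basin p -> basin (Ginv j p).
Proof. by move=> /PhiP[t a]; exists ((Phi p).1 - 1, (Phi p).2); [|exact: attr_Gi]. Qed.

(** [Slog] of the image point lacks the first summand [Alog p], and [ln (n + 1) - ln n] tends to
    0. *)
Lemma Lam_G p : basin p -> Lam (G p) = Lam p - Alog p.
Proof.
move=> b; apply: LamE; have H := LamP b; move/climit_shift in H.
have D : climit (fun n => (lnal n - lnal n.+1)%:C%C : R[i]) 0.
  apply: (climit_bound (N := 1%N) (T := fun n => pw n (- 1))) => [n n0|e e0].
    by rewrite subr0 nm_real -normrN opprB; exact: lnal_diff.
  have [N [N0 HN]] := @pw_large R j (e^-1 + 1); exists N => n Nn.
  rewrite -pwV -[e]invrK ltf_pV2 ?posrE ?invr_gt0 ?pw_gt0 //.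
  by apply: lt_le_trans (HN n 1 Nn (lexx _)); rewrite ltrDl.
have := climitD (climitD H (climit_cst (- Alog p))) D; rewrite addr0 => H'.
by apply: (climit_ext (N := 0%N) H') => n _; rewrite /wlog SlogSr rmorphB; ring.
Qed.

End Lambda.

(** * Recognizing the basin *)

Section Criterion.
Context {R : realType} (j : nat).
Local Notation C := (R[i]^o).
Local Notation X2 := (C * C)%type.
Local Notation J := j.+1.
Implicit Types (p c : X2) (n N : nat).
Local Notation Gu := (@Gu R j).
Local Notation G := (@G R j : X2 -> X2).
Local Notation pw := (@pw R j).
Local Notation wreg := (@wreg R j).
Local Notation phi := (@phi R j).
Local Notation rate := (@rate R j).
Local Notation target := (@target R j).
Local Notation basin := (@basin R j).
Local Notation Alog := (@Alog R j).

Lemma sum_rate (v : nat -> R[i]) (K : R) N : (0 < N)%N -> 0 <= K ->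
  (forall n, (N <= n)%N -> nm (v n.+1 - v n) <= K * pw n (- (110 * J)%N%:Z)) ->
  exists2 K' : R, 0 <= K' & forall n m, (N <= n)%N -> (n <= m)%N -> nm (v m - v n) <= K' * rate n.
Proof.
move=> N0 K0 H; have [C4 C40 tele] := @rate_tele R j.
exists (K * C4); first exact: mulr_ge0.
move=> n m Nn /subnKC <-; have n0 := leq_trans N0 Nn.
apply: (@le_trans _ _ (K * C4 * (rate n - rate (n + (m - n))))); last first.
  by rewrite ler_wpM2l ?mulr_ge0 // gerBl ltW ?rate_gt0.
elim: (m - n)%N => [|i IH]; first by rewrite addn0 !subrr nm0 mulr0.
have h1 := H (n + i)%N (leq_trans Nn (leq_addr _ _)).
have h2 := ler_wpM2l K0 (tele (n + i)%N (leq_trans n0 (leq_addr _ _))).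
rewrite addnS (le_trans (nm_tri (v (n + i)%N) _ _)) // (le_trans (lerD (le_trans h1 h2) IH)) //.
by rewrite mulrA -mulrDr addrC subrKA.
Qed.

(** Two rounds: [stepU] makes [1/u_n - n] bounded, thus below [n^(1/2)], and then [stepphi] makes
    the coordinates a Cauchy sequence. For [j > 0] the relative errors of the second coordinate show
    that its limit is not 0. *)
Lemma wreg_basin p N : (forall n, (N <= n)%N -> wreg n (iter n G p)) -> basin p.
Proof.
move=> w; have [N1 N10 [K1 K10 H1]] := @stepU R j; have [N2 N20 [K2 K20 H2]] := @stepk R j.
have [N3 N30 [K3 K30 H3]] := @stepphi R j.
have [M [MN M1 M2 M3]] : exists M, [/\ (N <= M)%N, (N1 <= M)%N, (N2 <= M)%N & (N3 <= M)%N].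
  by exists (N + N1 + N2 + N3)%N; split; clear; lia.
have M0 : (0 < M)%N := leq_trans N10 M1.
pose a n := (Gu (iter n G p))^-1 - n%:R : R[i].
have aS n : (M <= n)%N -> nm (a n.+1 - a n) <= K1 * pw n (- (110 * J)%N%:Z).
  move=> Mn; have := H1 n _ (leq_trans M1 Mn) (w n (leq_trans MN Mn)).
  have -> // : (Gu (G (iter n G p)))^-1 - (Gu (iter n G p))^-1 - 1 = a n.+1 - a n.
  by rewrite /a -(natr1 n) iterS; ring.
have [K' K'0 ca] := sum_rate M0 K10 aS.
have ab n : (M <= n)%N -> nm (a n) <= nm (a M) + K' * rate M.
  by move=> Mn; have := ca M n (leqnn M) Mn; have := nm_dist (a n) (a M); move: (K' * rate M) => x; nlra.
have [N4 [N40 H4]] := @pw_large R j (nm (a M) + K' * rate M).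
pose M' := (M + N4)%N.
have st n : (M' <= n)%N -> nm (a n) <= pw n (50 * J)%N.
  have z1 : (1 : int) <= (50 * J)%N by clear; lia.
  move=> Mn; apply: (le_trans (ab n _)); first exact: leq_trans (leq_addr _ _) Mn.
  exact: H4 _ _ (leq_trans (leq_addl _ _) Mn) z1.
have MM n : (M' <= n)%N -> (M <= n)%N by apply: leq_trans; exact: leq_addr.
have M'0 : (0 < M')%N by rewrite /M' addn_gt0 M0.
have phiS n : (M' <= n)%N -> dist (phi n.+1 (iter n.+1 G p)) (phi n (iter n G p)) <= K3 * pw n (- (110 * J)%N%:Z).
  move=> Mn; have Mn' := MM n Mn; apply: H3; [exact: leq_trans M3 Mn'|exact: w _ (leq_trans MN Mn')|exact: st].
have [C4 C40 tele] := @rate_tele R j.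
have cau n m : (M' <= n)%N -> (n <= m)%N -> dist (phi m (iter m G p)) (phi n (iter n G p)) <= K3 * C4 * rate n.
  move=> Mn nm_; have n0 := leq_trans M'0 Mn.
  have S1 := fun n Mn => le_trans (dist_fst _ _) (phiS n Mn); have S2 := fun n Mn => le_trans (dist_snd _ _) (phiS n Mn).
  rewrite -(subnKC nm_); apply: (@le_trans _ _ (K3 * C4 * (rate n - rate (n + (m - n))))); last first.
    by rewrite ler_wpM2l ?mulr_ge0 // gerBl ltW ?rate_gt0.
  elim: (m - n)%N => [|i IH]; first by rewrite addn0 distxx subrr mulr0.
  have h1 := phiS (n + i)%N (leq_trans Mn (leq_addr _ _)).
  have h2 := ler_wpM2l K30 (tele (n + i)%N (leq_trans n0 (leq_addr _ _))).
  rewrite addnS (le_trans (dist_tri (phi (n + i) (iter (n + i) G p)) _ _)) // (le_trans (lerD (le_trans h1 h2) IH)) //.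
  by rewrite mulrA -mulrDr addrC subrKA.
have cau0 n m : (n <= m)%N -> dist (phi (M' + m) (iter (M' + m) G p)) (phi (M' + n) (iter (M' + n) G p)) <= K3 * C4 * rate (M' + n).
  by move=> nm_; apply: cau; [exact: leq_addr|rewrite leq_add2l].
have [c Hc] := @pair_cauchy R (fun i => phi (M' + i) (iter (M' + i) G p)) (fun i => K3 * C4 * rate (M' + i)) cau0.
have at_c : attr j p c.
  have K40 : 0 <= 2 * (K3 * C4) by rewrite !mulr_ge0.
  move=> e e0; have [N5 _ H5] := @rate_lim R j (2 * (K3 * C4)) e K40 e0.
  exists (M' + N5)%N => n Nn; have := Hc (n - M')%N; rewrite subnKC ?(leq_trans (leq_addr _ _) Nn) // mulrA.
  by move=> /le_lt_trans; apply; apply: H5; exact: leq_trans (leq_addl _ _) Nn.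
exists c => // jp.
pose k n := (iter n G p).2 * (pw n 40)%:C%C : R[i].
have kS n : (M' <= n)%N -> nm (k n.+1 - k n) <= K2 * pw n (- (110 * J)%N%:Z) * nm (k n).
  move=> Mn; have Mn' := MM n Mn.
  by have [_ /(_ jp)] := H2 n _ (leq_trans M2 Mn') (w n (leq_trans MN Mn')) (st n Mn).
have q0 : (0 : R) < 1 / 2 by rewrite divr_gt0.
have K24 : 0 <= K2 * C4 by rewrite mulr_ge0.
have [N6 N60 H6] := @rate_lim R j (K2 * C4) (1 / 2) K24 q0.
pose Q := (M' + N6)%N; have Q0 : (0 < Q)%N by rewrite addn_gt0 M'0.
have kQ : 0 < nm (k Q).
  have [_ _ _ /(_ jp) y0] := w Q (leq_trans MN (MM Q (leq_addr _ _))).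
  rewrite nmM nm_real ger0_norm ?pw_ge0 // mulr_gt0 ?pw_gt0 //; apply: lt_le_trans y0; exact: pw_gt0.
(* The product of the factors [1 - error] is bounded below by 1 minus the sum of the errors, and
   this sum is at most [1/2] from time [Q] on. *)
have low i : nm (k Q) * (1 - K2 * C4 * (rate Q - rate (Q + i))) <= nm (k (Q + i)%N).
  elim: i => [|i IH]; first by rewrite addn0 subrr mulr0 subr0 mulr1.
  have Qi : (M' <= Q + i)%N by rewrite /Q -addnA leq_addr.
  have h1 := kS _ Qi; have h2 := tele (Q + i)%N (leq_trans Q0 (leq_addr _ _)).
  have h3 := nm_distC (k (Q + i)%N) (k (Q + i).+1).
  rewrite addnS; set e1 := rate (Q + i) in IH h2 *; set e2 := rate (Q + i).+1 in h2 *; set e0 := rate Q in IH *.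
  have e12 : 0 <= K2 * C4 * (e1 - e2).
    by rewrite mulr_ge0 // subr_ge0 rate_mono // (leq_trans Q0 (leq_addr _ _)).
  have e01 : 0 <= K2 * C4 * (e0 - e1) by rewrite mulr_ge0 // subr_ge0 rate_mono // leq_addr.
  have e0h : K2 * C4 * e0 < 1 / 2 by apply: H6; exact: leq_addl.
  have e2p : 0 <= K2 * C4 * e2 by rewrite mulr_ge0 // ltW ?rate_gt0.
  have h4 : K2 * pw (Q + i) (- (110 * J)%N%:Z) <= K2 * C4 * (e1 - e2).
    by rewrite -mulrA ler_wpM2l.
  have ki := nm_ge0 (k (Q + i)%N).
  have h5 := ler_wpM2r ki h4.
  have -> : K2 * C4 * (e0 - e2) = K2 * C4 * (e0 - e1) + K2 * C4 * (e1 - e2) by ring.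
  have s12 : K2 * C4 * (e1 - e2) <= 1 / 2.
    by move: e01 e2p e0h; rewrite !mulrBr; clear; lra.
  move: (K2 * C4 * (e0 - e1)) (K2 * C4 * (e1 - e2)) IH e12 e01 h1 h3 h5 s12 => x y IH y0 x0 h1 h3 h5 s12.
  have h6 := le_trans h3 (le_trans h1 h5).
  have h7 : (1 - y) * (nm (k Q) * (1 - x)) <= (1 - y) * nm (k (Q + i)%N).
    by rewrite ler_wpM2l //; move: s12; clear; lra.
  have xy : 0 <= nm (k Q) * (x * y) by rewrite mulr_ge0 ?nm_ge0 // mulr_ge0.
  have e7 : (1 - y) * (nm (k Q) * (1 - x)) = nm (k Q) * (1 - (x + y)) + nm (k Q) * (x * y) by ring.
  by rewrite e7 in h7; move: h6 h7 xy; move: (nm (k Q) * _) (nm (k Q) * (x * y)) => t s; nlra.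
apply/negP => /eqP c0; have e4 : 0 < nm (k Q) / 4 by rewrite divr_gt0.
have [N7 H7] := at_c _ e4.
have := le_lt_trans (dist_snd _ _) (H7 (Q + N7)%N (leq_addl _ _)).
rewrite phiE /= c0 subr0 -/(k (Q + N7)%N); have := low N7.
have : K2 * C4 * (rate Q - rate (Q + N7)) <= 1 / 2.
  have := H6 Q (leq_addl _ _); have : 0 <= K2 * C4 * rate (Q + N7) by rewrite mulr_ge0 // ltW ?rate_gt0.
  by rewrite mulrBr; move: (K2 * C4 * rate Q) (K2 * C4 * rate (Q + N7)) => x y; lra.
move: (K2 * C4 * _) => x x2 h1 h2; have h3 : nm (k Q) * (1 / 2) <= nm (k Q) * (1 - x).
  by rewrite ler_wpM2l ?nm_ge0 //; move: x2; clear; lra.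
by move: h1 h2 h3 kQ; move: (nm (k Q) * (1 - x)) => y; nlra.
Qed.

Lemma linear_growth (u : nat -> R[i]) (t s : R) N : 0 < s -> 0 <= t ->
  (forall n, (N <= n)%N -> nm (u n.+1 - u n - 1) <= t) ->
  exists N', forall n, (N' <= n)%N -> nm (u n - n%:R) <= (t + s) * n%:R.
Proof.
move=> s0 t0 H; pose D := nm (u N - N%:R).
have h i : nm (u (N + i)%N - (N + i)%:R) <= D + t * i%:R.
  elim: i => [|i IH]; first by rewrite addn0 mulr0 addr0.
  have -> : u (N + i.+1)%N - (N + i.+1)%:R = (u (N + i)%N - (N + i)%:R) + (u (N + i).+1 - u (N + i)%N - 1).
    by rewrite addnS -(natr1 (N + i)); ring.
  rewrite (le_trans (nmD _ _)) // -natr1 mulrDr mulr1 addrA lerD //; exact: H _ (leq_addr _ _).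
exists (N + (Num.trunc (D / s)).+1)%N => n Nn; have Nn' := leq_trans (leq_addr _ _) Nn.
have := h (n - N)%N; rewrite subnKC // => /le_trans; apply.
have k1 : D / s < (Num.trunc (D / s)).+1%:R by exact: truncnS_gt.
rewrite ltr_pdivrMr // in k1.
have k2 : (Num.trunc (D / s)).+1%:R <= n%:R :> R by rewrite ler_nat; exact: leq_trans (leq_addl _ _) Nn.
have k3 : (n - N)%:R <= n%:R :> R by rewrite ler_nat leq_subr.
have := ler_wpM2r (ltW s0) k2; have := ler_wpM2l t0 k3; move: k1.
rewrite mulrDl (mulrC s); move: (_.+1%:R * s) (t * (n - N)%:R) (t * n%:R) (n%:R * s) => *; lra.
Qed.

(** For [J = 1] the exponent 39 lies between the true decay 40 of [y] and the value 38 required by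
    [wreg]; the slack absorbs the errors on both sides. *)
Lemma shrink39 n : (0 < n)%N -> (1 - 39 / 100 * n%:R^-1) * expR (39 / 100 * ln (1 + n%:R^-1)) <= 1 :> R.
Proof.
move=> n0; have [t0 t1 /andP[_ l2] _] := @natV_ln R n n0; set t : R := n%:R^-1 in t0 t1 l2 *.
have s1 : 0 <= 1 - 39 / 100 * t by move: t1; clear; lra.
apply: (@le_trans _ _ ((1 - 39 / 100 * t) * expR (39 / 100 * t))).
  by rewrite ler_wpM2l // ler_expR ler_wpM2l // divr_ge0.
have h := expR_ge1Dx (- (39 / 100 * t)).
apply: (@le_trans _ _ (expR (- (39 / 100 * t)) * expR (39 / 100 * t))).
  by rewrite ler_wpM2r ?expR_ge0.
by rewrite -expRD addNr expR0.
Qed.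

Lemma wr_vanish p : (forall e : R, 0 < e -> exists N, forall n, (N <= n)%N -> nm (iter n G p) <= e) ->
  forall e : R, 0 < e -> exists N, forall n, (N <= n)%N -> wr (iter n G p) <= e /\ small j (iter n G p).
Proof.
move=> H e e0; have J0 : (0 : R) < J%:R by rewrite ltr0n.
have q0 : 0 < Num.min (e / 2) (@eps R / J%:R) by rewrite lt_min !divr_gt0 // /eps !divr_gt0.
have [N HN] := H _ q0; exists N => n /HN; rewrite le_min => /andP[h1 h2]; move: (iter n G p) h1 h2 => q h1 h2.
have x1 : nm (q.1 : R[i]) <= nm q by rewrite {2}(surjective_pairing q) nm_pair le_max lexx.
have y1 : nm (q.2 : R[i]) <= nm q by rewrite {2}(surjective_pairing q) nm_pair le_max lexx orbT.
rewrite ler_pdivlMr // in h2; split; first by rewrite /wr; move: x1 y1 h1; nlra.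
have xJ := ler_wpM2l (ltW J0) x1; have yJ := ler_wpM2l (ltW J0) y1; rewrite mulrC in h2.
by split; [exact: le_trans xJ h2|exact: le_trans yJ h2].
Qed.

(** For [j = 0] convergence to the origin off the line [x = 0] suffices. Then [u = x], so the
    increments of [1/x] tend to 1 and [x_n] is close to [1/n] up to a relative error of 1 percent;
    hence [y] is multiplied by at most [1 - 39 / (100 n)] up to a summable term, and
    [|y_n| n^(39/100)] stays bounded. *)
Lemma basin_j0 p : j = 0%N -> p.1 != 0 ->
  (forall e : R, 0 < e -> exists N, forall n, (N <= n)%N -> nm (iter n G p) <= e) -> basin p.
Proof.
move=> j0 x0 H; have J1 : J = 1%N by rewrite j0.
have wv := wr_vanish H; have [K1 K10 HK1] := @LEU0 R j j0; have [K2 K20 HK2] := @O_snd2 R j.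
have xn n : (iter n G p).1 != 0 by rewrite iter_fst_neq0.
have uE q : Gu q = q.1 by rewrite /Gu j0 expr0 mulr1.
pose U n := (Gu (iter n G p))^-1 : R[i].
have U1 (t : R) : 0 < t -> exists N, forall n, (N <= n)%N -> nm (U n.+1 - U n - 1) <= t.
  move=> t0; have q0 : 0 < Num.min 1 (t / (K1 + 1)) by rewrite lt_min ltr01 divr_gt0 // ltr_wpDl.
  have [N HN] := wv _ q0; exists N => n /HN[]; rewrite le_min => /andP[w1 w2] sn.
  apply: (le_trans (HK1 _ sn (xn n))); rewrite ler_pdivlMr in w2; last by rewrite ltr_wpDl.
  have r0 : 0 <= wr (iter n G p) by rewrite addr_ge0 ?nm_ge0.
  have r3 : wr (iter n G p) ^+ 3 <= wr (iter n G p).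
    by rewrite exprS ler_piMr // exprn_ile1.
  have := ler_wpM2l K10 r3; move: w2 r0; move: (wr _) (wr _ ^+ 3) => a b; clear; nra.
have U2 (t : R) : 0 < t -> exists N, forall n, (N <= n)%N -> nm (U n - n%:R) <= t * n%:R.
  move=> t0; have t2 : 0 < t / 2 by rewrite divr_gt0.
  have [N HN] := U1 _ t2; have [N' HN'] := linear_growth t2 (ltW t2) HN.
  by exists N' => n /HN'; rewrite -splitr.
have h100 : (0 : R) < 1 / 100 by rewrite divr_gt0.
have [N1 HN1] := U2 _ h100.
have e2 : 0 < Num.min 1 (1 / 10 / 100 / (K2 + 1)) :> R by rewrite lt_min ltr01 !divr_gt0 // ltr_wpDl.
have [N2 HN2] := wv _ e2.
pose M := (N1 + N2).+1.
have b25 : beta j = 2 / 5 :> R by rewrite /beta J1; field.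
have yS n : (M <= n)%N -> nm ((iter n.+1 G p).2 : R[i]) <=
    nm ((iter n G p).2 : R[i]) * (1 - 39 / 100 * n%:R^-1) + 12 * K2 * n%:R^-1 ^+ 2.
  move=> Mn; have n0 : (0 < n)%N by apply: leq_trans Mn.
  have MN1 : (N1 <= n)%N by apply: leq_trans (ltnW Mn); exact: leq_addr.
  have MN2 : (N2 <= n)%N by apply: leq_trans (ltnW Mn); exact: leq_addl.
  have [] := HN2 n MN2; rewrite le_min => /andP[w1 w2] sn; rewrite ler_pdivlMr in w2; last by rewrite ltr_wpDl.
  have h := HK2 _ sn; have hU := HN1 n MN1; move: (xn n) => x0n; rewrite /U uE in hU.
  move: h; rewrite uE b25 -iterS; move: (iter n.+1 G p) (iter n G p) x0n hU w1 w2 {sn} => q' q x0n hU w1 w2 h.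
  have n1 : (0 : R) < n%:R by rewrite ltr0n.
  have t0 : 0 < n%:R^-1 :> R by rewrite invr_gt0.
  have xp : 0 < nm (q.1 : R[i]) by rewrite nm_gt0.
  have xle : nm (q.1 : R[i]) <= 100 / 99 * n%:R^-1.
    have h1 : 99 / 100 * n%:R <= nm (q.1^-1 : R[i]).
      by have := nm_dist (n%:R : R[i]) q.1^-1; rewrite nm_nat nmB; move: hU; nlra.
    rewrite nmV -[99 / 100 * _]invrK lef_pV2 ?posrE // ?invr_gt0 ?mulr_gt0 ?divr_gt0 // in h1.
    by rewrite invfM invf_div in h1.
  have du : nm (q.1 - n%:R^-1 : R[i]) <= 1 / 99 * n%:R^-1.
    have -> : q.1 - n%:R^-1 = - (q.1^-1 - n%:R) * (q.1 * n%:R^-1).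
      have aux (x a : R[i]) : x != 0 -> a != 0 -> x - a^-1 = - (x^-1 - a) * (x * a^-1).
        by move=> x0' a0; field; rewrite x0' a0.
      by apply: aux => //; rewrite pnatr_eq0 -lt0n.
    rewrite nmM nmN [nm (q.1 * _)]nmM nmV nm_nat.
    apply: (le_trans (ler_pM _ _ hU (ler_wpM2r (ltW t0) xle))); rewrite ?mulr_ge0 ?nm_ge0 ?(ltW t0) //.
    by rewrite le_eqVlt; apply/orP; left; apply/eqP; field; rewrite gt_eqF.
  have t1 : n%:R^-1 <= 1 :> R by rewrite invf_le1 // ler1n.
  set t : R := n%:R^-1 in t0 t1 xle du *.
  have main : nm (1 - (2 / 5)%:C%C * q.1) <= 1 - 395 / 10 / 100 * t.
    have -> : 1 - (2 / 5)%:C%C * q.1 = (1 - 2 / 5 * t)%:C%C - (2 / 5)%:C%C * (q.1 - n%:R^-1).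
      have -> : (1 - 2 / 5 * t)%:C%C = 1 - (2 / 5)%:C%C * n%:R^-1 :> R[i].
        by rewrite rmorphB rmorph1 rmorphM /t fmorphV rmorph_nat.
      have aux (x a b : R[i]) : 1 - b * x = 1 - b * a - b * (x - a) by ring.
      exact: aux.
    rewrite (le_trans (nm_sub _ _)) // [nm (_ * (q.1 - _))]nmM !nm_real.
    have p1 : 0 <= 1 - 2 / 5 * t by move: t1; clear; lra.
    rewrite (ger0_norm p1) (ger0_norm (_ : 0 <= 2 / 5)) ?divr_ge0 //.
    apply: (@le_trans _ _ (1 - 2 / 5 * t + 2 / 5 * (1 / 99 * t))).
      by rewrite lerD2l ler_wpM2l // divr_ge0.
    by move: t0; move: (t) => a; clear => a0; lra.
  have y0 := nm_ge0 (q.2 : R[i]); have r0 : 0 <= wr q by rewrite addr_ge0 ?nm_ge0.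
  have err : nm (q'.2 - q.2 * (1 - (2 / 5)%:C%C * q.1)) <= K2 * (nm (q.1 : R[i]) ^+ 2 + nm (q.1 : R[i]) * wr q ^+ 2).
    by move: h; rewrite /wt j0 expr0 mulr1 expr1.
  have y1 : nm (q'.2 : R[i]) <= nm (q.2 : R[i]) * nm (1 - (2 / 5)%:C%C * q.1) + nm (q'.2 - q.2 * (1 - (2 / 5)%:C%C * q.1)).
    by have := nm_dist (q'.2 : R[i]) (q.2 * (1 - (2 / 5)%:C%C * q.1)); rewrite [nm (q.2 * _)]nmM; nlra.
  have x0' := nm_ge0 (q.1 : R[i]).
  rewrite /wr in w2 r0 err w1.
  have l1 := ler_wpM2l y0 main.
  move: y1 l1 err xle w1 w2 y0 xp t0 t1 K20.
  move: (nm (q'.2 - _)) (nm (1 - _)) (nm q.1) (nm q.2) (nm q'.2) => er f x y y'.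
  clear => y1 l1 err xle w1 w2 y0 xp t0 t1 K20.
  have q1 : x ^+ 2 <= 2 * t ^+ 2.
    have : x ^+ 2 <= (100 / 99 * t) ^+ 2 by rewrite lerXn2r ?nnegrE // ltW // mulr_gt0 // divr_gt0.
    by rewrite exprMn; have := sqr_ge0 t; nra.
  have q2 : x * (x + y) ^+ 2 <= x * (2 * x ^+ 2 + 2 * y ^+ 2).
    by rewrite ler_wpM2l ?(ltW xp) //; have := sqr_ge0 (x - y); nra.
  have q3 : K2 * y <= 1 / 10 / 100 by move: w2 xp y0; nra.
  have q4 : x * x ^+ 2 <= x ^+ 2 by rewrite ler_piMl ?sqr_ge0 //; lra.
  have q5 : K2 * (x * y ^+ 2) <= 100 / 99 * t * (1 / 10 / 100 * y).
    have -> : K2 * (x * y ^+ 2) = x * (K2 * y * y) by ring.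
    by apply: ler_pM => //; [exact: ltW|rewrite !mulr_ge0|rewrite ler_wpM2r].
  have q6 := ler_wpM2l K20 q2; have q7 := ler_wpM2l K20 q4; have q8 := ler_wpM2l K20 q1.
  have ty : 0 <= t * y by rewrite mulr_ge0 // ltW.
  have q9 : y * (1 - 395 / 10 / 100 * t) = y - 395 / 10 / 100 * (t * y) by ring.
  have q10 : y * (1 - 39 / 100 * t) = y - 39 / 100 * (t * y) by ring.
  have q11 : K2 * (x * (2 * x ^+ 2 + 2 * y ^+ 2)) = 2 * (K2 * (x * x ^+ 2)) + 2 * (K2 * (x * y ^+ 2)) by ring.
  have q12 : 100 / 99 * t * (1 / 10 / 100 * y) = 100 / 99 * (1 / 10 / 100) * (t * y) by ring.
  have q13 : K2 * (2 * t ^+ 2) = 2 * (K2 * t ^+ 2) by ring.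
  have q14 : K2 * (x ^+ 2 + x * (x + y) ^+ 2) = K2 * x ^+ 2 + K2 * (x * (x + y) ^+ 2) by ring.
  have q15 : 0 <= K2 * t ^+ 2 by rewrite mulr_ge0 ?sqr_ge0.
  have q16 : 12 * K2 * t ^+ 2 = 12 * (K2 * t ^+ 2) by ring.
  rewrite q10 q16; rewrite q9 in l1; rewrite q14 in err; rewrite q11 in q6; rewrite q12 in q5; rewrite q13 in q8.
  move: (K2 * x ^+ 2) (K2 * (x * (x + y) ^+ 2)) (K2 * (x * x ^+ 2)) (K2 * (x * y ^+ 2)) (K2 * t ^+ 2) (t * y) (y * f)
    y1 l1 err q6 q7 q8 q5 q15 ty.
  by clear => *; lra.
have J100 : (100 * J)%:R = 100 :> R by rewrite J1 muln1.
pose v n := nm ((iter n G p).2 : R[i]) * pw n 39.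
have vS n : (M <= n)%N -> v n.+1 <= v n + 24 * K2 * pw n (- (110 * J)%N%:Z).
  move=> Mn; have n0 : (0 < n)%N by apply: leq_trans Mn.
  have h := yS n Mn; have sh := shrink39 n0; have [t0 t1 _ _] := @natV_ln R n n0.
  have s0 := @pw_succ R j n 39 n0; rewrite J100 in s0; move: sh s0; rewrite (_ : 39%:~R = 39) //.
  have := expR_gt0 (39 / 100 * ln (1 + n%:R^-1 : R)); move: (expR _) => E E0 sh s0.
  have E2 : E <= 2 by move: sh t1 t0 E0; clear; nra.
  have p0 := @pw_gt0 R j n 39; have y0 := nm_ge0 ((iter n G p).2 : R[i]).
  have t2 : n%:R^-1 ^+ 2 * pw n 39 <= pw n (- (110 * J)%N%:Z).
    by rewrite (@pwnV R j) // expr2 !pwD pw_le // J1.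
  rewrite /v s0; have l1 := ler_wpM2r (mulr_ge0 (ltW p0) (ltW E0)) h.
  have l2 := ler_wpM2l (mulr_ge0 y0 (ltW p0)) sh.
  have l3 : 12 * K2 * (n%:R^-1 ^+ 2 * pw n 39) * E <= 24 * K2 * pw n (- (110 * J)%N%:Z).
    rewrite (_ : 24 * K2 * pw n _ = 12 * K2 * pw n (- (110 * J)%N%:Z) * 2); last by ring.
    by apply: ler_pM => //; [rewrite !mulr_ge0 ?sqr_ge0 // ltW|exact: ltW|rewrite ler_wpM2l // mulr_ge0].
  apply: (le_trans l1); rewrite mulrDl; apply: lerD.
    rewrite mulr1 in l2; apply: le_trans l2; rewrite le_eqVlt; apply/orP; left; apply/eqP; ring.
  apply: le_trans l3; rewrite le_eqVlt; apply/orP; left; apply/eqP; ring.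
have [C4 C40 tele] := @rate_tele R j.
have M0 : (0 < M)%N by [].
have K24 : 0 <= 24 * K2 by rewrite mulr_ge0.
have vb i : v (M + i)%N <= v M + 24 * K2 * C4 * (rate M - rate (M + i)).
  elim: i => [|i IH]; first by rewrite addn0 subrr mulr0 addr0.
  rewrite addnS (le_trans (vS _ (leq_addr _ _))) //.
  have h2 := ler_wpM2l K24 (tele (M + i)%N (leq_trans M0 (leq_addr _ _))).
  move: IH h2; rewrite mulrA; move: (v _) (v M) (24 * K2 * pw _ _) (24 * K2 * C4) (rate M) (rate (M + i)) (rate _) => a b c d e f g.
  by rewrite !mulrBr; clear; lra.
pose V := v M + 24 * K2 * C4 * rate M.
have [N3 [N30 HN3]] := @pw_large R j V.
apply: (@wreg_basin p (M + N1 + N3)%N) => n Nn.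
have n0 : (0 < n)%N by apply: leq_trans Nn; rewrite addSn.
have [nM nN1 nN3] : [/\ (M <= n)%N, (N1 <= n)%N & (N3 <= n)%N] by split; move: Nn; clear; lia.
split=> //.
- have := HN1 n nN1; move: (nm (U n - _)) => a; have : (0 : R) < n%:R by rewrite ltr0n.
  by rewrite -/(U n); clear; lra.
- have h : v n <= V.
    rewrite -(subnKC nM) (le_trans (vb _)) // lerD2l ler_wpM2l ?mulr_ge0 // gerBl; exact: pw_ge0.
  have V1 : V <= pw n 1 := HN3 n 1 nN3 (lexx _).
  rewrite -(ler_pM2r (@pw_gt0 R j n 39)) pwD; exact: le_trans h V1.
- by rewrite j0.
Qed.

End Criterion.

(** * From the decay rate of [x] to the basin *)

Section Regime.
Context {R : realType} (j : nat).
Local Notation C := (R[i]^o).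
Local Notation X2 := (C * C)%type.
Local Notation J := j.+1.
Implicit Types (p c : X2) (n N : nat).
Local Notation Gu := (@Gu R j).
Local Notation G := (@G R j : X2 -> X2).
Local Notation pw := (@pw R j).
Local Notation wreg := (@wreg R j).
Local Notation zal := (zal j).
Local Notation basin := (@basin R j).
Local Notation Alog := (@Alog R j).
Local Notation Slog := (@Slog R j).

Definition vanishes p := forall e : R, 0 < e -> exists N, forall n, (N <= n)%N -> nm (iter n G p) <= e.

Definition fst_rate p N := forall n, (N <= n)%N -> pw n (- zal - 1) <= nm ((iter n G p).1 : R[i]) <= pw n (- zal + 1).

(* Otherwise the increments [Alog] of the logarithm of the first coordinate are summable, so that this
   coordinate stays away from [0]. *)
Lemma snd_often p N N' : (0 < j)%N -> p.1 != 0 -> vanishes p -> fst_rate p N ->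
  exists2 n, (N' <= n)%N & pw n (- 44) <= nm ((iter n G p).2 : R[i]).
Proof.
move=> jp x0 van hx; case: (pselect (exists2 n, (N' <= n)%N & pw n (- 44) <= nm ((iter n G p).2 : R[i]))) => // H; exfalso.
have lo n : (N' <= n)%N -> nm ((iter n G p).2 : R[i]) <= pw n (- 44).
  by move=> Nn; rewrite leNgt; apply/negP => /ltW h; apply: H; exists n.
have [K K0 HK] := @O_Alog R j; have [N1 HN1] := wr_vanish van ltr01.
pose M := (N + N' + N1).+1.
(* The exponent of [x_n wr^j] is at most [- zal + 1 - 44 j = - 100 J - (4 j - 1)], and
   [4 j - 1 >= 3]. *)
have bA n : (M <= n)%N -> nm (Slog n.+1 p - Slog n p) <= K * 2 ^+ j * pw n (- (100 * J)%N%:Z - 3).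
  move=> Mn; have n0 : (0 < n)%N by apply: leq_trans Mn.
  have [nN nN' nN1] : [/\ (N <= n)%N, (N' <= n)%N & (N1 <= n)%N] by split; move: Mn; clear; lia.
  rewrite SlogS addrC addKr (le_trans (HK _ (HN1 n nN1).2)) // -mulrA ler_wpM2l //.
  have y1 := lo n nN'; have /andP[_ x1] := hx n nN.
  have x2 : nm ((iter n G p).1 : R[i]) <= pw n (- 44).
    by apply: le_trans x1 _; rewrite pw_le // /zal; move: jp; clear; lia.
  have w2 : wr (iter n G p) <= 2 * pw n (- 44) by rewrite /wr; move: x2 y1; clear; lra.
  have w0 : 0 <= wr (iter n G p) by rewrite addr_ge0 ?nm_ge0.
  rewrite /wt expr1; apply: (@le_trans _ _ (pw n (- zal + 1) * (2 * pw n (- 44)) ^+ j)).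
    have wj : wr (iter n G p) ^+ j <= (2 * pw n (- 44)) ^+ j.
      by rewrite lerXn2r ?nnegrE // mulr_ge0 // pw_ge0.
    by apply: ler_pM wj; rewrite ?nm_ge0 ?exprn_ge0.
  rewrite exprMn pwX mulrCA pwD ler_wpM2l ?exprn_ge0 // pw_le // /zal; move: jp; clear; lia.
have K20 : 0 <= K * 2 ^+ j by rewrite mulr_ge0 ?exprn_ge0.
have M0 : (0 < M)%N by [].
have ts := tele_sum M0 (isT : 1 <= (3 : int)) K20 bA.
pose K' := K * 2 ^+ j * (400 * J)%:R; have K'0 : 0 <= K' by apply: mulr_ge0 K20 (ler0n _ _).
pose c := nm ((iter M G p).1 : R[i]) * expR (- K').
have c0 : 0 < c by rewrite mulr_gt0 ?expR_gt0 // nm_gt0 iter_fst_neq0.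
have [N2 [N20 HN2]] := @pw_large R j (c^-1 + 1).
pose m := (M + N2)%N; have Mm : (M <= m)%N by exact: leq_addr.
have m0 : (0 < m)%N := leq_trans M0 Mm.
have clo : c <= nm ((iter m G p).1 : R[i]).
  rewrite iter_fst nmM nm_cexp /c iter_fst nmM nm_cexp -mulrA ler_wpM2l ?nm_ge0 // -expRD ler_expR.
  have h := ts M m (leqnn M) Mm; have h2 := Re_le_nm (Slog m p - Slog M p).
  have h3 : pw M (- 3) - pw m (- 3) <= 1 by have := @pw_le1 R j M (- 3) M0 isT; have := @pw_ge0 R j m (- 3); lra.
  have h4 := ler_wpM2l K'0 h3; rewrite mulr1 -/K' in h h4.
  have := le_trans h2 (le_trans h h4); rewrite ler_norml => /andP[h5 _]; move: h5.
  by rewrite raddfB /=; move: (complex.Re _) (complex.Re _) (K') => a b d; clear; lra.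
have z1 : (1 : int) <= zal - 1 by rewrite /zal; clear; lia.
have big := HN2 m _ (leq_addl _ _) z1.
have mN : (N <= m)%N by rewrite /m /M; clear; lia.
have /andP[_ x1] := hx m mN; have := le_trans clo x1.
rewrite (_ : - zal + 1 = - (zal - 1)); last by ring.
rewrite -(@pwV R j m (zal - 1)) -[X in _ <= X -> _]mul1r ler_pdivlMr ?pw_gt0 // => h.
have := ler_wpM2l (ltW c0) big; rewrite mulrDr mulr1 divff ?gt_eqF //; move: c0 h; clear; lra.
Qed.

(** At some late time [y] is not too small, by [snd_often]. While [|y_n|] exceeds [pw n (- 47)], the
    ratio [x / y] is small and [1/u] moves by 1 up to [1/4]; so [1/u] grows at most linearly, and
    [|y|^j = 1 / (|1/u| |x|)] is bounded below again, which makes the condition persist. Afterwards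
    [1/u_n] is comparable to [n], and [y_n] is pinned down by [u_n] and [x_n]. *)
Lemma fst_rate_basin p N : (0 < j)%N -> p.1 != 0 -> vanishes p -> fst_rate p N -> basin p.
Proof.
move=> jp x0 van hx; have [K K0 HK] := @LEUp R j.
pose U n := (Gu (iter n G p))^-1 : R[i]; pose X n := nm ((iter n G p).1 : R[i]); pose Y n := nm ((iter n G p).2 : R[i]).
have X0 n : 0 < X n by rewrite nm_gt0 iter_fst_neq0.
have Y0 n : 0 <= Y n by exact: nm_ge0.
have hX n : (N <= n)%N -> pw n (- zal - 1) <= X n <= pw n (- zal + 1) := hx n.
have UE n : nm (U n) = (X n * Y n ^+ j)^-1 by rewrite /U nmV Gu_nm.
have J2 : (1 < J)%N by [].
have q0 : 0 < Num.min 1 ((K + 1)^-1 / 8) by rewrite lt_min ltr01 divr_gt0 // invr_gt0 ltr_wpDl.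
have [N1 HN1] := wr_vanish van q0; have [N2 [N20 HN2]] := @pw_large R j (8 * (K + 1)).
have inv1 n : (N2 <= n)%N -> pw n (- 1) * (8 * (K + 1)) <= 1.
  move=> Nn; have h := HN2 n 1 Nn (lexx _); by rewrite -(@pwV R j n 1) [X in X <= _]mulrC ler_pdivrMr ?pw_gt0 // mul1r.
have step n : (N + N1 + N2 < n)%N -> pw n (- 47) <= Y n -> nm (U n.+1 - U n - 1) <= 1 / 4.
  move=> Mn yn; have n0 : (0 < n)%N by exact: leq_trans Mn.
  have [nN nN1 nN2] : [/\ (N <= n)%N, (N1 <= n)%N & (N2 <= n)%N] by split; move: Mn; clear; lia.
  have [] := HN1 n nN1; rewrite le_min => /andP[w1 w2] sn; have /andP[_ x1] := hX n nN.
  have yp : 0 < Y n := lt_le_trans (@pw_gt0 R _ _ _) yn.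
  have xy1 : X n / Y n <= pw n (- 1).
    rewrite ler_pdivrMr // (le_trans x1) // (@le_trans _ _ (pw n (- 1) * pw n (- 47))) ?ler_wpM2l ?pw_ge0 //.
    rewrite pwD pw_le // /zal; move: jp; clear; lia.
  have p1 : pw n (- 1) <= 1 by exact: pw_le1.
  have xy : X n <= Y n by move: (le_trans xy1 p1); rewrite ler_pdivrMr // mul1r.
  have xy0 : 0 <= X n / Y n by rewrite divr_ge0 // ltW.
  have xn0 : (iter n G p).1 != 0 by rewrite iter_fst_neq0.
  have h := HK _ sn xn0 xy.
  have w0 : 0 <= wr (iter n G p) by rewrite addr_ge0 ?nm_ge0.
  have e1 : (X n / Y n) ^+ 2 <= pw n (- 1).
    by apply: (le_trans _ xy1); rewrite expr2 ler_piMl // (le_trans xy1).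
  have e2 : wr (iter n G p) ^+ (3 * J) <= wr (iter n G p).
    by rewrite mulnS -addn1 addnAC addn1 exprS ler_piMr // exprn_ile1.
  apply: (le_trans h); have h1 := inv1 n nN2.
  have K1 : 0 < K + 1 by rewrite ltr_wpDl.
  rewrite mulrC ler_pdivlMr // in w2.
  have h2 := ler_wpM2l K0 (lerD e1 e2).
  apply: le_trans h2 _.
  have pp := @pw_ge0 R j n (- 1).
  move: h1 w2 pp w0; move: (pw n (- 1)) (wr _) => a b h1 w2 a0 b0.
  by move: h1 w2 a0 b0; clear; lra.
have UX n : Y n != 0 -> nm (U n) * X n * Y n ^+ j = 1.
  by move=> y0; rewrite UE -mulrA mulVf // mulf_neq0 ?expf_neq0 // gt_eqF.
have [N3 [N30 HN3]] := @pw_large R j 4.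
have [n0 Nn0 yn0] := @snd_often p N (N + N1 + N2 + N3).+1 jp x0 van hx.
have n00 : (0 < n0)%N by exact: leq_trans Nn0.
(* The lower bounds of [x] and [y] give the exponent [zal + 1 + 44 j = 104 J - 3]. *)
have U0 : nm (U n0) <= pw n0 (104 * J - 3)%N.
  have nN : (N <= n0)%N by move: Nn0; clear; lia.
  have /andP[x1 _] := hX n0 nN.
  have yj : pw n0 (- 44 * j%:Z) <= Y n0 ^+ j by rewrite -pwX lerXn2r ?nnegrE ?pw_ge0.
  have -> : (104 * J - 3)%N%:Z = - (- zal - 1 + - 44 * j%:Z) by rewrite /zal; move: J2; clear; lia.
  rewrite UE -pwV lef_pV2 ?posrE ?pw_gt0 ?mulr_gt0 ?exprn_gt0 ?(lt_le_trans (@pw_gt0 R _ _ _) yn0) //.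
  by rewrite -pwD ler_pM ?pw_ge0.
have mono n m z : (0 < n)%N -> (n <= m)%N -> (0 <= z)%R -> pw n z <= pw m z.
  move=> n_0 nm_ z0; have := @pw_mono R j n m z n_0 nm_ z0.
  by rewrite -!pwV lef_pV2 ?posrE ?pw_gt0.
have persist i : pw (n0 + i) (- 47) <= Y (n0 + i)%N /\ nm (U (n0 + i)%N) <= nm (U n0) + 2 * i%:R.
  elim: i => [|i [IH1 IH2]].
    by rewrite addn0 mulr0 addr0; split=> //; apply: le_trans yn0; exact: pw_le.
  rewrite !addnS; set n := (n0 + i)%N in IH1 IH2 *.
  have nn0 : (n0 <= n)%N by exact: leq_addr.
  have n_0 : (0 < n)%N := leq_trans n00 nn0.
  have [nN nN3 nb] : [/\ (N <= n)%N, (N3 <= n)%N & (N + N1 + N2 < n)%N] by split; move: Nn0 nn0; clear; lia.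
  have du := step n nb IH1.
  have up : nm (U n.+1) <= nm (U n) + 2.
    have := nm_dist (U n.+1) (U n + 1); rewrite opprD addrA => h; have h2 := nmD (U n) 1; rewrite nm1 in h2.
    by move: h h2 du; clear; lra.
  have yp : 0 < Y n := lt_le_trans (@pw_gt0 R _ _ _) IH1.
  have U4 : 4 <= nm (U n).
    rewrite UE -[4]invrK lef_pV2 ?posrE ?invr_gt0 ?mulr_gt0 ?exprn_gt0 //.
    have /andP[_ x1] := hX n nN; have [_ s1] := HN1 n (leq_trans (leq_addl _ _) (leq_trans (leq_addr _ _) (ltnW nb))).
    have y1 : Y n <= 1 by have [_] := small_le s1; rewrite /eps; move=> h _ _; apply: (le_trans h); clear; lra.
    have x2 : X n <= pw n (- 1) by apply: le_trans x1 _; rewrite pw_le // /zal; move: jp; clear; lia.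
    have p4 : pw n (- 1) <= 4^-1 by rewrite -pwV lef_pV2 ?posrE ?pw_gt0 //; exact: HN3.
    by apply: (le_trans _ p4); apply: (le_trans _ x2); rewrite ler_piMr // ?(ltW (X0 _)) // exprn_ile1.
  have Un0 : U n.+1 != 0.
    rewrite -nm_gt0; have := nm_dist (U n) (U n.+1); have := nm_distC (U n.+1 - U n) 1; rewrite nm1.
    have := nm_tri (U n.+1) (U n) 0; rewrite !subr0 nmB.
    have := nm_dist (U n.+1 - U n) 1; rewrite nm1; move: du U4; clear; lra.
  have yn1 : 0 < Y n.+1.
    rewrite lt_neqAle Y0 andbT eq_sym nm_eq0; apply: contraNneq Un0 => y0.
    by rewrite /U /Gu y0 expr0n gtn_eqF // mulr0 invr0.
  have up2 : nm (U n.+1) <= nm (U n0) + 2 * i.+1%:R by rewrite -natr1; move: up IH2; clear; lra.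
  split=> //; have nN' : (N <= n.+1)%N := leqW nN; have /andP[_ x1] := hX n.+1 nN'.
  have U3 : nm (U n.+1) <= 3 * pw n.+1 (104 * J - 3)%N.
    have h1 : pw n0 (104 * J - 3)%N <= pw n.+1 (104 * J - 3)%N by apply: mono; rewrite // leqW.
    have h2 : i.+1%:R <= pw n.+1 (104 * J - 3)%N.
      apply: (@le_trans _ _ n.+1%:R); first by rewrite ler_nat ltnS leq_addl.
      by rewrite (@pwn R j) // pw_le //; move: J2; clear; lia.
    by move: up2 U0 h1 h2; clear; lra.
  (* The exponents add up to [2 - 3 j <= - 1], which leaves room for the factor 3. *)
  have hj : pw n.+1 (- 47 * j%:Z) <= Y n.+1 ^+ j.
    have p3 : 3 * (pw n.+1 (104 * J - 3)%N * pw n.+1 (- zal + 1) * pw n.+1 (- 47 * j%:Z)) <= 1.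
      rewrite !pwD; apply: (@le_trans _ _ (3 * pw n.+1 (- 1))).
        rewrite ler_wpM2l // pw_le // /zal; move: jp; clear; lia.
      by rewrite -(@pwV R j n.+1 1) ler_pdivrMr ?pw_gt0 // mul1r (le_trans _ (HN3 _ 1 (leqW nN3) (lexx _))) // ler_nat.
    have h1 : nm (U n.+1) * X n.+1 <= 3 * (pw n.+1 (104 * J - 3)%N * pw n.+1 (- zal + 1)).
      by rewrite mulrA ler_pM // ?nm_ge0 // ltW.
    have u0 : 0 < nm (U n.+1) * X n.+1 by rewrite mulr_gt0 // nm_gt0.
    rewrite -(ler_pM2l u0) UX ?gt_eqF //; apply: le_trans p3; rewrite mulrA.
    by rewrite ler_wpM2r ?pw_ge0.
  by move: hj; rewrite -pwX ler_pXn2r ?nnegrE ?pw_ge0.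
have step' n : (n0 <= n)%N -> nm (U n.+1 - U n - 1) <= 1 / 4.
  move=> nn; apply: step; first by move: Nn0 nn; clear; lia.
  by have [] := persist (n - n0)%N; rewrite subnKC.
have q4 : (0 : R) < 1 / 4 by rewrite divr_gt0.
have [N' HN'] := linear_growth q4 (ltW q4) step'.
have [N4 [N40 HN4]] := @pw_large R j 2.
apply: (@wreg_basin _ _ p (n0 + N' + N4)%N) => n Nn.
have [nn0 nN' nN4] : [/\ (n0 <= n)%N, (N' <= n)%N & (N4 <= n)%N] by split; move: Nn; clear; lia.
have n_0 : (0 < n)%N := leq_trans n00 nn0.
have nN : (N <= n)%N by move: Nn0 nn0; clear; lia.
have [yn _] := persist (n - n0)%N; rewrite subnKC // in yn.
have yp : 0 < Y n := lt_le_trans (@pw_gt0 R _ _ _) yn.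
have hU := HN' n nN'; have n1 : (0 : R) < n%:R by rewrite ltr0n.
have Ulo : n%:R / 2 <= nm (U n).
  have := nm_dist n%:R (U n); rewrite nm_nat nmB; move: hU; clear -n1; lra.
have Uhi : nm (U n) <= 2 * n%:R.
  have := nm_dist (U n) n%:R; rewrite nm_nat; move: hU; clear -n1; lra.
have Up : 0 < nm (U n) by apply: lt_le_trans Ulo; rewrite divr_gt0.
have /andP[x1 x2] := hX n nN; have xp := X0 n.
have p2 : 2 * pw n (- 1) <= 1.
  by rewrite -(@pwV R j n 1) ler_pdivrMr ?pw_gt0 // mul1r HN4.
(* The exponents leave [2 j - 1 >= 1], which absorbs the factor 2; the lower bound is analogous with
   42. *)
have yu : Y n ^+ j <= pw n (- 38 * j%:Z).
  rewrite -(ler_pM2l (mulr_gt0 Up xp)) UX ?gt_eqF //.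
  apply: (@le_trans _ _ (n%:R / 2 * pw n (- zal - 1) * pw n (- 38 * j%:Z))); last first.
    by rewrite ler_wpM2r ?pw_ge0 // ler_pM ?pw_ge0 // divr_ge0 // ltW.
  rewrite (@pwn R j) // -mulrA pwD mulrAC pwD ler_pdivlMr // mul1r.
  rewrite (le_trans (HN4 n 1 nN4 (lexx _))) // pw_le // /zal; move: jp; clear; lia.
have yl : pw n (- 42 * j%:Z) <= Y n ^+ j.
  rewrite -(ler_pM2l (mulr_gt0 Up xp)) UX ?gt_eqF //.
  apply: (@le_trans _ _ (2 * n%:R * pw n (- zal + 1) * pw n (- 42 * j%:Z))).
    by rewrite ler_wpM2r ?pw_ge0 // ler_pM ?nm_ge0 // ltW.
  rewrite (@pwn R j n) // -!mulrA !pwD; apply: (le_trans _ p2); rewrite ler_wpM2l // pw_le // /zal; move: jp; clear; lia.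
split; first by rewrite iter_fst_neq0.
- by rewrite (le_trans hU) // mulrC ler_pM2l //; clear; lra.
- by move: yu; rewrite -pwX ler_pXn2r ?nnegrE ?pw_ge0.
- by move=> _; move: yl; rewrite -pwX ler_pXn2r ?nnegrE ?pw_ge0.
Qed.

End Regime.

(** * Limit points of the basin *)

Section Endgame.
Context {R : realType} (j : nat).
Local Notation C := (R[i]^o).
Local Notation X2 := (C * C)%type.
Local Notation J := j.+1.
Implicit Types (p c : X2) (n N : nat).
Local Notation G := (@G R j : X2 -> X2).
Local Notation pw := (@pw R j).
Local Notation zal := (zal j).
Local Notation basin := (@basin R j).
Local Notation vanishes := (@vanishes R j).
Local Notation Slog := (@Slog R j).
Local Notation wlog := (@wlog R j).

Lemma ln_large (T : R) : exists2 N, (0 < N)%N & forall n, (N <= n)%N -> T <= ln n%:R.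
Proof.
exists (Num.trunc (expR T)).+1 => // n Nn.
have h : expR T < n%:R by apply: lt_le_trans (truncnS_gt _) _; rewrite ler_nat.
by rewrite -[T]expRK ler_ln ?posrE ?expR_gt0 ?(lt_trans (expR_gt0 T) h) // ltW.
Qed.

Lemma Re_scale (z : R[i]) (c : R) : complex.Re (z * c%:C%C) = complex.Re z * c.
Proof. by case: z => a b /=; rewrite mulr0 subr0. Qed.

Lemma dist_le2 (x y z e : R) : `|x - y| <= e -> `|y - z| <= e -> `|x - z| <= 2 * e.
Proof. by move=> h1 h2; rewrite -(subrKA y) (le_trans (ler_normD _ _)) // mulr_natl lerD. Qed.

Lemma expR_near1 (x e : R) : 0 <= e <= 1 -> `|expR x - 1| <= e / 4 -> `|x| <= e.
Proof.
move=> /andP[e0 e1]; rewrite !ler_norml => /andP[h1 h2].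
have h3 := expR_ge1Dx x; have h4 := expR_ge1Dx (- x).
have h5 : expR (- x) * expR x = 1 by rewrite -expRD addNr expR0.
have h6 := expR_gt0 x; apply/andP; split; last by move: h2 h3 e0; clear; lra.
rewrite lerNl; move: h1 h4 h5 h6; move: (expR x) (expR (- x)) => a b h1 h4 h5 h6.
have h7 : 1 - e / 4 <= a by move: h1; clear; lra.
have b0 : 0 < b by rewrite -(pmulr_lgt0 _ h6) h5.
have h8 := ler_wpM2l (ltW b0) h7; rewrite h5 in h8.
suff : b <= 1 + e by move: h4; clear; lra.
rewrite -(ler_pM2l (_ : 0 < 1 - e / 4)); last by move: e1; clear; lra.
rewrite mulrC; apply: (le_trans h8); clear -e0 e1; nra.
Qed.

(* The functions [|x_n| ^ (1 / ln n)] are uniformly Lipschitz by Cauchy's estimate, so their limit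
   along the basin determines the decay rate of the first coordinate at a limit point of the basin. *)
Lemma basin_closed (V : normedModType R[i]) (q : V) (pi : V -> X2) (d : R) N0 : 0 < d -> nice (nball q d) pi ->
  (forall v n, nball q d v -> (N0 <= n)%N -> nm (iter n G (pi v)) <= 1) ->
  vanishes (pi q) -> (pi q).1 != 0 ->
  (forall e : R, 0 < e -> exists2 v, nball q e v & basin (pi v)) -> basin (pi q).
Proof.
move=> d0 npi le1 van x0 cl.
case: (posnP j) => [j0|jp]; first exact: basin_j0.
have [K K0 HK] := nice_dist npi.
pose b := nm ((pi q).1 : R[i]); have b0 : 0 < b by rewrite nm_gt0.
(* On this smaller ball [|x_0| >= b / 2], so [|x_n| <= 1] bounds [Re Slog] from above, and thereby
   the functions [h n] uniformly in [n]. *)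
pose r := Num.min d (b / (2 * K)); have r0 : 0 < r by rewrite lt_min d0 divr_gt0 // mulr_gt0.
have rd v : nball q r v -> nball q d v by move=> h; apply: lt_le_trans h _; rewrite ge_min lexx.
have lo v : nball q r v -> b / 2 <= nm ((pi v).1 : R[i]).
  move=> hv; have h1 : dist (pi v) (pi q) <= K * dist v q := HK q v (nball0 q d0) (rd v hv).
  have h2 := dist_fst (pi v) (pi q); have h3 := nm_distC ((pi q).1 : R[i]) (pi v).1.
  have h4 : dist v q <= b / (2 * K) by apply: le_trans (ltW hv) _; rewrite ge_min lexx orbT.
  rewrite ler_pdivlMr ?mulr_gt0 // in h4.
  by move: h1 h2 h3 h4; rewrite -/b; clear -K0; lra.
pose B := `|ln (2 / b)|.
have ReS v n : nball q r v -> (N0 <= n)%N -> complex.Re (Slog n (pi v)) <= B.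
  move=> hv Nn; have := le1 v n (rd v hv) Nn => h; have := dist_fst (iter n G (pi v)) 0.
  rewrite /dist !subr0 => /le_trans/(_ h); rewrite iter_fst nmM nm_cexp => h1.
  have h2 : expR (complex.Re (Slog n (pi v))) <= 2 / b.
    rewrite ler_pdivlMr //; have := ler_wpM2r (expR_ge0 (complex.Re (Slog n (pi v)))) (lo v hv).
    by move: h1; clear; lra.
  apply: le_trans (ler_norm _); rewrite -ler_expR lnK // posrE divr_gt0 //.
(* A holomorphic version of [(x_n / x_0)^(1 / ln n)]; on the basin its modulus tends to
   [e^(- alpha)]. *)
pose h n v : C := cexp (Slog n (pi v) * ((ln n%:R)^-1)%:C%C).
have nmh n v : nm (h n v) = expR (complex.Re (Slog n (pi v)) / ln n%:R) by rewrite /h nm_cexp Re_scale.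
have nh n : nice (nball q r) (h n).
  apply: nice_exp; apply: niceM (nice_cst _ _).
  exact: (nice_entire (nice_sub rd npi) (Slog_entire j n)).
have [N1 N10 HN1] := ln_large 1.
have hM n v : (N0 + N1 <= n)%N -> nball q r v -> nm (h n v) <= expR B.
  move=> Nn hv; rewrite nmh ler_expR.
  have l1 := HN1 n (leq_trans (leq_addl _ _) Nn); have s1 := ReS v n hv (leq_trans (leq_addr _ _) Nn).
  rewrite ler_pdivrMr ?(lt_le_trans ltr01 l1) // (le_trans s1) // ler_peMr ?normr_ge0 //.
pose L := expR B * (1 + 8 / r + 64 / r ^+ 2).
have L0 : 0 <= L by rewrite mulr_ge0 ?expR_ge0 // !addr_ge0 // divr_ge0 ?sqr_ge0 // ltW.
have lip n v : (N0 + N1 <= n)%N -> nball q (r / 4) v -> nm (h n v - h n q) <= L * nm (v - q).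
  move=> Nn hv; have [D [K' t]] := nh n; have [_ t2] := cauchy_tayl r0 t (hM n ^~ Nn).
  by have [_ _ _ /(_ v hv)[]] := t2 q (nball0 q (divr_gt0 r0 (ltr0n _ 4))).
(* [al] is [alpha], and [e] is half of the tolerance [1 / (100 J)] of [fst_rate]: one half for the
   error of the exponent, the other for the factor [|x_0|]. *)
pose al : R := zal%:~R / (100 * J)%:R; pose e : R := (200 * J)%:R^-1.
have J1 : 1 <= J%:R :> R by rewrite ler1n.
have e0 : 0 < e by rewrite invr_gt0 ltr0n.
have e1 : e <= 1 by rewrite invf_le1 ?ltr0n // ler1n.
(* One [s] pays for the passage from [q] to the basin point [v], another for the convergence of
   [|h n v|] to [e^(- alpha)]; together they are a relative error [e / 4], as [expR_near1]
   demands. *)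
pose s := expR (- al) * (e / 8); have s0 : 0 < s by rewrite mulr_gt0 ?expR_gt0 // divr_gt0.
have L1 : 0 < L + 1 by rewrite ltr_wpDl.
have eta0 : 0 < Num.min (r / 4) (s / (L + 1)) by rewrite lt_min !divr_gt0.
have [v hv bv] := cl _ eta0.
have hv4 : nball q (r / 4) v by apply: lt_le_trans hv _; rewrite ge_min lexx.
have hvs : L * nm (v - q) <= s.
  have : nm (v - q) <= s / (L + 1) by apply: le_trans (ltW hv) _; rewrite ge_min lexx orbT.
  rewrite ler_pdivlMr // => h1; apply: le_trans h1; rewrite mulrC ler_wpM2l ?nm_ge0 //; clear; lra.
have [N2 HN2] := LamP bv ltr01.
pose Cv := nm (Lam j (pi v)) + 1; have Cv0 : 0 < Cv by rewrite ltr_wpDl ?nm_ge0.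
have Rew n : (N2 <= n)%N -> `|complex.Re (wlog n (pi v))| <= Cv.
  move=> Nn; apply: le_trans (Re_le_nm _) _; have := HN2 n Nn.
  by have := nm_dist (wlog n (pi v)) (Lam j (pi v)); rewrite /Cv; clear; lra.
have [N3 N30 HN3] := ln_large (Cv * (16 / e)); have [N4 N40 HN4] := ln_large (`|ln b| / e).
apply: (@fst_rate_basin _ _ (pi q) (N0 + N1 + N2 + N3 + N4)%N) => // n Nn.
have [Nn01 Nn1 Nn2 [Nn3 Nn4]] : [/\ (N0 + N1 <= n)%N, (N1 <= n)%N, (N2 <= n)%N & (N3 <= n)%N /\ (N4 <= n)%N].
  by split=> //; first [split|idtac]; move: Nn; clear; lia.
have l1 := HN1 n Nn1; have lp : 0 < ln n%:R := lt_le_trans ltr01 l1.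
pose th := complex.Re (wlog n (pi v)) / ln n%:R.
have th_le : `|th| <= e / 16.
  rewrite /th normrM normfV (gtr0_norm lp) ler_pdivrMr // mulrC -ler_pdivrMr ?divr_gt0 // invf_div.
  by rewrite (le_trans _ (HN3 n Nn3)) // ler_wpM2r ?Rew // divr_ge0 // ltW.
have hvE : nm (h n v) = expR (- al) * expR th.
  rewrite nmh -expRD; congr expR; rewrite /th /wlog raddfD /= mulrDl (_ : lnal j n / ln n%:R = al); first by ring.
  by rewrite /lnal mulrAC mulfV ?mul1r // gt_eqF.
have th2 : `|expR th - 1| <= e / 8.
  have th1 : `|th| <= 1 / 2 by apply: le_trans th_le _; move: e1; clear; lra.
  have := expR_sub1_le th1; have sq : th ^+ 2 = `|th| ^+ 2 by rewrite real_normK ?num_real.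
  have sq2 : `|th| ^+ 2 <= `|th| * (1 / 2) by rewrite expr2 ler_wpM2l.
  rewrite sq => hh; have := ler_normD (expR th - 1 - th) th; rewrite subrK.
  by move: hh th_le sq2; clear; lra.
have lp1 := lip n v Nn01 hv4.
pose t := complex.Re (Slog n (pi q)) / ln n%:R.
have main : `|expR (t + al) - 1| <= e / 4.
  have ea := expR_gt0 (- al); rewrite -(ler_pM2l ea) -{1}(gtr0_norm ea) -normrM mulrBr mulr1 -expRD [- al + _]addrC addrK.
  have -> : expR t = nm (h n q) by rewrite nmh.
  have a1 : `|nm (h n q) - nm (h n v)| <= s.
    apply: (@le_trans _ _ (nm (h n v - h n q))); last exact: le_trans lp1 hvs.
    have d1 := nm_distC (h n q) (h n v); have d2 := nm_dist (h n v) (h n q).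
    by rewrite ler_norml d1 andbT lerNl opprB.
  have a2 : `|nm (h n v) - expR (- al)| <= s.
    by rewrite hvE -{2}[expR (- al)]mulr1 -mulrBr normrM (gtr0_norm ea) ler_wpM2l // ltW.
  have -> : expR (- al) * (e / 4) = 2 * s by rewrite /s; move: (expR _) => w; field.
  exact: dist_le2 a1 a2.
have := expR_near1 (_ : 0 <= e <= 1) main; rewrite (ltW e0) e1 => /(_ isT) tal.
have bE : b = expR (ln b) by rewrite lnK.
have lb : `|ln b| <= e * ln n%:R by rewrite mulrC -ler_pdivrMr // HN4.
have xE : nm ((iter n G (pi q)).1 : R[i]) = expR (ln b + ln n%:R * t).
  by rewrite iter_fst nmM nm_cexp expRD -bE /t mulrCA mulfV ?mulr1 // gt_eqF.
have e2 : (100 * J)%:R^-1 = 2 * e.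
  by rewrite /e !natrM; field; rewrite gt_eqF // (lt_le_trans ltr01).
rewrite xE !pwE !ler_expR !rmorphD !rmorphN rmorph1 /= !mulrDl mulNr !mul1r mulN1r -/al e2 ler_norml in tal lb *.
rewrite ler_norml in lb; move: tal lb => /andP[t1 t2] /andP[b1 b2].
have t3 := ler_wpM2l (ltW lp) t1; have t4 := ler_wpM2l (ltW lp) t2.
move: t3 t4 b1 b2; rewrite !mulrDr !mulrN; move: (ln n%:R * t) (ln n%:R * al) => x y.
by rewrite (mulrC e) mulrCA; move: (ln n%:R * e) => z; clear => *; apply/andP; split; lra.
Qed.

End Endgame.

(** * Normal families *)

Section Normal.
Context {R : realType} {V : normedModType R[i]}.
Implicit Types (x y z q : V) (A U F : set V) (f G : V -> V).

Definition ucvg A (h : nat -> V -> V) g := forall e : R, 0 < e -> exists N, forall n x, (N <= n)%N -> A x -> nm (h n x - g x) < e.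

Lemma entourage_nm (E : set (V * V)) : entourage E <-> exists2 e : R, 0 < e & forall x y, nm (x - y) < e -> E (x, y).
Proof.
rewrite -entourage_ballE; split=> [[e /= e0 sub]|[e e0 sub]].
  have ee : e = (complex.Re e)%:C%C by rewrite RRe_real // gtr0_real.
  exists (complex.Re e) => [|x y xy]; first by rewrite -ltcR -ee.
  by apply: sub => /=; rewrite -ball_normE /ball_ /= nmE ee ltcR.
exists (e%:C)%C => [|[x y]] /=; first by rewrite ltcR.
by rewrite -ball_normE /ball_ /= nmE ltcR; apply: sub.
Qed.

Lemma uniform_ucvg A (h : nat -> V -> V) g : {uniform A, h @ \oo --> g} <-> ucvg A h g.
Proof.
split=> [H e e0|H P /uniform_nbhs[E [/entourage_nm[e e0 sE] sub]]].
  have : nbhs (g : {uniform` A -> V}) [set f | forall y, A y -> nm (f y - g y) < e].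
    apply/uniform_nbhs; exists [set xy | nm (xy.2 - xy.1) < e]; split=> //.
    by apply/entourage_nm; exists e => // x y; rewrite nmB.
  by move=> /H[N _ HN]; exists N => n x Nn; exact: HN n Nn x.
have [N HN] := H e e0; exists N => // n Nn; apply: sub => y Ay; apply: sE.
by rewrite nmB; exact: HN.
Qed.

Lemma compactly_convergesP U (h : nat -> V -> V) g : compactly_converges U h g <-> forall K, compact K -> K `<=` U -> ucvg K h g.
Proof.
split=> [/fam_cvgP H K cK KU|H]; first by apply/uniform_ucvg; apply: H; split.
by apply/fam_cvgP => K [cK KU]; apply/uniform_ucvg; exact: H.
Qed.

Lemma seq_compact (u : nat -> V) x : (forall e : R, 0 < e -> exists N, forall n, (N <= n)%N -> nm (u n - x) < e) ->
  compact ([set x] `|` range u).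
Proof.
move=> ux; apply/compact_near_coveringP => I F P FF H.
have [/= [A B] [/nbhs_nm[e e0 sA] FB] sub] := H x (or_introl erefl).
have [N HN] := ux e e0.
have cN : compact (u @` `I_N) by apply: finite_compact; apply: finite_image; exact: finite_II.
have HC : \near F, u @` `I_N `<=` P F.
  move/compact_near_coveringP: cN; apply=> // _ [n _ <-]; apply: H; by right; exists n.
apply: filterS2 FB HC => i Bi Ci y [->|[n _ <-]].
  by apply: (sub (x, i)); split=> //=; apply: sA; rewrite subrr nm0.
case: (ltnP n N) => nN; first by apply: Ci; exists n.
by apply: (sub (u n, i)); split=> //=; apply: sA; exact: HN.
Qed.

Lemma open_nbhs_nm U z : open_nbhs z U -> exists2 d : R, 0 < d & forall y, nm (y - z) < d -> U y.
Proof. by rewrite open_nbhsE => -[_ /nbhs_nm]. Qed.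

Lemma nball_open z (d : R) : open (nball z d).
Proof.
rewrite openE => y yz; apply/nbhs_nm; exists (d - nm (y - z)) => [|x]; first by rewrite subr_gt0.
by rewrite /nball /=; have := nm_tri y x z; lra.
Qed.

Lemma closure_nm A q : closure A q <-> forall e : R, 0 < e -> exists2 v, nball q e v & A v.
Proof.
split=> [H e e0|H B /nbhs_nm[e e0 sB]].
  have [v [Av vq]] : A `&` nball q e !=set0 by apply: H; apply/nbhs_nm; exists e.
  by exists v.
by have [v vq Av] := H e e0; exists v; split=> //; exact: sB.
Qed.

(** A sequence of iterates either takes one exponent infinitely often, and has a constant
    subsequence, or its exponents tend to infinity, and it converges to 0 itself. *)
Lemma fatou_of_ucvg G z (d : R) : 0 < d -> ucvg (nball z d) (fun n => iter n G) (cst 0) -> fatou_set G z.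
Proof.
move=> d0 H; exists (nball z d).
  by rewrite open_nbhsE; split; [exact: nball_open|apply/nbhs_nm; exists d].
move=> h Hh; have /choice[m hm] : forall n, exists m, iter m G = h n by move=> n; have [m _ <-] := Hh n; exists m.
case: (pselect (exists a, forall N, exists n, (N <= n)%N /\ m n = a)) => [[a /choice[f Hf]]|nex].
  pose s := fix s n := if n is n'.+1 then f (s n').+1 else f 0%N.
  exists s.
    apply: homo_ltn => [n l k|n]; first exact: ltn_trans.
    by have [] := Hf (s n).+1.
  left; exists (iter a G); apply/compactly_convergesP => K _ _ e e0; exists 0%N => n x _ _ /=.
  have ma : m (s n) = a by case: n => [|n]; [have [] := Hf 0%N|have [] := Hf (s n).+1].
  by rewrite -hm ma subrr nm0.
exists id => //; left; exists (cst 0); apply/compactly_convergesP => K _ KU e e0.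
have [N HN] := H e e0.
have [M HM] : exists M, forall n, (M <= n)%N -> (N <= m n)%N.
  elim: (N) => [|b [M HM]]; first by exists 0%N.
  have [M' HM'] : exists M', forall n, (M' <= n)%N -> m n <> b.
    apply: contrapT => nM; apply: nex; exists b => M'; apply: contrapT => nn; apply: nM; exists M' => n Mn mb.
    by apply: nn; exists n.
  exists (M + M')%N => n Mn; rewrite ltn_neqAle HM ?andbT; last by move: Mn; clear; lia.
  by apply/eqP => /esym; apply: HM'; move: Mn; clear; lia.
by exists M => n x Mn Kx /=; rewrite -hm; apply: HN; [exact: HM|exact: KU].
Qed.

(* Otherwise normality, applied to iterates that are large at points tending to [q], fails on the compact
   set formed by these points, by [q] and by a sequence of points of [A] tending to [q]. *)
Lemma fatou_closure G A q : (forall n x (e : R), 0 < e -> exists2 d : R, 0 < d & forall y, nm (y - x) < d -> nm (iter n G y - iter n G x) < e) ->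
  (forall v, A v -> forall e : R, 0 < e -> exists N, forall n, (N <= n)%N -> nm (iter n G v) < e) ->
  fatou_set G q -> closure A q ->
  forall e : R, 0 < e -> exists2 d : R, 0 < d & exists N, forall v n, nball q d v -> (N <= n)%N -> nm (iter n G v) <= e.
Proof.
move=> Gc Aat [U oU nU] /closure_nm clA e e0; apply: contrapT => nex.
have [d0 d00 sU] := open_nbhs_nm oU.
pose del (i : nat) : R := Num.min d0 (i.+1%:R^-1).
have del0 i : 0 < del i by rewrite lt_min d00 invr_gt0 ltr0n.
have lim0 (u : nat -> V) : (forall i, nm (u i - q) < del i) ->
    (forall e : R, 0 < e -> exists N, forall n, (N <= n)%N -> nm (u n - q) < e) /\ range u `<=` U.
  move=> Hu; split=> [e' e'0|_ [i _ <-]]; last first.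
    by apply: sU; apply: lt_le_trans (Hu i) _; rewrite ge_min lexx.
  exists (Num.trunc (e'^-1)) => n Nn; apply: lt_le_trans (Hu n) _; rewrite ge_min; apply/orP; right.
  rewrite invf_ple ?posrE //; apply: le_trans (ltW (truncnS_gt _)) _; by rewrite ler_nat ltnS.
have /choice[w Hw] : forall i, exists w : V * nat, [/\ nm (w.1 - q) < del i, (i <= w.2)%N & e < nm (iter w.2 G w.1)].
  move=> i; apply: contrapT => nw; apply: nex; exists (del i) => //; exists i => v n vq Nn.
  by rewrite leNgt; apply/negP => h; apply: nw; exists (v, n).
have /choice[a Ha] : forall i, exists a, nm (a - q) < del i /\ A a.
  by move=> i; have [a aq Aa] := clA _ (del0 i); exists a.
have [wl wU] := lim0 (fun i => (w i).1) (fun i => let: And3 h _ _ := Hw i in h).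
have [al aU] := lim0 a (fun i => (Ha i).1).
have qU : U q by apply: sU; rewrite subrr nm0.
have [s sm lim] := nU (fun i => iter (w i).2 G) (fun i => ex_intro2 _ _ (w i).2 I erefl).
have ss n : (n <= s n)%N.
  elim: n => // n IH; apply: (leq_ltn_trans IH); exact: sm.
have big n : (n <= (w (s n)).2)%N by have [_ h _] := Hw (s n); exact: leq_trans (ss n) h.
have small v (e' : R) : A v -> 0 < e' -> exists N, forall n, (N <= n)%N -> nm (iter (w (s n)).2 G v) < e'.
  by move=> Av e'0; have [N HN] := Aat v Av e' e'0; exists N => n Nn; apply: HN; exact: leq_trans (big n).
(* A limit [g] is small at the points [a i], hence at [q], hence at the nearby points [w], where the
   iterates are large. Locally uniform divergence is excluded by the orbit of [a 0], which converges
   to 0. *)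
case: lim => [[g /compactly_convergesP Hg]|dv].
  have aqU : [set q] `|` range a `<=` U by move=> y [->//|/aU].
  have wqU : [set q] `|` range (fun i => (w i).1) `<=` U by move=> y [->//|/wU].
  have c0 : 0 < e / 16 by rewrite divr_gt0.
  have [N1 HN1] := Hg _ (seq_compact al) aqU _ c0.
  have [N2 HN2] := Hg _ (seq_compact wl) wqU _ c0.
  have ga i : nm (g (a i)) < 2 * (e / 16).
    have [N HN] := small (a i) _ (Ha i).2 c0; have h1 := HN (N + N1)%N (leq_addr _ _).
    have h2 := HN1 (N + N1)%N (a i) (leq_addl _ _) (or_intror (ex_intro2 _ _ i I erefl)).
    have h3 := nm_distC (g (a i)) (iter (w (s (N + N1)%N)).2 G (a i)).
    by move: h1 h2 h3 => /=; lra.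
  have gq : nm (g q) < 5 * (e / 16).
    have [d1 d10 Hd1] := Gc (w (s N1)).2 q _ c0; have [N HN] := al _ d10.
    have h1 := Hd1 _ (HN N (leqnn N)).
    have h2 := HN1 N1 (a N) (leqnn _) (or_intror (ex_intro2 _ _ N I erefl)).
    have h3 := HN1 N1 q (leqnn _) (or_introl erefl); have h4 := ga N.
    have h5 := nm_distC (g q) (iter (w (s N1)).2 G q).
    have h6 := nm_dist (iter (w (s N1)).2 G (a N)) (g (a N)).
    have h7 := nm_distC (iter (w (s N1)).2 G q) (iter (w (s N1)).2 G (a N)).
    by move: h1 h2 h3 h4 h5 h6 h7 => /=; lra.
  have [d1 d10 Hd1] := Gc (w (s N2)).2 q _ c0; have [N HN] := wl _ d10.
  pose n := (N + N2)%N; have nN2 : (N2 <= n)%N by exact: leq_addl.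
  have [_ _] := Hw (s n); set v := (w (s n)).1 => ev.
  have vr : ([set q] `|` range (fun i => (w i).1)) v by right; exists (s n).
  have h1 : nm (iter (w (s N2)).2 G v - iter (w (s N2)).2 G q) < e / 16.
    by apply/Hd1/HN; exact: leq_trans (leq_addr _ _) (ss n).
  have h2 := HN2 N2 v (leqnn _) vr; have h3 := HN2 N2 q (leqnn _) (or_introl erefl); have h4 := HN2 n v nN2 vr.
  have h5 := nm_dist (iter (w (s n)).2 G v) (g v); have h6 := nm_distC (g v) (iter (w (s N2)).2 G v).
  have h7 := nm_dist (iter (w (s N2)).2 G v) (iter (w (s N2)).2 G q).
  have h8 := nm_dist (iter (w (s N2)).2 G q) (g q).
  by move: h1 h2 h3 h4 h5 h6 h7 h8 gq ev => /=; lra.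
have v0U : [set a 0%N] `<=` U by move=> _ ->; apply: aU; exists 0%N.
have c0 : compact [set a 0%N] by exact: compact_set1.
have cL : compact ([set 0] `|` range (fun n => iter (w (s n)).2 G (a 0%N))).
  by apply: seq_compact => e' e'0; have [N HN] := small _ e' (Ha 0%N).2 e'0; exists N => n Nn; rewrite subr0; exact: HN.
have [N _ HN] := dv _ _ (conj c0 v0U) cL.
have := HN N (leqnn N); rewrite -subset0 => /(_ (iter (w (s N)).2 G (a 0%N))); apply.
by split; [exists (a 0%N)|right; exists N].
Qed.

Lemma component_clopen F A z : connected A -> A `<=` F -> A z -> open A -> closure A `&` F `<=` A ->
  connected_component F z = A.
Proof.
move=> cA AF Az oA clA; apply/seteqP; split; last exact: connected_component_max.
set C := connected_component F z.
have CF : C `<=` F by exact: connected_component_sub.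
have <- : C `&` A = C.
  apply: (component_connected (A := F) (x := z)); first by exists z; split=> //; apply: connected_component_refl; exact: AF.
    by exists A.
  exists (closure A); first exact: closed_closure.
  apply/seteqP; split=> y [Cy Ay]; split=> //; first exact: subset_closure.
  by apply: clA; split=> //; exact: CF.
by move=> y [].
Qed.

Lemma locally_ucvg_attracted G A : (forall z, A z -> exists2 d : R, 0 < d & ucvg (nball z d) (fun n => iter n G) (cst 0)) ->
  attracted_to G A 0.
Proof.
move=> H; apply/compactly_convergesP => K cK KA e e0.
have : \forall n \near \oo, K `<=` [set x | nm (iter n G x - cst 0 x) < e].
  move/compact_near_coveringP: cK; apply=> x Kx.
  have [d d0 Hd] := H x (KA x Kx); have [N HN] := Hd e e0.
  exists (nball x d, [set n | (N <= n)%N]); first by split; [apply/nbhs_nm; exists d|exists N].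
  by move=> [y n] [/= yd Nn]; exact: HN.
by move=> [N _ HN]; exists N => n x Nn Kx; exact: HN.
Qed.

End Normal.

(** * Taylor bounds near a point *)

Section NiceAt.
Context {R : realType}.
Local Notation C := (R[i]^o).
Implicit Types (V W U : normedModType R[i]).

Definition nice_at V W (x : V) (f : V -> W) := exists2 d : R, 0 < d & nice (nball x d) f.

Lemma nball_le V (x : V) (a b : R) : a <= b -> nball x a `<=` nball x b.
Proof. by move=> ab y ya; exact: lt_le_trans ya ab. Qed.

Lemma nice_at_sub V W (x : V) (f : V -> W) (d : R) : 0 < d -> nice_at x f ->
  exists2 d' : R, 0 < d' <= d & nice (nball x d') f.
Proof.
move=> d0 [d1 d10 nf]; exists (Num.min d d1); first by rewrite lt_min d0 d10 ge_min lexx.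
by apply: nice_sub nf; apply: nball_le; rewrite ge_min lexx orbT.
Qed.

Lemma nice_at_fin V W (x : V) n (F : 'I_n -> V -> W) : (forall i, nice_at x (F i)) ->
  exists2 d : R, 0 < d & forall i, nice (nball x d) (F i).
Proof.
move=> H; suff [d d0 Hd] : exists2 d : R, 0 < d & forall i, i \in enum 'I_n -> nice (nball x d) (F i).
  by exists d => // i; apply: Hd; rewrite mem_enum.
elim: (enum 'I_n) => [|i s [d d0 IH]]; first by exists 1.
have [d' /andP[d'0 d'd] nf] := nice_at_sub d0 (H i); exists d' => // l; rewrite inE => /predU1P[->//|/IH].
by apply: nice_sub; exact: nball_le.
Qed.

Lemma nice_at_both V W U (x : V) (f : V -> W) (g : V -> U) : nice_at x f -> nice_at x g ->
  exists2 d : R, 0 < d & nice (nball x d) f /\ nice (nball x d) g.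
Proof.
move=> nf [d d0 ng]; have [d' /andP[d'0 d'd] nf'] := nice_at_sub d0 nf.
by exists d' => //; split=> //; apply: nice_sub ng; exact: nball_le.
Qed.

Lemma nice_at_entire V W (x : V) (f : V -> W) : entire f -> nice_at x f.
Proof. by move=> ef; exists 1 => //; exact: entire_nice. Qed.

Lemma nice_at_cst V W (x : V) (c : W) : nice_at x (fun=> c).
Proof. by exists 1 => //; exact: nice_cst. Qed.

Lemma nice_at_pair V W U (x : V) (f : V -> W) (g : V -> U) : nice_at x f -> nice_at x g -> nice_at x (fun v => (f v, g v)).
Proof. by move=> nf ng; have [d d0 [h1 h2]] := nice_at_both nf ng; exists d => //; exact: nice_pair. Qed.

Lemma nice_atM V (x : V) (f g : V -> C) : nice_at x f -> nice_at x g -> nice_at x (fun v => f v * g v : C).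
Proof. by move=> nf ng; have [d d0 [h1 h2]] := nice_at_both nf ng; exists d => //; exact: niceM. Qed.

Lemma nice_at_exp V (x : V) (f : V -> C) : nice_at x f -> nice_at x (fun v => cexp (f v) : C).
Proof. by move=> [d d0 nf]; exists d => //; exact: nice_exp. Qed.

Lemma nice_at_row V (x : V) n (F : 'I_n -> V -> C) : (forall i, nice_at x (F i)) -> nice_at x (fun v => \row_i F i v : 'rV[R[i]]_n).
Proof. by move=> /nice_at_fin[d d0 H]; exists d => //; exact: nice_row. Qed.

Lemma nice_at_lim V W (x : V) (f : V -> W) : nice_at x f ->
  forall e : R, 0 < e -> exists2 d : R, 0 < d & forall y, nm (y - x) < d -> nm (f y - f x) < e.
Proof.
move=> [d d0 nf] e e0; have [K K0 HK] := nice_dist nf.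
exists (Num.min d (e / K)) => [|y]; rewrite ?lt_min ?d0 ?divr_gt0 // => /andP[yd ye].
apply: le_lt_trans (HK x y (nball0 x d0) yd) _; rewrite mulrC -ltr_pdivlMr //.
Qed.

Lemma nice_at_inv V (x : V) (f : V -> C) : nice_at x f -> f x != 0 -> nice_at x (fun v => (f v)^-1 : C).
Proof.
move=> nf f0; have c0 : 0 < nm (f x : R[i]) / 2 by rewrite divr_gt0 // nm_gt0.
have [d d0 Hd] := nice_at_lim nf c0; have [d' /andP[d'0 d'd] nf'] := nice_at_sub d0 nf.
exists d' => //; apply: (nice_inv c0 _ nf') => y yd.
by have := Hd y (lt_le_trans yd d'd); have := nm_distC (f x : R[i]) (f y); lra.
Qed.

Lemma nice_at_comp U V W (x : U) (f : U -> V) (g : V -> W) : nice_at x f -> nice_at (f x) g -> nice_at x (fun u => g (f u)).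
Proof.
move=> nf [d d0 ng]; have [d1 d10 Hd] := nice_at_lim nf d0; have [d2 /andP[d20 d21] nf'] := nice_at_sub d10 nf.
by exists d2 => //; apply: (nice_comp nf' ng) => y yd; apply: Hd; exact: lt_le_trans yd d21.
Qed.

Lemma nice_at_differentiable V W (x : V) (f : V -> W) : nice_at x f -> differentiable f x.
Proof. by move=> [d d0]; exact: nice_differentiable. Qed.

End NiceAt.

(** * The lift to higher dimension *)

Section Lift.
Context {R : realType} (d r k e j : nat) (zeta : R[i]) (iy : 'I_d).
(** Divisibility of [j] by [k] gives [y_oo^j] the single-valued [k]-th root [y_oo^e], from which the
    [k]-th root of [x] is built. *)
Context (jke : j = (k * e)%N).
Context (ry : iy = r :> nat).
Context (r0 : (0 < r)%N).
Context (k0 : (0 < k)%N).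
Context (zk : zeta ^+ k = 1).
Local Notation C := (R[i]^o).
Local Notation X2 := (C * C)%type.
Local Notation V := ('rV[R[i]]_d).
Local Notation G := (@G R j : X2 -> X2).
Local Notation Gi := (@Ginv R j : X2 -> X2).
Local Notation basin := (@basin R j).
Local Notation Phi := (@Phi R j).
Local Notation Alog := (@Alog R j).
Local Notation Lam := (@Lam R j).
Implicit Types (v w : V) (p : X2) (c : R[i]).

Definition zprod v : R[i] := \prod_(i < d | (i < r)%N) v ord0 i.
Definition hpi v : X2 := (zprod v ^+ k, v ord0 iy).
Definition rt (i : 'I_d) : R[i] := if (i == 0%N :> nat) then zeta else 1.
Definition Afac p : R[i] := cexp (Alog p / (k * r)%:R).
(* The lift of [G] under [hpi]; dividing [Alog] by [k r] distributes the multiplier of [x] over the [r] coordinates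
   whose product to the power [k] is [x], and [zeta] rotates the first of them. *)
Definition Ghat v : V :=
  \row_i if (i < r)%N then v ord0 i * (rt i * Afac (hpi v)) else if i == iy then (G (hpi v)).2 else v ord0 i / 2.
Definition Ghatinv w : V :=
  \row_i if (i < r)%N then w ord0 i * (rt i * Afac (Gi (hpi w)))^-1
  else if i == iy then (Gi (hpi w)).2 else w ord0 i * 2.

Lemma r_lt_d : (r < d)%N. Proof. by rewrite -ry ltn_ord. Qed.

Lemma zeta_neq0 : zeta != 0.
Proof. by apply/eqP => z0; move: zk; rewrite z0 expr0n gtn_eqF // => /esym/eqP; rewrite oner_eq0. Qed.

Lemma rt_neq0 i : rt i != 0.
Proof. by rewrite /rt; case: ifP => _; rewrite ?zeta_neq0 ?oner_neq0. Qed.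

Lemma prod_rt c : \prod_(i < d | (i < r)%N) (rt i * c) = zeta * c ^+ r.
Proof.
rewrite big_split /=; congr (_ * _); last first.
  by rewrite (big_ord_narrow (ltnW r_lt_d)) prodr_const card_ord.
have i0d : (0 < d)%N by apply: leq_ltn_trans r_lt_d.
rewrite (bigD1 (Ordinal i0d)) //= /rt eqxx big1 ?mulr1 // => i /andP[_ /negPf].
by rewrite -val_eqE /= => ->.
Qed.

Lemma AfacX p : Afac p ^+ r = cexp (Alog p / k%:R).
Proof.
rewrite /Afac -cexpMn -mulr_natr; congr cexp; rewrite natrM; field.
by rewrite !pnatr_eq0 -!lt0n k0 r0.
Qed.

Lemma cexp_divX c : cexp (c / k%:R) ^+ k = cexp c.
Proof. by rewrite -cexpMn -(mulr_natr (c / k%:R) k) divfK // pnatr_eq0 -lt0n. Qed.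

Lemma zprod_Ghat v : zprod (Ghat v) = zprod v * (zeta * cexp (Alog (hpi v) / k%:R)).
Proof.
rewrite /zprod -AfacX -prod_rt -big_split /=; apply: eq_bigr => i ir.
by rewrite mxE ir.
Qed.

Lemma Ghat_y v : (Ghat v) ord0 iy = (G (hpi v)).2.
Proof. by rewrite mxE ry ltnn eqxx. Qed.

Lemma hpi_Ghat v : hpi (Ghat v) = G (hpi v).
Proof.
rewrite /hpi zprod_Ghat Ghat_y [RHS]surjective_pairing; congr pair.
by rewrite exprMn [(zeta * _) ^+ k]exprMn zk mul1r cexp_divX -/(hpi v) (G_fst j (hpi v)).
Qed.

Lemma hpi_Ghatinv w : hpi (Ghatinv w) = Gi (hpi w).
Proof.
set p := Gi (hpi w); have Gp : G p = hpi w by exact: GinvK.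
rewrite /hpi [RHS]surjective_pairing; congr pair; last by rewrite mxE ry ltnn eqxx.
have -> : zprod (Ghatinv w) = zprod w * (zeta * cexp (Alog p / k%:R))^-1.
  rewrite /zprod -AfacX -prod_rt -prodfV -big_split /=; apply: eq_bigr => i ir.
  by rewrite mxE ir.
rewrite exprMn exprVn exprMn zk mul1r cexp_divX.
have -> : zprod w ^+ k = p.1 * cexp (Alog p) by rewrite -(G_fst j p) Gp.
by rewrite mulfK // cexp_neq0.
Qed.

Lemma Afac_neq0 p : Afac p != 0. Proof. exact: cexp_neq0. Qed.

Lemma GhatK : cancel Ghat Ghatinv.
Proof.
move=> v; apply/rowP => i; rewrite mxE hpi_Ghat GK.
have h : rt i * Afac (hpi v) != 0 by rewrite mulf_neq0 ?rt_neq0 ?Afac_neq0.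
case: ifP => ir; first by rewrite mxE ir mulfK.
by case: eqP => [->//|/eqP/negPf ne]; rewrite mxE ir ne divfK // pnatr_eq0.
Qed.

Lemma GhatinvK : cancel Ghatinv Ghat.
Proof.
move=> v; apply/rowP => i; rewrite mxE hpi_Ghatinv GinvK.
have h : rt i * Afac (Gi (hpi v)) != 0 by rewrite mulf_neq0 ?rt_neq0 ?Afac_neq0.
case: ifP => ir; first by rewrite mxE ir divfK.
by case: eqP => [->//|/eqP/negPf ne]; rewrite mxE ir ne mulfK // pnatr_eq0.
Qed.

Lemma zprod_entire : entire (zprod : V -> C).
Proof.
move=> M; have := @nice_prod R V (nball 0 M) 'I_d (index_enum 'I_d) (fun i v => if (i < r)%N then v ord0 i else 1 : C).
move=> H; apply: (nice_eq _ (H _)) => [v _|i]; first by rewrite /zprod [RHS]big_mkcond.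
by case: (i < r)%N; [exact: nice_coord|exact: nice_cst].
Qed.

Lemma coord_entire (i : 'I_d) : entire (fun v : V => v ord0 i : C).
Proof. by move=> M; exact: nice_coord. Qed.

Lemma hpi_entire : entire (hpi : V -> X2).
Proof. by move=> M; apply: nice_pair; [apply: niceX; exact: zprod_entire|exact: coord_entire]. Qed.

Lemma Afac_entire : entire (Afac : X2 -> C).
Proof. by move=> M; apply: nice_exp; apply: niceM (Alog_entire j M) (nice_cst _ _). Qed.

Lemma AfacN_entire : entire (fun p => (Afac p)^-1 : C).
Proof.
move=> M; apply: (nice_eq (f := fun p => cexp (- (Alog p / (k * r)%:R)) : C)) => [p _|]; first by rewrite cexpN.
by apply: nice_exp; apply: niceN; apply: niceM (Alog_entire j M) (nice_cst _ _).
Qed.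

Lemma Ghat_entire : entire (Ghat : V -> V).
Proof.
move=> M; apply: nice_row => i; case: (i < r)%N.
  apply: niceM (coord_entire i M) _; apply: niceM (nice_cst _ _) _.
  exact: (entire_comp hpi_entire Afac_entire).
case: (i == iy); last by apply: niceM (coord_entire i M) (nice_cst _ _).
exact: nice_sndE (entire_comp hpi_entire (@G_entire R j) M).
Qed.

Lemma Ghatinv_entire : entire (Ghatinv : V -> V).
Proof.
have gi : entire (Gi \o hpi : V -> X2) := entire_comp hpi_entire (@Ginv_entire R j).
move=> M; apply: nice_row => i; case: (i < r)%N.
  apply: niceM (coord_entire i M) _.
  apply: (nice_eq (f := fun v => (rt i)^-1 * (Afac (Gi (hpi v)))^-1 : C)) => [v _|]; first exact/esym/invfM.
  apply: niceM (nice_cst _ _) _; exact: (entire_comp gi AfacN_entire).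
case: (i == iy); last by apply: niceM (coord_entire i M) (nice_cst _ _).
exact: nice_sndE (gi M).
Qed.

Lemma Ghat_automorphism : automorphism Ghat.
Proof.
exists Ghatinv; split=> //.
- by split=> x _; apply: entire_differentiable; [exact: Ghat_entire|exact: Ghatinv_entire].
- by move=> v _; exact: GhatK.
- by move=> v _; exact: GhatinvK.
Qed.

(* A holomorphic [k]-th root of [x] on the basin, since [e ^ (- Lam) = x y_oo ^ j] with [y_oo = (Phi p).2]. *)
Definition xi p : R[i] := cexp (- Lam p / k%:R) / (Phi p).2 ^+ e.

Lemma Phi2e_neq0 p : basin p -> (Phi p).2 ^+ e != 0.
Proof. by move=> /cexp_Lam[_]; rewrite {2}jke mulnC exprM expf_eq0 k0. Qed.

Lemma xiX p : basin p -> xi p ^+ k = p.1.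
Proof.
move=> b; have [E y0] := cexp_Lam b; by rewrite /xi expr_div_n cexp_divX cexpN E invrK -exprM (mulnC e) -jke mulfK.
Qed.

Lemma xi_neq0 p : basin p -> xi p != 0.
Proof. by move=> b; rewrite mulf_neq0 ?cexp_neq0 // invr_neq0 ?Phi2e_neq0. Qed.

Lemma xi_G p : basin p -> xi (G p) = xi p * cexp (Alog p / k%:R).
Proof.
move=> b; have [_ PG] := basin_G b.
rewrite /xi PG Lam_G //=.
have -> : - (Lam p - Alog p) / k%:R = - Lam p / k%:R + Alog p / k%:R by ring.
by rewrite cexpD mulrAC.
Qed.

Lemma xi_nice_at p : basin p -> nice_at p (xi : X2 -> C).
Proof.
move=> b; have [d1 d10 [nL _]] := Lam_nice b; have [d2 d20 [N _ [K _ [nP _]]]] := basin_nbhd b.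
apply: nice_atM; first by exists d1 => //; apply: nice_exp; apply: niceM (niceN nL) (nice_cst _ _).
apply: (nice_at_inv (f := fun q => (Phi q).2 ^+ e : C) _ (Phi2e_neq0 b)); exists d2 => //; apply: niceX; exact: nice_sndE nP.
Qed.

Definition branch (om : R[i]) : set V := [set v | basin (hpi v) /\ zprod v = om * xi (hpi v)].

Lemma branch_uniq om om' v : branch om v -> branch om' v -> om = om'.
Proof. by move=> [b h] [_]; rewrite h => /(mulIf (xi_neq0 b)). Qed.

Lemma branch_of v : basin (hpi v) -> exists2 om, om ^+ k = 1 & branch om v.
Proof.
move=> b; exists (zprod v / xi (hpi v)); last by split=> //; rewrite divfK ?xi_neq0.
by rewrite expr_div_n xiX // divff //; exact: basin_neq0 b.
Qed.

Lemma branch_Ghat om v : branch om v -> branch (zeta * om) (Ghat v).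
Proof.
move=> [b E]; split; rewrite hpi_Ghat; first by have [] := basin_G b.
by rewrite zprod_Ghat E xi_G //; ring.
Qed.

Lemma branch_Ghatinv om v : branch (zeta * om) v -> branch om (Ghatinv v).
Proof.
move=> cv; have b : basin (hpi (Ghatinv v)) by rewrite hpi_Ghatinv; apply: basin_Gi; case: cv.
have [om' _ c'] := branch_of b; have := branch_Ghat c'; rewrite GhatinvK => c2.
by have /(mulfI zeta_neq0) -> := branch_uniq cv c2.
Qed.

Lemma iter_branch n om : iter n Ghat @` branch om = branch (zeta ^+ n * om).
Proof.
elim: n => [|n IH]; first by rewrite expr0 mul1r; apply/seteqP; split=> [_ [v cv <-//]|v cv]; exists v.
have -> : iter n.+1 Ghat @` branch om = Ghat @` (iter n Ghat @` branch om).
  by apply/seteqP; split=> [_ [v cv <-]|_ [_ [v cv <-] <-]]; [exists (iter n Ghat v) => //|]; exists v.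
rewrite IH exprS -mulrA; apply/seteqP; split=> [_ [v cv <-]|v cv]; first exact: branch_Ghat.
by exists (Ghatinv v); [exact: branch_Ghatinv|exact: GhatinvK].
Qed.

End Lift.

Lemma half_lower (R : realType) (a b c : R) : a - b <= c -> c < a / 2 -> a / 2 <= b.
Proof. lra. Qed.

Lemma half_lt (R : realType) (a : R) : 0 < a -> a / 2 < a.
Proof. lra. Qed.

(** * The Fatou components of the lift *)

Section LiftFatou.
Context {R : realType} (d r k e j : nat) (zeta : R[i]) (iy : 'I_d).
Context (jke : j = (k * e)%N).
Context (ry : iy = r :> nat).
Context (r0 : (0 < r)%N).
Context (k0 : (0 < k)%N).
Context (zk : zeta ^+ k = 1).
Local Notation C := (R[i]^o).
Local Notation X2 := (C * C)%type.
Local Notation V := ('rV[R[i]]_d).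
Local Notation G := (@G R j : X2 -> X2).
Local Notation Gi := (@Ginv R j : X2 -> X2).
Local Notation basin := (@basin R j).
Local Notation vanishes := (@vanishes R j).
Local Notation Phi := (@Phi R j).
Local Notation Alog := (@Alog R j).
Local Notation Slog := (@Slog R j).
Local Notation pw := (@pw R j).
Local Notation zprod := (@zprod R d r).
Local Notation hpi := (@hpi R d r k iy).
Local Notation Ghat := (@Ghat R d r k j zeta iy).
Local Notation rt := (@rt R d zeta).
Local Notation xi := (@xi R k e j).
Local Notation branch := (@branch R d r k e j iy).
Local Notation Vn := ('rV[R[i]]_d : normedModType R[i]).
Implicit Types (v w q : V) (p : X2) (c om : R[i]).

Lemma nm_unity_root c : c ^+ k = 1 -> nm c = 1.
Proof.
move=> ck; apply/eqP; rewrite -(@pexpr_eq1 _ _ k) ?nm_ge0 //; apply/eqP.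
by rewrite -nmX ck nm1.
Qed.

(** The powers of a [k]-th root of unity other than 1 sum to 0, whereas here each of the [k]
    summands would be within distance less than 1 of 1. *)
Lemma unity_root_sep c : c ^+ k = 1 -> nm (c - 1) < k%:R^-1 -> c = 1.
Proof.
move=> ck c1; apply/eqP; rewrite -subr_eq0; apply/negPn/negP => cn1.
have geo : \sum_(i < k) c ^+ i = 0.
  by apply: (mulfI cn1); rewrite mulr0 -subrX1 ck subrr.
have b i : nm (c ^+ i - 1) <= i%:R * nm (c - 1).
  elim: i => [|i IH]; first by rewrite expr0 subrr nm0 mul0r.
  have -> : c ^+ i.+1 - 1 = c * (c ^+ i - 1) + (c - 1) by rewrite exprS; ring.
  rewrite (le_trans (nmD _ _)) // nmM (nm_unity_root ck) mul1r -natr1 mulrDl mul1r lerD2r //.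
have kp : 0 < k%:R :> R by rewrite ltr0n.
have : nm (\sum_(i < k) (c ^+ i - 1)) < k%:R.
  apply: (@le_lt_trans _ _ (\sum_(i < k) (k%:R * nm (c - 1)))).
    apply: (le_trans (nm_sum _ _ _)); apply: ler_sum => i _; apply: (le_trans (b i)).
    by rewrite ler_wpM2r ?nm_ge0 // ler_nat ltnW.
  by rewrite sumr_const card_ord -(mulr_natr (k%:R * nm (c - 1)) k) -[X in _ < X]mul1r ltr_pM2r // mulrC -ltr_pdivlMr // div1r.
rewrite sumrB geo sub0r nmN sumr_const card_ord nm_nat ltxx //.
Qed.

Lemma iter_hpi n v : hpi (iter n Ghat v) = iter n G (hpi v).
Proof. by elim: n => //= n <-; rewrite (hpi_Ghat j ry r0 k0 zk). Qed.

Lemma iter_z n v (i : 'I_d) : (i < r)%N ->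
  (iter n Ghat v) ord0 i = v ord0 i * (rt i ^+ n * cexp (Slog n (hpi v) / (k * r)%:R)).
Proof.
move=> ir; elim: n => [|n IH]; first by rewrite /Slog big_ord0 mul0r cexp0 expr0 !mulr1.
rewrite iterS mxE ir IH iter_hpi SlogS mulrDl cexpD exprSr /Afac.
move: (cexp _) (cexp _) => a b; ring.
Qed.

Lemma iter_t n v (i : 'I_d) : (r < i)%N -> (iter n Ghat v) ord0 i = v ord0 i / 2 ^+ n.
Proof.
move=> ri; elim: n => [|n IH]; first by rewrite expr0 divr1.
have ne : (i == iy) = false by apply/eqP => E; move: ri; rewrite E ry ltnn.
rewrite iterS mxE ltnNge (ltnW ri) ne /=.
by rewrite IH exprSr invfM mulrA.
Qed.

Lemma nm_rt (i : 'I_d) n : nm (rt i ^+ n) = 1.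
Proof. by rewrite nmX /rt; case: ifP => _; rewrite ?nm1 ?(nm_unity_root zk) expr1n. Qed.

Lemma zprod_cst v c : (forall i : 'I_d, (i < r)%N -> v ord0 i = c) -> zprod v = c ^+ r.
Proof.
move=> H; rewrite /zprod (eq_bigr (fun=> c)) //.
by rewrite (big_ord_narrow (ltnW (r_lt_d ry))) prodr_const card_ord.
Qed.

Lemma nm_hpi_le v : nm v <= 1 -> nm (hpi v) <= nm v.
Proof.
move=> v1; have zi i : nm (v ord0 i) <= nm v by exact: nm_row.
apply: nm_pair_le; last exact: zi.
have zle : nm (zprod v) <= nm v ^+ r.
  have -> : nm v ^+ r = \prod_(i < d | (i < r)%N) nm v.
    by rewrite (big_ord_narrow (ltnW (r_lt_d ry))) prodr_const card_ord.
  rewrite /zprod (big_morph (@nm R _) (@nmM R) (@nm1 R)); apply: ler_prod => i _.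
  by rewrite nm_ge0 zi.
rewrite nmX; apply: (@le_trans _ _ ((nm v ^+ r) ^+ k)); first by rewrite lerXn2r ?nnegrE ?nm_ge0 ?exprn_ge0 ?nm_ge0.
have rk0 : (0 < r * k)%N by rewrite muln_gt0 r0.
by rewrite -exprM -(prednK rk0) exprS ler_piMr ?nm_ge0 // exprn_ile1 ?nm_ge0.
Qed.

Lemma basin_ucvg p0 : basin p0 -> exists2 dl : R, 0 < dl & forall e' : R, 0 < e' -> exists N, forall n p, (N <= n)%N ->
  nball p0 dl p -> basin p /\ nm (iter n G p) <= e'.
Proof.
move=> b0; have [dl dl0 [N N0 [K K0 [_ H]]]] := basin_nbhd b0; exists dl => // e' e0.
have [N1 N10 H1] := @wreg_nm R j; have [N2 [N20 H2]] := @pw_large R j (2 / e').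
exists (N + N1 + N2)%N => n p Nn hp; have [b w _] := H p hp; split=> //.
have [n1 n2 n3] : [/\ (N <= n)%N, (N1 <= n)%N & (N2 <= n)%N] by split; move: Nn; clear; lia.
apply: (le_trans (H1 n _ n2 (w n n1))); have := H2 n 38 n3 isT.
by rewrite ler_pdivrMr // -(@pwV R j n 38) ler_pdivrMr ?pw_gt0 // mulrC.
Qed.

(** The [(k r)]-th power of each of the first [r] coordinates is multiplied by [x_n / x_0] up to a
    factor of modulus 1; this tends to 0 uniformly where [x_0] is bounded away from 0. The
    coordinates after [iy] are halved at each step. *)
Lemma lift_ucvg v0 : basin (hpi v0) -> exists2 dl : R, 0 < dl & ucvg (nball v0 dl) (fun n => iter n Ghat) (cst 0).
Proof.
move=> b0; have [d1 d10 H1] := basin_ucvg b0.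
have [d2 d20 H2] := nice_at_lim (nice_at_entire v0 (hpi_entire r k iy)) d10.
have x0 : 0 < nm ((hpi v0).1 : R[i]) by rewrite nm_gt0 (basin_neq0 b0).
pose b := nm ((hpi v0).1 : R[i]) / 2; have bp : 0 < b by rewrite divr_gt0.
have [d3 d30 H3] := nice_at_lim (nice_at_entire v0 (hpi_entire r k iy)) bp.
pose dl := Num.min 1 (Num.min d2 d3); exists dl; first by rewrite !lt_min ltr01 d20 d30.
move=> e' e0; pose M := nm v0 + 1; have M1 : 1 <= M by rewrite lerDr nm_ge0.
have M0 : 0 < M by apply: lt_le_trans M1.
(* Chosen so that [M^(k r) s / b = (e' / 2)^(k r)]. *)
pose s := (e' / 2) ^+ (k * r) * b / M ^+ (k * r).
have e2 : 0 < e' / 2 by rewrite divr_gt0.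
have s0 : 0 < Num.min s (e' / 2) by rewrite lt_min e2 andbT divr_gt0 ?mulr_gt0 ?exprn_gt0.
have [N HN] := H1 _ s0; exists (N + (Num.trunc (M / (e' / 2))).+1)%N => n v Nn.
rewrite /nball /= !lt_min => /andP[v1 /andP[v2 v3]].
have nN : (N <= n)%N by apply: leq_trans Nn; exact: leq_addr.
have nT : ((Num.trunc (M / (e' / 2))).+1 <= n)%N by apply: leq_trans Nn; exact: leq_addl.
have [bv] := HN n (hpi v) nN (H2 v v2); rewrite le_min => /andP[ps pe].
have vM : nm v <= M by have := nm_dist v v0; rewrite /M; move: v1; lra.
have xb : b <= nm ((hpi v).1 : R[i]).
  have h := H3 v v3; have h' := le_lt_trans (dist_fst (hpi v) (hpi v0)) h.
  exact: half_lower (nm_distC ((hpi v0).1 : R[i]) (hpi v).1) h'.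
rewrite subr0; apply: (@le_lt_trans _ _ (e' / 2)); last by rewrite ltr_pdivrMr // ltr_pMr // ltr1n.
apply: nm_row_le => [|i]; first exact: ltW.
have viM : nm (v ord0 i) <= M := le_trans (nm_row v i) vM.
case: (ltngtP i r) => ir.
- have kr0 : (0 < k * r)%N by rewrite muln_gt0 k0 r0.
  rewrite -(ler_pXn2r kr0) ?nnegrE ?nm_ge0 ?(ltW e2) // iter_z // nmM [nm (rt i ^+ n * _)]nmM nm_rt mul1r exprMn -[nm (cexp _) ^+ _]nmX (cexp_divX kr0).
  have xE : nm ((iter n G (hpi v)).1 : R[i]) = nm ((hpi v).1 : R[i]) * nm (cexp (Slog n (hpi v))) by rewrite iter_fst nmM.
  have h1 : nm ((hpi v).1 : R[i]) * nm (cexp (Slog n (hpi v))) <= s.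
    by rewrite -xE; apply: le_trans ps; have := dist_fst (iter n G (hpi v)) 0; rewrite /dist !subr0.
  have h2 : b * nm (cexp (Slog n (hpi v))) <= s by apply: le_trans h1; rewrite ler_wpM2r ?nm_ge0.
  have h3 : nm (v ord0 i) ^+ (k * r) <= M ^+ (k * r) by rewrite lerXn2r ?nnegrE ?nm_ge0 // ltW.
  rewrite -(ler_pM2l bp); apply: (@le_trans _ _ (M ^+ (k * r) * s)); last first.
    by rewrite /s mulrC divfK ?gt_eqF ?exprn_gt0 // mulrC.
  by rewrite mulrCA ler_pM ?exprn_ge0 ?mulr_ge0 ?nm_ge0 // ltW.
- rewrite iter_t // nmM nmV nmX nm_nat ler_pdivrMr ?exprn_gt0 // (le_trans viM) //.
  rewrite mulrC -ler_pdivrMr // (le_trans (ltW (truncnS_gt _))) // -natrX ler_nat (leq_trans nT) // ltnW // ltn_expl //.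
- have -> : i = iy by apply: val_inj; rewrite /= ry.
  have -> : (iter n Ghat v) ord0 iy = (iter n G (hpi v)).2 by rewrite -iter_hpi.
  by apply: le_trans pe; have := dist_snd (iter n G (hpi v)) 0; rewrite /dist !subr0.
Qed.

Lemma lift_attr v : basin (hpi v) -> forall e' : R, 0 < e' -> exists N, forall n, (N <= n)%N -> nm (iter n Ghat v) < e'.
Proof.
move=> /lift_ucvg[dl dl0 H] e' e0; have [N HN] := H e' e0; exists N => n Nn.
by have := HN n v Nn (nball0 v dl0); rewrite subr0.
Qed.

Lemma basin_fatou v : basin (hpi v) -> fatou_set Ghat v.
Proof. by move=> /lift_ucvg[dl dl0 H]; exact: fatou_of_ucvg H. Qed.

Lemma basin_vanishes p : basin p -> vanishes p.
Proof.
move=> /basin_ucvg[dl dl0 H] e' e0; have [N HN] := H e' e0; exists N => n Nn.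
by have [] := HN n p Nn (nball0 p dl0).
Qed.

(** Reversibility: [flip] conjugates [G] to its inverse. *)
Lemma iter_flip n p : iter n G (flip (iter n G p)) = flip p.
Proof.
elim: n => // n IH; rewrite iterSr [iter n.+1 _ p]iterS -IH; congr (iter n _ _).
move: (iter n G p) => q; apply: (inv_inj (@flipK R)); rewrite (flipK q) -GinvE; exact: GK.
Qed.

Lemma Alog_fst0 p : p.1 = 0 -> Alog p = 0.
Proof.
move=> p0; have x1 : Gx1 j p = 0 by rewrite /Gx1 /= p0 mul0r.
have h0 : Gh j p = 0 by rewrite /Gh x1 mul0r.
have x4 : Gx4 j p = 0 by rewrite /Gx4 h0 mul0r.
have l : Gl3 j p = Gl2 j p by rewrite /Gl3 /Gl2 /Gy3 h0 subr0.
have u0 : Gu j p = 0 by rewrite /Gu p0 mul0r.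
have u4 : Gu4 j p = 0 by rewrite /Gu4 x4 mul0r.
by rewrite AlogE u0 u4 l subrr !addr0 !mulr0.
Qed.

Lemma nm_flip p : nm (flip p : X2) = nm p.
Proof. by case: p => x y; rewrite /flip !nm_pair /= nmN. Qed.

(* Backward orbits accumulate at [q]: [G^n] maps [flip (G^n p)], which tends to [0], to [flip p]. *)
Lemma no_vanishing q : (forall i : 'I_d, (i <= r)%N -> q ord0 i = 0) ->
  (forall e' : R, 0 < e' -> exists2 dl : R, 0 < dl & exists N, forall v n, nball q dl v -> (N <= n)%N -> nm (iter n Ghat v) <= e') -> False.
Proof.
move=> q0 US; have t0 : @target R j (0, 1) by move=> _; rewrite /= oner_neq0.
have [d1 d10 [Psi _ HPsi]] := Phi_surj t0; have [bp _] := HPsi _ (nball0 _ d10).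
move: (Psi _) bp => p bp; have x0 := basin_neq0 bp.
have xp : 0 < nm (p.1 : R[i]) by rewrite nm_gt0.
have e0 : 0 < Num.min 1 (nm (p.1 : R[i]) / 2) by rewrite lt_min ltr01 divr_gt0.
have [dl dl0 [N HN]] := US _ e0.
have kr0 : (0 < r * k)%N by rewrite muln_gt0 r0.
have dl2 : 0 < dl / 2 by rewrite divr_gt0.
have e1 : 0 < Num.min (dl / 2) ((dl / 2) ^+ (r * k)) by rewrite lt_min dl2 exprn_gt0.
have [n [b [nN bn0 E bs]]] : exists n (b : X2), [/\ (N <= n)%N, b.1 != 0, iter n G b = flip p &
    nm b <= Num.min (dl / 2) ((dl / 2) ^+ (r * k))].
  have [N1 HN1] := basin_vanishes bp e1.
  exists (N + N1)%N, (flip (iter (N + N1)%N G p)); split; first exact: leq_addr.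
  - by rewrite /= oppr_eq0 iter_fst_neq0.
  - exact: iter_flip.
  - by rewrite nm_flip; apply: HN1; exact: leq_addl.
move: bs; rewrite le_min => /andP[h1 h2].
have b1 : nm (b.1 : R[i]) <= nm b by have := dist_fst b 0; rewrite /dist !subr0.
have b2 : nm (b.2 : R[i]) <= nm b by have := dist_snd b 0; rewrite /dist !subr0.
(* With [z_1, ..., z_r] all equal to this root the point lies over [b]; it is close to [q] because
   the first [r + 1] coordinates of [q] vanish and the others are copied. *)
have [w wX] : exists w : R[i], w ^+ (r * k) = b.1.
  by have [l cl] := cexp_surj bn0; exists (cexp (l / (r * k)%:R)); rewrite (cexp_divX kr0).
have wle : nm w <= dl / 2.
  rewrite -(ler_pXn2r kr0) ?nnegrE ?nm_ge0 ?(ltW dl2) // -nmX wX; exact: le_trans b1 h2.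
pose v : V := \row_i if (i < r)%N then w else if i == iy then b.2 else q ord0 i.
have zv : zprod v = w ^+ r by apply: zprod_cst => i ir; rewrite mxE ir.
have pv : hpi v = b.
  rewrite /hpi [RHS]surjective_pairing; congr pair; last by rewrite mxE ry ltnn eqxx.
  by rewrite zv -exprM.
have vq : nball q dl v.
  apply: (le_lt_trans _ (half_lt dl0)).
  apply: nm_row_le => [|i]; first exact: ltW.
  rewrite !mxE; case: ltnP => ir; first by rewrite (q0 i (ltnW ir)) subr0.
  case: (i =P iy) => [->|_]; last by rewrite subrr nm0 ltW.
  rewrite (q0 iy) ?ry // subr0; exact: le_trans b2 h1.
have := HN v n vq nN; rewrite le_min => /andP[s1 s2].
have := nm_hpi_le s1; rewrite iter_hpi pv E => h.
have f1 : nm (p.1 : R[i]) <= nm p by have := dist_fst p 0; rewrite /dist !subr0.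
rewrite nm_flip in h; have := le_lt_trans (le_trans f1 (le_trans h s2)) (half_lt xp).
by rewrite ltxx.
Qed.

(** If [z_1 ... z_r = 0] at [q], the plane orbit is constant and the moduli of the first [r + 1]
    coordinates do not change; since the orbit tends to 0 they all vanish, against [no_vanishing].
    Otherwise [basin_closed] applies. *)
Lemma lift_closed q : fatou_set Ghat q -> closure ([set v | basin (hpi v)] : set Vn) q -> basin (hpi q).
Proof.
move=> Fq clq.
have US : forall e' : R, 0 < e' -> exists2 dl : R, 0 < dl & exists N, forall v n, nball q dl v -> (N <= n)%N -> nm (iter n Ghat v) <= e'.
  apply: (fatou_closure _ _ Fq clq) => [n x|v bv]; last exact: lift_attr.
  exact: nice_at_lim (nice_at_entire x (entire_iter n (Ghat_entire r k j zeta iy))).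
have van (e' : R) : 0 < e' -> exists N, forall n, (N <= n)%N -> nm (iter n Ghat q) <= e'.
  by move=> /US[dl dl0 [N HN]]; exists N => n Nn; apply: HN Nn; exact: nball0.
case: (eqVneq (zprod q) 0) => [z0|z0].
  have x0 : (hpi q).1 = 0 by rewrite /= z0 expr0n gtn_eqF.
  exfalso; apply: (@no_vanishing q) US => i ir.
  have cst (n : nat) : nm ((iter n Ghat q) ord0 i) = nm (q ord0 i).
    move: ir; rewrite leq_eqVlt => /predU1P[ir|ir].
      have -> : i = iy by apply: val_inj; rewrite /= ry.
      have -> : (iter n Ghat q) ord0 iy = (iter n G (hpi q)).2 by rewrite -iter_hpi.
      by rewrite (@iter_fst0 R j _ (hpi q) x0).
    rewrite iter_z // nmM [nm (rt i ^+ n * _)]nmM nm_rt mul1r.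
    have -> : Slog n (hpi q) = 0.
      by rewrite /Slog big1 // => l _; rewrite (@iter_fst0 R j _ (hpi q) x0) Alog_fst0.
    by rewrite mul0r cexp0 nm1 mulr1.
  apply/eqP; rewrite -nm_eq0; apply/eqP/le_anti; rewrite nm_ge0 andbT.
  apply/ler_addgt0Pr => e' e0; rewrite add0r; have [N HN] := van e' e0.
  by rewrite -(cst N) (le_trans (nm_row _ _)) // HN.
have [dl dl0 [N HN]] := US 1 ltr01.
apply: (@basin_closed R j V q hpi dl N dl0); first exact: entire_nice (hpi_entire r k iy).
- by move=> v n vq Nn; have h := HN v n vq Nn; rewrite -iter_hpi (le_trans (nm_hpi_le h)).
- move=> e' e0; have e1 : 0 < Num.min 1 e' by rewrite lt_min ltr01.
  have [N1 HN1] := van _ e1; exists N1 => n /HN1; rewrite le_min => /andP[h1 h2].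
  by rewrite -iter_hpi (le_trans (nm_hpi_le h1)).
- by rewrite /= expf_neq0.
- by move/closure_nm: clq.
Qed.

(** Over the basin [zprod / xi] is continuous with values in the [k]-th roots of unity, which are
    separated by [1 / k]; hence it is locally constant. *)
Lemma branch_open om : open (branch om : set Vn).
Proof.
rewrite openE => v0 [b0 E0]; apply/nbhs_nm.
have nx := nice_at_comp (nice_at_entire v0 (hpi_entire r k iy)) (xi_nice_at jke k0 b0).
have x0 := xi_neq0 jke k0 b0.
have nq := nice_atM (nice_at_entire v0 (zprod_entire d r)) (nice_at_inv nx x0).
have ki : 0 < k%:R^-1 :> R by rewrite invr_gt0 ltr0n.
have [d1 d10 H1] := nice_at_lim nq ki.
have [d2 d20 H2] := basin_ucvg b0.
have [d3 d30 H3] := nice_at_lim (nice_at_entire v0 (hpi_entire r k iy)) d20.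
exists (Num.min d1 d3); first by rewrite lt_min d10 d30.
move=> v; rewrite lt_min => /andP[v1 v3].
have [N HN] := H2 1 ltr01; have [b _] := HN N (hpi v) (leqnn N) (H3 v v3).
have [om' ok' c'] := branch_of jke k0 b.
have [om0 ok0 c0] := branch_of jke k0 b0.
have oE : om0 = om := branch_uniq jke k0 c0 (conj b0 E0); rewrite oE in ok0.
have om0' : om != 0 by apply/eqP => z; move: ok0; rewrite z expr0n gtn_eqF // => /esym/eqP; rewrite oner_eq0.
suff -> : om = om' by exact: c'.
have q' : zprod v / xi (hpi v) = om' by case: c' => _ ->; exact: mulfK (xi_neq0 jke k0 b) _.
have q0 : zprod v0 / xi (hpi v0) = om by rewrite E0; exact: mulfK x0 _.
have := H1 v v1; rewrite q' q0 => hv; have := @unity_root_sep (om' / om); rewrite expr_div_n ok' ok0 divr1 => /(_ erefl).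
have -> : om' / om - 1 = (om' - om) / om by rewrite mulrBl divff.
by rewrite nmM nmV (nm_unity_root ok0) invr1 mulr1 => /(_ hv) /divr1_eq.
Qed.

(** A Fatou point adherent to the sheet lies over the basin, hence on some sheet; sheets are open
    and pairwise disjoint, so it is the same one. *)
Lemma branch_component om v : connected (branch om : set Vn) -> branch om v -> connected_component (fatou_set Ghat) v = branch om.
Proof.
move=> cn cv; apply: (@component_clopen R V (fatou_set Ghat) (branch om) v cn _ cv (@branch_open om)) => [w [b _]|q [clq Fq]].
  exact: basin_fatou.
 have bq : basin (hpi q).
  by apply: lift_closed => //; apply: closure_subset clq => w [].
have [om' _ c'] := branch_of jke k0 bq.
have [w [cw cw']] : branch om `&` branch om' !=set0.
  by apply: clq; apply: open_nbhs_nbhs; split=> //; exact: branch_open.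
by rewrite (branch_uniq jke k0 cw cw').
Qed.

Lemma branch_attracted om : attracted_to Ghat (branch om) 0.
Proof. by apply: locally_ucvg_attracted => v [b _]; exact: lift_ucvg. Qed.

Lemma branch_boundary om : branch om !=set0 -> boundary (branch om : set Vn) 0.
Proof.
move=> [v cv]; split; last first.
  have z0 : zprod 0 = 0.
    by rewrite (@zprod_cst 0 0) ?expr0n ?gtn_eqF // => i _; rewrite mxE.
  by move=> /interior_subset[b _]; move: (basin_neq0 b); rewrite /= z0 expr0n gtn_eqF // eqxx.
apply/closure_nm => e' e0; have [b _] := cv; have [N HN] := lift_attr b e0.
(* Exponents divisible by [k] return to the same sheet, because [zeta^k = 1]. *)
exists (iter (N * k) Ghat v); first by rewrite /nball /= subr0; apply: HN; rewrite leq_pmulr.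
suff -> : branch om = iter (N * k) Ghat @` branch om by exists v.
by rewrite (iter_branch jke ry r0 k0 zk) mulnC exprM zk expr1n mul1r.
Qed.

End LiftFatou.

(** * The components and their parametrization *)

Section PhiInverse.
Context {R : realType} (j : nat).
Local Notation C := (R[i]^o).
Local Notation X2 := (C * C)%type.
Local Notation basin := (@basin R j).
Local Notation Phi := (@Phi R j).
Implicit Types (p c : X2).

Definition PhiInv c : X2 := xget 0 [set p | basin p /\ Phi p = c].

Lemma PhiInvP c : target j c -> basin (PhiInv c) /\ Phi (PhiInv c) = c.
Proof.
move=> t; rewrite /PhiInv; case: xgetP => [p _ []//|nP].
have [d d0 [Psi _ H]] := Phi_surj t; exfalso; exact: nP (H c (nball0 c d0)).
Qed.

Lemma PhiInvK p : basin p -> PhiInv (Phi p) = p.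
Proof. by move=> b; have [t _] := PhiP b; have [b' E] := PhiInvP t; exact: Phi_inj b' b E. Qed.

Lemma PhiInv_nice_at c : target j c -> nice_at c PhiInv.
Proof.
move=> t; have [d d0 [Psi nP H]] := Phi_surj t; exists d; first exact: d0.
apply: (nice_eq _ nP) => c' hc.
by have [b E] := H c' hc; have h := PhiInvK b; rewrite E in h; exact: esym h.
Qed.

Lemma Phi_nice_at p : basin p -> nice_at p Phi.
Proof. by move=> b; have [d d0 [N _ [K _ [nP _]]]] := basin_nbhd b; exists d. Qed.

End PhiInverse.

(** * Connectedness of the model *)

Section TorusConnected.
Context {R : realType} (a b : nat).
Local Notation C := (R[i]^o).
Local Notation Va := ('rV[R[i]]_a : normedModType R[i]).
Local Notation Vb := ('rV[R[i]]_b : normedModType R[i]).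
Local Notation X := ((Va * Vb)%type : normedModType R[i]).

Lemma real_complex_continuous : continuous (fun t : R => t%:C%C : C).
Proof.
move=> t A /nbhs_nm[e e0 sA]; apply/nbhs_ballP; exists e => // s; rewrite /ball /= => ts.
by apply: sA; rewrite -rmorphB nm_real distrC.
Qed.

(** The path [s |-> (s w_1, exp (s log w_2))] joins the base point [(0, 1)] to any point of the
    model; logarithms are taken coordinatewise, and no continuous choice of them is required. *)
Lemma torus_connected : connected (affine_torus R a b : set X).
Proof.
pose path (w : X * 'rV[R[i]]_b) (s : C) : X := (\row_i (s * w.1.1 ord0 i), \row_i cexp (s * w.2 ord0 i)).
have path_nice w s : nice_at s (path w).
  apply: nice_at_pair; apply: nice_at_row => i.
    by apply: nice_atM (nice_at_cst _ _); exists 1 => //; exact: nice_id.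
  by apply: nice_at_exp; apply: nice_atM (nice_at_cst _ _); exists 1 => //; exact: nice_id.
pose S (w : X * 'rV[R[i]]_b) := (fun t : R => path w t%:C%C) @` `[0, 1]%classic.
have Sc w : connected (S w).
  apply: connected_continuous_connected; first exact: segment_connected.
  apply: continuous_subspaceT => t.
  apply: (@continuous_comp _ _ _ (fun t : R => t%:C%C : C) (path w)); first exact: real_complex_continuous.
  by apply/cvg_nmP; exact: nice_at_lim (path_nice w t%:C%C).
have -> : (affine_torus R a b : set X) = \bigcup_(w in [set: X * 'rV[R[i]]_b]) S w.
  apply/seteqP; split=> [w tw|_ [w _ [t _ <-] l]]; last by rewrite mxE cexp_neq0.
  have /choice[l Hl] : forall i, exists l, cexp l = w.2 ord0 i by move=> i; exact: cexp_surj (tw i).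
  exists (w, \row_i l i) => //; exists 1; first by rewrite /= in_itv /= ler01 lexx.
  by rewrite /path /= [RHS]surjective_pairing; congr pair; apply/rowP => i; rewrite !mxE mul1r ?mxE.
apply: bigcup_connected => [|w _]; last exact: Sc.
exists (0, \row_i 1) => w _; exists 0; first by rewrite /= in_itv /= ler01 lexx.
by rewrite /path; congr pair; apply/rowP => i; rewrite !mxE mul0r ?cexp0.
Qed.

End TorusConnected.

(** * Parametrization of a sheet by the model *)

Section Chart.
Context {R : realType} (d r k e j m : nat) (iy i1 : 'I_d).
Context (jke : j = (k * e)%N).
Context (ry : iy = r :> nat).
Context (r1 : i1 = r.-1 :> nat).
Context (r0 : (0 < r)%N).
Context (k0 : (0 < k)%N).
Context (e1 : (e <= 1)%N).
Context (mre : m = (r.-1 + e)%N).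
Context (om : R[i]).
Context (omk : om ^+ k = 1).
Local Notation C := (R[i]^o).
Local Notation X2 := (C * C)%type.
Local Notation V := ('rV[R[i]]_d).
Local Notation Vn := ('rV[R[i]]_d : normedModType R[i]).
Local Notation basin := (@basin R j).
Local Notation Phi := (@Phi R j).
Local Notation PhiInv := (@PhiInv R j).
Local Notation zprod := (@zprod R d r).
Local Notation hpi := (@hpi R d r k iy).
Local Notation xi := (@xi R k e j).
Local Notation branch := (@branch R d r k e j iy).
Implicit Types (v w q c : V) (p : X2).

Definition lower v : R[i] := \prod_(i < d | (i < r.-1)%N) v ord0 i.
(* The two Fatou coordinates take the places [r - 1] and [r] in this order, so that the coordinates that must not
   vanish are the first [m] ones. *)
Definition chartF v : V := \row_i if i == i1 then (Phi (hpi v)).2 else if i == iy then (Phi (hpi v)).1 else v ord0 i.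
Definition chartp c : X2 := PhiInv (c ord0 iy, c ord0 i1).
(** The coordinate in the place [i1] is recovered from the equation [z_1 ... z_r = om xi] of the
    sheet. *)
Definition chartH c : V :=
  \row_i if i == i1 then om * xi (chartp c) / lower c else if i == iy then (chartp c).2 else c ord0 i.

Lemma iy_neq : (iy == i1) = false.
Proof. by apply/eqP => /(congr1 val) /=; rewrite ry r1 => /eqP; rewrite -[X in X == _](prednK r0) gtn_eqF. Qed.

Lemma zprodE v : zprod v = v ord0 i1 * lower v.
Proof.
rewrite /zprod (bigD1 i1) /=; last by rewrite r1 prednK.
congr (_ * _); apply: eq_bigl => i; rewrite -val_eqE /= r1 -[X in (_ < X)%N](prednK r0) ltnS.
by rewrite [in RHS]ltn_neqAle andbC.
Qed.

Lemma lower_ext v w : (forall i : 'I_d, (i < r.-1)%N -> v ord0 i = w ord0 i) -> lower v = lower w.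
Proof. by move=> H; apply: eq_bigr => i; exact: H. Qed.

Lemma lt_neq (i : 'I_d) : (i < r.-1)%N -> (i == i1) = false /\ (i == iy) = false.
Proof.
move=> ir; split; apply/eqP => E; move: ir; rewrite E ?r1 ?ry ?ltnn // -{1}(prednK r0).
by rewrite ltnNge leqnSn.
Qed.

(** Since [m = r - 1 + e], the place [i1], which carries the limit of [y], is included exactly if
    [e = 1]. *)
Definition slit c := forall i : 'I_d, (i < m)%N -> c ord0 i != 0.

Lemma slit_lower c : slit c -> lower c != 0.
Proof.
move=> Ec; apply/prodf_neq0 => i ir; apply: Ec; rewrite mre; exact: leq_trans ir (leq_addr _ _).
Qed.

Lemma om_neq0 : om != 0.
Proof. by apply/eqP => z; move: omk; rewrite z expr0n gtn_eqF // => /esym/eqP; rewrite oner_eq0. Qed.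

Lemma slit_target c : slit c -> target j (c ord0 iy, c ord0 i1).
Proof.
move=> Ec; rewrite /target jke muln_gt0 => /andP[_ e0]; apply: Ec.
by rewrite r1 mre -addn1 leq_add2l.
Qed.

Lemma chartF_slit v : branch om v -> slit (chartF v).
Proof.
move=> [b E] i im; rewrite mxE; case: (i =P i1) => [ei|/eqP ne1].
  have := Phi2e_neq0 jke k0 b; rewrite expf_eq0 negb_and => /orP[|//].
  by rewrite -leqNgt leqn0 => /eqP e0; move: im; rewrite ei r1 mre e0 addn0 ltnn.
case: (i =P iy) => [ei|_].
  exfalso; move: im; rewrite ei ry mre => h; have := leq_trans h (leq_add (leqnn _) e1).
  by rewrite addn1 (prednK r0) ltnn.
have : zprod v != 0 by rewrite E mulf_neq0 ?om_neq0 // (xi_neq0 jke k0 b).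
move/prodf_neq0; apply; apply: (leq_trans im); rewrite mre -[X in (_ <= X)%N](prednK r0) -addn1 leq_add2l //.
Qed.

Lemma chartH_comp c : slit c -> hpi (chartH c) = chartp c /\ branch om (chartH c).
Proof.
move=> Ec; have [b P] := PhiInvP (slit_target Ec); have l0 := slit_lower Ec.
have lE : lower (chartH c) = lower c.
  by apply: lower_ext => i /lt_neq[h1 h2]; rewrite mxE h1 h2.
have zE : zprod (chartH c) = om * xi (chartp c) by rewrite zprodE lE mxE eqxx divfK.
have hE : hpi (chartH c) = chartp c.
  rewrite /hpi [RHS]surjective_pairing; congr pair; last by rewrite mxE iy_neq eqxx.
  by rewrite zE exprMn omk mul1r (xiX jke k0 b).
split; first exact: hE.
by split; [rewrite hE; exact: b|rewrite hE; exact: zE].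
Qed.

Lemma chartFK v : branch om v -> chartH (chartF v) = v.
Proof.
move=> cv; have Ev := chartF_slit cv; have [b E] := cv.
have pE : chartp (chartF v) = hpi v.
  by rewrite /chartp !mxE iy_neq !eqxx -surjective_pairing PhiInvK.
have lE : lower (chartF v) = lower v by apply: lower_ext => i /lt_neq[h1 h2]; rewrite mxE h1 h2.
have l0 := slit_lower Ev; rewrite lE in l0.
apply/rowP => i; rewrite mxE pE lE; case: (i =P i1) => [->|/eqP/negPf n1].
  by rewrite -E zprodE mulfK.
by case: (i =P iy) => [->//|/eqP/negPf n2]; rewrite mxE n1 n2.
Qed.

Lemma chartHK c : slit c -> chartF (chartH c) = c.
Proof.
move=> Ec; have [b P] := PhiInvP (slit_target Ec); have [hE _] := chartH_comp Ec.
apply/rowP => i; rewrite mxE hE P; case: (i =P i1) => [->//|/eqP/negPf n1].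
by case: (i =P iy) => [->//|/eqP/negPf n2]; rewrite mxE n1 n2.
Qed.

Lemma chartF_nice_at v : branch om v -> nice_at v chartF.
Proof.
move=> [b _]; have nP := nice_at_comp (nice_at_entire v (hpi_entire r k iy)) (Phi_nice_at b).
apply: nice_at_row => i; case: (i == i1); last case: (i == iy); last exact: nice_at_entire (coord_entire i).
  by have [dl dl0 H] := nP; exists dl => //; exact: nice_sndE H.
by have [dl dl0 H] := nP; exists dl => //; exact: nice_fstE H.
Qed.

Lemma chartH_nice_at c : slit c -> nice_at c chartH.
Proof.
move=> Ec; have t := slit_target Ec; have [b P] := PhiInvP t.
have nc := nice_at_pair (nice_at_entire c (coord_entire iy)) (nice_at_entire c (coord_entire i1)).
have np := nice_at_comp nc (PhiInv_nice_at t).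
have nx := nice_at_comp np (xi_nice_at jke k0 b).
apply: nice_at_row => i; case: (i == i1); last case: (i == iy); last exact: nice_at_entire (coord_entire i).
  apply: nice_atM; first exact: nice_atM (nice_at_cst _ _) nx.
  exact: nice_at_inv (nice_at_entire c (zprod_entire d r.-1)) (slit_lower Ec).
by have [dl dl0 H] := np; exists dl => //; exact: nice_sndE H.
Qed.

Context (md : (m <= d)%N).

Definition eqd : (m + (d - m) = d)%N := subnKC md.
Definition toT c : 'rV[R[i]]_(d - m) * 'rV[R[i]]_m :=
  (\row_b c ord0 (cast_ord eqd (rshift m b)), \row_a c ord0 (cast_ord eqd (lshift (d - m) a))).
Definition ofT (t : 'rV[R[i]]_(d - m) * 'rV[R[i]]_m) : V :=
  \row_i match fintype.split (cast_ord (esym eqd) i) with inl a => t.2 ord0 a | inr b => t.1 ord0 b end.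

Lemma toTK : cancel toT ofT.
Proof.
move=> c; apply/rowP => i; rewrite mxE; have := splitK (cast_ord (esym eqd) i).
by case: (fintype.split _) => [a|b] /= h; rewrite mxE h cast_ordKV.
Qed.

Lemma ofTK : cancel ofT toT.
Proof.
move=> [w1 w2]; rewrite /toT; congr pair; apply/rowP => i; rewrite !mxE cast_ordK.
  by rewrite -[rshift m i]/(unsplit (inr i)) unsplitK.
by rewrite -[lshift _ i]/(unsplit (inl i)) unsplitK.
Qed.

Lemma toT_torus c : slit c -> affine_torus R (d - m) m (toT c).
Proof. by move=> Ec l; rewrite mxE; apply: Ec => /=. Qed.

Lemma ofT_slit t : affine_torus R (d - m) m t -> slit (ofT t).
Proof.
move=> tw i im; rewrite mxE; case: fintype.splitP => [a _|b /= E]; first exact: tw.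
by move: im; rewrite E ltnNge leq_addr.
Qed.

Definition toTor v := toT (chartF v).
Definition ofTor t := chartH (ofT t).

Lemma toT_nice_at c : nice_at c (toT : Vn -> (('rV[R[i]]_(d - m) : normedModType R[i]) * ('rV[R[i]]_m : normedModType R[i]))%type).
Proof. by apply: nice_at_pair; apply: nice_at_row => i; exact: nice_at_entire (coord_entire _). Qed.

Lemma ofT_nice_at t : nice_at t (ofT : (('rV[R[i]]_(d - m) : normedModType R[i]) * ('rV[R[i]]_m : normedModType R[i]))%type -> Vn).
Proof.
apply: nice_at_row => i; case: (fintype.split _) => [a|b].
  by apply: (@nice_at_comp _ _ _ _ t snd) (nice_at_entire _ (coord_entire a)); exists 1 => //; exact: nice_snd.
by apply: (@nice_at_comp _ _ _ _ t fst) (nice_at_entire _ (coord_entire b)); exists 1 => //; exact: nice_fst.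
Qed.

Lemma ofTor_nice_at t : affine_torus R (d - m) m t -> nice_at t (ofTor : (('rV[R[i]]_(d - m) : normedModType R[i]) * ('rV[R[i]]_m : normedModType R[i]))%type -> Vn).
Proof. by move=> tw; apply: nice_at_comp (ofT_nice_at t) (chartH_nice_at (ofT_slit tw)). Qed.

Lemma branch_biholomorphic : biholomorphic (branch om) (affine_torus R (d - m) m).
Proof.
exists toTor, ofTor; split.
- split=> [v cv|w tw]; apply: nice_at_differentiable; last exact: ofTor_nice_at.
  exact: nice_at_comp (chartF_nice_at cv) (toT_nice_at _).
- by move=> v cv; apply: toT_torus; exact: chartF_slit.
- by move=> w tw; have [] := chartH_comp (ofT_slit tw).
- by move=> v; rewrite inE => cv; rewrite /ofTor /toTor toTK chartFK.
- by move=> w; rewrite inE => tw; rewrite /ofTor /toTor chartHK ?ofTK //; exact: ofT_slit.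
Qed.

Lemma branch_image : branch om = ofTor @` affine_torus R (d - m) m.
Proof.
apply/seteqP; split=> [v cv|_ [w tw <-]]; last by have [] := chartH_comp (ofT_slit tw).
exists (toTor v); first by apply: toT_torus; exact: chartF_slit.
by rewrite /ofTor /toTor toTK chartFK.
Qed.

(** Connectedness is inherited from the model through the inverse chart; it is needed to identify
    the sheet with a whole Fatou component. *)
Lemma branch_connected : connected (branch om : set Vn).
Proof.
rewrite branch_image.
apply: (@connected_continuous_connected (('rV[R[i]]_(d - m) : normedModType R[i]) * ('rV[R[i]]_m : normedModType R[i]))%type Vn _ ofTor (@torus_connected R (d - m) m)).
apply: continuous_in_subspaceT => w; rewrite inE => tw.
by apply/cvg_nmP; exact: nice_at_lim (ofTor_nice_at tw).
Qed.

Lemma branch_nonempty : branch om !=set0.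
Proof.
have Ec : slit (\row_i 1) by move=> i _; rewrite mxE oner_neq0.
by exists (chartH (\row_i 1)); have [] := chartH_comp Ec.
Qed.

End Chart.

(** * A primitive root of unity *)

Section UnityRoot.
Context {R : realType} (k : nat).
Context (k0 : (0 < k)%N).

Definition unity : R[i] := cexp (Complex 0 (2 * pi / k%:R)).

Lemma unityX n : unity ^+ n = cexp (Complex 0 (2 * pi / k%:R * n%:R)).
Proof.
rewrite /unity -cexpMn; congr cexp; elim: n => [|n IH]; first by rewrite mulr0n mulr0.
by rewrite mulrSr IH -(natr1 n); apply/eqP; rewrite eq_complex /= addr0 eqxx /=; apply/eqP; ring.
Qed.

Lemma unity_k : unity ^+ k = 1.
Proof.
rewrite unityX divfK ?pnatr_eq0 -?lt0n // /cexp /= expR0 mul1r.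
by rewrite mulr_natl cos2pi sin2pi.
Qed.

Lemma unity_neq1 n : (0 < n < k)%N -> unity ^+ n != 1.
Proof.
move=> /andP[n0 nk]; apply/eqP; rewrite unityX /cexp /= expR0 mul1r => /(congr1 (@complex.Re R)) /=.
have kp : 0 < k%:R :> R by rewrite ltr0n.
have np : 0 < n%:R :> R by rewrite ltr0n.
have nkr : n%:R < k%:R :> R by rewrite ltr_nat.
set x := 2 * pi / k%:R * n%:R.
have xE : x = (pi * (n%:R / k%:R)) *+ 2 by rewrite /x -mulr_natl; ring.
have s0 : 0 < sin (pi * (n%:R / k%:R) : R).
  apply: sin_gt0_pi; rewrite mulr_gt0 ?pi_gt0 ?divr_gt0 //=.
  by rewrite gtr_pMr ?pi_gt0 // ltr_pdivrMr // mul1r.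
rewrite xE cos_mulr2n => h; have := cos2Dsin2 (pi * (n%:R / k%:R) : R).
by move: s0 h; move: (cos _) (sin _) => c s s0 h h2; nra.
Qed.

Lemma unity_inj a b : (a < k)%N -> (b < k)%N -> unity ^+ a = unity ^+ b -> a = b.
Proof.
wlog ab : a b / (a <= b)%N => [H ak bk E|ak bk E].
  by case: (leqP a b) => [ab|/ltnW ba]; [exact: H|apply/esym; apply: H].
apply/eqP; rewrite eqn_leq ab leqNgt; apply/negP => lt_ab.
have u0 : unity ^+ a != 0 by rewrite expf_neq0 // cexp_neq0.
have := @unity_neq1 (b - a); rewrite subn_gt0 lt_ab (leq_ltn_trans (leq_subr _ _) bk) => /(_ isT)/eqP; apply.
by apply: (mulfI u0); rewrite -exprD subnKC // mulr1 E.
Qed.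

End UnityRoot.

Theorem corollary5 (R : realType) (d k p m : nat) :
  (1 < d)%N -> (0 < k)%N -> (0 < p)%N -> (p %| k)%N -> (m < d)%N ->
  exists2 G : 'rV[R[i]]_d -> 'rV[R[i]]_d, automorphism G &
  exists c : 'I_(k %/ p) -> 'I_p -> set 'rV[R[i]]_d,
    [/\ forall i, fatou_cycle G (c i),
        trivIset [set: 'I_(k %/ p)] (fun i => \bigcup_j c i j) &
        forall i j, non_recurrent_attracted_to G (c i j) 0 /\
          biholomorphic (c i j) (affine_torus R (d - m) m)].
Proof.
move=> d1 k0 p0 pk md.
(* With [e = 0] the [r - 1] free nonvanishing coordinates have to supply all of [m], which requires
   [m + 1 < d]. For [m = d - 1] the second Fatou coordinate supplies the last one, at the price of
   [j = k]. *)
have [r [e [rd r0 e1 mre]]] : exists r e, [/\ (r < d)%N, (0 < r)%N, (e <= 1)%N & m = (r.-1 + e)%N].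
  case: (ltnP m.+1 d) => dm; first by exists m.+1, 0%N; split=> //; rewrite addn0.
  exists d.-1, 1%N; split=> //; move: d1 md dm; clear; lia.
pose iy := Ordinal rd; have r1d : (r.-1 < d)%N by exact: leq_ltn_trans (leq_pred r) rd.
pose i1 := Ordinal r1d; pose K := (k %/ p)%N; have kK : (k = K * p)%N by rewrite /K divnK.
pose eta := unity k : R[i]; have etak : eta ^+ k = 1 := unity_k k0.
have K0 : (0 < K)%N by rewrite divn_gt0 // dvdn_leq.
(* A primitive [p]-th root of unity, as [eta] is a primitive [k]-th one and [k = K p]. *)
pose zeta := eta ^+ K; have zetap : zeta ^+ p = 1 by rewrite /zeta -exprM -kK.
have zk : zeta ^+ k = 1 by rewrite /zeta exprAC etak expr1n.
have etaX n : (eta ^+ n) ^+ k = 1 by rewrite exprAC etak expr1n.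
pose j := (k * e)%N; pose G := @Ghat R d r k j zeta iy; pose cmp := @branch R d r k e j iy.
have mdl : (m <= d)%N := ltnW md.
have cn n : cmp (eta ^+ n) !=set0 := @branch_nonempty R d r k e j m iy i1 erefl erefl erefl r0 k0 mre _ (etaX n).
have cc n : connected (cmp (eta ^+ n) : set ('rV[R[i]]_d : normedModType R[i])) :=
  @branch_connected R d r k e j m iy i1 erefl erefl erefl r0 k0 e1 mre _ (etaX n) mdl.
have it n a : iter n G @` cmp a = cmp (zeta ^+ n * a) := @iter_branch R d r k e j zeta iy erefl erefl r0 k0 zk n a.
have uniq a b : cmp a !=set0 -> cmp a = cmp b -> a = b.
  move=> [v ca] E; have cb : cmp b v by rewrite -E.
  exact: (@branch_uniq R d r k e j iy erefl k0 a b v ca cb).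
exists G; first exact: (@Ghat_automorphism R d r k j zeta iy erefl r0 k0 zk).
have lt_k (i : 'I_K) (l : 'I_p) : (i + l * K < k)%N.
  rewrite kK (mulnC K p); apply: (@leq_trans (K + l * K)); first by rewrite ltn_add2r.
  by rewrite -mulSn leq_mul2r ltn_ord orbT.
(* The lift multiplies [om] by [eta^K], so the residue [i] of the exponent modulo [K] labels the
   cycle, and the quotient [l] the place in it. *)
exists (fun i l => cmp (eta ^+ (i + l * K))); split.
- move=> i; exists (cmp (eta ^+ i)).
    split=> //.
    + have [v cv] := cn i; exists v; last first.
        exact/esym/(@branch_component R d r k e j zeta iy erefl erefl r0 k0 zk _ v (cc i) cv).
      by case: cv => b _; exact: (@basin_fatou R d r k j zeta iy erefl r0 k0 zk v b).
    + by rewrite it zetap mul1r.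
    + move=> q /andP[q0 qp]; rewrite it => E.
      have := uniq _ _ (cn i) (esym E); rewrite -[LHS]mul1r => /(mulIf _) h.
      have e0 : eta ^+ i != 0 by rewrite expf_neq0 // cexp_neq0.
      have /eqP := h e0; rewrite eq_sym /zeta -exprM; apply/negP.
      by rewrite unity_neq1 // muln_gt0 K0 q0 /= kK ltn_pmul2l.
  by move=> l; rewrite it /zeta -exprM -exprD mulnC addnC.
- move=> i i' _ _ [v [[l _ cv] [l' _ cv']]].
  have E := @branch_uniq R d r k e j iy erefl k0 _ _ v cv cv'.
  have := unity_inj k0 (lt_k i l) (lt_k i' l') E => /(congr1 (modn^~ K)) /=.
  by rewrite addnC modnMDl addnC modnMDl !modn_small // => /val_inj.
- move=> i l; split; first split.
  + exact: (@branch_attracted R d r k e j zeta iy erefl r0 k0 zk).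
  + exact: (@branch_boundary R d r k e j zeta iy erefl erefl r0 k0 zk _ (cn _)).
  exact: (@branch_biholomorphic R d r k e j m iy i1 erefl erefl erefl r0 k0 e1 mre _ (etaX _) mdl).
Qed.
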